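(* Let $F$ be an $\mathcal F_T$-measurable real random variable such that $E[e^{p\alpha F^+}]<\infty$ for some integer $p>1$ and $F^-\le k$ for some constant $k>0$. Let $(Y,Z)$ be the unique solution of BSDE$(F,f)$. Then the value function $$V(0,x)=\sup_{\pi\in\mathcal A_D^{M}}E\left[-\exp\left(-\alpha\left(X_T^{\pi}-F\right)\right)\right],\qquad x\in\mathbb R,$$ is given by $V(0,x)=-\exp(-\alpha(x-Y_0))$, and there is an optimal trading strategy $\pi^\star\in\mathcal A_D^{M}$ such that $$\sigma_t^{tr}\pi_t^\star=\mathrm{Proj}_{\sigma_t^{tr}\mathcal C}\left(Z_t+\frac{\theta_t}{\alpha}\right),\quad \mathbb P\text{-a.s., for } t\in[0,T].$$
   Context: Fix $T>0$, integers $1\le d\le m$ and $\alpha>0$. $B$ is a standard $m$-dimensional Brownian motion on a complete probability space $(\Omega,\mathcal F,\mathbb P)$ with augmented natural filtration $(\mathcal F_t)$; predictability is with respect to this filtration, $E$ is expectation under $\mathbb P$, and $A^{tr}$ is the transpose of $A$. The processes $b$ ($\mathbb R^d$-valued) and $\sigma$ ($\mathbb R^{d\times m}$-valued) are predictable and bounded, $\sigma_t\sigma_t^{tr}$ is invertible, and $\theta_t=\sigma_t^{tr}(\sigma_t\sigma_t^{tr})^{-1}b_t$ is bounded. $\mathcal C\subset\mathbb R^d$ is closed and convex with $0\in\mathcal C$. For a closed convex set $K\subset\mathbb R^m$, $\mathrm{dist}_K$ and $\mathrm{Proj}_K$ are the Euclidean distance to and projection onto $K$; $\sigma_t^{tr}\mathcal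 C=\{\sigma_t^{tr}\pi:\pi\in\mathcal C\}$. $y^+=\max\{y,0\}$, $y^-=\max\{-y,0\}$. Wealth: $X_t^\pi=x+\int_0^t\pi_u^{tr}\sigma_u(dB_u+\theta_u\,du)$. Generator: for $(t,z)\in[0,T]\times\mathbb R^m$, $$f(t,z)=\frac{\alpha}{2}\mathrm{dist}^2_{\sigma_t^{tr}\mathcal C}\left(z+\frac1\alpha\theta_t\right)-z^{tr}\theta_t-\frac{1}{2\alpha}|\theta_t|^2 .$$ A solution of BSDE$(F,f)$ is a pair of predictable processes $(Y,Z)$ with values in $\mathbb R\times\mathbb R^m$, $Y$ continuous, $\int_0^T|Z_t|^2dt<\infty$ and $\int_0^T|f(t,Z_t)|dt<\infty$ a.s., and $Y_t=F+\int_t^Tf(s,Z_s)ds-\int_t^TZ_s^{tr}dB_s$, $t\in[0,T]$. The ''unique solution'' is the one which is unique in the class: $E[\sup_{t\le T}e^{p\alpha Y_t^+}]<\infty$, $Y^-$ bounded, $E[\int_0^T|Z_s|^2ds]<\infty$. Admissible set: let $\mathbb Q^\theta$ be the probability on $\mathcal F_T$ with $d\mathbb Q^\theta/d\mathbb P=\mathcal E_T(-\int_0^\cdot\theta_t^{tr}dB_t)$, $\mathcal E$ the stochastic exponential. $\mathcal A_D^{M}$ is the set of $\mathbb R^d$-valued predictable processes $\pi$ with $\int_0^T|\sigma_t^{tr}\pi_t|^2dt<\infty$ a.s., $\pi_t\in\mathcal C$ $\mathbb P$-a.s. for $t\in[0,T]$, and such that $X^\pi$ is a martingale under $\mathbb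 Q^\theta$. *)

(* Defs.v *)
From HB Require Import structures.
From mathcomp Require Import all_boot all_order all_algebra.
From mathcomp Require Import all_classical all_reals all_analysis.
Import Order.TTheory GRing.Theory Num.Theory.
Import numFieldNormedType.Exports.

Local Open Scope classical_set_scope.
Local Open Scope ring_scope.

(* Processes are functions of time and outcome; only their values at times of
   [0, T] are ever used.  Vectors are column vectors. *)

Section euclid.
Context {R : realType} {n : nat}.
Implicit Types (u v z : 'cV[R]_n) (K : set 'cV[R]_n).

Definition dot u v : R := \sum_(i < n) u i 0 * v i 0.

(* The library norm on matrices is the sup norm. *)
Definition enorm u : R := Num.sqrt (dot u u).

Definition dist K z : R := inf [set enorm (z - y) | y in K].

Definition is_proj K z y : Prop :=
  K y /\ forall y', K y' -> enorm (z - y) <= enorm (z - y').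

End euclid.

Section processes.
Context {disp : measure_display} {Om : measurableType disp} {R : realType}.
Variables (P : probability Om R) (T : R) (Ft : R -> set (set Om)).

Definition measurable_wrt (G : set (set Om)) (f : Om -> R) : Prop :=
  forall U : set R, measurable U -> G (f @^-1` U).

Definition adapted (X : R -> Om -> R) : Prop :=
  forall t : R, 0 <= t <= T -> measurable_wrt (Ft t) (X t).

Definition predictable_sets : set (set (R * Om)) :=
  <<s `[0, T] `*` setT,
    [set D | (exists (s t : R) A, [/\ 0 <= s, s < t, t <= T, Ft s A &
                D = `]s, t] `*` A]) \/
             (exists2 A, Ft 0 A & D = [set 0] `*` A)] >>.

Definition predictable (X : R -> Om -> R) : Prop :=
  forall U : set R, measurable U ->
    predictable_sets ((`[0, T] `*` setT) `&` [set z | U (X z.1 z.2)]).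

Definition predictable_mx {k l : nat} (X : R -> Om -> 'M[R]_(k, l)) : Prop :=
  forall i j, predictable (fun t w => X t w i j).

Definition bounded_mx {k l : nat} (X : R -> Om -> 'M[R]_(k, l)) : Prop :=
  exists c : R, {ae P, forall w, forall t : R, 0 <= t <= T ->
    forall i j, `|X t w i j| <= c}.

Definition ae_continuous (X : R -> Om -> R) : Prop :=
  {ae P, forall w, {within `[0, T], continuous (fun t => X t w)}}.

Definition square_integrable {n : nat} (X : R -> Om -> 'cV[R]_n) : Prop :=
  {ae P, forall w,
    (\int[lebesgue_measure]_(t in `[0%R, T]) (enorm (X t w) ^+ 2)%:E < +oo)%E}.

Definition martingale (X : R -> Om -> R) : Prop :=
  [/\ adapted X,
      (forall t : R, 0 <= t <= T -> P.-integrable setT (EFin \o X t)) &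
      forall s t : R, 0 <= s -> s <= t -> t <= T -> forall A, Ft s A ->
        (\int[P]_(w in A) (X t w)%:E = \int[P]_(w in A) (X s w)%:E)%E].

Definition cvg0_in_probability (X : nat -> Om -> \bar R) : Prop :=
  forall e : R, 0 < e ->
    (P [set w | (e%:E <= X n w)%E] @[n --> \oo] --> 0%E).

End processes.

Section brownian.
Context {disp : measure_display} {Om : measurableType disp} {R : realType}.
Context {m : nat}.
Variables (P : probability Om R) (T : R) (B : R -> Om -> 'cV[R]_m).

Definition past_events (t : R) : set (set Om) :=
  [set A | exists (s : R) (i : 'I_m) (U : set R),
     [/\ 0 <= s <= t, measurable U & A = [set w | U (B s w i 0)]]].

Definition augmented_filtration (t : R) : set (set Om) :=
  <<s past_events t `|` [set N | P.-negligible N] >>.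

(* In the last clause, B_t - B_s is independent of sigma(B_u, u <= s) and has
   law N(0, (t - s) I); the second parameter of normal_prob is the standard
   deviation. *)
Definition brownian_motion : Prop :=
  [/\ (forall (t : R) i, 0 <= t <= T ->
         measurable_fun setT (fun w => B t w i 0)),
      {ae P, forall w, B 0 w = 0},
      (forall i, ae_continuous P T (fun t w => B t w i 0)) &
      forall s t : R, 0 <= s -> s < t -> t <= T ->
      forall (A : set Om) (U : 'I_m -> set R),
        <<s past_events s >> A -> (forall i, measurable (U i)) ->
        P (A `&` [set w | forall i, U i (B t w i 0 - B s w i 0)]) =
        (P A * \prod_(i < m) normal_prob 0 (Num.sqrt (t - s)) (U i))%E].

(* The simple integrand sum_k xi_k 1_{]s_k, t_k]}. *)
Record simple_process := SimpleProcess {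
  sp_size : nat;
  sp_start : 'I_sp_size -> R;
  sp_end : 'I_sp_size -> R;
  sp_coef : 'I_sp_size -> Om -> 'cV[R]_m }.

Definition is_simple (S : simple_process) : Prop :=
  forall k : 'I_(sp_size S),
    [/\ 0 <= sp_start S k, sp_start S k <= sp_end S k, sp_end S k <= T,
        (forall i, measurable_wrt (augmented_filtration (sp_start S k))
                     (fun w => sp_coef S k w i 0)) &
        exists c : R, forall w i, `|sp_coef S k w i 0| <= c].

Definition simple_val (S : simple_process) (t : R) (w : Om) : 'cV[R]_m :=
  \sum_(k < sp_size S)
    (\1_(`]sp_start S k, sp_end S k] : set R) t : R) *: sp_coef S k w.

Definition simple_integral (S : simple_process) (t : R) (w : Om) : R :=
  \sum_(k < sp_size S)
    dot (sp_coef S k w)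
      (B (Num.min (sp_end S k) t) w - B (Num.min (sp_start S k) t) w).

(* The Ito integral of a predictable H with int_0^T |H|^2 dt < oo a.s. is the
   limit, uniformly in time in probability, of the integrals of simple
   processes S_n with int_0^T |S_n - H|^2 dt -> 0 in probability.  This
   determines it up to indistinguishability. *)
Definition is_ito_integral (H : R -> Om -> 'cV[R]_m) (I : R -> Om -> R) :
    Prop :=
  [/\ adapted T augmented_filtration I, ae_continuous P T I &
      exists S : nat -> simple_process,
        [/\ (forall n, is_simple (S n)),
            cvg0_in_probability P (fun n w =>
              \int[lebesgue_measure]_(t in `[0%R, T])
                (enorm (simple_val (S n) t w - H t w) ^+ 2)%:E)%E &
            cvg0_in_probability P (fun n w =>
              ereal_sup [set `|simple_integral (S n) t w - I t w|%:E
                        | t in `[0, T]])]].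

Definition ito (H : R -> Om -> 'cV[R]_m) : R -> Om -> R :=
  xget (fun _ _ => 0) (is_ito_integral H).

(* The exponential of the continuous local martingale int_0^. H^tr dB, whose
   quadratic variation is int_0^. |H|^2 du. *)
Definition stochastic_exponential (H : R -> Om -> 'cV[R]_m) (t : R) (w : Om) :
    R :=
  expR (ito H t w -
    2^-1 * \int[lebesgue_measure]_(u in `[0, t]) (enorm (H u w) ^+ 2)).

End brownian.

Section market.
Context {disp : measure_display} {Om : measurableType disp} {R : realType}.
Context {d m : nat}.
Variables (P : probability Om R) (T : R) (B : R -> Om -> 'cV[R]_m).
Variables (alpha : R) (b : R -> Om -> 'cV[R]_d).
Variables (sigma : R -> Om -> 'M[R]_(d, m)) (C : set 'cV[R]_d).

Local Notation Ft := (augmented_filtration P B).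

Definition theta (t : R) (w : Om) : 'cV[R]_m :=
  (sigma t w)^T *m invmx (sigma t w *m (sigma t w)^T) *m b t w.

Definition sigmaC (t : R) (w : Om) : set 'cV[R]_m :=
  [set (sigma t w)^T *m y | y in C].

Definition gen (t : R) (w : Om) (z : 'cV[R]_m) : R :=
  alpha / 2 * dist (sigmaC t w) (z + alpha^-1 *: theta t w) ^+ 2
  - dot z (theta t w) - (2 * alpha)^-1 * enorm (theta t w) ^+ 2.

Definition bsde_solution (F : Om -> R)
    (Y : R -> Om -> R) (Z : R -> Om -> 'cV[R]_m) : Prop :=
  [/\ predictable T Ft Y /\ predictable_mx T Ft Z,
      ae_continuous P T Y,
      square_integrable P T Z,
      {ae P, forall w,
        (\int[lebesgue_measure]_(t in `[0%R, T]) `|gen t w (Z t w)|%:E < +oo)%E}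
    & {ae P, forall w, forall t : R, 0 <= t <= T ->
        Y t w = F w + \int[lebesgue_measure]_(s in `[t, T]) gen s w (Z s w)
                - (ito P T B Z T w - ito P T B Z t w)}].

Definition uniqueness_class (p : nat)
    (Y : R -> Om -> R) (Z : R -> Om -> 'cV[R]_m) : Prop :=
  [/\ (\int[P]_w ereal_sup
         [set (expR (p%:R * alpha * Num.max (Y t w) 0))%:E | t in `[0%R, T]]
         < +oo)%E,
      exists c : R, {ae P, forall w, forall t : R, 0 <= t <= T ->
        Num.max (- Y t w) 0 <= c} &
      (\int[P]_w \int[lebesgue_measure]_(s in `[0%R, T])
         (enorm (Z s w) ^+ 2)%:E < +oo)%E].

Definition wealth (x : R) (pi : R -> Om -> 'cV[R]_d) (t : R) (w : Om) : R :=
  x + ito P T B (fun u w => (sigma u w)^T *m pi u w) t w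
    + \int[lebesgue_measure]_(u in `[0, t])
        dot ((sigma u w)^T *m pi u w) (theta u w).

(* Q extends the measure Q^theta, which lives on the sigma-algebra F_T. *)
Definition is_Qtheta (Q : probability Om R) : Prop :=
  forall A, Ft T A ->
    Q A = (\int[P]_(w in A)
      (stochastic_exponential P T B (fun t w => - theta t w) T w)%:E)%E.

Definition admissible (Q : probability Om R) (pi : R -> Om -> 'cV[R]_d) :
    Prop :=
  [/\ predictable_mx T Ft pi,
      square_integrable P T (fun t w => (sigma t w)^T *m pi t w),
      (forall t : R, 0 <= t <= T -> {ae P, forall w, C (pi t w)}) &
      forall x, martingale Q T Ft (wealth x pi)].

Definition expected_utility (F : Om -> R) (x : R)
    (pi : R -> Om -> 'cV[R]_d) : \bar R :=
  'E_P[fun w => - expR (- alpha * (wealth x pi T w - F w))].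

Definition value_function (Q : probability Om R) (F : Om -> R) (x : R) :
    \bar R :=
  ereal_sup [set expected_utility F x pi | pi in admissible Q].

End market.

(* Main.v *)
Require Import Defs.
From HB Require Import structures.
From mathcomp Require Import all_boot all_order all_algebra.
From mathcomp Require Import all_classical all_reals all_analysis.
From mathcomp Require Import measurable_realfun ring lra.
Import Order.TTheory GRing.Theory Num.Theory.
Import numFieldNormedType.Exports.
Local Open Scope classical_set_scope.
Local Open Scope ring_scope.

(* Write q = sigma^tr pi, zeta = Z + theta / alpha, v for the projection of zeta
   and h = alpha (Z - v), and let E(H) be the exponential of int H dB minus half
   of int |H|^2 dt.  The BSDE says that exp (- alpha (X* - x) + alpha (Y - Y_0))
   = E(h) along the strategy given by v, so that the optimal utility is a
   multiple of the mass of M = E_T(h).  Stopping h when a clock exceeds n gives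
   densities M_n of mass one, and the sign of v.(zeta - v) together with Fenchel's
   inequality and the exponential moment of sup Y^+ bounds E[M_n ln M_n]: the M_n
   are uniformly integrable, M has mass one, and E[M X*_T] is at least the
   expected gain E[M int v.(theta + h) dt].  For another strategy the tangent line
   of exp at X*_T bounds the utility by that of v as soon as E[M X_T] does not
   exceed E[M X*_T].  As q.(theta + h) <= v.(theta + h), this follows by Fatou's
   lemma, where X is bounded below by an M-integrable variable: the martingale
   property under Q^theta controls the tail of its running minimum.  Ito's
   formula is never needed: everything about stochastic integrals rests on the
   exponential martingales of simple integrands. *)

Set Implicit Arguments.
Unset Strict Implicit.
Unset Printing Implicit Defensive.

(** * Almost sure convergence and integration *)

Section measure_toolbox.
Context {d} {X : measurableType d} {R : realType}.
Variable mu : {measure set X -> \bar R}.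
Local Open Scope ereal_scope.

(** The choice of [h] comes from [theta + h = alpha (zeta - v)]: completing the square turns the
    generator into [|h|^2 / (2 alpha) - v.theta], which is what an exponential density needs. The
    obstacle is that [int |h|^2] is not bounded, so [M] might lose mass. The hypothesis [p > 1]
    prevents this: Fenchel's inequality bounds [M_n alpha Y^+] by
    [(M_n ln M_n + exp (p alpha Y^+)) / p], and a fraction [1 / p < 1] of the entropy can be
    absorbed. Finite entropy also makes every variable with an exponential moment of some positive
    order integrable against [M], and the lower bound of a competing wealth is built to have one.
    That bound is found under [Q] by a maximal inequality and carried back to [P], where the density
    is square integrable and its inverse integrable because [theta] is bounded. Stopped integrals
    are identified through the locality of the integral, itself a consequence of a tail estimate
    that involves the energy [int |H|^2] along the path and never its expectation. *)

Lemma cvge0P (u : nat -> \bar R) : (forall n, 0 <= u n) ->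
  u @ \oo --> 0 <-> forall e, (0 < e)%R -> \forall n \near \oo, u n < e%:E.
Proof.
move=> u0; split=> [u_cvg e e0|u_small].
  move/fine_cvgP : u_cvg => [ufin /cvgrPdist_lt/(_ _ e0) u_lt].
  near=> n; have un : u n \is a fin_num by near: n.
  rewrite -(fineK un) lte_fin (le_lt_trans (ler_norm _))// -normrN -sub0r.
  by near: n.
have ufin : \forall n \near \oo, u n \is a fin_num.
  apply: filterS (u_small 1%R ltr01) => n un.
  by rewrite ge0_fin_numE// (lt_trans un)// ltry.
apply/fine_cvgP; split => //; apply/cvgrPdist_lt => e e0.
near=> n; rewrite sub0r normrN ger0_norm ?fine_ge0//=.
rewrite -lte_fin fineK; last by near: n.
by near: n; exact: u_small.
Unshelve. all: by end_near. Qed.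

Lemma ae_set_measurable (Q : X -> Prop) : measure_is_complete mu ->
  {ae mu, forall x, Q x} -> measurable [set x | Q x].
Proof.
move=> cmu aQ; rewrite -(setCK [set x | Q x]); apply: measurableC.
exact: cmu.
Qed.

Import HBNNSimple.

(** The law [nu] is known only on sets, so the identity passes from indicators through simple
    functions to monotone limits. [V] is often the identity from [Om] onto [Om] under a smaller
    sigma-algebra, which restricts [P] to past events or reads a density known only on them. *)
Lemma ge0_integral_law d' (Y : measurableType d') (V : X -> Y) (W : X -> R)
    (nu : {measure set Y -> \bar R}) :
  measurable_fun setT V -> measurable_fun setT W -> (forall x, 0 <= W x)%R ->
  (forall C, measurable C -> \int[mu]_(x in V @^-1` C) (W x)%:E = nu C) ->
  forall f : Y -> \bar R, measurable_fun setT f -> (forall y, 0 <= f y) ->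
  \int[mu]_x (f (V x) * (W x)%:E) = \int[nu]_y f y.
Proof.
move=> mV mW W0 VW f mf f0.
pose g := nnsfun_approx measurableT mf.
have gf y : (fun n => (g n y)%:E) @ \oo --> f y by exact: cvg_nnsfun_approx.
have ndg : forall y a b, (a <= b)%N -> (g a y <= g b y)%R.
  by move=> y a b ab; exact/lefP/nd_nnsfun_approx.
transitivity (limn (fun n => \int[mu]_x ((g n (V x))%:E * (W x)%:E))).
  rewrite -monotone_convergence//.
  - apply: eq_integral => x _; apply/esym/cvg_lim => //.
    by apply: cvgeZr => //; exact: gf.
  - move=> n; apply: emeasurable_funM; apply/measurable_EFinP => //.
    by apply: measurableT_comp.
  - by move=> n x _; rewrite mule_ge0// lee_fin.
  - by move=> x _ a b ab; apply: lee_wpmul2r; rewrite lee_fin//; exact: ndg.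
transitivity (limn (fun n => \int[nu]_y (g n y)%:E)); last first.
  rewrite -monotone_convergence//.
  - by apply: eq_integral => x _; apply/cvg_lim => //; exact: gf.
  - by move=> n; apply/measurable_EFinP.
  - by move=> n x _; rewrite lee_fin.
  - by move=> x _ a b ab; rewrite lee_fin ndg.
congr (limn _); apply/funext => n.
have indich m r : measurable_fun setT (fun x => (r * \1_(g m @^-1` [set r]) x)%:E).
  by apply/measurable_EFinP; apply: measurable_funM.
transitivity (\int[nu]_y
   (\sum_(r \in range (g n)) (r * \1_(g n @^-1` [set r]) y)%:E)); last first.
  by apply: eq_integral => t tE; rewrite /= fimfunE -fsumEFin.
rewrite ge0_integral_fsum//; last by move=> m y Ey; exact: nnfun_muleindic_ge0.
transitivity (\int[mu]_x (\sum_(r \in range (g n))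
    (r * \1_(g n @^-1` [set r]) (V x))%:E * (W x)%:E)).
  under [RHS]eq_integral => x xE.
    rewrite -ge0_mule_fsuml => [|y]; last exact: nnfun_muleindic_ge0.
    rewrite fsumEFin // -(fimfunE _ (V x)); over.
  by [].
rewrite ge0_integral_fsum//; last 2 first.
  - move=> y; apply: emeasurable_funM; last exact/measurable_EFinP.
    by apply: (measurableT_comp (indich n y)).
  - by move=> m y Ey; apply: mule_ge0; [exact: nnfun_muleindic_ge0|rewrite lee_fin].
apply: eq_fsbigr => r rhn.
under [RHS]eq_integral do rewrite EFinM.
rewrite integralZl_indic_nnsfun => //.
under eq_integral do rewrite EFinM -muleA.
have mVr : measurable (V @^-1` (g n @^-1` [set r])).
  by rewrite -[X in measurable X]setTI; apply: mV.
rewrite ge0_integralZl//.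
- congr (_ * _).
  rewrite integral_indic// setIT -VW// [RHS]integral_mkcond.
  apply: eq_integral => x _; rewrite patchE indicE.
  by have -> : (V x \in g n @^-1` [set r]) = (x \in V @^-1` (g n @^-1` [set r])) by [];
    case: ifP => _; rewrite ?mul1e ?mul0e.
- apply: emeasurable_funM; apply/measurable_EFinP => //.
  exact: (@measurable_indic _ X R setT _ mVr).
- by move=> t Et; apply: mule_ge0; rewrite lee_fin.
- by move: rhn; rewrite inE => -[t _ <-]; rewrite lee_fin.
Qed.

Lemma fatou_le (f : nat -> X -> R) (g : X -> R) (c : \bar R) :
  (forall n, measurable_fun setT (f n)) -> measurable_fun setT g ->
  (forall n x, (0 <= f n x)%R) -> (forall x, 0 <= g x)%R ->
  {ae mu, forall x, f ^~ x @ \oo --> g x} ->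
  (\forall n \near \oo, \int[mu]_x (f n x)%:E <= c) ->
  \int[mu]_x (g x)%:E <= c.
Proof.
move=> mf mg f0 g0 fg fc.
have mf' n : measurable_fun setT (EFin \o f n) by exact/measurable_EFinP.
apply: (@le_trans _ _ (\int[mu]_x limn_einf (fun n => (f n x)%:E))).
  apply: ae_ge0_le_integral => //.
  - by move=> x _; rewrite lee_fin.
  - exact/measurable_EFinP.
  - move=> x _; rewrite limn_einf_lim; apply: lime_ge.
      by apply: is_cvg_einfs.
    by apply: nearW => n; apply: le_ereal_inf_tmp => _ [m /= nm <-]; rewrite lee_fin.
  - apply: (eq_measurable_fun (fun x => - limn_esup (fun n => - (f n x)%:E))).
      by move=> x _; rewrite limn_esupN oppeK.
    apply: measurableT_comp => //; apply: measurable_fun_limn_esup => n.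
    exact: (measurableT_comp (@oppe_measurable _ _) (mf' n)).
  - apply: filterS fg => x fgx _.
    have fE : (fun n => (f n x)%:E) @ \oo --> (g x)%:E.
      by apply: cvg_EFin; [exact: nearW|exact: fgx].
    by have [-> _] := cvg_limn_einf_sup fE.
apply: (le_trans (fatou _ _ _ _)) => //.
  by move=> n x _; rewrite lee_fin.
rewrite limn_einf_lim; apply: lime_le; first exact: is_cvg_einfs.
case: fc => N _ fc; apply: nearW => n.
(* Only a tail of the integrals is bounded and rank [n] may precede it, so the infimum over later
   ranks is compared with rank [maxn n N]. *)
apply: (@le_trans _ _ (\int[mu]_x (f (maxn n N) x)%:E)).
  by apply: ereal_inf_lbound; exists (maxn n N) => //=; rewrite leq_maxl.
by apply: fc => /=; rewrite leq_maxr.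
Qed.

Lemma ae_lim_sup_set (F : nat -> set X) : (forall n, measurable (F n)) ->
  mu (lim_sup_set F) = 0 -> {ae mu, forall x, \forall n \near \oo, ~ F n x}.
Proof.
move=> mF F0; exists (lim_sup_set F); split => //.
  by apply: bigcap_measurable => // k _; exact: bigcup_measurable.
move=> x /= nx n _ /=; apply: contrapT => h; apply: nx; exists n => // k /= nk Fk.
by apply: h; exists k.
Qed.

End measure_toolbox.

Section convergence_in_probability.
Context {d} {X : measurableType d} {R : realType} (P : probability X R).
Local Open Scope ereal_scope.

(** For a finite measure the tail unions decrease in measure to the limsup set, here null, and the
    event at rank [n] lies in the tail union from [n] on. *)
Lemma ae_small_cvg0 (u : nat -> X -> \bar R) :
  (forall n e, measurable [set w | e%:E <= u n w]) ->
  {ae P, forall w, forall e, (0 < e)%R -> \forall n \near \oo, u n w < e%:E} ->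
  cvg0_in_probability P u.
Proof.
move=> mu_ [N [mN N0 uN]] e e0.
pose F n := [set w | e%:E <= u n w].
have lim0 : P (lim_sup_set F) = 0.
  apply: (subset_measure0 _ mN) => //.
  - by apply: bigcap_measurable => // k _; apply: bigcup_measurable => j _; exact: mu_.
  - move=> w Fw; apply: uN => /= /(_ e e0) [n _ un].
    by have [k /= nk] := Fw n Logic.I; rewrite /F/= leNgt un.
have /= := @lim_sup_set_cvg _ _ _ P F (fun n => mu_ n e).
rewrite lim0 => /(_ _)/wrap[].
  by apply: (le_lt_trans (probability_le1 _ _)); rewrite ?ltry//; apply: bigcup_measurable => j _; exact: mu_.
move=> FP; apply: (squeeze_cvge _ (cvg_cst _) FP).
near=> n; rewrite measure_ge0/= le_measure ?inE//.
  by apply: bigcup_measurable => j _; exact: mu_.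
by move=> w uw; exists n => /=.
Unshelve. all: by end_near. Qed.

(** Ranks are chosen so that both exceptional events have probability at most [2^-(n+1)], and
    Borel-Cantelli applies. Two sequences are treated at once because the integrands and the
    integrals of an Ito approximation must converge along the same ranks. *)
Lemma cvg0_ae_subseq (u v : nat -> X -> \bar R) :
  (forall n e, measurable [set w | e%:E <= u n w]) ->
  (forall n e, measurable [set w | e%:E <= v n w]) ->
  cvg0_in_probability P u -> cvg0_in_probability P v ->
  exists g : nat -> nat,
  {ae P, forall w, forall e, (0 < e)%R -> \forall n \near \oo, u (g n) w < e%:E} /\
  {ae P, forall w, forall e, (0 < e)%R -> \forall n \near \oo, v (g n) w < e%:E}.
Proof.
move=> mu_ mv_ uP vP.
have e2_gt0 n : (0 < (2 ^+ n.+1)^-1 :> R)%R by rewrite invr_gt0 exprn_gt0.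
have P0 (A : set X) : 0 <= P A by [].
have /choice[g gP] n : exists k, P [set w | ((2 ^+ n.+1)^-1)%:E <= u k w] <= ((2 ^+ n.+1)^-1)%:E /\
    P [set w | ((2 ^+ n.+1)^-1)%:E <= v k w] <= ((2 ^+ n.+1)^-1)%:E.
  have /cvge0P/(_ _ (e2_gt0 n)) := uP _ (e2_gt0 n).
  move=> /(_ (fun=> P0 _))[N1 _ N1P].
  have /cvge0P/(_ _ (e2_gt0 n)) := vP _ (e2_gt0 n).
  move=> /(_ (fun=> P0 _))[N2 _ N2P].
  by exists (maxn N1 N2); split; apply: ltW; [apply: N1P|apply: N2P];
    rewrite /= ?leq_maxl ?leq_maxr.
have key (x : nat -> X -> \bar R) : (forall n e, measurable [set w | e%:E <= x n w]) ->
    (forall n, P [set w | ((2 ^+ n.+1)^-1)%:E <= x (g n) w] <= ((2 ^+ n.+1)^-1)%:E) ->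
    {ae P, forall w, forall e, (0 < e)%R -> \forall n \near \oo, x (g n) w < e%:E}.
  move=> mx xP; pose F n := [set w | ((2 ^+ n.+1)^-1)%:E <= x (g n) w].
  have F0 : P (lim_sup_set F) = 0.
    apply: lim_sup_set_cvg0 => //; first by move=> n; exact: mx.
    apply: (@le_lt_trans _ _ (\sum_(n <oo) (1 / (2 ^ n.+1)%:R)%:E)).
      by apply: lee_nneseries => // n _; rewrite natrX div1r; exact: xP.
    by apply: (le_lt_trans (epsilon_trick0 xpredT ler01)); rewrite ltry.
  have := @ae_lim_sup_set _ _ _ P F (fun n => mx _ _) F0.
  apply: filterS => w Fw e e0.
  near=> n.
  have : ~ F n w by near: n.
  move=> /negP; rewrite -ltNge => /lt_le_trans; apply; rewrite lee_fin.
  near: n.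
  have /cvgrPdist_lt/(_ _ e0) : (2^-1 ^+ n : R)%R @[n --> \oo] --> (0 : R)%R.
    by apply: cvg_expr; rewrite ger0_norm// invf_lt1// ltr1n.
  apply: filterS => n; rewrite sub0r normrN ger0_norm ?exprn_ge0// => /ltW.
  apply: le_trans; rewrite -exprVn exprS ler_piMl ?exprn_ge0//.
  by rewrite invf_le1// ler1n.
by exists g; split; apply: key => // n; have [] := gP n.
Unshelve. all: by end_near. Qed.

End convergence_in_probability.

(** * Progressive measurability *)

Section parametric_integral.
Context {d1 d2} {X : measurableType d1} {Y : measurableType d2} {R : realType}.
Variable mu : {sigma_finite_measure set X -> \bar R}.
Local Open Scope ereal_scope.

Lemma ge0_measurable_fun_integral (E : set X) (g : X * Y -> \bar R) :
  measurable E -> measurable_fun (E `*` setT) g ->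
  (forall z, (E `*` setT) z -> 0 <= g z) ->
  measurable_fun setT (fun y => \int[mu]_(x in E) g (x, y)).
Proof.
move=> mE mg g0.
have mEY : measurable (E `*` setT : set (X * Y)) by exact: measurableX.
have mg' : measurable_fun setT (g \_ (E `*` setT)) by exact/(measurable_restrictT _ _).1.
have g0' z : 0 <= (g \_ (E `*` setT)) z.
  by rewrite patchE; case: ifPn => // /set_mem; exact: g0.
apply: (eq_measurable_fun (fubini_G mu (g \_ (E `*` setT)))); last first.
  exact: measurable_fun_fubini_tonelli_G.
move=> y _; rewrite /fubini_G [RHS]integral_mkcond; apply: eq_integral => x _.
rewrite !patchE; congr (if _ then _ else _).
by apply/idP/idP => /set_mem h; apply/mem_set => //=; case: h.
Qed.

Lemma measurable_fun_integral (E : set X) (g : X * Y -> \bar R) :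
  measurable E -> measurable_fun (E `*` setT) g ->
  measurable_fun setT (fun y => \int[mu]_(x in E) g (x, y)).
Proof.
move=> mE mg.
apply: (eq_measurable_fun (fun y => \int[mu]_(x in E) g^\+ (x, y) -
                                    \int[mu]_(x in E) g^\- (x, y))).
  by move=> y _; rewrite [RHS]integralE; congr (_ - _);
    apply: eq_integral => x _; rewrite /= ?funeposE ?funenegE.
apply: emeasurable_funB; apply: ge0_measurable_fun_integral => //.
- exact: measurable_funepos.
- exact: measurable_funeneg.
Qed.

End parametric_integral.

Section filtration.
Context {disp : measure_display} {Om : measurableType disp} {R : realType}.
Context {m : nat}.
Variables (P : probability Om R) (T : R) (B : R -> Om -> 'cV[R]_m).
Hypothesis P_complete : measure_is_complete P.
Hypothesis mB : forall (t : R) i, 0 <= t <= T -> measurable_fun setT (fun w => B t w i 0).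

Local Notation Ft := (augmented_filtration P B).

Definition filtration_gen t := past_events B t `|` [set N | P.-negligible N].

(** [Om] under the sigma-algebra of time [t]. As a separate type it turns adaptedness into ordinary
    measurability, with all its closure properties. *)
Definition OmF t := g_sigma_algebraType (filtration_gen t).

Lemma Ft_sub s t : s <= t -> Ft s `<=` Ft t.
Proof.
move=> st; apply: sub_sigma_algebra2 => A [|nA]; last by right.
move=> [r [i [U [/andP[r0 rs] mU ->]]]]; left.
by exists r, i, U; split => //; rewrite r0 (le_trans rs).
Qed.

Lemma Ft_measurable t : t <= T -> Ft t `<=` measurable.
Proof.
move=> tT; apply: smallest_sub; first exact: sigma_algebra_measurable.
move=> A [[r [i [U [/andP[r0 rt] mU ->]]]]|]; last exact: P_complete.
rewrite -[X in measurable X]setTI.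
by apply: (@mB r i _ measurableT _ mU); rewrite r0 (le_trans rt).
Qed.

Lemma Ft_negligible t N : P.-negligible N -> Ft t N.
Proof. by move=> nN; apply: sub_sigma_algebra; right. Qed.

Lemma Ft_ae t (Q : Om -> Prop) : {ae P, forall w, Q w} -> Ft t [set w | Q w].
Proof.
move=> aQ; rewrite -(setCK [set w | Q w]).
by apply: sigma_algebraC; exact: Ft_negligible.
Qed.

Lemma measurable_wrtP t (f : Om -> R) :
  measurable_wrt (Ft t) f <-> measurable_fun setT (f : OmF t -> R).
Proof.
split => [mf _ U mU|mf U mU]; first by rewrite setTI; exact: mf.
by rewrite -[X in Ft t X]setTI; exact: mf.
Qed.

Lemma Ft_measurable_id t : t <= T -> measurable_fun setT (id : Om -> OmF t).
Proof. by move=> tT _ U mU; rewrite setTI; exact: (Ft_measurable tT mU). Qed.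

Lemma Ft_sub_id s t : s <= t -> measurable_fun setT (id : OmF t -> OmF s).
Proof. by move=> st _ U mU; rewrite setTI; exact: (Ft_sub st mU). Qed.

(** The augmentation at work: the two preimages differ by a negligible set, and all of those belong
    to the filtration at every time. *)
Lemma ae_eq_Ft_measurable d' (Y : measurableType d') t (f g : Om -> Y) :
  {ae P, forall w, f w = g w} ->
  measurable_fun setT (f : OmF t -> Y) -> measurable_fun setT (g : OmF t -> Y).
Proof.
move=> fg mf _ U mU; rewrite setTI.
have fg_m : measurable ([set w | f w = g w] : set (OmF t)) := @Ft_ae t _ fg.
have fg_n : measurable (g @^-1` U `\` [set w | f w = g w] : set (OmF t)).
  by apply: Ft_negligible; apply: negligibleS fg => w [].
rewrite (_ : g @^-1` U = (f @^-1` U `&` [set w | f w = g w]) `|`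
    (g @^-1` U `\` [set w | f w = g w])).
  apply: measurableU => //; apply: measurableI => //.
  by rewrite -[X in measurable X]setTI; exact: mf.
apply/seteqP; split=> w /=.
  by move=> Ug; have [fgw|] := pselect (f w = g w); [left; rewrite fgw|right].
by move=> [[+ <-]//|[]].
Qed.

Definition predictable_gen : set (set (R * Om)) :=
  [set D | (exists (s t : R) A, [/\ 0 <= s, s < t, t <= T, Ft s A &
                D = `]s, t] `*` A]) \/
             (exists2 A, Ft 0 A & D = [set 0] `*` A)].

(** Generated on all of [R * Om], as a measurable type requires, while [predictable_sets] is a
    sigma-algebra on [[0, T] * Om] only; [predictable_setsE] shows that the traces agree. *)
Definition OmP := g_sigma_algebraType predictable_gen.

Hypothesis T_gt0 : 0 < T.

Lemma Ft_setT t : Ft t setT.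
Proof. exact: (@measurableT _ (OmF t)). Qed.

Lemma predictable_dom : measurable (`[0, T] `*` setT : set OmP).
Proof.
rewrite -(@setU1itv _ _ _ _ false) ?bnd_simp 1?ltW// setXT preimage_setU -!setXT; apply: measurableU.
  by apply: sub_sigma_algebra; right; exists setT => //; exact: Ft_setT.
by apply: sub_sigma_algebra; left; exists 0, T, setT; split => //; exact: Ft_setT.
Qed.

Lemma predictable_setsE A : predictable_sets T Ft (`[0, T] `*` setT `&` A) <->
  measurable (`[0, T] `*` setT `&` A : set OmP).
Proof.
set D := `[0, T] `*` setT; split.
  suff : <<s D, predictable_gen >> `<=` [set A | measurable (A : set OmP)] by apply.
  apply: smallest_sub; last by move=> C; exact: sub_sigma_algebra.
  split => /=; first exact: measurable0.
  - by move=> C mC; apply: measurableD => //; exact: predictable_dom.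
  - by move=> F mF; exact: bigcupT_measurable.
suff h : <<s predictable_gen >> `<=` [set A | predictable_sets T Ft (D `&` A)].
  by move/h => /=; rewrite setIA setIid.
apply: smallest_sub; last first.
  move=> C GC /=; rewrite setIidr; first exact: sub_sigma_algebra.
  case: GC => [[s [t [E [s0 st tT _ ->]]]]|[E _ ->]] [r w] /= [rE _]; split => //=.
    by move: rE; rewrite /= !in_itv/= => /andP[sr rt]; rewrite (le_trans s0 (ltW sr)) (le_trans rt).
  by rewrite rE in_itv/= lexx ltW.
split => /=; first by rewrite setI0; exact: sigma_algebra0.
- move=> C mC; rewrite (_ : D `&` (setT `\` C) = D `\` (D `&` C)).
    exact: sigma_algebraCD.
  by apply/seteqP; split => x /=; tauto.
- by move=> F mF; rewrite setI_bigcupr; exact: sigma_algebra_bigcup.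
Qed.

Lemma predictableP (X : R -> Om -> R) : predictable T Ft X <->
  measurable_fun (`[0, T] `*` setT : set OmP) (fun z : OmP => X z.1 z.2).
Proof.
split=> [pX mD U mU|pX U mU]; first exact: (proj1 (predictable_setsE _) (pX U mU)).
exact: (proj2 (predictable_setsE _) (pX predictable_dom U mU)).
Qed.

(** Checked on generators: a rectangle that starts after [t] becomes empty when cut at [t], and one
    that starts earlier rests on an event already known at [t]. *)
Lemma predictable_progressive t A : 0 <= t <= T -> measurable (A : set OmP) ->
  measurable (`[0, t] `*` setT `&` A : set (R * OmF t)).
Proof.
move=> /andP[t0 tT].
suff : <<s predictable_gen >> `<=`
    [set A | measurable (`[0, t] `*` setT `&` A : set (R * OmF t))] by apply.
have mD : measurable (`[0, t] `*` setT : set (R * OmF t)).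
  by apply: measurableX => //; exact: measurable_itv.
apply: smallest_sub; last first.
  move=> C [[s [u [E [s0 su uT FE ->]]]]|[E FE ->]] /=; rewrite -setXI setTI.
    have [st|ts] := leP s t.
      by apply: measurableX; [exact: measurableI|exact: (Ft_sub st)].
    rewrite (_ : _ `&` _ = set0) ?set0X//.
    apply/seteqP; split => // r /=; rewrite !in_itv/= => -[/andP[_ rt] /andP[sr _]].
    by move: (lt_le_trans sr rt); rewrite ltNge (ltW ts).
  by apply: measurableX; [exact: measurableI|exact: (Ft_sub t0)].
split => /=; first by rewrite setI0.
- move=> C mC; rewrite (_ : `[0, t] `*` setT `&` (setT `\` C) =
      `[0, t] `*` setT `\` (`[0, t] `*` setT `&` C)).
    exact: measurableD.
  by apply/seteqP; split => x /=; tauto.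
- by move=> F mF; rewrite setI_bigcupr; exact: bigcupT_measurable.
Qed.

Section predictable_functions.
Context {d'} {Y : measurableType d'}.
Implicit Type f : R * Om -> Y.

Definition predictable_fun f :=
  measurable_fun (`[0, T] `*` setT : set OmP) (f : OmP -> Y).

Lemma predictable_fun_progressive f t : 0 <= t <= T -> predictable_fun f ->
  measurable_fun (`[0, t] `*` setT : set (R * OmF t)) (f : R * OmF t -> Y).
Proof.
move=> t0T pf _ U mU.
have := predictable_progressive t0T (pf predictable_dom U mU).
move: t0T => /andP[_ tT].
congr measurable; apply/seteqP; split=> [[r w]/= [? []]//|[r w]/= []].
rewrite !in_itv/= => -[/andP[r0 rt] _] ?; split; first by rewrite r0.
by rewrite r0 (le_trans rt).
Qed.

Lemma measurable_fun_prod_Ft d'' (X : measurableType d'') t (E : set X) (f : X * Om -> Y) :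
  t <= T -> measurable E ->
  measurable_fun (E `*` setT : set (X * OmF t)) (f : X * OmF t -> Y) ->
  measurable_fun (E `*` setT) f.
Proof.
move=> tT mE mf _ U mU.
have mid : measurable_fun setT (fun z : X * Om => (z.1, z.2) : X * OmF t).
  apply/measurable_fun_pairP; split; first exact: measurable_fst.
  exact: (measurableT_comp (Ft_measurable_id tT) (@measurable_snd _ _ _ _)).
have hC (C : set (X * OmF t)) : measurable C -> measurable (C : set (X * Om)).
  move=> mC; have := mid measurableT C mC; rewrite setTI.
  by congr measurable; apply/seteqP; split => -[].
by apply: hC; apply: mf => //; exact: measurableX.
Qed.

End predictable_functions.

End filtration.

(** * Exponential martingales of the Brownian motion *)

Section density_law.
Context {d1 d2} {X : measurableType d1} {Y : measurableType d2} {R : realType}.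
Variable mu : {measure set X -> \bar R}.
Variables (V : X -> Y) (W : X -> R).
Hypotheses (mV : measurable_fun setT V) (mW : measurable_fun setT W)
  (W0 : forall x, 0 <= W x).
Local Open Scope ereal_scope.

(** The measure [W dmu] transported by [V]. The proofs are arguments so that the name alone carries
    what the measure structure declared below requires. *)
Definition density_law of measurable_fun setT V & measurable_fun setT W &
  (forall x, (0 <= W x)%R) := fun C : set Y => \int[mu]_(x in V @^-1` C) (W x)%:E.

Local Notation nu := (density_law mV mW W0).

Let nu0 : nu set0 = 0.
Proof. by rewrite /density_law preimage_set0 integral_set0. Qed.

Let nu_ge0 C : 0 <= nu C.
Proof. by apply: integral_ge0 => x _; rewrite lee_fin. Qed.

Let nu_sigma_additive : semi_sigma_additive nu.
Proof.
move=> F mF tF mUF; rewrite /density_law preimage_bigcup ge0_integral_bigcup//.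
- apply: is_cvg_ereal_nneg_natsum_cond => n _ _.
  by apply: integral_ge0 => x _; rewrite lee_fin.
- by move=> n; rewrite -[X in measurable X]setTI; exact: mV.
- by apply/measurable_funTS/measurable_EFinP.
- by move=> x _; rewrite lee_fin.
- apply/trivIsetP => i j _ _ ij; rewrite -preimage_setI.
  by move/trivIsetP : tF => -> //; rewrite preimage_set0.
Qed.

HB.instance Definition _ := isMeasure.Build _ _ _ nu nu0 nu_ge0 nu_sigma_additive.

End density_law.

Lemma measurable_prod_cond d (X : measurableType d) (R : realType) I (r : seq I)
    (p : pred I) (f : I -> X -> R) :
  (forall i, measurable_fun setT (f i)) ->
  measurable_fun setT (fun x => \prod_(i <- r | p i) f i x).
Proof.
move=> mf; elim: r => [|i r IH].
  by under eq_fun do rewrite big_nil; exact: measurable_cst.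
under eq_fun do rewrite big_cons.
by case: (p i) => //; exact: measurable_funM.
Qed.

Section gaussian.
Context {R : realType}.
Local Open Scope ereal_scope.

(** Completing the square: the integrand times the density of [N(0, v)] is the density of
    [N(a v, v)]. *)
Lemma integral_normal_expR (v a : R) : (0 < v)%R ->
  \int[normal_prob 0 (Num.sqrt v)]_x (expR (a * x - a ^+ 2 * v / 2))%:E = 1.
Proof.
move=> v0; have sv0 : (Num.sqrt v != 0 :> R)%R by rewrite gt_eqF// sqrtr_gt0.
have mf : measurable_fun [set: R] (fun x => (expR (a * x - a ^+ 2 * v / 2))%:E).
  apply/measurable_EFinP; apply: measurableT_comp => //.
  apply: measurable_funB => //; exact: measurable_funM.
rewrite -(@ge0_integral_law _ _ _ lebesgue_measure _ _ id
  (normal_pdf 0 (Num.sqrt v)) (normal_prob 0 (Num.sqrt v)) _ _ _ _ _ mf)//; last 2 first.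
- exact: measurable_normal_pdf.
- exact: normal_pdf_ge0.
rewrite -(integral_normal_pdf (a * v) (Num.sqrt v)); apply: eq_integral => x _.
rewrite !normal_pdfE// -EFinM mulrCA -expRD; congr (_ * expR _)%:E.
rewrite sqr_sqrtr 1?ltW// -mulr_natr; field.
by rewrite gt_eqF.
Qed.

End gaussian.

Section increments.
Context {disp : measure_display} {Om : measurableType disp} {R : realType}.
Context {m : nat}.
Variables (P : probability Om R) (T : R) (B : R -> Om -> 'cV[R]_m).
Hypothesis P_complete : measure_is_complete P.
Hypothesis B_brownian : brownian_motion P T B.

Local Notation Ft := (augmented_filtration P B).
Local Notation OmF := (OmF P B).

Lemma brownian_measurable (t : R) i : 0 <= t <= T ->
  measurable_fun setT (fun w => B t w i 0).
Proof. by case: B_brownian => + _ _ _; exact. Qed.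
Let mB := brownian_measurable.

Lemma negligible_eq_measure (A C : set Om) : measurable A -> measurable C ->
  P.-negligible (A `\` C) -> P.-negligible (C `\` A) -> P A = P C.
Proof.
move=> mA mC /negligibleP AC /negligibleP CA.
rewrite (measureDI P mA mC) [RHS](measureDI P mC mA) setIC.
by rewrite AC ?CA//; exact: measurableD.
Qed.

(** Independence of the increments is given for the raw past only. The events equal to a raw one up
    to a negligible set form a sigma-algebra that contains the generators of the augmented
    filtration. *)
Lemma Ft_raw_approx s A : Ft s A -> exists A',
  [/\ <<s past_events B s >> A', P.-negligible (A `\` A') &
      P.-negligible (A' `\` A)].
Proof.
suff h : Ft s `<=` [set A | exists A', [/\ <<s past_events B s >> A',
    P.-negligible (A `\` A') & P.-negligible (A' `\` A)]] by exact: h.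
apply: smallest_sub; last first.
  move=> C [pC|nC] /=.
    exists C; rewrite setDv; split; [exact: sub_sigma_algebra|exact: negligible_set0..].
  exists set0; rewrite setD0 set0D; split => //; [exact: sigma_algebra0|exact: negligible_set0].
split => /=.
- exists set0; rewrite setDv; split; [exact: sigma_algebra0|exact: negligible_set0..].
- move=> C [C' [sC n1 n2]]; exists (setT `\` C'); split; first exact: sigma_algebraCD.
    by apply: negligibleS n2 => w /= [[_ nC] /not_andP[//|/contrapT]].
  by apply: negligibleS n1 => w /= [[_ nC] /not_andP[//|/contrapT]].
- move=> F /choice[F' F'P]; exists (\bigcup_n F' n); split.
  + by apply: sigma_algebra_bigcup => n; have [] := F'P n.
  + apply: (@negligibleS _ _ _ _ (\bigcup_n (F n `\` F' n))).
      by move=> w [[n _ Fn] nF']; exists n => //; split => // F'n; apply: nF'; exists n.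
    by apply: negligible_bigcup => n; have [] := F'P n.
  + apply: (@negligibleS _ _ _ _ (\bigcup_n (F' n `\` F n))).
      by move=> w [[n _ Fn] nF']; exists n => //; split => // F'n; apply: nF'; exists n.
    by apply: negligible_bigcup => n; have [] := F'P n.
Qed.

Variables (s t : R).
Hypotheses (s_ge0 : 0 <= s) (st : s < t) (tT : t <= T).

Definition increment i w : R := B t w i 0 - B s w i 0.

Let s0T : 0 <= s <= T. Proof. by rewrite s_ge0 (le_trans (ltW st)). Qed.
Let t0T : 0 <= t <= T. Proof. by rewrite tT (le_trans s_ge0 (ltW st)). Qed.
Let sT : s <= T. Proof. by move/andP: s0T => []. Qed.

Lemma measurable_increment i : measurable_fun setT (increment i).
Proof. by apply: measurable_funB; exact: mB. Qed.

Local Notation v := (t - s).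
Local Notation N := (normal_prob 0 (Num.sqrt v)).

Lemma increment_indep A (U : 'I_m -> set R) : Ft s A ->
  (forall i, measurable (U i)) ->
  P (A `&` [set w | forall i, U i (increment i w)]) =
  (P A * \prod_(i < m) N (U i))%E.
Proof.
move=> FA mU; have [A' [sA' n1 n2]] := Ft_raw_approx FA.
have mA : measurable A by exact: (Ft_measurable P_complete mB sT FA).
have mA' : measurable A'.
  apply: (Ft_measurable P_complete mB sT); apply: sub_sigma_algebra2 sA'.
  by move=> C ?; left.
have mE : measurable [set w | forall i, U i (increment i w)].
  rewrite (_ : [set w | _] = \bigcap_(i in [set: 'I_m]) (increment i @^-1` U i)).
    apply: fin_bigcap_measurable => [|i _]; first exact: finite_finset.
    by rewrite -[X in measurable X]setTI; exact: measurable_increment.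
  by apply/seteqP; split => w /= h i; [move=> _|]; exact: h.
rewrite (negligible_eq_measure mA mA')//.
rewrite (@negligible_eq_measure _ (A' `&` [set w | forall i, U i (increment i w)]));
  try exact: measurableI; last 2 first.
- by apply: negligibleS n1 => w [[? ?] nA']; split => // ?; exact: nA'.
- by apply: negligibleS n2 => w [[? ?] nA']; split => // ?; exact: nA'.
by case: B_brownian => _ _ _; exact.
Qed.

Variable xi : Om -> 'cV[R]_m.
Hypothesis mxi : forall i, measurable_wrt (Ft s) (fun w => xi w i 0).

Let e i w := expR (xi w i 0 * increment i w - xi w i 0 ^+ 2 * v / 2).

Let mxiOm i : measurable_fun setT (fun w => xi w i 0).
Proof.
have /measurable_wrtP := mxi i.
exact: (fun h => measurableT_comp h (Ft_measurable_id P_complete mB sT)).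
Qed.

Let me_ i : measurable_fun setT (e i).
Proof.
apply: measurableT_comp => //; apply: measurable_funB.
  by apply: measurable_funM => //; exact: measurable_increment.
by do 2 apply: measurable_funM => //; exact: measurable_funX.
Qed.

Let idF_mixin := isMeasurableFun.Build _ _ _ _ (id : Om -> OmF s)
  (Ft_measurable_id P_complete mB sT).
Let idF : {mfun Om >-> OmF s} := HB.pack (id : Om -> OmF s) idF_mixin.

Let c_ (r : pred 'I_m) (U : 'I_m -> set R) : {nonneg R} :=
  NngNum (fine_ge0 (prode_ge0 (index_enum 'I_m) (fun i (_ : r i) => measure_ge0 N (U i)))).

Let c_E r U : (forall i, measurable (U i)) ->
  (c_ r U)%:num%:E = (\prod_(i < m | r i) N (U i))%E.
Proof.
move=> mU; rewrite /= fineK//; apply: prode_fin_num => i _.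
rewrite ge0_fin_numE//; apply: (le_lt_trans (probability_le1 N (mU i))).
by rewrite ltry.
Qed.

(** Induction on the number [j] of coordinates that carry their exponential; the others still carry
    indicators. For one more coordinate, the induction hypothesis identifies the law of the pair
    (past, increment [j]) under the density [W] as a product measure, and Tonelli's theorem leaves a
    Gaussian integral equal to one. *)
Let gauss_ind (j : nat) (V : Om -> R) (U : 'I_m -> set R) : (j <= m)%N ->
  measurable_fun setT (V : OmF s -> R) -> (forall w, 0 <= V w) ->
  (forall i, measurable (U i)) ->
  (\int[P]_w (V w * \prod_(i < m | (i < j)%N) e i w *
     \prod_(i < m | (j <= i)%N) \1_(U i) (increment i w))%:E =
   \int[P]_w (V w)%:E * \prod_(i < m | (j <= i)%N) N (U i))%E.
Proof.
elim: j V U => [|j IH] V U jm mV V0 mU.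
  pose E := [set w | forall i, U i (increment i w)].
  have mE : measurable E.
    rewrite (_ : E = \bigcap_(i in [set: 'I_m]) (increment i @^-1` U i)).
      apply: fin_bigcap_measurable => [|i _]; first exact: finite_finset.
      by rewrite -[X in measurable X]setTI; exact: measurable_increment.
    by apply/seteqP; split => w /= h i; [move=> _|]; exact: h.
  pose nu : {measure set (OmF s) -> \bar R} := mscale (c_ xpredT U) (distribution P idF).
  transitivity (\int[P]_w ((V w)%:E * (\1_E w)%:E))%E.
    apply: eq_integral => w _; rewrite big_pred0// mulr1 -EFinM; congr (_ * _)%:E.
    rewrite indicE; case: (boolP (w \in E)) => [/set_mem Ew|/negP nE].
      by rewrite big1// => i _; rewrite indicE mem_set.
    have [i nUi] : exists i, ~ U i (increment i w).
      by apply/existsNP => h; apply: nE; apply/mem_set.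
    by rewrite (bigD1 i)//= indicE memNset// mul0r.
  rewrite (@ge0_integral_law _ _ _ P _ (OmF s) id (\1_E) nu
    (Ft_measurable_id P_complete mB sT) _ _ _ (EFin \o V))//; last 2 first.
  - move=> C mC; rewrite integral_indic//; last exact: (Ft_measurable P_complete mB sT).
    rewrite setIC /nu /= /mscale /distribution /pushforward c_E// muleC.
    exact: increment_indep.
  - exact/measurable_EFinP.
  rewrite ge0_integral_mscale//; last 2 first.
  - exact/measurable_EFinP.
  - by move=> w _; rewrite lee_fin.
  rewrite ge0_integral_distribution//; last exact/measurable_EFinP.
  by rewrite c_E// muleC; congr (_ * _)%E.
pose jo := Ordinal jm.
pose W w := \prod_(i < m | (i < j)%N) e i w *
  \prod_(i < m | (j < i)%N) (\1_(U i) (increment i w) : R).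
have W0 w : 0 <= W w by rewrite mulr_ge0// prodr_ge0// => i _; rewrite expR_ge0.
have mW : measurable_fun setT W.
  apply: measurable_funM; apply: measurable_prod_cond => i //.
  have mUi : measurable (increment i @^-1` U i).
    by rewrite -[X in measurable X]setTI; exact: measurable_increment.
  exact: (@measurable_indic _ Om R setT _ mUi).
pose X w : OmF s * measurableTypeR R := (w, increment jo w).
have mX : measurable_fun setT X.
  apply/measurable_fun_pairP; split; last exact: measurable_increment.
  exact: (Ft_measurable_id P_complete mB sT).
have m2 : measurable_fun setT (fun z : OmF s * measurableTypeR R => z.2 : R).
  exact: (@measurable_snd _ _ (OmF s) (measurableTypeR R)).
pose c := c_ (fun i => (j < i)%N) U.
pose nu := (mscale c (distribution P idF) \x N)%E.
pose f (z : OmF s * measurableTypeR R) := V z.1 * expR (xi z.1 jo 0 * z.2 - xi z.1 jo 0 ^+ 2 * v / 2).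
have mxis : measurable_fun setT (fun z : OmF s * R => xi z.1 jo 0).
  have /measurable_wrtP h := mxi jo.
  exact: (measurableT_comp h (@measurable_fst _ _ _ _)).
have mf : measurable_fun setT f.
  apply: measurable_funM.
    exact: (measurableT_comp mV (@measurable_fst _ _ _ _)).
  apply: measurableT_comp => //; apply: measurable_funB.
    exact: measurable_funM.
  by do 2 apply: measurable_funM => //; exact: measurable_funX.
have f0 z : 0 <= f z by rewrite mulr_ge0// expR_ge0.
have XW C : measurable C -> (\int[P]_(w in X @^-1` C) (W w)%:E = nu C)%E.
  move=> mC; rewrite /nu; apply/esym.
  apply: (@product_measure_unique _ _ _ _ _ (mscale c (distribution P idF)) N (density_law P mX mW W0)) => //.
  move=> A U0 mA mU0; rewrite /= /density_law.
  (* The mass of the rectangle with sides [A] and [U0] is given by the induction hypothesis for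
     [V = 1_A], with [U0] in the slot of the current coordinate. *)
  pose U' (i : 'I_m) : set R := if i == jo then U0 else U i.
  have mU' i : measurable (U' i).
    by rewrite /U'; case: eqP => _; [exact: mU0|exact: mU].
  transitivity (\int[P]_w (\1_A w * \prod_(i < m | (i < j)%N) e i w *
      \prod_(i < m | (j <= i)%N) \1_(U' i) (increment i w))%:E)%E.
    rewrite [LHS]integral_mkcond; apply: eq_integral => w _.
    rewrite patchE; case: ifPn => [/set_mem[/= Aw U0w]|/negP nX].
      rewrite indicE mem_set// mul1r /W; congr (_ * _)%:E.
      rewrite [RHS](bigD1 jo)//= {1}/U' eqxx indicE mem_set// mul1r.
      apply: eq_big => [i|i ji]; first by rewrite -val_eqE/= ltn_neqAle eq_sym andbC.
      by rewrite /U' -val_eqE/= gtn_eqF.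
    rewrite [X in _ * X](bigD1 jo)//= {1}/U' eqxx !indicE.
    have [Aw|] := boolP (w \in A); last by rewrite !mul0r.
    have [U0w|] := boolP (increment jo w \in U0); last by rewrite mul0r mulr0.
    by exfalso; apply: nX; apply/mem_set; split; exact/set_mem.
  rewrite (IH _ _ (ltnW jm))//.
  rewrite integral_indic ?setIT//; last exact: (Ft_measurable P_complete mB sT).
  rewrite (bigD1 jo)//= {1}/U' eqxx /c /mscale c_E// [X in (_ = X * _)%E]muleC -muleA.
  congr (_ * _)%E; rewrite muleC; congr (_ * _)%E.
  apply: eq_big => [i|i]; first by rewrite -val_eqE/= ltn_neqAle eq_sym andbC.
  by move=> /andP[_ /negbTE ij]; rewrite /U' ij.
transitivity (\int[P]_w ((f (X w))%:E * (W w)%:E))%E.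
  apply: eq_integral => w _; rewrite -EFinM; congr (_%:E).
  rewrite /f /X /W/= (bigD1 jo)//=.
  rewrite (eq_bigl (fun i : 'I_m => (i < j)%N)); first by rewrite /e; ring.
  by move=> i; rewrite ltnS -val_eqE/= ltn_neqAle andbC.
rewrite (@ge0_integral_law _ _ _ P _ _ X W nu mX mW W0 XW (EFin \o f))//; last exact/measurable_EFinP.
rewrite /nu fubini_tonelli1//; last exact/measurable_EFinP.
rewrite ge0_integral_mscale//; last 2 first.
- apply: measurable_fun_fubini_tonelli_F => //; exact/measurable_EFinP.
- by move=> w _; apply: integral_ge0 => x _; rewrite lee_fin.
rewrite c_E// muleC; congr (_ * _)%E.
rewrite ge0_integral_distribution//; last 2 first.
- apply: measurable_fun_fubini_tonelli_F => //; exact/measurable_EFinP.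
- by move=> w; apply: integral_ge0 => x _; rewrite lee_fin.
apply: eq_integral => w _; rewrite /= /fubini_F/=.
under eq_integral do rewrite /f/= EFinM.
rewrite ge0_integralZl_EFin//; last first.
  apply/measurable_EFinP; apply: measurableT_comp => //.
  by apply: measurable_funB => //; exact: measurable_funM.
by rewrite integral_normal_expR ?subr_gt0// mule1.
Qed.

Lemma gaussian_increment_martingale (V : Om -> R) :
  measurable_wrt (Ft s) V -> (forall w, 0 <= V w) ->
  (\int[P]_w (V w * expR (dot (xi w) (B t w - B s w) - 
      2^-1 * (dot (xi w) (xi w) * v)))%:E = \int[P]_w (V w)%:E)%E.
Proof.
move=> /measurable_wrtP mV V0.
have := @gauss_ind m V (fun=> setT) (leqnn _) mV V0 (fun=> measurableT).
rewrite [X in (_ * X)%E]big_pred0; last by move=> i; rewrite leqNgt ltn_ord.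
rewrite mule1 => <-; apply: eq_integral => w _; congr (_%:E).
rewrite [X in _ = _ * X]big_pred0 ?mulr1; last by move=> i; rewrite leqNgt ltn_ord.
congr (_ * _); rewrite (eq_bigl predT); last by move=> i; rewrite ltn_ord.
rewrite -expR_sum /dot; congr expR; rewrite mulr_suml mulr_sumr -sumrB.
by apply: eq_bigr => i _; rewrite /increment !mxE expr2; field.
Qed.

End increments.

(** * Continuous paths and the maximal inequality *)

Section continuous_paths.
Context {R : realType}.
Variable T : R.
Hypothesis T_gt0 : 0 < T.
Implicit Types f g : R -> R.

Definition path_continuous f := forall t, 0 <= t <= T -> forall e, 0 < e ->
  exists2 d, 0 < d & forall s, 0 <= s <= T -> `|s - t| < d -> `|f s - f t| < e.

Lemma path_continuousP f :
  {within `[0, T], continuous f} <-> path_continuous f.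
Proof.
split.
  move=> /subspace_continuousP cf t t0T e e0.
  have /cvgrPdist_lt/(_ e e0) : f @ (within `[0, T] (nbhs t)) --> f t.
    by apply: cf; rewrite /= in_itv.
  rewrite near_withinE => /nbhs_ballP[d /= d0 dP]; exists d => // s s0T sd.
  by rewrite distrC; apply: dP; rewrite /ball/= 1?distrC ?in_itv.
move=> cf; apply/subspace_continuousP => t; rewrite /= in_itv/= => t0T.
apply/cvgrPdist_lt => e e0; have [d d0 dP] := cf t t0T e e0.
rewrite near_withinE; apply/nbhs_ballP; exists d => //= s.
by rewrite /ball/= => ts; rewrite in_itv/= => s0T; rewrite distrC; apply: dP; rewrite // distrC.
Qed.

Lemma path_continuous_cst a : path_continuous (fun=> a).
Proof. by move=> t _ e e0; exists 1 => // s _ _; rewrite subrr normr0. Qed.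

Lemma path_continuousD f g : path_continuous f -> path_continuous g ->
  path_continuous (fun t => f t + g t).
Proof.
move=> cf cg t tT e e0; have e20 : 0 < e / 2 by rewrite divr_gt0.
have [d1 d10 h1] := cf t tT _ e20; have [d2 d20 h2] := cg t tT _ e20.
exists (Num.min d1 d2); first by rewrite lt_min d10.
move=> s sT; rewrite lt_min => /andP[/(h1 _ sT) a1 /(h2 _ sT) a2].
rewrite (_ : _ - _ = f s - f t + (g s - g t)); last by ring.
by rewrite (le_lt_trans (ler_normD _ _))// (splitr e) ltrD.
Qed.

Lemma path_continuousZ a f : path_continuous f -> path_continuous (fun t => a * f t).
Proof.
move=> cf t tT e e0.
have e'0 : 0 < e / (`|a| + 1) by rewrite divr_gt0// ltr_wpDl.
have [d d0 h] := cf t tT _ e'0; exists d => // s sT sd.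
rewrite -mulrBr normrM (@le_lt_trans _ _ ((`|a| + 1) * `|f s - f t|))//.
  by rewrite ler_wpM2r// lerDl.
by rewrite mulrC -ltr_pdivlMr ?h// ltr_wpDl.
Qed.

Lemma path_continuousN f : path_continuous f -> path_continuous (fun t => - f t).
Proof.
move=> /(path_continuousZ (-1)) h t tT e e0; have [d d0 hd] := h t tT e e0.
by exists d => // s sT sd; have := hd s sT sd; rewrite !mulN1r.
Qed.

Lemma path_continuousB f g : path_continuous f -> path_continuous g ->
  path_continuous (fun t => f t - g t).
Proof. by move=> cf cg; apply: path_continuousD => //; exact: path_continuousN. Qed.

Lemma path_continuous_sum I (r : seq I) (f : I -> R -> R) :
  (forall i, path_continuous (f i)) -> path_continuous (fun t => \sum_(i <- r) f i t).
Proof.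
move=> cf; elim: r => [|i r IH].
  by under [X in path_continuous X]eq_fun do rewrite big_nil; exact: path_continuous_cst.
under [X in path_continuous X]eq_fun do rewrite big_cons.
exact: path_continuousD.
Qed.

Lemma path_continuous_min a f : 0 <= a <= T -> path_continuous f ->
  path_continuous (fun t => f (Num.min a t)).
Proof.
move=> aT cf t tT e e0.
have minT s : 0 <= s <= T -> 0 <= Num.min a s <= T.
  by move=> sT; case: (leP a s).
have [d d0 h] := cf _ (minT _ tT) _ e0; exists d => // s sT sd; apply: h => //.
  exact: minT.
apply: le_lt_trans sd; rewrite !minElt.
by case: ltP => ?; case: ltP => ?; rewrite ?subrr ?normr0//;
  rewrite !ler_normr ?ler_norml; lra.
Qed.

Lemma path_continuous_comp (h : R -> R) f : continuous h -> path_continuous f ->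
  path_continuous (h \o f).
Proof.
move=> ch cf t tT e e0.
have /cvgrPdist_lt/(_ e e0)/nbhs_ballP[d /= d0 dP] := ch (f t).
have [d' d'0 h'] := cf t tT d d0; exists d' => // s sT sd.
by rewrite distrC; apply: dP; rewrite /ball/= distrC; exact: h'.
Qed.

Lemma path_continuous_lipschitz (k : R) f :
  (forall s t, 0 <= s -> s <= t -> t <= T -> `|f t - f s| <= k * (t - s)) ->
  path_continuous f.
Proof.
move=> fk t tT e e0; have k10 : 0 < `|k| + 1 by rewrite ltr_wpDl.
exists (e / (`|k| + 1)); first by rewrite divr_gt0.
have key s u : 0 <= s -> s <= u -> u <= T -> `|u - s| < e / (`|k| + 1) -> `|f u - f s| < e.
  move=> s0 su uT; rewrite ltr_pdivlMr// => h; apply: le_lt_trans h.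
  rewrite (le_trans (fk s u s0 su uT))// ger0_norm ?subr_ge0// mulrC.
  by rewrite ler_wpM2l ?subr_ge0// (le_trans (ler_norm k))// lerDl.
move=> s sT sd; have [st|/ltW ts] := leP s t.
  by rewrite distrC; apply: key => //; [case/andP: sT|case/andP: tT|rewrite distrC].
by apply: key => //; [case/andP: tT|case/andP: sT].
Qed.

Definition dyadic (n j : nat) : R := T * (j%:R / 2 ^+ n).

Lemma dyadic_itv n j : (j <= 2 ^ n)%N -> 0 <= dyadic n j <= T.
Proof.
move=> jn; rewrite /dyadic mulr_ge0 ?(ltW T_gt0) ?divr_ge0 ?exprn_ge0//=.
by rewrite ler_piMr ?(ltW T_gt0)// ler_pdivrMr ?exprn_gt0// mul1r -natrX ler_nat.
Qed.

Lemma dyadic_dense t d : 0 <= t <= T -> 0 < d ->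
  exists n j, (j <= 2 ^ n)%N /\ `|dyadic n j - t| < d.
Proof.
move=> /andP[t0 tT] d0.
have /cvgrPdist_lt/(_ (d / T) (divr_gt0 d0 T_gt0)) :
    (2^-1 ^+ n : R) @[n --> \oo] --> (0 : R).
  by apply: cvg_expr; rewrite ger0_norm// invf_lt1// ltr1n.
case=> n _ /(_ n (leqnn n)); rewrite sub0r normrN ger0_norm ?exprn_ge0// => nd.
exists n, (Num.truncn (t / T * 2 ^+ n)).
have p2 : (0 : R) < 2 ^+ n by rewrite exprn_gt0.
have x0 : 0 <= t / T * 2 ^+ n by rewrite mulr_ge0 ?divr_ge0 ?(ltW T_gt0)// ltW.
have /andP[tr1 tr2] := truncn_itv x0; split.
  rewrite -(ler_nat R) (le_trans tr1)// natrX ler_piMl ?(ltW p2)//.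
  by rewrite ler_pdivrMr// mul1r.
rewrite /dyadic -[X in _ - X](divfK (lt0r_neq0 T_gt0)) -(mulrC T) -mulrBr.
rewrite normrM gtr0_norm// mulrC -ltr_pdivlMr//; apply: le_lt_trans nd.
rewrite distrC exprVn -[leRHS]mul1r ler_pdivlMr//.
rewrite -[X in _ * X](ger0_norm (ltW p2)) -normrM mulrBl divfK ?gt_eqF//.
rewrite ger0_norm ?subr_ge0// lerBlDl -[X in X + 1]/(_%:R).
by rewrite natr1 ltW.
Qed.

(** Reduces the existence of a time to countably many times: suprema of continuous paths become
    measurable, and maximal inequalities extend from finite grids to [[0, T]]. *)
Lemma path_continuous_dyadic f c t : path_continuous f -> 0 <= t <= T ->
  c < f t -> exists n j, (j <= 2 ^ n)%N /\ c < f (dyadic n j).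
Proof.
move=> cf tT cft; have fc0 : 0 < f t - c by rewrite subr_gt0.
have [d d0 h] := cf t tT _ fc0.
have [n [j [jn /h h']]] := dyadic_dense tT d0; exists n, j; split => //.
by have := h' (dyadic_itv jn); rewrite ltr_norml => /andP[+ _]; lra.
Qed.

Lemma dyadic_refine n j : dyadic n j = dyadic n.+1 j.*2.
Proof.
rewrite /dyadic exprS -muln2 natrM; field.
by rewrite expf_eq0/= pnatr_eq0 andbF.
Qed.

End continuous_paths.

Section sup_paths.
Context {d} {X : measurableType d} {R : realType} (P : probability X R).
Hypothesis P_complete : measure_is_complete P.
Variable T : R.
Hypothesis T_gt0 : 0 < T.
Local Open Scope ereal_scope.

(** On continuous paths the event is a countable combination of events at dyadic times, with a
    margin [1 / (k + 1)] because dyadic times only approach the supremum. Completeness takes care of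
    the null set of other paths. *)
Lemma measurable_sup_paths (f : R -> X -> R) (e : R) :
  (forall t : R, (0 <= t <= T)%R -> measurable_fun setT (f t)) ->
  {ae P, forall w, path_continuous T (f ^~ w)} ->
  measurable [set w | e%:E <= ereal_sup [set `|f t w|%:E | t in `[0%R, T]]].
Proof.
move=> mf cf.
set A := [set w | _].
pose C := \bigcap_(k in [set: nat]) \bigcup_(n in [set: nat]) \bigcup_(j in [set j | (j <= 2 ^ n)%N])
  [set w | (e - k.+1%:R^-1 < `|f (dyadic T n j) w|)%R].
have mC : measurable C.
  apply: bigcap_measurable => // k _; apply: bigcup_measurable => n _.
  apply: bigcup_measurable => j /= jn.
  rewrite -[X in measurable X]setTI.
  have := @measurable_fun_ltr _ X R setT (cst (e - k.+1%:R^-1)%R)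
    (fun w => `|f (dyadic T n j) w|%R) (measurable_cst _).
  move=> /(_ (measurableT_comp (@normr_measurable R setT) (mf _ (dyadic_itv T_gt0 jn)))).
  by move=> /(_ measurableT [set true]); apply.
have AC : {ae P, forall w, A w <-> C w}.
  apply: filterS cf => w cw; split.
  - move=> Aw k _.
    have : (e - k.+1%:R^-1)%:E < ereal_sup [set `|f t w|%:E | t in `[0%R, T]].
      by apply: lt_le_trans Aw; rewrite lte_fin ltrBlDr ltrDl invr_gt0.
    move=> /ereal_sup_gt[_ [t/= + <-]]; rewrite in_itv/= lte_fin => t0T kt.
    have cn : path_continuous T (fun t => `|f t w|%R).
      by apply: (@path_continuous_comp _ _ (@Num.norm _ R)) => //; exact: norm_continuous.
    by have [n [j [jn h]]] := path_continuous_dyadic T_gt0 cn t0T kt; exists n => //; exists j.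
  - move=> Cw; apply/lee_addgt0Pr => r r0.
    have [k _ kr] := near_infty_natSinv_lt (PosNum r0).
    have [n _ [j jn /= h]] := Cw k Logic.I.
    apply: (@le_trans _ _ (`|f (dyadic T n j) w|%:E + r%:E)).
      rewrite -EFinD lee_fin; have := kr k (leqnn k); move=> /=.
      by move: h; set u := (k.+1%:R^-1)%R; set v := `|_|%R; lra.
    rewrite leeD2r//; apply: ereal_sup_ubound; exists (dyadic T n j) => //=.
    by rewrite in_itv/= (dyadic_itv T_gt0).
have mAC := ae_set_measurable P_complete AC.
rewrite (_ : A = (C `&` [set w | A w <-> C w]) `|` (A `\` [set w | A w <-> C w])).
  apply: measurableU; first exact: measurableI.
  by apply: P_complete; apply: negligibleS AC => w [].
apply/seteqP; split => w /=; last by move=> [[Cw [_ h]]|[]//]; exact: h.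
by move=> Aw; have [h|h] := pselect (A w <-> C w); [left; split => //; apply/h|right].
Qed.

End sup_paths.

Section maximal_inequality.
Context {d} {X : measurableType d} {R : realType} (P : {measure set X -> \bar R}).
Local Open Scope ereal_scope.

(* Decompose according to the first index j at which E j occurs. *)
Lemma maximal_inequality (Fil : nat -> set (set X)) (E : nat -> set X)
    (Z : X -> R) (c : R) (n : nat) : (0 <= c)%R ->
  (forall j, sigma_algebra setT (Fil j)) ->
  (forall i j, (i <= j)%N -> Fil i `<=` Fil j) ->
  (forall j, (j <= n)%N -> Fil j `<=` measurable) ->
  (forall j, Fil j (E j)) ->
  measurable_fun setT Z -> (forall w, 0 <= Z w)%R ->
  (forall j A, (j <= n)%N -> Fil j A -> A `<=` E j ->
    c%:E * P A <= \int[P]_(w in A) (Z w)%:E) ->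
  c%:E * P (\bigcup_(j in [set j | (j <= n)%N]) E j) <= \int[P]_w (Z w)%:E.
Proof.
move=> c0 sF nF mF FE mZ Z0 H.
have FE_ j A : Fil j A <-> measurable (A : set (g_sigma_algebraType (Fil j))).
  by split=> [|h]; [exact: sub_sigma_algebra|rewrite -(sigma_algebra_id (sF j))].
have FG j : Fil j (seqDU E j).
  apply/FE_; apply: measurableD; first exact/FE_.
  apply: bigsetU_measurable => i _; apply/FE_/(nF i); first exact/ltnW.
  exact: FE.
pose G j := if (j <= n)%N then seqDU E j else set0.
have mG j : measurable (G j) by rewrite /G; case: ifP => // jn; exact: mF (FG j).
have GE : \bigcup_(j in [set j | (j <= n)%N]) E j = \bigcup_j G j.
  transitivity (\big[setU/set0]_(j < n.+1) E j); first exact: (bigcup_mkord n.+1).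
  rewrite bigsetU_seqDU -bigcup_mkord.
  apply/seteqP; split => w [j].
    by move=> /= jn Dj; exists j => //; rewrite /G -ltnS jn.
  by move=> _; rewrite /G; case: ifPn => // jn Dj; exists j.
have tG : trivIset setT G.
  apply/trivIsetP => i j _ _ ij; rewrite /G.
  case: ifP => _; last by rewrite set0I.
  case: ifP => _; last by rewrite setI0.
  by move/trivIsetP : (trivIset_seqDU E); apply.
rewrite GE measure_bigcup// -nneseriesZl//.
apply: (@le_trans _ _ (\int[P]_(w in \bigcup_j G j) (Z w)%:E)); last first.
  apply: ge0_subset_integral => //; last by move=> w _; rewrite lee_fin.
  - exact: bigcupT_measurable.
  - exact/measurable_EFinP.
rewrite ge0_integral_bigcup//; last 2 first.
- exact/measurable_funTS/measurable_EFinP.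
- by move=> w _; rewrite lee_fin.
rewrite (@eq_eseriesl _ _ xpredT); last by move=> i; rewrite in_setT.
apply: lee_nneseries => [j _ _|j _]; first by rewrite mule_ge0 ?lee_fin.
rewrite /G; case: ifPn => [jn|_]; last by rewrite measure0 mule0 integral_set0.
by apply: (H j) => //; exact: subDsetl.
Qed.

End maximal_inequality.

(** * Predictable processes *)

Section euclidean_space.
Context {R : realType} {n : nat}.
Implicit Types (u v z : 'cV[R]_n) (a : R).

Lemma dotC u v : dot u v = dot v u.
Proof. by apply: eq_bigr => i _; rewrite mulrC. Qed.

Lemma dotDl u v z : dot (u + v) z = dot u z + dot v z.
Proof. by rewrite -big_split; apply: eq_bigr => i _; rewrite mxE mulrDl. Qed.

Lemma dotZl a u z : dot (a *: u) z = a * dot u z.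
Proof. by rewrite mulr_sumr; apply: eq_bigr => i _; rewrite mxE mulrA. Qed.

Lemma dotNl u z : dot (- u) z = - dot u z.
Proof. by rewrite -scaleN1r dotZl mulN1r. Qed.

Lemma dotBl u v z : dot (u - v) z = dot u z - dot v z.
Proof. by rewrite dotDl dotNl. Qed.

Lemma dotDr u v z : dot z (u + v) = dot z u + dot z v.
Proof. by rewrite !(dotC z) dotDl. Qed.

Lemma dotZr a u z : dot z (a *: u) = a * dot z u.
Proof. by rewrite !(dotC z) dotZl. Qed.

Lemma dotNr u z : dot z (- u) = - dot z u.
Proof. by rewrite !(dotC z) dotNl. Qed.

Lemma dotBr u v z : dot z (u - v) = dot z u - dot z v.
Proof. by rewrite dotDr dotNr. Qed.

Lemma dot0l z : dot 0 z = 0.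
Proof. by rewrite -(scale0r 0) dotZl mul0r. Qed.

Lemma dot0r z : dot z 0 = 0.
Proof. by rewrite dotC dot0l. Qed.

Lemma dot_suml I (r : seq I) (p : pred I) (F : I -> 'cV[R]_n) z :
  dot (\sum_(i <- r | p i) F i) z = \sum_(i <- r | p i) dot (F i) z.
Proof. exact: (big_morph (dot^~ z) (fun u v => dotDl u v z) (dot0l z)). Qed.

Lemma dot_ge0 u : 0 <= dot u u.
Proof. by apply: sumr_ge0 => i _; rewrite -expr2 sqr_ge0. Qed.

Lemma sqr_enorm u : enorm u ^+ 2 = dot u u.
Proof. by rewrite sqr_sqrtr ?dot_ge0. Qed.

Lemma coord_sqr_le u i : u i 0 ^+ 2 <= dot u u.
Proof.
rewrite /dot (bigD1 i)//= -expr2 lerDl; apply: sumr_ge0 => j _.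
by rewrite -expr2 sqr_ge0.
Qed.

(** The difference of the two sides is a multiple of a square. A small [e] keeps the leading factor
    close to one, as needed to pass to the limit in quadratic variations and in distances. *)
Lemma dot_sqr_add u v (e : R) : 0 < e ->
  dot u u <= (1 + e) * dot v v + (1 + e^-1) * dot (u - v) (u - v).
Proof.
move=> e0; rewrite -subr_ge0.
have -> : (1 + e) * dot v v + (1 + e^-1) * dot (u - v) (u - v) - dot u u =
    e^-1 * dot (e *: v - (u - v)) (e *: v - (u - v)).
  rewrite !(dotBl, dotBr, dotZl, dotZr) (dotC v u).
  by field; rewrite gt_eqF.
by rewrite mulr_ge0 ?dot_ge0// invr_ge0 ltW.
Qed.

Lemma dot_sqrD_le u v : dot (u + v) (u + v) <= 2 * dot u u + 2 * dot v v.
Proof.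
rewrite -subr_ge0 (_ : _ - _ = dot (u - v) (u - v)) ?dot_ge0//.
by rewrite !(dotBl, dotBr, dotDl, dotDr) (dotC v u); ring.
Qed.

Lemma dot_norm_le u v : `|dot u v| <= 2^-1 * (dot u u + dot v v).
Proof.
have h1 := dot_ge0 (u - v); have h2 := dot_ge0 (u + v).
move: h1 h2; rewrite !(dotBl, dotBr, dotDl, dotDr) (dotC v u).
by rewrite ler_norml => h1 h2; apply/andP; split; lra.
Qed.

End euclidean_space.

Section predictable_integrands.
Context {disp : measure_display} {Om : measurableType disp} {R : realType}.
Context {m : nat}.
Variables (P : probability Om R) (T : R) (B : R -> Om -> 'cV[R]_m).
Hypothesis P_complete : measure_is_complete P.
Hypothesis mB : forall (t : R) i, 0 <= t <= T -> measurable_fun setT (fun w => B t w i 0).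
Hypothesis T_gt0 : 0 < T.

Local Notation Ft := (augmented_filtration P B).
Local Notation OmF := (OmF P B).
Local Notation OmP := (OmP P T B).
Local Notation leb := (@lebesgue_measure R).
Implicit Types f g : R -> Om -> R.

Lemma predictable_cst a : predictable T Ft (fun _ _ => a).
Proof. by apply/predictableP => //; exact: measurable_cst. Qed.

Lemma predictableD f g : predictable T Ft f -> predictable T Ft g ->
  predictable T Ft (fun t w => f t w + g t w).
Proof.
move=> /predictableP-/(_ T_gt0) pf /predictableP-/(_ T_gt0) pg.
by apply/predictableP => //; exact: measurable_funD.
Qed.

Lemma predictableM f g : predictable T Ft f -> predictable T Ft g ->
  predictable T Ft (fun t w => f t w * g t w).
Proof.
move=> /predictableP-/(_ T_gt0) pf /predictableP-/(_ T_gt0) pg.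
by apply/predictableP => //; exact: measurable_funM.
Qed.

Lemma predictable_comp (h : R -> R) f : measurable_fun setT h -> predictable T Ft f ->
  predictable T Ft (fun t w => h (f t w)).
Proof.
move=> mh /predictableP-/(_ T_gt0) pf.
by apply/predictableP => //; exact: (measurableT_comp mh).
Qed.

Lemma predictable_sum I (r : seq I) (F : I -> R -> Om -> R) :
  (forall i, predictable T Ft (F i)) ->
  predictable T Ft (fun t w => \sum_(i <- r) F i t w).
Proof.
move=> pF; apply/predictableP => //; apply: measurable_sum => i.
exact/predictableP.
Qed.

Lemma predictable_prod (I : eqType) (r : seq I) (F : I -> R -> Om -> R) :
  (forall i, predictable T Ft (F i)) ->
  predictable T Ft (fun t w => \prod_(i <- r) F i t w).
Proof.
move=> pF; apply/predictableP => //; apply: measurable_prod => i _.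
exact/predictableP.
Qed.

Lemma predictable_limit (F : nat -> R -> Om -> R) f :
  (forall n, predictable T Ft (F n)) ->
  (forall t w, 0 <= t <= T -> F n t w @[n --> \oo] --> f t w) ->
  predictable T Ft f.
Proof.
move=> pF Ff; apply/predictableP => //.
apply: (@measurable_fun_cvg _ OmP R (`[0, T] `*` setT) (fun n z => F n z.1 z.2)).
  by move=> n; exact/predictableP.
by move=> [t w] [/= + _]; rewrite in_itv/= => tT; exact: Ff.
Qed.

Lemma predictable_ite (f g : R -> Om -> R) (b : R -> Om -> bool) :
  measurable (`[0, T] `*` setT `&` [set z | b z.1 z.2] : set OmP) ->
  predictable T Ft f -> predictable T Ft g ->
  predictable T Ft (fun t w => if b t w then f t w else g t w).
Proof.
move=> mb /predictableP-/(_ T_gt0) pf /predictableP-/(_ T_gt0) pg.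
apply/predictableP => // mD U mU.
set D := _ `*` _.
rewrite (_ : _ `&` _ = (D `&` [set z | b z.1 z.2] `&` (D `&` [set z | U (f z.1 z.2)]))
    `|` ((D `&` [set z | U (g z.1 z.2)]) `\` (D `&` [set z | b z.1 z.2]))).
  apply: measurableU; first by apply: measurableI => //; exact: pf.
  by apply: measurableD => //; exact: pg.
apply/seteqP; split => z /=.
  by case: ifP => bz [Dz Uz]; [left|right]; split => // -[].
move=> [[[Dz bz] [_ Uz]]|[[Dz Uz] nb]]; first by rewrite bz.
by split => //; case: ifP => // bz; exfalso; apply: nb.
Qed.

Lemma predictable_path f w : predictable T Ft f ->
  measurable_fun `[0, T] (fun t : measurableTypeR R => f t w).
Proof.
move=> /predictableP-/(_ T_gt0) pf.
have T0T : 0 <= T <= T by rewrite lexx ltW.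
have mf : measurable_fun (`[0, T] `*` setT : set (measurableTypeR R * OmF T))
    (fun z => f z.1 z.2) := predictable_fun_progressive T_gt0 T0T pf.
have mD : measurable (`[0, T] : set (measurableTypeR R)) by exact: measurable_itv.
have := @measurable_comp _ _ _ _ _ _ (`[0, T] `*` setT : set (measurableTypeR R * OmF T))
  (fun z => f z.1 z.2) `[0, T] (fun t : measurableTypeR R => (t, w)).
apply => //.
- exact: measurableX.
- by move=> _ [t tT <-].
- apply: measurable_funTS; apply/measurable_fun_pairP; split.
    exact: measurable_id.
  exact: measurable_cst.
Qed.

Lemma predictable_eintegral f t (E : set R) : 0 <= t <= T -> measurable E ->
  E `<=` `[0, t] -> predictable T Ft f ->
  measurable_fun setT ((fun w => \int[leb]_(u in E) (f u w)%:E)%E : OmF t -> \bar R).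
Proof.
move=> tT mE Et /predictableP-/(_ T_gt0) pf.
have mf : measurable_fun (`[0, t] `*` setT : set (measurableTypeR R * OmF t))
    (fun z => f z.1 z.2) := predictable_fun_progressive T_gt0 tT pf.
apply: (@measurable_fun_integral _ _ (measurableTypeR R) (OmF t) R leb E
  (fun z => (f z.1 z.2)%:E)) => //.
apply/measurable_EFinP; apply: measurable_funS mf.
  by apply: measurableX => //; exact: measurable_itv.
by move=> z [/= /Et].
Qed.

Lemma predictable_Rintegral f t (E : set R) : 0 <= t <= T -> measurable E ->
  E `<=` `[0, t] -> predictable T Ft f ->
  measurable_wrt (Ft t) (fun w => \int[leb]_(u in E) f u w).
Proof.
move=> tT mE Et pf; apply/measurable_wrtP.
apply: (@measurableT_comp _ _ _ _ _ _ (@fine R)); first exact: fine_measurable.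
exact: predictable_eintegral.
Qed.

Lemma measurable_wrt_Om t f : t <= T -> measurable_wrt (Ft t) (f t) ->
  measurable_fun setT (f t).
Proof.
move=> tT mf _ U mU; rewrite setTI.
by apply: (Ft_measurable P_complete mB tT); exact: mf.
Qed.

Lemma predictable_dot {k : nat} (H G : R -> Om -> 'cV[R]_k) :
  predictable_mx T Ft H -> predictable_mx T Ft G ->
  predictable T Ft (fun t w => dot (H t w) (G t w)).
Proof.
by move=> pH pG; apply: predictable_sum => i; apply: predictableM; [exact: pH|exact: pG].
Qed.

Lemma predictable_mulmx {k l q : nat} (A : R -> Om -> 'M[R]_(k, l)) (C : R -> Om -> 'M[R]_(l, q)) :
  predictable_mx T Ft A -> predictable_mx T Ft C ->
  predictable_mx T Ft (fun t w => A t w *m C t w).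
Proof.
move=> pA pC i j.
have -> : (fun t w => (A t w *m C t w) i j) =
    (fun t w => \sum_(r < l) A t w i r * C t w r j).
  by apply/funext => t; apply/funext => w; rewrite mxE.
by apply: predictable_sum => r; apply: predictableM; [exact: pA|exact: pC].
Qed.

Lemma predictable_tr {k l : nat} (A : R -> Om -> 'M[R]_(k, l)) :
  predictable_mx T Ft A -> predictable_mx T Ft (fun t w => (A t w)^T).
Proof.
move=> pA i j; have -> : (fun t w => (A t w)^T i j) = (fun t w => A t w j i).
  by apply/funext => t; apply/funext => w; rewrite mxE.
exact: pA.
Qed.

Lemma predictable_mxD {k l : nat} (A C : R -> Om -> 'M[R]_(k, l)) :
  predictable_mx T Ft A -> predictable_mx T Ft C ->
  predictable_mx T Ft (fun t w => A t w + C t w).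
Proof.
move=> pA pC i j; have -> : (fun t w => (A t w + C t w) i j) = (fun t w => A t w i j + C t w i j).
  by apply/funext => t; apply/funext => w; rewrite mxE.
by apply: predictableD; [exact: pA|exact: pC].
Qed.

Lemma predictable_mxZ {k l : nat} (f : R -> Om -> R) (A : R -> Om -> 'M[R]_(k, l)) :
  predictable T Ft f -> predictable_mx T Ft A ->
  predictable_mx T Ft (fun t w => f t w *: A t w).
Proof.
move=> pf pA i j; have -> : (fun t w => (f t w *: A t w) i j) = (fun t w => f t w * A t w i j).
  by apply/funext => t; apply/funext => w; rewrite mxE.
by apply: predictableM => //; exact: pA.
Qed.

Lemma predictable_mxB {k l : nat} (A C : R -> Om -> 'M[R]_(k, l)) :
  predictable_mx T Ft A -> predictable_mx T Ft C ->
  predictable_mx T Ft (fun t w => A t w - C t w).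
Proof.
move=> pA pC; have h := predictable_mxD pA (predictable_mxZ (predictable_cst (-1)) pC).
by move=> i j; have := h i j; under eq_fun do under eq_fun do rewrite scaleN1r.
Qed.

Lemma predictable_mxN {k l : nat} (A : R -> Om -> 'M[R]_(k, l)) :
  predictable_mx T Ft A -> predictable_mx T Ft (fun t w => - A t w).
Proof.
move=> pA; have h := predictable_mxZ (predictable_cst (-1)) pA.
by move=> i j; have := h i j; under eq_fun do under eq_fun do rewrite scaleN1r.
Qed.

Lemma predictable_mx_const {k l : nat} (A : 'M[R]_(k, l)) :
  predictable_mx T Ft (fun _ _ => A).
Proof. by move=> i j; exact: predictable_cst. Qed.

Lemma predictable_rectangle (s t : R) (A : set Om) : 0 <= s -> s <= t -> t <= T -> Ft s A ->
  measurable (`]s, t] `*` A : set OmP).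
Proof.
move=> s0 + tT FA; rewrite le_eqVlt => /predU1P[<-|st].
  by rewrite set_itvoc0// set0X.
by apply: sub_sigma_algebra; left; exists s, t, A; split.
Qed.

Lemma predictable_indic_rectangle (s t : R) (xi : Om -> R) : 0 <= s -> s <= t -> t <= T ->
  measurable_wrt (Ft s) xi ->
  predictable T Ft (fun u w => (\1_(`]s, t] : set R) u : R) * xi w).
Proof.
move=> s0 st tT mxi.
have -> : (fun (u : R) w => (\1_(`]s, t] : set R) u : R) * xi w) =
    (fun u w => if u \in (`]s, t]%classic : set R) then xi w else 0).
  apply/funext => u; apply/funext => w; rewrite indicE.
  by case: ifP => _; rewrite ?mul1r ?mul0r.
apply/predictableP => // mD U mU.
have mUxi : measurable (`]s, t] `*` (xi @^-1` U) : set OmP).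
  by apply: predictable_rectangle => //; exact: mxi.
have mst : measurable (`]s, t] `*` setT : set OmP).
  by apply: predictable_rectangle => //; exact: Ft_setT.
have subD A : `]s, t] `*` A `<=` (`[0, T] `*` setT : set (R * Om)).
  move=> [u w] [/= + _]; rewrite !in_itv/= => /andP[su ut].
  by rewrite (le_trans s0 (ltW su)) (le_trans ut).
have [U0|nU0] := pselect (U 0).
  rewrite (_ : _ `&` _ = (`]s, t] `*` (xi @^-1` U)) `|` (`[0, T] `*` setT `\` (`]s, t] `*` setT))).
    by apply: measurableU => //; exact: measurableD.
  apply/seteqP; split => -[u w] /=.
    case: ifPn => [/set_mem/= ust|/negP ust] [Du Uu]; first by left.
    by right; split => // -[ust' _]; apply: ust; exact/mem_set.
  move=> [[ust Uw]|[Du nst]].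
    by have [? _] := subD setT (u, w) (conj ust Logic.I); rewrite mem_set.
  by rewrite memNset// => ust; apply: nst.
rewrite (_ : _ `&` _ = (`]s, t] `*` (xi @^-1` U)))//.
apply/seteqP; split => -[u w] /=.
  by case: ifPn => [/set_mem/= ust|_] [Du Uu].
by move=> [ust Uw]; have [? _] := subD setT (u, w) (conj ust Logic.I); rewrite mem_set.
Qed.

End predictable_integrands.

(** * Quadratic variation and simple integrands *)

Section quadratic_variation.
Context {disp : measure_display} {Om : measurableType disp} {R : realType}.
Context {m : nat}.
Local Notation leb := (@lebesgue_measure R).

(** Kept extended-valued, since finiteness holds only almost surely. Its real version [qvar], the
    quadratic variation of the integral, takes the value 0 where this is infinite. *)
Definition energy (H : R -> Om -> 'cV[R]_m) (t : R) (w : Om) : \bar R :=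
  (\int[leb]_(u in `[0%R, t]) (enorm (H u w) ^+ 2)%:E)%E.

Definition qvar H t w : R := fine (energy H t w).

Lemma energy_ge0 H t w : (0 <= energy H t w)%E.
Proof. by apply: integral_ge0 => u _; rewrite lee_fin sqr_ge0. Qed.

Lemma qvar_ge0 H t w : 0 <= qvar H t w.
Proof. by rewrite fine_ge0// energy_ge0. Qed.

End quadratic_variation.

Section simple_operations.
Context {disp : measure_display} {Om : measurableType disp} {R : realType} {m : nat}.
Implicit Types S : @simple_process disp Om R m.

Definition simple_add S S' : @simple_process disp Om R m :=
  @SimpleProcess _ _ _ _ (sp_size S + sp_size S')
    (fun k => match fintype.split k with inl i => sp_start S i | inr j => sp_start S' j end)
    (fun k => match fintype.split k with inl i => sp_end S i | inr j => sp_end S' j end)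
    (fun k => match fintype.split k with inl i => sp_coef S i | inr j => sp_coef S' j end).

Definition simple_scale (a : R) S : @simple_process disp Om R m :=
  @SimpleProcess _ _ _ _ (sp_size S) (sp_start S) (sp_end S)
    (fun k w => a *: sp_coef S k w).

(** A coefficient that starts after [t] is replaced by 0: its interval collapses to the point [t],
    at which it need not be measurable yet. *)
Definition simple_stop (t : R) S : @simple_process disp Om R m :=
  @SimpleProcess _ _ _ _ (sp_size S) (fun k => Num.min (sp_start S k) t)
    (fun k => Num.min (sp_end S k) t) (fun k => if sp_start S k <= t then sp_coef S k else fun=> 0).

Let splitl k n (i : 'I_k) : fintype.split (lshift n i) = inl i.
Proof. exact: (@unsplitK k n (inl i)). Qed.
Let splitr k n (i : 'I_n) : fintype.split (rshift k i) = inr i.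
Proof. exact: (@unsplitK k n (inr i)). Qed.

Lemma simple_val_add S S' t w :
  simple_val (simple_add S S') t w = simple_val S t w + simple_val S' t w.
Proof.
rewrite /simple_val big_split_ord /=; congr (_ + _).
- by apply: eq_bigr => i _; rewrite splitl.
- by apply: eq_bigr => i _; rewrite splitr.
Qed.

Lemma simple_integral_add B S S' t w :
  simple_integral B (simple_add S S') t w =
  simple_integral B S t w + simple_integral B S' t w.
Proof.
rewrite /simple_integral big_split_ord /=; congr (_ + _).
- by apply: eq_bigr => i _; rewrite splitl.
- by apply: eq_bigr => i _; rewrite splitr.
Qed.

Lemma simple_val_scale a S t w : simple_val (simple_scale a S) t w = a *: simple_val S t w.
Proof.
rewrite /simple_val scaler_sumr; apply: eq_bigr => i _ /=.
by rewrite !scalerA mulrC.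
Qed.

Lemma simple_integral_scale B a S t w :
  simple_integral B (simple_scale a S) t w = a * simple_integral B S t w.
Proof. by rewrite /simple_integral mulr_sumr; apply: eq_bigr => i _; rewrite dotZl. Qed.

Lemma simple_integral_stop B s S t w :
  (forall k, sp_start S k <= sp_end S k) ->
  simple_integral B (simple_stop s S) t w = simple_integral B S (Num.min s t) w.
Proof.
move=> se; apply: eq_bigr => i _ /=; rewrite -!minA; case: ifPn => //.
rewrite -ltNge => si; have ms : Num.min s t < sp_start S i by rewrite gt_min si.
have me : Num.min s t <= sp_end S i := le_trans (ltW ms) (se i).
by rewrite (min_r me) (min_r (ltW ms)) subrr !dot0r.
Qed.

Lemma simple_val_stop s S t w :
  simple_val (simple_stop s S) t w = if t <= s then simple_val S t w else 0.
Proof.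
rewrite /simple_val /=; case: ifPn => [ts|].
  apply: eq_bigr => i _; case: ifPn => [_|]; last first.
    rewrite -ltNge => /ltW tsi; rewrite scaler0 indicE memNset ?scale0r//=.
    by rewrite in_itv/= => /andP[/(le_lt_trans (le_trans ts tsi))]; rewrite ltxx.
  congr (_ *: _); rewrite !indicE; congr (_%:R); congr nat_of_bool.
  apply/idP/idP => /set_mem/=; rewrite in_itv/= => /andP[h1 h2]; apply/mem_set;
    rewrite /= in_itv/=; move: h1 h2.
    rewrite gt_min le_min => /orP[-> /andP[->]//|st]; by rewrite leNgt st in ts.
  by move=> h1 h2; rewrite gt_min h1 le_min h2 ts.
rewrite -ltNge => st; apply: big1 => i _; rewrite indicE memNset ?scale0r//=.
by rewrite in_itv/= le_min => /andP[_ /andP[_]]; rewrite leNgt st.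
Qed.

End simple_operations.

Section simple_processes.
Context {disp : measure_display} {Om : measurableType disp} {R : realType}.
Context {m : nat}.
Variables (P : probability Om R) (T : R) (B : R -> Om -> 'cV[R]_m).
Hypothesis P_complete : measure_is_complete P.
Hypothesis B_brownian : brownian_motion P T B.
Hypothesis T_gt0 : 0 < T.

Local Notation Ft := (augmented_filtration P B).
Local Notation leb := (@lebesgue_measure R).
Let mB := brownian_measurable B_brownian.
Local Notation simple := (is_simple P T B).
Implicit Types S : @simple_process disp Om R m.

Lemma is_simple_add S S' : simple S -> simple S' -> simple (simple_add S S').
Proof.
by move=> sS sS' k /=; case: (fintype.split k) => i; [exact: sS|exact: sS'].
Qed.

Lemma is_simple_scale a S : simple S -> simple (simple_scale a S).
Proof.
move=> sS k /=; have [h1 h2 h3 mS [c hc]] := sS k; split => //.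
  move=> i; apply/measurable_wrtP.
  have -> : (fun w => (a *: sp_coef S k w) i 0) = (fun w => a * sp_coef S k w i 0).
    by apply/funext => w; rewrite mxE.
  by apply: measurable_funM => //; apply/measurable_wrtP; exact: mS.
exists (`|a| * c) => w i; rewrite mxE normrM.
by apply: ler_wpM2l => //; exact: hc.
Qed.

Lemma is_simple_stop t S : 0 <= t -> simple S -> simple (simple_stop t S).
Proof.
move=> t0 sS k /=; have [h1 h2 h3 mS [c hc]] := sS k; split => //.
- by rewrite le_min h1.
- by rewrite le_min !ge_min h2 lexx !orbT.
- by rewrite ge_min h3.
- case: ifPn => [st|_]; first by rewrite min_l.
  by move=> i; apply/measurable_wrtP; under eq_fun do rewrite mxE; exact: measurable_cst.
- by case: ifP => _; [exists c|exists 0 => w i; rewrite mxE normr0].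
Qed.

Lemma simple_val_predictable S : simple S -> predictable_mx T Ft (simple_val S).
Proof.
move=> sS i j; rewrite ord1 {j}.
have -> : (fun t w => simple_val S t w i 0) = (fun (t : R) w => \sum_(k < sp_size S)
    (\1_(`]sp_start S k, sp_end S k] : set R) t : R) * sp_coef S k w i 0).
  apply/funext => t; apply/funext => w; rewrite summxE.
  by apply: eq_bigr => k _; rewrite mxE.
apply: predictable_sum => // k; have [s0 se eT mS _] := sS k.
exact: predictable_indic_rectangle.
Qed.

Lemma simple_bounded S : simple S ->
  exists2 K : R, 0 <= K & forall t w, enorm (simple_val S t w) ^+ 2 <= K.
Proof.
move=> sS.
have /choice[c hc] : forall k, exists c : R, forall w i, `|sp_coef S k w i 0| <= c.
  by move=> k; have [_ _ _ _] := sS k.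
pose K := \sum_(k < sp_size S) `|c k|.
have K0 : 0 <= K by apply: sumr_ge0.
exists (\sum_(i < m) K ^+ 2); first by apply: sumr_ge0 => i _; rewrite sqr_ge0.
move=> t w; rewrite sqr_enorm; apply: ler_sum => i _.
rewrite -expr2 -[leLHS]real_normK ?num_real//; apply: lerXn2r; rewrite ?nnegrE//.
rewrite summxE (le_trans (ler_norm_sum _ _ _))//; apply: ler_sum => k _.
rewrite mxE normrM (le_trans (ler_piMl _ _))//.
  by rewrite indicE; case: (_ \in _); rewrite ?normr1 ?normr0.
by rewrite (le_trans (hc k w i))// ler_norm.
Qed.

Lemma measurable_sqr_enorm (H : R -> Om -> 'cV[R]_m) w (E : set R) :
  predictable_mx T Ft H -> E `<=` `[0, T] -> measurable E ->
  measurable_fun E (fun u : measurableTypeR R => (enorm (H u w) ^+ 2)%:E).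
Proof.
move=> pH ET mE; apply/measurable_EFinP.
apply: (@measurable_funS _ _ _ _ `[0, T]) => //.
have -> : (fun u : R => enorm (H u w) ^+ 2) = (fun u => dot (H u w) (H u w)).
  by apply/funext => u; rewrite sqr_enorm.
exact: predictable_path (predictable_dot T_gt0 pH pH).
Qed.

Lemma energyD (H : R -> Om -> 'cV[R]_m) w (s t : R) : predictable_mx T Ft H ->
  0 <= s -> s <= t -> t <= T ->
  energy H t w = (energy H s w + \int[leb]_(u in `]s, t]) (enorm (H u w) ^+ 2)%:E)%E.
Proof.
move=> pH s0 st tT; rewrite /energy.
rewrite (@itv_bndbnd_setU _ _ (BLeft 0) (BRight s) (BRight t)) ?bnd_simp//.
rewrite ge0_integral_setU//=.
- apply: measurable_sqr_enorm => //; last by apply: measurableU; exact: measurable_itv.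
  move=> u [] /=; rewrite !in_itv/= => /andP[h1 h2].
    by rewrite h1 (le_trans h2)// (le_trans st).
  by rewrite (le_trans h2)// (le_trans s0)// ltW.
- by move=> u _; rewrite lee_fin sqr_ge0.
- apply/disj_setPRL => u /=; rewrite !in_itv/= => /andP[su _] /andP[_].
  by rewrite leNgt su.
Qed.

Lemma energy_le (H : R -> Om -> 'cV[R]_m) w (s t : R) : predictable_mx T Ft H ->
  0 <= s -> s <= t -> t <= T -> (energy H s w <= energy H t w)%E.
Proof.
move=> pH s0 st tT; rewrite (energyD _ pH s0 st tT) leeDl//.
by apply: integral_ge0 => u _; rewrite lee_fin sqr_ge0.
Qed.

Lemma energy_measurable (H : R -> Om -> 'cV[R]_m) t : predictable_mx T Ft H ->
  0 <= t <= T -> measurable_fun setT (energy H t : OmF P B t -> \bar R).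
Proof.
move=> pH tT; rewrite /energy.
have -> : (fun w => \int[leb]_(u in `[0%R, t]) (enorm (H u w) ^+ 2)%:E)%E =
    (fun w => \int[leb]_(u in `[0%R, t]) (dot (H u w) (H u w))%:E)%E.
  by apply/funext => w; apply: eq_integral => u _; rewrite sqr_enorm.
apply: (@predictable_eintegral _ _ _ _ P T B T_gt0 (fun u w => dot (H u w) (H u w)) t `[0, t]) => //.
exact: predictable_dot.
Qed.

Lemma simple_energy_increment S w (s t K : R) : simple S ->
  (forall t w, enorm (simple_val S t w) ^+ 2 <= K) -> 0 <= s -> s <= t -> t <= T ->
  (\int[leb]_(u in `]s, t]) (enorm (simple_val S u w) ^+ 2)%:E <= (K * (t - s))%:E)%E.
Proof.
move=> sS hK s0 st tT.
have stT : `]s, t] `<=` `[0, T].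
  by move=> u /=; rewrite !in_itv/= => /andP[h1 h2]; rewrite (le_trans h2)// (le_trans s0)// ltW.
apply: (@le_trans _ _ (\int[leb]_(u in `]s, t]) (cst K%:E u))%E).
  apply: ge0_le_integral => //=.
  - by move=> u _; rewrite lee_fin sqr_ge0.
  - by apply: measurable_sqr_enorm => //; exact: simple_val_predictable.
  - by move=> u _; rewrite lee_fin hK.
rewrite integral_cst//= lebesgue_measure_itv/= lte_fin.
have [_|ts] := ltP s t; first by rewrite -EFinD -EFinM.
have -> : t = s by apply/le_anti; rewrite ts st.
by rewrite subrr mulr0 mule0.
Qed.

Lemma simple_energy_lty S t w : simple S -> 0 <= t <= T -> (energy (simple_val S) t w < +oo)%E.
Proof.
move=> sS /andP[t0 tT]; have [K K0 hK] := simple_bounded sS.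
rewrite (energyD _ (simple_val_predictable sS) (lexx 0) t0 tT).
rewrite lte_add_pinfty//.
  by rewrite /energy set_itv1 integral_set1 ltry.
by apply: (le_lt_trans (simple_energy_increment w sS hK (lexx 0) t0 tT)); rewrite ltry.
Qed.

Lemma simple_energyE S t w : simple S -> 0 <= t <= T ->
  energy (simple_val S) t w = (qvar (simple_val S) t w)%:E.
Proof.
by move=> sS tT; rewrite fineK// ge0_fin_numE ?energy_ge0// simple_energy_lty.
Qed.

Lemma simple_qvar_lipschitz S w : simple S -> path_continuous T (fun t => qvar (simple_val S) t w).
Proof.
move=> sS; have [K K0 hK] := simple_bounded sS.
apply: (@path_continuous_lipschitz _ _ K) => s t s0 st tT.
have sT : 0 <= s <= T by rewrite s0 (le_trans st).
have tT' : 0 <= t <= T by rewrite tT (le_trans s0 st).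
have := energyD w (simple_val_predictable sS) s0 st tT.
rewrite !simple_energyE//.
have := simple_energy_increment w sS hK s0 st tT.
have : (0 <= \int[leb]_(u in `]s, t]) (enorm (simple_val S u w) ^+ 2)%:E)%E.
  by apply: integral_ge0 => u _; rewrite lee_fin sqr_ge0.
case: (integral _ _ _) => [r| |]//.
rewrite !lee_fin -EFinD => r0 rK [->]; rewrite ger0_norm; lra.
Qed.

Lemma simple_integral_adapted S t : simple S -> 0 <= t <= T ->
  measurable_wrt (Ft t) (simple_integral B S t).
Proof.
move=> sS tT; apply/measurable_wrtP; rewrite /simple_integral.
apply: measurable_sum => k; have [s0 se eT mS _] := sS k.
case/orP: (le_total (sp_start S k) t) => [st|ts]; last first.
  under eq_fun do rewrite (min_r ts) (min_r (le_trans ts se)) subrr dot0r.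
  exact: measurable_cst.
rewrite /dot; apply: measurable_sum => i.
have mB' (r : R) : 0 <= r -> r <= t -> measurable_fun setT ((fun w => B r w i 0) : OmF P B t -> R).
  move=> r0 rt; apply/measurable_wrtP => U mU; apply: sub_sigma_algebra; left.
  by exists r, i, U; rewrite r0 rt; split.
apply: measurable_funM.
  apply: (@measurableT_comp _ _ _ _ _ _ ((fun w => sp_coef S k w i 0) : OmF P B (sp_start S k) -> R) _ (id : OmF P B t -> _)).
    by apply/measurable_wrtP; exact: mS.
  exact: Ft_sub_id.
under eq_fun do rewrite !mxE.
have t0 : 0 <= t by case/andP: tT.
apply: measurable_funB; apply: mB'; rewrite ?le_min ?ge_min ?lexx ?orbT ?t0 ?andbT//.
exact: le_trans se.
Qed.

Lemma simple_integral_continuous S : simple S ->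
  {ae P, forall w, path_continuous T (fun t => simple_integral B S t w)}.
Proof.
move=> sS; have [_ _ cB _] := B_brownian.
have : {ae P, forall w, forall i, path_continuous T (fun t => B t w i 0)}.
  have h i : {ae P, forall w, path_continuous T (fun t => B t w i 0)}.
    by apply: filterS (cB i) => w /path_continuousP.
  exact: filter_forall.
apply: filterS => w cw.
apply: path_continuous_sum => k; have [s0 se eT _ _] := sS k.
apply: path_continuous_sum => i.
apply: path_continuousZ.
have -> : (fun t => (B (Num.min (sp_end S k) t) w - B (Num.min (sp_start S k) t) w) i 0) =
    (fun t => B (Num.min (sp_end S k) t) w i 0 - B (Num.min (sp_start S k) t) w i 0).
  by apply/funext => t; rewrite !mxE.
apply: path_continuousB; apply: (@path_continuous_min _ _ _ (fun t => B t w i 0)) => //.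
- by rewrite eT (le_trans s0 se).
- by rewrite s0 (le_trans se eT).
Qed.

End simple_processes.

Section simple_exponential.
Context {disp : measure_display} {Om : measurableType disp} {R : realType}.
Context {m : nat}.
Variables (P : probability Om R) (T : R) (B : R -> Om -> 'cV[R]_m).
Hypothesis P_complete : measure_is_complete P.
Hypothesis B_brownian : brownian_motion P T B.
Hypothesis T_gt0 : 0 < T.

Local Notation Ft := (augmented_filtration P B).
Local Notation leb := (@lebesgue_measure R).
Let mB := brownian_measurable B_brownian.
Local Notation simple := (is_simple P T B).
Implicit Types S : @simple_process disp Om R m.

Lemma energyZ a (H : R -> Om -> 'cV[R]_m) w (t : R) : predictable_mx T Ft H -> t <= T ->
  energy (fun t w => a *: H t w) t w = ((a ^+ 2)%:E * energy H t w)%E.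
Proof.
move=> pH tT; rewrite /energy -ge0_integralZl_EFin//; last 3 first.
- by move=> u _; rewrite lee_fin sqr_ge0.
- apply: (measurable_sqr_enorm T_gt0) => //.
  by move=> u /=; rewrite !in_itv/= => /andP[-> /le_trans->].
- exact: sqr_ge0.
by apply: eq_integral => u _; rewrite !sqr_enorm dotZl dotZr mulrA -expr2 EFinM.
Qed.

Lemma qvarZ a (H : R -> Om -> 'cV[R]_m) w (t : R) : predictable_mx T Ft H -> t <= T ->
  qvar (fun t w => a *: H t w) t w = a ^+ 2 * qvar H t w.
Proof. 
move=> pH tT; rewrite /qvar energyZ//.
have : (0 <= energy H t w)%E by exact: energy_ge0.
case: (energy H t w) => [r _||]//=; rewrite mulr0.
have := sqr_ge0 a; rewrite le_eqVlt => /predU1P[<-|a0] _; first by rewrite mul0e.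
by rewrite gt0_muley.
Qed.

Definition simple_exp S t w := expR (simple_integral B S t w - 2^-1 * qvar (simple_val S) t w).

Lemma simple_exp_adapted S t : simple S -> 0 <= t <= T -> measurable_wrt (Ft t) (simple_exp S t).
Proof.
move=> sS tT; apply/measurable_wrtP; apply: measurableT_comp => //.
apply: measurable_funB; first by apply/measurable_wrtP; exact: simple_integral_adapted.
apply: measurable_funM => //; apply: (@measurableT_comp _ _ _ _ _ _ (@fine R)).
  exact: fine_measurable.
apply: (energy_measurable T_gt0 _ tT).
exact: (simple_val_predictable T_gt0).
Qed.

Lemma simple_exp_measurable S t : simple S -> 0 <= t <= T -> measurable_fun setT (simple_exp S t).
Proof.
move=> sS tT; apply: (measurable_wrt_Om P_complete mB _ (simple_exp_adapted sS tT)).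
by case/andP: tT.
Qed.

Lemma simple_exp_continuous S : simple S ->
  {ae P, forall w, path_continuous T (fun t => simple_exp S t w)}.
Proof.
move=> sS; apply: filterS (simple_integral_continuous B_brownian sS) => w cw.
apply: (@path_continuous_comp _ _ expR); first exact: continuous_expR.
apply: path_continuousB => //; apply: path_continuousZ.
exact: (simple_qvar_lipschitz T_gt0).
Qed.

Lemma simple_exp0 S w : simple S -> simple_exp S 0 w = 1.
Proof.
move=> sS.
rewrite /simple_exp /qvar /energy set_itv1 integral_set1 mulr0 subr0 -expR0.
congr expR; apply: big1 => k _; have [s0 se _ _ _] := sS k.
by rewrite (min_r s0) (min_r (le_trans s0 se)) subrr dot0r.
Qed.

Section one_cell.
Variables (S : @simple_process disp Om R m) (u v : R).
Hypotheses (sS : simple S) (u0 : 0 <= u) (uv : u < v) (vT : v <= T).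
Hypothesis start_notin : forall k, ~~ (u < sp_start S k < v).
Hypothesis end_notin : forall k, ~~ (u < sp_end S k < v).

Let cell (k : 'I_(sp_size S)) := (sp_start S k <= u) && (v <= sp_end S k).
Let xi w := \sum_(k | cell k) sp_coef S k w.

Let simple_val_cell r w : u < r <= v -> simple_val S r w = xi w.
Proof.
move=> /andP[ur rv]; rewrite /simple_val /xi [RHS]big_mkcond; apply: eq_bigr => k _.
rewrite indicE; have := start_notin k; have := end_notin k.
have [s0 se eT _ _] := sS k.
rewrite !negb_and -!leNgt /cell => h1 h2.
case: ifPn => [/andP[ku vk]|nk].
  by rewrite mem_set ?scale1r//= in_itv/= (le_lt_trans ku ur) (le_trans rv).
rewrite memNset ?scale0r//= in_itv/= => /andP[sr re]; move/negP : nk; apply.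
by apply/andP; split; [case/orP: h2|case/orP: h1] => //; lra.
Qed.

Let integral_cell w : simple_integral B S v w - simple_integral B S u w =
  dot (xi w) (B v w - B u w).
Proof.
rewrite /simple_integral -sumrB /xi dot_suml [RHS]big_mkcond; apply: eq_bigr => k _.
have := start_notin k; have := end_notin k; have [s0 se eT _ _] := sS k.
rewrite !negb_and -!leNgt /cell -dotBr => h1 h2.
case: ifPn => [/andP[ku vk]|].
  rewrite (min_r vk) (min_r (le_trans (ltW uv) vk)) (min_l ku).
  rewrite (min_l (le_trans ku (ltW uv))); congr (dot _ _).
  by rewrite opprB addrA subrK.
rewrite negb_and -!ltNge => /orP[us|ev].
  have vs : v <= sp_start S k by case/orP: h2 => //; lra.
  rewrite !min_r ?subrr ?dot0r//; lra.
have eu : sp_end S k <= u by case/orP: h1 => //; lra.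
rewrite !min_l ?subrr ?dot0r//; lra.
Qed.

Let qvar_cell w : qvar (simple_val S) v w = qvar (simple_val S) u w + dot (xi w) (xi w) * (v - u).
Proof.
have uT : 0 <= u <= T by rewrite u0 (le_trans (ltW uv)).
have v0T : 0 <= v <= T by rewrite vT (le_trans u0 (ltW uv)).
apply: EFin_inj; rewrite EFinD -(simple_energyE T_gt0 w sS uT) -(simple_energyE T_gt0 w sS v0T).
rewrite (energyD T_gt0 w (simple_val_predictable T_gt0 sS) u0 (ltW uv) vT).
congr (_ + _)%E.
rewrite (eq_integral (cst (dot (xi w) (xi w))%:E)); last first.
  by move=> r /set_mem/=; rewrite in_itv/= => ur; rewrite simple_val_cell// sqr_enorm.
by rewrite integral_cst//= lebesgue_measure_itv/= lte_fin uv -EFinD -EFinM.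
Qed.

(** No endpoint lies strictly between [u] and [v], so on []u, v]] the process is a single vector
    [xi] known at time [u]. The claim is then the Gaussian identity applied to the indicator of [A]
    times the exponential at [u]. *)
Lemma simple_exp_cell A : Ft u A ->
  (\int[P]_(w in A) (simple_exp S v w)%:E = \int[P]_(w in A) (simple_exp S u w)%:E)%E.
Proof.
move=> FA; have uT : 0 <= u <= T by rewrite u0 (le_trans (ltW uv)).
pose V w := \1_A w * simple_exp S u w.
have mV : measurable_wrt (Ft u) V.
  apply/measurable_wrtP; apply: measurable_funM.
    exact: (@measurable_indic _ (OmF P B u) R setT _ FA).
  by apply/measurable_wrtP; exact: simple_exp_adapted.
have V0 w : 0 <= V w by rewrite mulr_ge0// expR_ge0.
have mxi i : measurable_wrt (Ft u) (fun w => xi w i 0).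
  apply/measurable_wrtP; rewrite /xi.
  have -> : (fun w => (\sum_(k | cell k) sp_coef S k w) i 0) =
     (fun w => \sum_k (if cell k then sp_coef S k w i 0 else 0)).
    by apply/funext => w; rewrite summxE [LHS]big_mkcond.
  apply: measurable_sum => k; case: (boolP (cell k)) => [/andP[ku _]|_]; last exact: measurable_cst.
  have [_ _ _ mS _] := sS k.
  apply: (@measurableT_comp _ _ _ _ _ _ ((fun w => sp_coef S k w i 0) : OmF P B (sp_start S k) -> R) _ (id : OmF P B u -> _)).
    exact/measurable_wrtP.
  exact: Ft_sub_id.
have := gaussian_increment_martingale P_complete B_brownian u0 uv vT mxi mV V0.
move=> h; rewrite [LHS]integral_mkcond [RHS]integral_mkcond.
transitivity (\int[P]_w (V w)%:E)%E; last first.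
  apply: eq_integral => w _; rewrite /V patchE indicE.
  by case: (w \in A); rewrite ?mul1r ?mul0r.
rewrite -h; apply: eq_integral => w _; rewrite /V patchE indicE.
case: (w \in A); rewrite ?mul1r ?mul0r//; congr (_%:E).
rewrite /simple_exp -expRD; congr expR.
by rewrite qvar_cell -integral_cell; ring.
Qed.

End one_cell.

Let count S (u v : R) := (#|[pred k : 'I_(sp_size S) | (u < sp_start S k < v)%R]| +
  #|[pred k : 'I_(sp_size S) | (u < sp_end S k < v)%R]|)%N.

Let card_sub (n : nat) (f : 'I_n -> R) (u v u' v' : R) : u' <= u -> v <= v' ->
  (#|[pred k | (u < f k < v)%R]| <= #|[pred k | (u' < f k < v')%R]|)%N.
Proof.
move=> uu vv; apply: subset_leq_card; apply/fintype.subsetP => k; rewrite !inE => /andP[h1 h2].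
by rewrite (le_lt_trans uu) ?(lt_le_trans h2).
Qed.

Let card_proper (n : nat) (f : 'I_n -> R) (u v u' v' : R) k : u' <= u -> v <= v' ->
  u' < f k < v' -> ~~ (u < f k < v) ->
  (#|[pred k | (u < f k < v)%R]| < #|[pred k | (u' < f k < v')%R]|)%N.
Proof.
move=> uu vv fk nfk; apply: proper_card; apply/properP; split.
  apply/fintype.subsetP => l; rewrite !inE => /andP[h1 h2].
  by rewrite (le_lt_trans uu) ?(lt_le_trans h2).
by exists k; rewrite !inE.
Qed.

(** Induction on the number of endpoints strictly inside []u, v[]: splitting at one of them lowers
    the count on both sides, and with none left a single cell remains. *)
Lemma simple_exp_martingale S u v A : simple S -> 0 <= u -> u <= v -> v <= T -> Ft u A ->
  (\int[P]_(w in A) (simple_exp S v w)%:E = \int[P]_(w in A) (simple_exp S u w)%:E)%E.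
Proof.
move=> sS; have [n] := ubnP (count S u v).
elim: n u v A => [|n IH] u v A cn u0 uv vT FA; first discriminate cn.
move: uv; rewrite le_eqVlt => /predU1P[->|uv]; first reflexivity.
have split_at r : u < r < v -> (count S u r < count S u v)%N -> (count S r v < count S u v)%N ->
    (\int[P]_(w in A) (simple_exp S v w)%:E = \int[P]_(w in A) (simple_exp S u w)%:E)%E.
  move=> /andP[ur rv] c1 c2; transitivity (\int[P]_(w in A) (simple_exp S r w)%:E)%E.
    apply: IH => //; [exact: leq_trans c2 _|exact: le_trans (ltW ur)|exact: ltW|].
    exact: (Ft_sub (ltW ur)).
  apply: IH => //; [exact: leq_trans c1 _|exact: ltW|].
  exact: le_trans (ltW rv) _.
have [[k ks]|/forallNP ns] := pselect (exists k, u < sp_start S k < v).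
  have /andP[h1 h2] := ks.
  apply: (split_at (sp_start S k)) => //.
    rewrite /count -addSn; apply: leq_add; last exact: card_sub (lexx _) (ltW h2).
    by apply: (card_proper (lexx _) (ltW h2) ks); rewrite ltxx andbF.
  rewrite /count -addSn; apply: leq_add; last exact: card_sub (ltW h1) (lexx _).
  by apply: (card_proper (ltW h1) (lexx _) ks); rewrite ltxx.
have [[k ks]|/forallNP ne] := pselect (exists k, u < sp_end S k < v).
  have /andP[h1 h2] := ks.
  apply: (split_at (sp_end S k)) => //.
    rewrite /count -addnS; apply: leq_add; first exact: card_sub (lexx _) (ltW h2).
    by apply: (card_proper (lexx _) (ltW h2) ks); rewrite ltxx andbF.
  rewrite /count -addnS; apply: leq_add; first exact: card_sub (ltW h1) (lexx _).
  by apply: (card_proper (ltW h1) (lexx _) ks); rewrite ltxx.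
by apply: simple_exp_cell => // k; apply/negP; [exact: ns|exact: ne].
Qed.

Lemma expectation_simple_exp S t : simple S -> 0 <= t <= T ->
  (\int[P]_w (simple_exp S t w)%:E = 1)%E.
Proof.
move=> sS /andP[t0 tT].
rewrite (simple_exp_martingale sS (lexx 0) t0 tT (@Ft_setT _ _ _ _ P B 0)).
under eq_integral do rewrite simple_exp0//.
by rewrite integral_cst//= probability_setT mul1e.
Qed.

(** Doob's inequality on each dyadic grid, with total mass one. The grids are nested, so the bound
    survives the increasing union, and path continuity reaches the other times. A covering event is
    enough, so no supremum is formed. *)
Lemma simple_exp_maximal S (c : R) : simple S -> 0 < c -> exists E : set Om,
  [/\ measurable E, (P E <= (c^-1)%:E)%E &
    {ae P, forall w, forall t, 0 <= t <= T -> c < simple_exp S t w -> E w}].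
Proof.
move=> sS c0.
pose E n := \bigcup_(j in [set j | (j <= 2 ^ n)%N]) [set w | c < simple_exp S (dyadic T n j) w].
have mEt t : 0 <= t <= T -> Ft t [set w | c < simple_exp S t w].
  move=> tT; have /measurable_wrtP mS := simple_exp_adapted sS tT.
  rewrite (_ : [set w | _] = simple_exp S t @^-1` `]c, +oo[).
    by rewrite -[X in Ft t X]setTI; apply: mS => //; exact: measurable_itv.
  by apply/seteqP; split => w /=; rewrite in_itv/= andbT.
have mE n : measurable (E n).
  apply: bigcup_measurable => j /= jn; have jT := dyadic_itv T_gt0 jn.
  by apply: (Ft_measurable P_complete mB _ (mEt _ jT)); case/andP: jT.
have PE n : (P (E n) <= (c^-1)%:E)%E.
  (* The grid is capped at [T] because the maximal inequality takes a filtration indexed by all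
     natural numbers. *)
  pose tj j := Num.min (dyadic T n j) T.
  have tjT j : 0 <= tj j <= T.
    have T0 := ltW T_gt0; apply/andP; split; last by rewrite /tj ge_min lexx orbT.
    by rewrite /tj le_min T0 andbT /dyadic mulr_ge0// divr_ge0// exprn_ge0.
  have tj_nd i j : (i <= j)%N -> tj i <= tj j.
    move=> ij; rewrite /tj le_min !ge_min lexx orbT andbT; apply/orP; left.
    rewrite /dyadic ler_pM2l// ler_pM2r ?ler_nat// invr_gt0 exprn_gt0//.
  have tjE j : (j <= 2 ^ n)%N -> tj j = dyadic T n j.
    by move=> /(dyadic_itv T_gt0)/andP[_ h]; rewrite /tj min_l.
  have mT : 0 <= T <= T by rewrite lexx ltW.
  have := @maximal_inequality _ _ R P (fun j => Ft (tj j))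
    (fun j => [set w | c < simple_exp S (tj j) w]) (simple_exp S T) c (2 ^ n) (ltW c0).
  move=> /(_ _ _ _ _ (simple_exp_measurable sS mT) _ _)/wrap[].
  - by move=> j; exact: smallest_sigma_algebra.
  - by move=> i j ij; apply: Ft_sub; exact: tj_nd.
  - by move=> j _; apply: (Ft_measurable P_complete mB); case/andP: (tjT j).
  - by move=> j; exact: mEt.
  - by move=> w; exact: expR_ge0.
  - move=> j A jn FA AE.
    have /andP[tj0 tjT'] := tjT j.
    rewrite (simple_exp_martingale sS tj0 tjT' (lexx T) FA).
    have mA := Ft_measurable P_complete mB tjT' FA.
    rewrite -integral_cst//; apply: ge0_le_integral => //.
    + by move=> w _; rewrite lee_fin ltW.
    + by apply: measurable_funTS; apply/measurable_EFinP/simple_exp_measurable.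
    + by move=> w /AE/= /ltW; rewrite lee_fin.
  rewrite expectation_simple_exp// => h.
  have <- : \bigcup_(j in [set j | (j <= 2 ^ n)%N]) [set w | c < simple_exp S (tj j) w] = E n.
    apply/seteqP; split => w [j jn h']; exists j; [exact: jn| |exact: jn|].
      by rewrite /= -tjE.
    by rewrite /= tjE.
  by rewrite -[leRHS]mule1 (lee_pdivlMl _ _ c0).
have ndE : nondecreasing_seq E.
  apply/nondecreasing_seqP => n; apply/subsetPset => w [j /= jn h].
  exists j.*2; last by rewrite /= -dyadic_refine.
  by rewrite /= expnS mul2n leq_double.
exists (\bigcup_n E n); split.
- exact: bigcupT_measurable.
- have mU : measurable (\bigcup_n E n) by exact: bigcupT_measurable.
  have /cvg_lim <- // := nondecreasing_cvg_mu (mu := P) mE mU ndE.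
  apply: lime_le; last by apply: nearW.
  apply/cvg_ex; exists (P (\bigcup_n E n)); exact: nondecreasing_cvg_mu.
- apply: filterS (simple_exp_continuous sS) => w cw t tT ct.
  have [n [j [jn h]]] := path_continuous_dyadic T_gt0 cw tT ct.
  by exists n => //; exists j.
Qed.

(* Exponential Chebyshev with the parameter [e / d], then [x <= expR x]. *)
Lemma simple_integral_tail S (e d : R) : simple S -> 0 < e -> 0 < d -> exists E : set Om,
  [/\ measurable E, (P E <= (4 * d / e ^+ 2)%:E)%E &
    {ae P, forall w, forall t, 0 <= t <= T -> e < `|simple_integral B S t w| ->
       qvar (simple_val S) t w <= d -> E w}].
Proof.
move=> sS e0 d0.
pose l := e / d; have l0 : 0 < l by rewrite divr_gt0.
pose c := expR (e ^+ 2 / (2 * d)); have c0 : 0 < c by exact: expR_gt0.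
have qvarZS a t w : t <= T ->
    qvar (simple_val (simple_scale a S)) t w = a ^+ 2 * qvar (simple_val S) t w.
  move=> tT; rewrite -qvarZ//; last exact: simple_val_predictable.
  by rewrite /qvar /energy; under eq_integral do rewrite simple_val_scale.
have [E1 [mE1 PE1 hE1]] := simple_exp_maximal (is_simple_scale (a := l) sS) c0.
have [E2 [mE2 PE2 hE2]] := simple_exp_maximal (is_simple_scale (a := - l) sS) c0.
exists (E1 `|` E2); split; first exact: measurableU.
  apply: (le_trans (measureU2 _ _ _)) => //.
  apply: (@le_trans _ _ ((c^-1)%:E + (c^-1)%:E)%E); first exact: leeD.
  rewrite -EFinD lee_fin.
  have : e ^+ 2 / (2 * d) <= c by apply: (le_trans _ (expR_ge1Dx _)); rewrite lerDr.
  have x0 : 0 < e ^+ 2 / (2 * d) by rewrite divr_gt0 ?exprn_gt0// mulr_gt0.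
  rewrite -lef_pV2 ?posrE// => h.
  rewrite (le_trans (lerD h h))// invf_div le_eqVlt; apply/orP; left; apply/eqP.
  by field; rewrite gt_eqF.
apply: filterS2 hE1 hE2 => w h1 h2 t tT.
have key a : `|a| = l -> a * simple_integral B S t w = l * `|simple_integral B S t w| ->
    e < `|simple_integral B S t w| -> qvar (simple_val S) t w <= d ->
    c < simple_exp (simple_scale a S) t w.
  move=> al aI eI qd; rewrite ltr_expR simple_integral_scale aI qvarZS ?(proj2 (andP tT))// -(real_normK (num_real a)) al.
  have : l * e < l * `|simple_integral B S t w| by rewrite ltr_pM2l.
  have : l ^+ 2 * qvar (simple_val S) t w <= l ^+ 2 * d by rewrite ler_pM2l// exprn_gt0.
  have -> : e ^+ 2 / (2 * d) = l * e - 2^-1 * (l ^+ 2 * d).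
    by rewrite /l; field; rewrite gt_eqF.
  by lra.
move=> eI qd; have [I0|I0] := leP 0 (simple_integral B S t w).
  left; apply: (h1 t tT); apply: key => //; first by rewrite gtr0_norm.
  by rewrite (ger0_norm I0).
right; apply: (h2 t tT); apply: key => //; first by rewrite normrN gtr0_norm.
by rewrite (ltr0_norm I0) mulrN mulNr.
Qed.

End simple_exponential.

(** * Approximation by simple integrands *)

Section dominated_paths.
Context {R : realType}.
Local Notation leb := (@lebesgue_measure R).

Lemma integral_dominated_cvg0 (E : set R) (f : nat -> R -> R) (g : R -> R) : measurable E ->
  (forall n, measurable_fun E (f n)) -> measurable_fun E g ->
  (forall n t, E t -> 0 <= f n t <= g t) -> (forall t, E t -> f n t @[n --> \oo] --> (0 : R)) ->
  (\int[leb]_(t in E) (g t)%:E < +oo)%E ->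
  forall e : R, 0 < e -> \forall n \near \oo, (\int[leb]_(t in E) (f n t)%:E < e%:E)%E.
Proof.
move=> mE mf mg fg f0 gfin e e0.
have g0 t : E t -> 0 <= g t by move=> Et; have /andP[/le_trans h /h] := fg 0%N t Et.
have f0' n t : E t -> 0 <= f n t by move=> /(fg n)/andP[].
have := @dominated_convergence _ _ _ leb E mE (fun n t => (f n t)%:E) (cst 0%E) (EFin \o g).
move=> /(_ _ _ _ _ _)/wrap[].
- by move=> n; apply: measurableT_comp => //; exact: mf.
- exact: measurable_cst.
- by apply: aeW => t Et; apply: cvg_EFin; [exact: nearW|exact: f0].
- apply/integrableP; split; first by apply: measurableT_comp => //; exact: mg.
  move: gfin; congr (_ < _)%E; apply: eq_integral => t /set_mem Et.
  by rewrite /= ger0_norm// g0.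
- apply: aeW => t n Et; have /andP[h1 h2] := fg n t Et.
  by rewrite /= lee_fin ger0_norm.
move=> [_ _].
rewrite integral0 => /cvge0P h; apply: h e0 => n.
by apply: integral_ge0 => t Et; rewrite lee_fin f0'.
Qed.

End dominated_paths.

Section elementary_processes.
Context {disp : measure_display} {Om : measurableType disp} {R : realType}.
Context {m : nat}.
Variables (P : probability Om R) (T : R) (B : R -> Om -> 'cV[R]_m).
Hypothesis P_complete : measure_is_complete P.
Hypothesis B_brownian : brownian_motion P T B.
Hypothesis T_gt0 : 0 < T.

Local Notation Ft := (augmented_filtration P B).
Local Notation leb := (@lebesgue_measure R).
Let mB := brownian_measurable B_brownian.
Local Notation simple := (is_simple P T B).
Implicit Types X Y : R -> Om -> R.

(** Scalar simple integrands with bounded coefficients. The inductive form gives stability under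
    sums and products by induction; products matter because they yield intersections of approximable
    sets. *)
Inductive elementary : (R -> Om -> R) -> Prop :=
| elementary0 : elementary (fun _ _ => 0)
| elementary_cell s t xi X : 0 <= s -> s <= t -> t <= T ->
    measurable_wrt (Ft s) xi -> (exists c, forall w, `|xi w| <= c) ->
    elementary X ->
    elementary (fun u w => (\1_(`]s, t] : set R) u : R) * xi w + X u w).

Lemma elementary_one_cell (s t : R) xi : 0 <= s -> s <= t -> t <= T ->
  measurable_wrt (Ft s) xi -> (exists c, forall w, `|xi w| <= c) ->
  elementary (fun u w => (\1_(`]s, t] : set R) u : R) * xi w).
Proof.
move=> s0 st tT mxi bxi.
have := elementary_cell s0 st tT mxi bxi elementary0.
by congr elementary; apply/funext => u; apply/funext => w; rewrite addr0.
Qed.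

Lemma elementaryD X Y : elementary X -> elementary Y -> elementary (fun t w => X t w + Y t w).
Proof.
move=> eX eY; elim: eX => [|s t xi X' s0 st tT mxi bxi _ IH].
  by move: eY; congr elementary; apply/funext => u; apply/funext => w; rewrite add0r.
have := elementary_cell s0 st tT mxi bxi IH.
by congr elementary; apply/funext => u; apply/funext => w; rewrite addrA.
Qed.

Lemma elementaryZ a X : elementary X -> elementary (fun t w => a * X t w).
Proof.
elim => [|s t xi X' s0 st tT mxi [c hc] _ IH].
  have := elementary0; congr elementary; apply/funext => u; apply/funext => w.
  by rewrite mulr0.
have mxi' : measurable_wrt (Ft s) (fun w => a * xi w).
  by apply/measurable_wrtP/measurable_funM => //; exact/measurable_wrtP.
have bxi : exists c, forall w, `|a * xi w| <= c.
  by exists (`|a| * c) => w; rewrite normrM ler_wpM2l.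
have := elementary_cell s0 st tT mxi' bxi IH.
by congr elementary; apply/funext => u; apply/funext => w; rewrite mulrDr mulrCA.
Qed.

Let elementaryM_cell (s t : R) xi Y : 0 <= s -> s <= t -> t <= T ->
  measurable_wrt (Ft s) xi -> (exists c, forall w, `|xi w| <= c) ->
  elementary Y -> elementary (fun u w => (\1_(`]s, t] : set R) u : R) * xi w * Y u w).
Proof.
move=> s0 st tT mxi [c hc]; elim => [|s' t' xi' Y' s0' st' tT' mxi' [c' hc'] _ IH].
  have := elementary0; congr elementary; apply/funext => u; apply/funext => w.
  by rewrite mulr0.
(* []a, b]] is the intersection of the two intervals; the outer maximum with [a] makes it empty, not
   reversed, when they are disjoint. *)
pose a := Num.max s s'; pose b := Num.max a (Num.min t t').
have sa : s <= a by rewrite le_max lexx.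
have s'a : s' <= a by rewrite le_max lexx orbT.
have mxx : measurable_wrt (Ft a) (fun w => xi w * xi' w).
  apply/measurable_wrtP/measurable_funM.
    apply: (@measurableT_comp _ _ _ _ _ _ (xi : OmF P B s -> R) _ (id : OmF P B a -> _)).
      exact/measurable_wrtP.
    exact: Ft_sub_id.
  apply: (@measurableT_comp _ _ _ _ _ _ (xi' : OmF P B s' -> R) _ (id : OmF P B a -> _)).
    exact/measurable_wrtP.
  exact: Ft_sub_id.
have bxx : exists c, forall w, `|xi w * xi' w| <= c.
  by exists (c * c') => w; rewrite normrM ler_pM.
have ab : a <= b by rewrite le_max lexx.
have bT : b <= T by rewrite !ge_max (le_trans st tT) (le_trans st' tT') ge_min tT.
have := elementary_cell (le_trans s0 sa) ab bT mxx bxx IH.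
congr elementary; apply/funext => u; apply/funext => w; rewrite mulrDr; congr (_ + _).
have -> : \1_(`]a, b] : set R) u = \1_(`]s, t] : set R) u * \1_(`]s', t'] : set R) u :> R.
  rewrite !indicE -natrM mulnb; congr (_%:R); congr nat_of_bool.
  apply/idP/andP => [/set_mem|[/set_mem h /set_mem h']].
    rewrite /= in_itv/= gt_max le_max => /andP[/andP[h1 h2] /orP[|]].
      by rewrite le_max => /orP[]; lra.
    by rewrite le_min => /andP[h3 h4]; split; apply/mem_set; rewrite /= in_itv/= ?h1 ?h2 ?h3 ?h4.
  apply/mem_set; move: h h' => /=; rewrite !in_itv/= => /andP[h1 h2] /andP[h3 h4].
  by rewrite gt_max h1 h3 le_max le_min h2 h4 orbT.
by ring.
Qed.

Lemma elementaryM X Y : elementary X -> elementary Y -> elementary (fun t w => X t w * Y t w).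
Proof.
move=> eX eY; elim: eX => [|s t xi X' s0 st tT mxi bxi _ IH].
  have := elementary0; congr elementary; apply/funext => u; apply/funext => w.
  by rewrite mul0r.
have := elementaryD (elementaryM_cell s0 st tT mxi bxi eY) IH.
by congr elementary; apply/funext => u; apply/funext => w; rewrite mulrDl.
Qed.

Lemma elementary_cst c : elementary (fun u w => (\1_(`]0, T] : set R) u : R) * c).
Proof.
apply: (@elementary_one_cell 0 T (fun=> c)) => //; first exact: ltW.
  exact/measurable_wrtP/measurable_cst.
by exists `|c|.
Qed.

Lemma elementary_out X t w : elementary X -> (\1_(`]0, T] : set R) t : R) = 0 -> X t w = 0.
Proof.
move=> eX ht; elim: eX => // s t' xi X' s0 _ tT _ _ _ ->.
rewrite addr0 indicE memNset ?mul0r//= in_itv/= => /andP[h1 h2].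
move: ht; rewrite indicE mem_set//= ?in_itv/= ?(le_lt_trans s0 h1) ?(le_trans h2 tT)//.
by move=> /eqP; rewrite oner_eq0.
Qed.

Lemma elementary_predictable X : elementary X -> predictable T Ft X.
Proof.
elim => [|s t xi X' s0 st tT mxi _ _ IH]; first exact: predictable_cst.
by apply: predictableD => //; exact: predictable_indic_rectangle.
Qed.

Lemma elementary_vec X i : elementary X -> exists2 S, simple S &
  forall t w, simple_val S t w = X t w *: delta_mx i 0.
Proof.
elim => [|s t xi X' s0 st tT mxi [c hc] _ [S sS SE]].
  exists (@SimpleProcess _ _ _ _ 0 (fun=> 0) (fun=> 0) (fun _ _ => 0)); first by case.
  by move=> t w; rewrite scale0r; apply: big1 => -[].
exists (simple_add (@SimpleProcess _ _ _ _ 1 (fun=> s) (fun=> t)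
   (fun _ w => xi w *: delta_mx i 0)) S).
  apply: is_simple_add => // k /=; split => //.
    move=> j; apply/measurable_wrtP; under eq_fun do rewrite mxE.
    by apply: measurable_funM => //; exact/measurable_wrtP.
  exists c => w j; rewrite mxE normrM (le_trans _ (hc w))// ler_piMr//.
  by rewrite mxE; case: (_ && _); rewrite ?normr1 ?normr0.
move=> u w; rewrite simple_val_add SE scalerDl; congr (_ + _).
by rewrite /simple_val big_ord1 /= scalerA.
Qed.

End elementary_processes.

Section density.
Context {disp : measure_display} {Om : measurableType disp} {R : realType}.
Context {m : nat}.
Variables (P : probability Om R) (T : R) (B : R -> Om -> 'cV[R]_m).
Hypothesis P_complete : measure_is_complete P.
Hypothesis B_brownian : brownian_motion P T B.
Hypothesis T_gt0 : 0 < T.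

Local Notation Ft := (augmented_filtration P B).
Local Notation leb := (@lebesgue_measure R).
Let mB := brownian_measurable B_brownian.
Local Notation simple := (is_simple P T B).
Local Notation elementary := (elementary P T B).
Implicit Types (X Y : R -> Om -> R) (D : set (R * Om)).

(** Taken over []0, T]]: elementary processes vanish at time 0, and a single instant does not change
    the integral. *)
Let gap X Y w : \bar R := (\int[leb]_(t in `]0%R, T]) ((X t w - Y t w) ^+ 2)%:E)%E.

Let integral_cst_lty (c : R) : (\int[leb]_(t in `]0%R, T]) (cst c t)%:E < +oo)%E.
Proof.
have -> : (\int[leb]_(t in `]0%R, T]) (cst c t)%:E = c%:E * leb `]0%R, T])%E.
  rewrite (_ : (fun t : R => (cst c t)%:E) = cst c%:E)//.
  by rewrite integral_cst//; exact: measurable_itv.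
by rewrite lebesgue_measure_itv/= lte_fin T_gt0 -EFinD -EFinM ltry.
Qed.

Let ocT : `]0, T] `<=` `[0, T].
Proof. by move=> t /=; rewrite !in_itv/= => /andP[/ltW-> ->]. Qed.

Let gap_integrand X Y w : predictable T Ft X -> predictable T Ft Y ->
  measurable_fun `]0, T] (fun t : measurableTypeR R => ((X t w - Y t w) ^+ 2)%:E).
Proof.
move=> pX pY; apply/measurable_EFinP; apply: (@measurable_funS _ _ _ _ `[0, T]) => //.
apply: (measurableT_comp (exprn_measurable 2)).
by apply: measurable_funB; [exact: (predictable_path T_gt0 w pX)|exact: (predictable_path T_gt0 w pY)].
Qed.

Let gap_measurable X Y e : predictable T Ft X -> predictable T Ft Y ->
  measurable [set w | (e%:E <= gap X Y w)%E].
Proof.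
move=> pX pY; have T0T : 0 <= T <= T by rewrite lexx ltW.
have pXY : predictable T Ft (fun t w => (X t w - Y t w) ^+ 2).
  apply: (@predictable_comp _ _ _ _ P T B T_gt0 (fun x => x ^+ 2) (fun t w => X t w - Y t w)).
    exact: exprn_measurable.
  have := predictableD T_gt0 pX (predictableM T_gt0 (predictable_cst T_gt0 (-1)) pY).
  by congr predictable; apply/funext => t; apply/funext => w; rewrite mulN1r.
have mI : measurable (`]0, T]%classic : set R) by exact: measurable_itv.
have mg := predictable_eintegral T_gt0 T0T mI ocT pXY.
apply: (Ft_measurable P_complete mB (lexx T)).
rewrite (_ : [set w | _] = gap X Y @^-1` `[e%:E, +oo[).
  rewrite -[X in Ft T X]setTI; apply: mg => //; exact: emeasurable_itv.
by apply/seteqP; split => w /=; rewrite in_itv/= andbT.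
Qed.

Let gap_le2 X Y S S' Z Z' w : predictable T Ft S -> predictable T Ft S' ->
  predictable T Ft Z -> predictable T Ft Z' ->
  predictable T Ft X -> predictable T Ft Y ->
  (forall t, 0 < t <= T ->
    (X t w - Y t w) ^+ 2 <= 2 * (S t w - S' t w) ^+ 2 + 2 * (Z t w - Z' t w) ^+ 2) ->
  (gap X Y w <= 2%:E * gap S S' w + 2%:E * gap Z Z' w)%E.
Proof.
move=> pS pS' pZ pZ' pX pY h; have mI : measurable (`]0, T]%classic : set R) by exact: measurable_itv.
rewrite /gap -!ge0_integralZl_EFin//; [|by move=> t _; rewrite lee_fin sqr_ge0|exact: gap_integrand|
  by move=> t _; rewrite lee_fin sqr_ge0|exact: gap_integrand].
rewrite -ge0_integralD//; last 4 first.
- by move=> t _; rewrite -EFinM lee_fin mulr_ge0// sqr_ge0.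
- by apply: measurable_funeM; exact: gap_integrand.
- by move=> t _; rewrite -EFinM lee_fin mulr_ge0// sqr_ge0.
- by apply: measurable_funeM; exact: gap_integrand.
apply: ge0_le_integral => //.
- by move=> t _; rewrite lee_fin sqr_ge0.
- exact: gap_integrand.
- by apply: emeasurable_funD; apply: measurable_funeM; exact: gap_integrand.
Qed.

(** Approximation in probability with values kept in [[0, K]]. The common bound is part of the
    notion because the exponentials of the approximants must later be bounded in [L^2] uniformly. *)
Let approx (K : R) X := [/\ predictable T Ft X, 0 <= K & forall e : R, 0 < e -> exists S,
  [/\ elementary S, forall t w, 0 <= S t w <= K &
      (P [set w | (e%:E <= gap S X w)%E] <= e%:E)%E]].

Let prob_le2 (u v z : Om -> \bar R) (e : R) : 0 < e ->
  (forall r, measurable [set w | (r%:E <= u w)%E]) ->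
  (forall r, measurable [set w | (r%:E <= v w)%E]) ->
  (forall r, measurable [set w | (r%:E <= z w)%E]) ->
  (P [set w | ((e / 4)%:E <= u w)%E] <= (e / 4)%:E)%E ->
  (P [set w | ((e / 4)%:E <= v w)%E] <= (e / 4)%:E)%E ->
  (forall w, z w <= 2%:E * u w + 2%:E * v w)%E -> (forall w, 0 <= u w)%E -> (forall w, 0 <= v w)%E ->
  (P [set w | (e%:E <= z w)%E] <= e%:E)%E.
Proof.
move=> e0 mu mv mz Pu Pv zuv u0 v0.
apply: (@le_trans _ _ (P ([set w | (e / 4)%:E <= u w]%E `|` [set w | (e / 4)%:E <= v w]%E))).
  apply: le_measure; rewrite ?inE//; first exact: measurableU.
  move=> w /= ez; apply: contrapT => /not_orP[/negP + /negP].
  rewrite -!ltNge => ue ve; move: (le_trans ez (zuv w)); move: ue ve (u0 w) (v0 w).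
  case: (u w) (v w) => [a| |]// [b| |]//; rewrite !lte_fin -!EFinM -EFinD !lee_fin.
  by lra.
apply: (le_trans (measureU2 _ _ _)) => //.
by apply: (le_trans (leeD Pu Pv)); rewrite -EFinD lee_fin; lra.
Qed.

Let approx_limit K (F : nat -> R -> Om -> R) X : (forall n, approx K (F n)) ->
  predictable T Ft X ->
  (forall w e, 0 < e -> \forall n \near \oo, (gap (F n) X w < e%:E)%E) -> approx K X.
Proof.
move=> aF pX FX; have [_ K0 _] := aF 0%N; split => // e e0.
have e4 : 0 < e / 4 by rewrite divr_gt0.
have pF n : predictable T Ft (F n) by have [] := aF n.
have /(_ _ e4) : cvg0_in_probability P (fun n => gap (F n) X).
  apply: ae_small_cvg0; first by move=> n r; exact: gap_measurable.
  by apply: aeW => w; exact: FX.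
have P0 (A : set Om) : (0 <= P A)%E by [].
move=> /cvge0P/(_ _ e4)-/(_ (fun=> P0 _))[N _ /(_ N (leqnn N))/ltW hN].
have [_ _ /(_ _ e4)[S [eS bS hS]]] := aF N.
have pS := elementary_predictable T_gt0 eS.
exists S; split => //; apply: (prob_le2 e0 _ _ _ hS hN) => //.
- by move=> r; exact: gap_measurable.
- by move=> r; exact: gap_measurable.
- by move=> r; exact: gap_measurable.
- move=> w; apply: gap_le2 => // t _.
  have := sqr_ge0 ((S t w - F N t w) - (F N t w - X t w)); nra.
- by move=> w; apply: integral_ge0 => t _; rewrite lee_fin sqr_ge0.
- by move=> w; apply: integral_ge0 => t _; rewrite lee_fin sqr_ge0.
Qed.

Let approxD K K' X Y : approx K X -> approx K' Y -> approx (K + K') (fun t w => X t w + Y t w).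
Proof.
move=> [pX K0 aX] [pY K0' aY]; have pXY := predictableD T_gt0 pX pY.
split => //; first exact: addr_ge0.
move=> e e0; have e4 : 0 < e / 4 by rewrite divr_gt0.
have [S [eS bS hS]] := aX _ e4; have [S' [eS' bS' hS']] := aY _ e4.
have pS := elementary_predictable T_gt0 eS; have pS' := elementary_predictable T_gt0 eS'.
have eSS := elementaryD eS eS'.
exists (fun t w => S t w + S' t w); split => //.
  move=> t w; have /andP[h1 h2] := bS t w; have /andP[h3 h4] := bS' t w.
  by rewrite addr_ge0// lerD.
apply: (prob_le2 e0 _ _ _ hS hS') => //.
- by move=> r; exact: gap_measurable.
- by move=> r; exact: gap_measurable.
- by move=> r; apply: gap_measurable => //; exact: elementary_predictable.
- move=> w; apply: gap_le2 => //; first exact: elementary_predictable.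
  by move=> t _; have := sqr_ge0 ((S t w - X t w) - (S' t w - Y t w)); nra.
- by move=> w; apply: integral_ge0 => t _; rewrite lee_fin sqr_ge0.
- by move=> w; apply: integral_ge0 => t _; rewrite lee_fin sqr_ge0.
Qed.

(** [s s' - x y = s (s' - y) + y (s - x)] with [s] and [y] in [[0, 1]], so the errors merely add
    up. *)
Let approxM X Y : (forall t w, 0 <= Y t w <= 1) -> approx 1 X -> approx 1 Y ->
  approx 1 (fun t w => X t w * Y t w).
Proof.
move=> Y01 [pX K0 aX] [pY K0' aY]; have pXY := predictableM T_gt0 pX pY.
split => // e e0; have e4 : 0 < e / 4 by rewrite divr_gt0.
have [S [eS bS hS]] := aX _ e4; have [S' [eS' bS' hS']] := aY _ e4.
have pS := elementary_predictable T_gt0 eS; have pS' := elementary_predictable T_gt0 eS'.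
have eSS := elementaryM eS eS'.
exists (fun t w => S t w * S' t w); split => //.
  move=> t w; have /andP[h1 h2] := bS t w; have /andP[h3 h4] := bS' t w.
  by rewrite mulr_ge0// mulr_ile1.
apply: (prob_le2 e0 _ _ _ hS hS') => //.
- by move=> r; exact: gap_measurable.
- by move=> r; exact: gap_measurable.
- by move=> r; apply: gap_measurable => //; exact: elementary_predictable.
- move=> w; apply: gap_le2 => //; first exact: elementary_predictable.
  move=> t _; have /andP[] := bS t w; have /andP[] := Y01 t w.
  move: (S t w) (S' t w) (X t w) (Y t w) => s s' x y y0 y1 s0 s1.
  have -> : s * s' - x * y = s * (s' - y) + y * (s - x) by ring.
  have h1 : (s * (s' - y)) ^+ 2 <= (s' - y) ^+ 2.
    by rewrite exprMn ler_piMl ?sqr_ge0// exprn_ile1.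
  have h2 : (y * (s - x)) ^+ 2 <= (s - x) ^+ 2.
    by rewrite exprMn ler_piMl ?sqr_ge0// exprn_ile1.
  have := sqr_ge0 (s * (s' - y) - y * (s - x)).
  move: h1 h2; set a := s * _; set b := y * _; nra.
- by move=> w; apply: integral_ge0 => t _; rewrite lee_fin sqr_ge0.
- by move=> w; apply: integral_ge0 => t _; rewrite lee_fin sqr_ge0.
Qed.

Let approx_elementary K X S : 0 <= K -> predictable T Ft X -> elementary S ->
  (forall t w, 0 <= S t w <= K) -> (forall t w, 0 < t <= T -> S t w = X t w) -> approx K X.
Proof.
move=> K0 pX eS bS SX; split => // e e0; exists S; split => //.
rewrite (_ : [set w | _] = set0) ?measure0 ?lee_fin ?ltW//.
apply/seteqP; split => // w /=; rewrite /gap (eq_integral (cst 0%E)).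
  by rewrite integral0 lee_fin leNgt e0.
by move=> t /set_mem/=; rewrite in_itv/= => tT; rewrite SX// subrr expr0n.
Qed.

Let ind D : R -> Om -> R := fun t w => \1_D (t, w).

(** The constant 1 is replaced by the elementary indicator of []0, T]]. Off that interval [S]
    vanishes too, so the difference stays in [[0, 1]]. *)
Let approx_indC D : D `<=` `[0, T] `*` setT -> approx 1 (ind D) ->
  predictable T Ft (ind (`[0, T] `*` setT `\` D)) -> approx 1 (ind (`[0, T] `*` setT `\` D)).
Proof.
move=> D0 [pD _ aD] pC; split => // e e0; have [S [eS bS hS]] := aD _ e0.
have eS1 := elementaryD (elementary_cst P B T_gt0 1) (elementaryZ (-1) eS).
exists (fun u w => (\1_(`]0, T] : set R) u : R) * 1 + -1 * S u w); split => //.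
  move=> t w; have /andP[h1 h2] := bS t w; rewrite mulr1 mulN1r.
  have [h|h] : \1_(`]0, T] : set R) t = 1 :> R \/ \1_(`]0, T] : set R) t = 0 :> R.
    by rewrite indicE; case: (_ \in _); [left|right].
    by rewrite h subr_ge0 h2 gerBl.
  by rewrite (elementary_out w eS h) h subrr ler01 lexx.
move: hS; congr (P _ <= _)%E; apply/seteqP; rewrite /gap; split=> w /=; congr (_ <= _)%E;
  apply: eq_integral => t /set_mem tT; congr (_ %:E).
all: have tT' := ocT tT.
all: rewrite indicE mem_set// mulr1 mulN1r /ind !indicE.
all: have -> : ((t, w) \in `[0, T] `*` setT `\` D) = ((t, w) \notin D) by
  apply/idP/idP => [/set_mem[_ h]|h]; [apply/negP => /set_mem|
    apply/mem_set; split => // Dtw; move: h; rewrite mem_set].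
all: by case: ((t, w) \in D); rewrite /= ?mulr1n ?mulr0n; ring.
Qed.

Let predictable_ind D : D `<=` `[0, T] `*` setT -> predictable_sets T Ft D -> predictable T Ft (ind D).
Proof.
move=> D0 pD.
have -> : ind D = (fun t w => if (t, w) \in D then 1 else 0).
  by apply/funext => t; apply/funext => w; rewrite /ind indicE; case: (_ \in _).
apply: predictable_ite; [exact: T_gt0| |exact: predictable_cst|exact: predictable_cst].
apply/predictable_setsE => //.
rewrite (_ : _ `&` _ = D)//; apply/seteqP; split => [[t w] [_ /= /set_mem]//|[t w] Dtw].
by split; [exact: D0|exact/mem_set].
Qed.

(** The sets with an approximable indicator form a sigma-algebra: complements by [1 - S],
    intersections by products, countable unions as dominated limits of finite ones. The rectangles
    that generate it are elementary, and those at time 0 are invisible to the error. *)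
Let approx_predictable_set D : predictable_sets T Ft D -> D `<=` `[0, T] `*` setT /\ approx 1 (ind D).
Proof.
set D0 := `[0, T] `*` setT.
pose M D := [/\ D `<=` D0, predictable_sets T Ft D & approx 1 (ind D)].
suff /(_ D) h : predictable_sets T Ft `<=` M by move=> /h[].
have [P0 PC PU] : sigma_algebra D0 (predictable_sets T Ft) by exact: smallest_sigma_algebra.
have M0 : M set0.
  split => //; apply: (approx_elementary _ _ (elementary0 P T B)) => //.
  - by apply: predictable_ind.
  - by move=> t w; rewrite lexx ler01.
  - by move=> t w _; rewrite /ind indicE in_set0.
have MC A : M A -> M (D0 `\` A).
  move=> [AD pA aA]; have pC := PC _ pA.
  have CD : D0 `\` A `<=` D0 by apply: subDsetl.
  by split => //; apply: approx_indC => //; exact: predictable_ind.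
have MI A C : M A -> M C -> M (A `&` C).
  move=> MA MB; have [AD pA aA] := MA; have [CD pC aC] := MB.
  have IE : A `&` C = D0 `\` \bigcup_k (if k is 0%N then D0 `\` A else D0 `\` C).
    apply/seteqP; split => [z [Az Cz]|z [Dz h]].
      by split; [exact: AD|move=> [[|k] _ []]].
    split; apply: contrapT => nz; apply: h; [by exists 0%N|by exists 1%N].
  split; first by move=> z [/AD].
    by rewrite IE; apply: (PC); apply: PU => -[|k]; apply: (PC).
  have := approxM _ aA aC => /(_ _)/wrap[].
    by move=> t w; rewrite /ind indicE; case: (_ \in _); rewrite ?lexx ?ler01.
  by congr approx; apply/funext => t; apply/funext => w; rewrite /ind !indicE in_setI -natrM mulnb.
apply: smallest_sub; first split => //.
- move=> F MF; have FD n : F n `<=` D0 by have [] := MF n.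
  have pU : predictable_sets T Ft (\bigcup_n F n) by apply: PU => n; have [] := MF n.
  have UD : \bigcup_n F n `<=` D0 by move=> z [n _ /FD].
  split => //.
  pose U n := \bigcup_(k in [set k | (k < n)%N]) F k.
  have MUn n : M (U n).
    elim: n => [|n IH].
      by rewrite (_ : U 0%N = set0)//; apply/seteqP; split => // z [].
    rewrite (_ : U n.+1 = D0 `\` ((D0 `\` U n) `&` (D0 `\` F n))).
      by apply: (MC); apply: (MI); apply: (MC).
    apply/seteqP; split => z.
      move=> [k /= kn Fz]; split; first exact: FD Fz.
      move=> [[_ nU] [_ nF]]; move: kn; rewrite ltnS leq_eqVlt => /predU1P[kn|kn].
        by apply: nF; rewrite -kn.
      by apply: nU; exists k.
    move=> [Dz h]; have [[k /= kn Fk]|nU] := pselect (U n z).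
      by exists k => //=; rewrite ltnS ltnW.
    exists n => //=; apply: contrapT => nF; apply: h; split; split => //.
  apply: (@approx_limit _ (fun n => ind (U n))).
  - by move=> n; have [] := MUn n.
  - exact: predictable_ind.
  - move=> w e e0.
    have mI : measurable (`]0, T]%classic : set R) by exact: measurable_itv.
    have pp D' : D' `<=` D0 -> predictable_sets T Ft D' -> predictable T Ft (ind D').
      exact: predictable_ind.
    apply: (@integral_dominated_cvg0 _ _ (fun n t => (ind (U n) t w - ind (\bigcup_n F n) t w) ^+ 2) (cst 1)) => //.
    + move=> n; have [UnD pUn _] := MUn n; apply/measurable_EFinP.
      by apply: gap_integrand; exact: predictable_ind.
    + move=> n t _; rewrite sqr_ge0/= /ind !indicE.
      by case: (_ \in _); case: (_ \in _); rewrite ?mulr1n ?mulr0n; lra.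
    + move=> t _; apply: cvg_near_cst.
      have [[k _ Fk]|nF] := pselect ((\bigcup_n F n) (t, w)).
        exists k.+1 => // n /= kn; have h1 : U n (t, w) by exists k.
        have h2 : (\bigcup_n F n) (t, w) by exists k.
        by rewrite /ind !indicE !mem_set// subrr expr0n.
      apply: nearW => n; have nU : ~ U n (t, w) by move=> [k _ Fk]; apply: nF; exists k.
      by rewrite /ind !indicE !memNset// subrr expr0n.
- move=> D' [[s [t [A [s0 st tT FA ->]]]]|[A FA ->]].
  + have sub : `]s, t] `*` A `<=` D0.
      move=> [u w] /= [+ _]; rewrite in_itv/= => /andP[h1 h2]; split => //=.
      by rewrite in_itv/= (le_trans s0 (ltW h1)) (le_trans h2).
    have pD : predictable_sets T Ft (`]s, t] `*` A).
      by apply: sub_sigma_algebra; left; exists s, t, A.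
    split => //.
    have mA : measurable_wrt (Ft s) (\1_A : Om -> R).
      by apply/measurable_wrtP; exact: (@measurable_indic _ (OmF P B s) R setT _ FA).
    have eS : elementary (fun u w => (\1_(`]s, t] : set R) u : R) * \1_A w).
      apply: elementary_one_cell => //; first exact: ltW.
      by exists 1 => w; rewrite indicE; case: (_ \in _); rewrite ?normr1 ?normr0.
    apply: (approx_elementary _ _ eS) => //; first exact: predictable_ind.
      by move=> u w; rewrite !indicE -natrM mulnb ler0n lern1 leq_b1.
    move=> u w _; rewrite /ind !indicE -natrM mulnb; congr (_%:R); congr nat_of_bool.
    by apply/andP/idP => [[/set_mem h1 /set_mem h2]|/set_mem[h1 h2]]; [exact/mem_set|split; exact/mem_set].
  + have sub : [set 0] `*` A `<=` D0.
      move=> [u w] /= [-> _]; split => //=.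
      by rewrite in_itv/= lexx ltW.
    have pD : predictable_sets T Ft ([set 0] `*` A).
      by apply: sub_sigma_algebra; right; exists A.
    split => //; apply: (approx_elementary _ _ (elementary0 P T B)) => //.
    * exact: predictable_ind.
    * by move=> u w; rewrite lexx ler01.
    * move=> u w /andP[u0 _]; rewrite /ind indicE memNset// => -[/= u00 _].
      by rewrite u00 ltxx in u0.
Qed.

Let approxZ a K X : 0 <= a -> approx K X -> approx (a * K) (fun t w => a * X t w).
Proof.
move=> a0 [pX K0 aX].
have paX : predictable T Ft (fun t w => a * X t w).
  by apply: predictableM => //; exact: predictable_cst.
split => //; first exact: mulr_ge0.
move=> e e0; pose e' := e / (a ^+ 2 + 1).
have a21 : 0 < a ^+ 2 + 1 by rewrite ltr_wpDl// sqr_ge0.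
have e'0 : 0 < e' by rewrite divr_gt0.
have e'e : e' <= e by rewrite ler_pdivrMr// ler_peMr ?(ltW e0)// lerDr sqr_ge0.
have [S [eS bS hS]] := aX _ e'0; have pS := elementary_predictable T_gt0 eS.
have eaS := elementaryZ a eS.
exists (fun t w => a * S t w); split => //.
  by move=> t w; have /andP[h1 h2] := bS t w; rewrite mulr_ge0//= ler_wpM2l.
apply: (@le_trans _ _ (P [set w | (e'%:E <= gap S X w)%E])); last first.
  by apply: (le_trans hS); rewrite lee_fin.
apply: le_measure; rewrite ?inE.
- by apply: gap_measurable => //; exact: elementary_predictable.
- exact: gap_measurable.
- move=> w /=.
  have -> : gap (fun t w => a * S t w) (fun t w => a * X t w) w = ((a ^+ 2)%:E * gap S X w)%E.
    rewrite /gap -ge0_integralZl_EFin ?sqr_ge0//; last 2 first.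
    - by move=> t _; rewrite lee_fin sqr_ge0.
    - exact: gap_integrand.
    by apply: eq_integral => t _; rewrite -EFinM -exprMn mulrBr.
  have : (0 <= gap S X w)%E by apply: integral_ge0 => t _; rewrite lee_fin sqr_ge0.
  case: (gap S X w) => [r| |]//; last by move=> _ _; rewrite leey.
  rewrite -EFinM !lee_fin => r0 er; rewrite ler_pdivrMr//; move: er; rewrite mulrDr mulr1 mulrC.
  by move=> /le_trans; apply; rewrite lerDl.
Qed.

(** A staircase: [F h n] adds a step [h] for each level [(k + 1) h] reached by [X], and so stays
    below [X] by at most [h]. With [h = c / (n + 1)] the [n + 1] steps never exceed [c]. *)
Let approx_bounded c X : 0 <= c -> predictable T Ft X -> (forall t w, 0 <= X t w <= c) -> approx c X.
Proof.
move=> c0 pX bX; pose D a := `[0, T] `*` setT `&` [set z | a <= X z.1 z.2].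
have aD a : approx 1 (ind (D a)).
  have [] // := @approx_predictable_set (D a).
  have := pX `[a, +oo[%classic (measurable_itv _); congr (predictable_sets _ _ _).
  by apply/seteqP; split => z /= [h1 h2]; split => //; move: h2; rewrite in_itv/= andbT.
have indD a t w : 0 < t <= T -> ind (D a) t w = (a <= X t w)%R%:R.
  move=> /andP[t0 tT]; rewrite /ind indicE; congr (_%:R); congr nat_of_bool.
  apply/idP/idP => [/set_mem[]//|h]; apply/mem_set; split => //; split => //=.
  by rewrite in_itv/= ltW.
pose F h n t w := \sum_(k < n) h * ind (D (k.+1%:R * h)) t w.
have aF h n : 0 <= h -> approx (n%:R * h) (F h n).
  move=> h0; elim: n => [|n IH].
    rewrite mul0r; apply: (approx_elementary _ _ (elementary0 P T B)) => //.
    - have -> : F h 0%N = (fun _ _ => 0) by apply/funext => t; apply/funext => w; rewrite /F big_ord0.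
      exact: predictable_cst.
    - by move=> t w; rewrite lexx.
    - by move=> t w _; rewrite /F big_ord0.
  rewrite -natr1 mulrDl; have := approxD IH (approxZ h0 (aD (n.+1%:R * h))).
  rewrite mulr1 mul1r; congr approx; apply/funext => t; apply/funext => w.
  by rewrite /F big_ord_recr.
have FX h n t w : 0 <= h -> 0 < t <= T ->
    (n%:R * h <= X t w -> F h n t w = n%:R * h) /\
    (X t w < n%:R * h -> X t w - h <= F h n t w <= X t w).
  move=> h0 tT; have /andP[X0 _] := bX t w.
  elim: n => [|n [IH1 IH2]].
    rewrite mul0r /F big_ord0; split => //.
    by move=> /(le_lt_trans X0); rewrite ltxx.
  rewrite /F big_ord_recr /= indD// -/(F h n t w) -natr1 mulrDl mul1r; split.
    move=> hX; have -> : (n%:R * h + h <= X t w)%R by [].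
    by rewrite mulr1 IH1//; lra.
  move=> Xh; have -> : (n%:R * h + h <= X t w) = false by apply/negbTE; rewrite -ltNge.
  rewrite mulr0 addr0; have [h1|h1] := leP (n%:R * h) (X t w); last exact: IH2.
  by rewrite IH1// h1 andbT; lra.
pose h n : R := c / n.+1%:R.
have h0 n : 0 <= h n by rewrite divr_ge0.
have hn n : n.+1%:R * h n = c by rewrite /h mulrC divfK.
apply: (@approx_limit _ (fun n => F (h n) n.+1)).
- by move=> n; have := aF (h n) n.+1 (h0 n); rewrite hn.
- exact: pX.
- move=> w e e0.
  have mI : measurable (`]0, T]%classic : set R) by exact: measurable_itv.
  have pF n : predictable T Ft (F (h n) n.+1) by have [] := aF (h n) n.+1 (h0 n).
  have FXn n t : 0 < t <= T -> (F (h n) n.+1 t w - X t w) ^+ 2 <= h n ^+ 2.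
    move=> tT; rewrite -[leLHS]real_normK ?num_real//; apply: lerXn2r; rewrite ?nnegrE//.
    rewrite ler_norml.
    have [] := FX (h n) n.+1 t w (h0 n) tT; rewrite hn; have /andP[X0 Xc] := bX t w.
    have := h0 n; have [cX|Xc'] := leP c (X t w); first by move=> ? -> // _; lra.
    by move=> ? _ /(_ isT); lra.
  apply: (@integral_dominated_cvg0 _ _ (fun n t => (F (h n) n.+1 t w - X t w) ^+ 2) (cst (c ^+ 2))) => //.
  + by move=> n; apply/measurable_EFinP; exact: gap_integrand.
  + move=> n t; rewrite /= in_itv/= sqr_ge0/= => /(FXn n)/le_trans; apply.
    apply: lerXn2r; rewrite ?nnegrE// /h ler_pdivrMr// ler_peMr// ler1n//.
  + move=> t; rewrite /= in_itv/= => tT.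
    apply: (@squeeze_cvgr _ _ _ _ (cst 0) (fun n => h n ^+ 2)).
    * by apply: nearW => n; rewrite sqr_ge0 FXn.
    * exact: cvg_cst.
    * have hc : h n @[n --> \oo] --> (0 : R).
        by rewrite -(mulr0 c); apply: cvgM; [exact: cvg_cst|exact: cvg_harmonic].
      by rewrite -(mulr0 0); under eq_fun do rewrite expr2; exact: cvgM.
Qed.

Lemma simple_dense_bounded (H : R -> Om -> 'cV[R]_m) (c : R) : predictable_mx T Ft H ->
  (forall t w i, `|H t w i 0| <= c) -> exists2 K : R, 0 <= K & forall e : R, 0 < e ->
  exists S, [/\ simple S, forall t w, enorm (simple_val S t w) ^+ 2 <= K &
    (P [set w | (e%:E <= energy (fun t w => (simple_val S t w - H t w)%R) T w)%E] <= e%:E)%E].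
Proof.
move=> pH bH; exists (\sum_(i < m) (2 * `|c|) ^+ 2); first by apply: sumr_ge0 => i _; rewrite sqr_ge0.
(* Each of the [m] coordinates receives an equal share of the error; dividing by [m + 1] keeps the
   total strictly below [e], also when [m = 0]. *)
move=> e e0; pose e' := e / m.+1%:R; have e'0 : 0 < e' by rewrite divr_gt0.
have bH' t w i : `|H t w i 0| <= `|c| by rewrite (le_trans (bH t w i)) ?ler_norm.
(* The shift makes the coordinates nonnegative, as [approx] requires; [V] removes it again. *)
pose X i t w := H t w i 0 + `|c|.
have pX i : predictable T Ft (X i).
  by apply: predictableD; [exact: T_gt0|exact: pH|exact: predictable_cst].
have aX i : approx (2 * `|c|) (X i).
  apply: approx_bounded => //.
  move=> t w; have := bH' t w i; rewrite ler_norml /X; lra.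
have /choice[U hU] i : exists U, [/\ elementary U, forall t w, 0 <= U t w <= 2 * `|c| &
   (P [set w | (e'%:E <= gap U (X i) w)%E] <= e'%:E)%E].
  by have [_ _ /(_ _ e'0)] := aX i.
pose V i t w := U i t w + -1 * ((\1_(`]0, T] : set R) t : R) * `|c|).
have eV i : elementary (V i).
  have [eU _ _] := hU i; apply: elementaryD => //; apply: elementaryZ.
  exact: elementary_cst.
have bV i t w : `|V i t w| <= 2 * `|c|.
  have [_ /(_ t w) + _] := hU i; rewrite /V ler_norml.
  have : 0 <= `|c| by []. 
  have : \1_(`]0, T] : set R) t = 1 :> R \/ \1_(`]0, T] : set R) t = 0 :> R.
    by rewrite indicE; case: (_ \in _); [left|right].
  by case=> ->; lra.
have [S sS SE] : exists2 S, simple S & forall t w, simple_val S t w = \sum_i V i t w *: delta_mx i 0.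
  elim: (index_enum _) => [|i r [S sS SE]].
    exists (@SimpleProcess _ _ _ _ 0 (fun=> 0) (fun=> 0) (fun _ _ => 0)); first by case.
    by move=> t w; rewrite big_nil; apply: big1 => -[].
  have [S' sS' SE'] := elementary_vec i (eV i).
  exists (simple_add S' S); first exact: is_simple_add.
  by move=> t w; rewrite simple_val_add SE SE' big_cons.
have Si t w i : simple_val S t w i 0 = V i t w.
  rewrite SE summxE (bigD1 i)//= !mxE !eqxx mulr1 big1 ?addr0// => j ji.
  by rewrite !mxE eq_sym (negbTE ji) mulr0.
exists S; split => //.
  move=> t w; rewrite sqr_enorm; apply: ler_sum => i _.
  rewrite -expr2 Si -[leLHS]real_normK ?num_real//; apply: lerXn2r; rewrite ?nnegrE//.
have energyE w : energy (fun t w => (simple_val S t w - H t w)%R) T w = (\sum_(i < m) gap (U i) (X i) w)%E.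
  rewrite /energy.
  have pi i : measurable_fun `[0, T] (fun t : measurableTypeR R => ((V i t w - H t w i 0) ^+ 2)%:E).
    apply/measurable_EFinP; apply: (measurableT_comp (exprn_measurable 2)).
    have pV := elementary_predictable T_gt0 (eV i).
    by apply: measurable_funB; [exact: (predictable_path T_gt0 w pV)|exact: (predictable_path T_gt0 w (pH i 0))].
  transitivity (\int[leb]_(t in `[0%R, T]) \sum_(i < m) ((V i t w - H t w i 0) ^+ 2)%:E)%E.
    apply: eq_integral => t _; rewrite sqr_enorm sumEFin; congr (_%:E); apply: eq_bigr => i _.
    by rewrite 2!mxE Si expr2.
  rewrite ge0_integral_sum//; last by move=> i t _; rewrite lee_fin sqr_ge0.
  apply: eq_bigr => i _; rewrite -integral_itv_obnd_cbnd; last first.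
    by apply: measurable_funS (pi i) => //; exact: ocT.
  apply: eq_integral => t /set_mem tT; congr (_%:E); rewrite /V /X.
  have -> : \1_(`]0, T] : set R) t = 1 :> R by rewrite indicE mem_set.
  ring.
pose A i := [set w | (e'%:E <= gap (U i) (X i) w)%E].
have mA i : measurable (A i).
  by apply: gap_measurable => //; have [eU _ _] := hU i; exact: elementary_predictable.
apply: (@le_trans _ _ (P (\big[setU/set0]_(i < m) A i))).
  apply: le_measure; rewrite ?inE.
  - have T0T : 0 <= T <= T by rewrite lexx ltW.
    have pD : predictable_mx T Ft (fun t w => simple_val S t w - H t w).
      by apply: predictable_mxB => //; exact: simple_val_predictable.
    apply: (Ft_measurable P_complete mB (lexx T)).
    rewrite (_ : [set w | _] = energy (fun t w => (simple_val S t w - H t w)%R) T @^-1` `[e%:E, +oo[).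
      by rewrite -[X in Ft T X]setTI; apply: (energy_measurable T_gt0 pD T0T) => //; exact: emeasurable_itv.
    by apply/seteqP; split => w /=; rewrite in_itv/= andbT.
  - by apply: bigsetU_measurable.
  - move=> w /=; rewrite energyE => ew; rewrite -bigcup_seq; apply: contrapT => nA.
    move: ew; apply/negP; rewrite -ltNge.
    apply: (@le_lt_trans _ _ (\sum_(i < m) e'%:E)%E).
      apply: lee_sum => i _; rewrite leNgt; apply/negP => /ltW h; apply: nA; exists i => //.
      by rewrite /= mem_index_enum.
    rewrite sumEFin lte_fin sumr_const card_ord -mulr_natr /e' -mulrA gtr_pMr// mulrC.
    by rewrite ltr_pdivrMr// mul1r ltr_nat.
have sub (r : seq 'I_m) : (P (\big[setU/set0]_(i <- r) A i) <= ((size r)%:R * e')%:E)%E.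
  elim: r => [|i r IH]; first by rewrite big_nil measure0 mul0r.
  rewrite big_cons; apply: (le_trans (measureU2 _ _ _)) => //; first exact: bigsetU_measurable.
  rewrite /= -natr1 mulrDl mul1r addrC EFinD leeD//.
  by have [_ _] := hU i.
apply: (le_trans (sub _)); rewrite lee_fin.
have -> : size (index_enum (ordinal m)) = m by rewrite /index_enum -enumT size_enum_ord.
by rewrite /e' mulrCA ler_piMr ?(ltW e0)// ler_pdivrMr// mul1r ler_nat.
Qed.

Lemma energy_dominated_cvg0 (G : nat -> R -> Om -> 'cV[R]_m) (H : R -> Om -> 'cV[R]_m) w :
  (forall n, predictable_mx T Ft (G n)) -> predictable_mx T Ft H ->
  (forall n t, enorm (G n t w) ^+ 2 <= enorm (H t w) ^+ 2) ->
  (forall t, 0 <= t <= T -> enorm (G n t w) ^+ 2 @[n --> \oo] --> (0 : R)) ->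
  (energy H T w < +oo)%E ->
  forall e : R, 0 < e -> \forall n \near \oo, (energy (G n) T w < e%:E)%E.
Proof.
move=> pG pH GH G0 Hfin; apply: integral_dominated_cvg0 Hfin => //.
- by move=> n; apply/measurable_EFinP; apply: (measurable_sqr_enorm T_gt0).
- by apply/measurable_EFinP; apply: (measurable_sqr_enorm T_gt0).
- by move=> n t _; rewrite sqr_ge0 GH.
Qed.

Lemma measurable_energy_level (H : R -> Om -> 'cV[R]_m) (e : R) : predictable_mx T Ft H ->
  measurable [set w | (e%:E <= energy H T w)%E].
Proof.
move=> pH; have T0T : 0 <= T <= T by rewrite lexx ltW.
apply: (Ft_measurable P_complete mB (lexx T)).
rewrite (_ : [set w | _] = energy H T @^-1` `[e%:E, +oo[).
  by rewrite -[X in Ft T X]setTI; apply: (energy_measurable T_gt0 pH T0T) => //; exact: emeasurable_itv.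
by apply/seteqP; split => w /=; rewrite in_itv/= andbT.
Qed.

Lemma energyD_le (H G : R -> Om -> 'cV[R]_m) t w : predictable_mx T Ft H -> predictable_mx T Ft G ->
  t <= T ->
  (energy (fun t w => (H t w + G t w)%R) t w <= 2%:E * energy H t w + 2%:E * energy G t w)%E.
Proof.
move=> pH pG tT; have sub : `[0, t] `<=` `[0, T].
  by move=> u /=; rewrite !in_itv/= => /andP[-> /le_trans->].
have pHG := predictable_mxD T_gt0 pH pG.
rewrite /energy -!ge0_integralZl_EFin//; [|by move=> u _; rewrite lee_fin sqr_ge0|
  exact: (measurable_sqr_enorm T_gt0)|
  by move=> u _; rewrite lee_fin sqr_ge0|exact: (measurable_sqr_enorm T_gt0)].
rewrite -ge0_integralD//; last 4 first.
- by move=> u _; rewrite -EFinM lee_fin mulr_ge0// sqr_ge0.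
- by apply: measurable_funeM; exact: (measurable_sqr_enorm T_gt0).
- by move=> u _; rewrite -EFinM lee_fin mulr_ge0// sqr_ge0.
- by apply: measurable_funeM; exact: (measurable_sqr_enorm T_gt0).
apply: ge0_le_integral => //.
- by move=> u _; rewrite lee_fin sqr_ge0.
- exact: (measurable_sqr_enorm T_gt0 w pHG).
- by apply: emeasurable_funD; apply: measurable_funeM; exact: (measurable_sqr_enorm T_gt0).
- by move=> u _; rewrite -!EFinM -EFinD lee_fin !sqr_enorm dot_sqrD_le.
Qed.

Definition truncate_mx (n : R) (H : R -> Om -> 'cV[R]_m) t w : 'cV[R]_m :=
  \col_i (if `|H t w i 0| <= n then H t w i 0 else 0).

Lemma predictable_truncate n H : predictable_mx T Ft H -> predictable_mx T Ft (truncate_mx n H).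
Proof.
move=> pH i j.
have -> : (fun t w => truncate_mx n H t w i j) = (fun t w => if `|H t w i 0| <= n then H t w i 0 else 0).
  by apply/funext => t; apply/funext => w; rewrite mxE.
apply: (@predictable_comp _ _ _ _ P T B T_gt0 (fun x => if `|x| <= n then x else 0) (fun t w => H t w i 0)) => //.
apply: measurable_fun_if => //; first exact: measurable_fun_ler.
Qed.

Lemma truncate_cvg0 H t w :
  \forall n \near \oo, truncate_mx n%:R H t w = H t w.
Proof.
have h i : \forall n \near \oo, `|H t w i 0| <= (n%:R : R) by exact: nbhs_infty_ger.
have : \forall n \near \oo, forall i, `|H t w i 0| <= (n%:R : R) by exact: filter_forall.
by apply: filterS => n hn; apply/colP => i; rewrite mxE hn.
Qed.

(** At each point the truncations equal [H] from some rank on and differ from it by at most [|H|],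
    so dominated convergence works path by path. The bounded case does the rest. *)
Lemma simple_dense (H : R -> Om -> 'cV[R]_m) : predictable_mx T Ft H -> square_integrable P T H ->
  forall e : R, 0 < e -> exists2 S, simple S &
    (P [set w | (e%:E <= energy (fun t w => (simple_val S t w - H t w)%R) T w)%E] <= e%:E)%E.
Proof.
move=> pH sH e e0; have e4 : 0 < e / 4 by rewrite divr_gt0.
pose G n t w := truncate_mx n%:R H t w - H t w.
have pG n : predictable_mx T Ft (G n).
  by apply: predictable_mxB => //; exact: predictable_truncate.
have /(_ _ e4) : cvg0_in_probability P (fun n => energy (G n) T).
  apply: ae_small_cvg0; first by move=> n r; exact: measurable_energy_level.
  apply: filterS sH => w sHw; apply: (@energy_dominated_cvg0 _ H) => //.
    move=> n t; rewrite !sqr_enorm; apply: ler_sum => i _; rewrite 3!mxE.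
    case: ifP => _; first by rewrite subrr mulr0 -expr2 sqr_ge0.
    by rewrite sub0r mulrNN.
  move=> t _; apply: cvg_near_cst; apply: filterS (truncate_cvg0 H t w) => n hn.
  by rewrite /G hn subrr sqr_enorm dot0l.
have P0 (A : set Om) : (0 <= P A)%E by [].
move=> /cvge0P/(_ _ e4)-/(_ (fun=> P0 _))[N _ /(_ N (leqnn N))/ltW hN].
have [t w i|K _ /(_ _ e4)[S [sS _ hS]]] := @simple_dense_bounded (truncate_mx N%:R H) N%:R (predictable_truncate _ pH).
  by rewrite mxE; case: ifP => // _; rewrite normr0.
have pS := simple_val_predictable T_gt0 sS.
exists S => //; apply: (prob_le2 e0 _ _ _ hS hN) => //.
- move=> r; apply: measurable_energy_level; apply: predictable_mxB => //; exact: predictable_truncate.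
- by move=> r; exact: measurable_energy_level.
- by move=> r; apply: measurable_energy_level; exact: predictable_mxB.
- move=> w; rewrite (_ : (fun t w => (simple_val S t w - H t w)%R) =
     (fun t w => (simple_val S t w - truncate_mx N%:R H t w) + G N t w)%R); last first.
    by apply/funext => t; apply/funext => w'; rewrite /G addrA subrK.
  by apply: energyD_le => //; apply: predictable_mxB => //; exact: predictable_truncate.
- by move=> w; exact: energy_ge0.
- by move=> w; exact: energy_ge0.
Qed.

End density.

(** * The Ito integral *)

(** [u n - 2 / 2^n] increases and [u n + 2 / 2^n] decreases. The explicit rate is the point: it
    makes the convergence of paths uniform in time. *)
Lemma geometric_cauchy {R : realType} (u : nat -> R) N :
  (forall n, (N <= n)%N -> `|u n.+1 - u n| <= (2 ^+ n)^-1) ->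
  exists2 l : R, u n @[n --> \oo] --> l & forall n, (N <= n)%N -> `|u n - l| <= 2 * (2 ^+ n)^-1.
Proof.
move=> hu; pose r n : R := 2 * (2 ^+ n)^-1.
have rS n : r n = r n.+1 + (2 ^+ n)^-1.
  by rewrite /r exprS; field; rewrite expf_neq0.
pose a n := u (n + N)%N - r (n + N)%N; pose b n := u (n + N)%N + r (n + N)%N.
have step n : `|u (n + N).+1 - u (n + N)%N| <= (2 ^+ (n + N))^-1 by apply: hu; rewrite leq_addl.
have a_nd : nondecreasing_seq a.
  apply/nondecreasing_seqP => n; rewrite /a addSn (rS (n + N)%N).
  by have := step n; rewrite ler_norml; lra.
have b_ni : nonincreasing_seq b.
  apply/nonincreasing_seqP => n; rewrite /b addSn (rS (n + N)%N).
  by have := step n; rewrite ler_norml; lra.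
have r0 n : 0 <= r n by rewrite mulr_ge0// invr_ge0 exprn_ge0.
have ab n k : a n <= b k.
  apply: (@le_trans _ _ (a (n + k)%N)); first by apply: a_nd; rewrite leq_addr.
  apply: (@le_trans _ _ (b (n + k)%N)); last by apply: b_ni; rewrite leq_addl.
  by rewrite /a /b; have := r0 (n + k + N)%N; lra.
pose l := sup (range a).
have ubl : has_ubound (range a) by exists (b 0%N) => _ [n _ <-].
have al n : a n <= l by apply: ub_le_sup => //; exists n.
have lb k : l <= b k by apply: ge_sup => [|_ [n _ <-]//]; exists (a 0%N); exists 0%N.
have ul n : (N <= n)%N -> `|u n - l| <= 2 * (2 ^+ n)^-1.
  move=> /subnK nN; have := al (n - N)%N; have := lb (n - N)%N; rewrite /a /b nN.
  by rewrite ler_norml -/(r n); lra.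
exists l => //; apply/cvgrPdist_le => e e0; near=> n.
rewrite distrC; apply: (le_trans (ul n _)); first by near: n; exact: nbhs_infty_ge.
near: n.
have : (2 * 2^-1 ^+ n : R)%R @[n --> \oo] --> (2 * 0 : R)%R.
  by apply: cvgM; [exact: cvg_cst|apply: cvg_expr; rewrite ger0_norm// invf_lt1// ltr1n].
rewrite mulr0 => /cvgrPdist_le/(_ _ e0); apply: filterS => n.
by rewrite sub0r normrN ger0_norm ?mulr_ge0 ?exprn_ge0// exprVn.
Unshelve. all: by end_near. Qed.

Lemma path_continuous_uniform_limit {R : realType} (T : R) (f : nat -> R -> R) g :
  (forall n, path_continuous T (f n)) ->
  (forall e : R, 0 < e -> \forall n \near \oo, forall t, 0 <= t <= T -> `|f n t - g t| < e) ->
  path_continuous T g.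
Proof.
move=> cf fg t tT e e0; have e3 : 0 < e / 3 by rewrite divr_gt0.
have [n _ /(_ n (leqnn n)) hn] := fg _ e3.
have [d d0 hd] := cf n t tT _ e3; exists d => // s sT sd.
have := hd s sT sd; have := hn s sT; have := hn t tT.
by rewrite !ltr_norml => /andP[? ?] /andP[? ?] /andP[? ?]; apply/andP; split; lra.
Qed.

Section borel_cantelli.
Context {d} {X : measurableType d} {R : realType} (P : probability X R).

Lemma borel_cantelli_geometric (E : nat -> set X) (c : R) : (forall n, measurable (E n)) ->
  0 <= c -> (forall n, P (E n) <= (c * (2 ^+ n)^-1)%:E)%E ->
  {ae P, forall x, \forall n \near \oo, ~ E n x}.
Proof.
move=> mE c0 PE; apply: ae_lim_sup_set => //; apply: lim_sup_set_cvg0 => //.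
apply: (@le_lt_trans _ _ (\sum_(n <oo) ((2 * c) / (2 ^ n.+1)%:R)%:E)%E).
  apply: lee_nneseries => // n _; apply: (le_trans (PE n)); rewrite lee_fin natrX exprS.
  by rewrite invfM mulrACA divff// mul1r.
apply: (le_lt_trans (epsilon_trick0 xpredT _)); last by rewrite ltry.
by rewrite mulr_ge0.
Qed.

(** Fatou's lemma for events. It carries a tail bound from approximants to their limit. *)
Lemma measure_liminf_le (E : nat -> set X) (c : \bar R) : (forall n, measurable (E n)) ->
  (forall n, P (E n) <= c)%E -> exists F, [/\ measurable F, (P F <= c)%E &
    forall x, (\forall n \near \oo, E n x) -> F x].
Proof.
move=> mE PE; pose G N := \bigcap_(n in [set n | (N <= n)%N]) E n.
have mG N : measurable (G N) by apply: bigcap_measurableType => n _; exact: mE.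
have GE N : (P (G N) <= c)%E.
  apply: le_trans (PE N); apply: le_measure; rewrite ?inE// => x; apply; exact: leqnn.
have mU : measurable (\bigcup_N G N) by exact: bigcupT_measurable.
exists (\bigcup_N G N); split => //.
have ndG : nondecreasing_seq G.
  by move=> i j ij; apply/subsetPset => x h n /= jn; apply: h; exact: leq_trans jn.
have cv := nondecreasing_cvg_mu (mu := P) mG mU ndG.
have /cvg_lim <- // := cv.
by apply: lime_le; [apply/cvg_ex; exists (P (\bigcup_n G n))|exact: nearW].
Qed.

End borel_cantelli.

Section ito_limits.
Context {disp : measure_display} {Om : measurableType disp} {R : realType}.
Context {m : nat}.
Variables (P : probability Om R) (T : R) (B : R -> Om -> 'cV[R]_m).
Hypothesis P_complete : measure_is_complete P.
Hypothesis B_brownian : brownian_motion P T B.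
Hypothesis T_gt0 : 0 < T.

Local Notation Ft := (augmented_filtration P B).
Local Notation leb := (@lebesgue_measure R).
Let mB := brownian_measurable B_brownian.
Local Notation simple := (is_simple P T B).
Implicit Types (H G : R -> Om -> 'cV[R]_m) (I J : R -> Om -> R).

(** Almost sure convergence, uniform in time, replaces the convergence in probability of
    [is_ito_integral]. Adaptedness and continuity are left out, so that linearity and stopping act
    directly on the limit. *)
Definition ito_approx (S : nat -> @simple_process disp Om R m) H I : Prop :=
  [/\ forall n, simple (S n),
   {ae P, forall w, forall e : R, 0 < e -> \forall n \near \oo,
     (energy (fun t w => (simple_val (S n) t w - H t w)%R) T w < e%:E)%E} &
   {ae P, forall w, forall e : R, 0 < e -> \forall n \near \oo, forall t, 0 <= t <= T ->
     `|simple_integral B (S n) t w - I t w| < e}].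

Definition ito_limit H I := exists S, ito_approx S H I.

Let predictable_simpleB S H : simple S -> predictable_mx T Ft H ->
  predictable_mx T Ft (fun t w => simple_val S t w - H t w).
Proof. by move=> sS pH; apply: predictable_mxB => //; exact: simple_val_predictable. Qed.

(** The tail bound for simple integrands at level [4 d]: since [|S|^2 <= 2 |H|^2 + 2 |S - H|^2], the
    energy of [S n] is eventually at most [4 d] wherever that of [H] is at most [d]. Only the energy
    along the path enters, and this later gives locality. *)
Lemma ito_limit_tail H I (e d : R) : predictable_mx T Ft H -> ito_limit H I -> 0 < e -> 0 < d ->
  exists E : set Om, [/\ measurable E, (P E <= (16 * d / e ^+ 2)%:E)%E &
    {ae P, forall w, forall t, 0 <= t <= T -> e < `|I t w| -> (energy H t w <= d%:E)%E -> E w}].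
Proof.
move=> pH [S [sS SH SI]] e0 d0; have d40 : 0 < 4 * d by rewrite mulr_gt0.
have /choice[E hE] n := simple_integral_tail P_complete B_brownian T_gt0 (sS n) e0 d40.
have [| |F [mF PF hF]] := @measure_liminf_le _ _ _ P E (16 * d / e ^+ 2)%:E.
- by move=> n; have [] := hE n.
- move=> n; have [_ + _] := hE n; move=> /le_trans; apply; rewrite lee_fin.
  by rewrite mulrA -natrM.
exists F; split => //.
have /ae_foralln hE' : forall n, {ae P, forall w, forall t, 0 <= t <= T ->
   e < `|simple_integral B (S n) t w| -> qvar (simple_val (S n)) t w <= 4 * d -> E n w}.
  by move=> n; have [] := hE n.
near=> w => t tT eI ed; have hSH : forall e : R, 0 < e -> \forall n \near \oo,
     (energy (fun t w => (simple_val (S n) t w - H t w)%R) T w < e%:E)%E by near: w.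
have hSI : forall e : R, 0 < e -> \forall n \near \oo, forall t, 0 <= t <= T ->
     `|simple_integral B (S n) t w - I t w| < e by near: w.
have hEw : forall n t, 0 <= t <= T ->
   e < `|simple_integral B (S n) t w| -> qvar (simple_val (S n)) t w <= 4 * d -> E n w by near: w.
have Ie : 0 < `|I t w| - e by rewrite subr_gt0.
apply: hF; apply: filterS2 (hSH d d0) (hSI _ Ie) => n h1 h2; apply: (hEw n t tT).
  have := h2 t tT; have := ler_distD 0 (simple_integral B (S n) t w) (I t w).
  have := lerB_dist (I t w) (simple_integral B (S n) t w); rewrite distrC; lra.
have /andP[t0 tT'] := tT; have pD := predictable_simpleB (sS n) pH.
rewrite -lee_fin -(simple_energyE T_gt0 w (sS n) tT).
have -> : simple_val (S n) = (fun t w => H t w + (simple_val (S n) t w - H t w)).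
  by apply/funext => u; apply/funext => w'; rewrite addrC subrK.
apply: (le_trans (energyD_le T_gt0 w pH pD tT')).
have h3 : (energy (fun t w => (simple_val (S n) t w - H t w)%R) t w <= d%:E)%E.
  apply: le_trans (ltW h1); apply: (energy_le T_gt0) pD _ _ _ => //.
apply: (@le_trans _ _ (2%:E * d%:E + 2%:E * d%:E)%E).
  by apply: leeD; apply: lee_wpmul2l.
by rewrite -!EFinM -EFinD lee_fin; lra.
Unshelve. all: by end_near. Qed.

(** The tail bound with [e = 2^-n] and [d = 8^-n] is [16 / 2^n], which is summable, so
    Borel-Cantelli applies. *)
Lemma ito_limit_small (U : nat -> R -> Om -> 'cV[R]_m) (I : nat -> R -> Om -> R) :
  (forall n, predictable_mx T Ft (U n)) -> (forall n, ito_limit (U n) (I n)) ->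
  {ae P, forall w, \forall n \near \oo, (energy (U n) T w <= ((8 ^+ n)^-1)%:E)%E} ->
  {ae P, forall w, \forall n \near \oo, forall t, 0 <= t <= T -> `|I n t w| <= (2 ^+ n)^-1}.
Proof.
move=> pU UI Usmall.
have p2 n : 0 < (2 ^+ n)^-1 :> R by rewrite invr_gt0 exprn_gt0.
have p8 n : 0 < (8 ^+ n)^-1 :> R by rewrite invr_gt0 exprn_gt0.
have /choice[E hE] n := ito_limit_tail (pU n) (UI n) (p2 n) (p8 n).
have /ae_foralln hE' : forall n, {ae P, forall w, forall t, 0 <= t <= T ->
   (2 ^+ n)^-1 < `|I n t w| -> (energy (U n) t w <= ((8 ^+ n)^-1)%:E)%E -> E n w}.
  by move=> n; have [] := hE n.
have BC : {ae P, forall w, \forall n \near \oo, ~ E n w}.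
  apply: (@borel_cantelli_geometric _ _ _ P E 16) => // n; first by have [] := hE n.
  have [_ + _] := hE n; move=> /le_trans; apply; rewrite lee_fin.
  rewrite -mulrA ler_pM2l// exprVn invrK.
  have -> : (8 : R) = 2 * 2 * 2 by rewrite -!natrM.
  rewrite !exprMn le_eqVlt; apply/orP; left; apply/eqP; field.
  by rewrite expf_neq0.
near=> w.
have hs : \forall n \near \oo, (energy (U n) T w <= ((8 ^+ n)^-1)%:E)%E by near: w.
have hB : \forall n \near \oo, ~ E n w by near: w.
have hEw : forall n t, 0 <= t <= T ->
   (2 ^+ n)^-1 < `|I n t w| -> (energy (U n) t w <= ((8 ^+ n)^-1)%:E)%E -> E n w by near: w.
apply: filterS2 hs hB => n h1 h2 t tT; rewrite leNgt; apply/negP => h3; apply: h2.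
apply: (hEw n t tT h3); apply: le_trans h1; have /andP[t0 tT'] := tT.
by apply: (energy_le T_gt0) (pU n) _ _ _.
Unshelve. all: by end_near. Qed.

Lemma ito_limit_simple S : simple S -> ito_limit (simple_val S) (simple_integral B S).
Proof.
move=> sS; exists (fun=> S); split => //.
  apply: aeW => w e e0; apply: nearW => n; rewrite /energy (eq_integral (cst 0%E)).
    by rewrite integral0 lte_fin.
  by move=> t _; rewrite subrr sqr_enorm dot0l.
by apply: aeW => w e e0; apply: nearW => n t _; rewrite subrr normr0.
Qed.

Let delta n : R := (8 ^+ n.+1)^-1.

(** Consecutive differences have energy at most [2 / 8^(n+2) + 2 / 8^(n+1) <= 8^-n], so the
    integrals form a Cauchy sequence, uniformly in time, at the rate [2^-n]. *)
Lemma ito_of_fast_approx H (S : nat -> @simple_process disp Om R m) : predictable_mx T Ft H ->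
  (forall n, simple (S n)) ->
  (forall n, P [set w | (((8 ^+ n.+1)^-1)%:E <= energy (fun t w => (simple_val (S n) t w - H t w)%R) T w)%E]
     <= ((8 ^+ n.+1)^-1)%:E)%E ->
  exists I, [/\ adapted T Ft I, {ae P, forall w, path_continuous T (I ^~ w)} & ito_approx S H I].
Proof.
move=> pH sS PS; pose J n := simple_integral B (S n).
have d0 n : 0 < delta n by rewrite invr_gt0 exprn_gt0.
have le8 n : (8 ^+ n.+1)^-1 <= (2 ^+ n)^-1 :> R.
  rewrite lef_pV2 ?posrE ?exprn_gt0// (@le_trans _ _ (2 ^+ n.+1))//.
    by rewrite ler_eXn2l// ltr1n.
  by apply: lerXn2r; rewrite ?nnegrE// ler_nat.
have BC : {ae P, forall w, \forall n \near \oo,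
    (energy (fun t w => (simple_val (S n) t w - H t w)%R) T w < (delta n)%:E)%E}.
  have := @borel_cantelli_geometric _ _ _ P _ 1
    (fun n => measurable_energy_level P_complete B_brownian T_gt0 (delta n) (predictable_simpleB (sS n) pH)) ler01.
  move=> /(_ _)/wrap[].
    by move=> n; apply: (le_trans (PS n)); rewrite lee_fin mul1r.
  apply: filterS => w; apply: filterS => n /negP; by rewrite -ltNge.
pose U n := simple_add (S n.+1) (simple_scale (-1) (S n)).
have sU n : simple (U n) by apply: is_simple_add => //; exact: is_simple_scale.
have Usmall : {ae P, forall w, \forall n \near \oo, (energy (simple_val (U n)) T w <= ((8 ^+ n)^-1)%:E)%E}.
  apply: filterS BC => w [N _ h]; exists N => // n /= Nn.
  have h1 := h n Nn; have h2 := h n.+1 (leqW Nn).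
  have -> : simple_val (U n) = (fun t w => (simple_val (S n.+1) t w - H t w) +
     (-1) *: (simple_val (S n) t w - H t w)).
    apply/funext => t; apply/funext => w'; rewrite simple_val_add simple_val_scale.
    by rewrite !scaleN1r opprB addrA subrK.
  have p1 := predictable_simpleB (sS n) pH; have p2 := predictable_simpleB (sS n.+1) pH.
  apply: (le_trans (energyD_le T_gt0 w p2 (predictable_mxZ T_gt0 (predictable_cst T_gt0 (-1)) p1) (lexx T))).
  rewrite (energyZ T_gt0 (-1) w p1 (lexx T)) sqrrN expr1n mul1e.
  apply: (@le_trans _ _ (2%:E * (delta n.+1)%:E + 2%:E * (delta n)%:E)%E).
    by apply: leeD; apply: lee_wpmul2l => //; exact: ltW.
  rewrite -!EFinM -EFinD lee_fin /delta !exprS !invfM; have := exprn_gt0 n (ltr0n R 8); rewrite -invr_gt0.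
  by set x := (8 ^+ n)^-1; lra.
have := ito_limit_small (fun n => simple_val_predictable T_gt0 (sU n))
   (fun n => ito_limit_simple (sU n)) Usmall.
pose Good w := exists N, forall n, (N <= n)%N -> forall t, 0 <= t <= T -> `|J n.+1 t w - J n t w| <= (2 ^+ n)^-1.
move=> h; have aeG : {ae P, forall w, Good w}.
  apply: filterS h => w [N _ h]; exists N => n Nn t tT; have := h n Nn t tT.
  by rewrite simple_integral_add simple_integral_scale mulN1r.
have /choice[l hl] : forall z : R * Om, exists l : R, Good z.2 -> 0 <= z.1 <= T -> J n z.1 z.2 @[n --> \oo] --> l.
  move=> [t w]; have [[N g]|ng] := pselect (Good w); last by exists 0.
  have [tT|tT] := pselect (0 <= t <= T); last by exists 0.
  by have [l hl _] := @geometric_cauchy R (fun n => J n t w) N (fun n Nn => g n Nn t tT); exists l.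
have lunif w e : Good w -> 0 < e -> \forall n \near \oo, forall t, 0 <= t <= T -> `|J n t w - l (t, w)| < e.
  move=> [N g] e0.
  have : (2 * 2^-1 ^+ n : R)%R @[n --> \oo] --> (2 * 0 : R)%R.
    by apply: cvgM; [exact: cvg_cst|apply: cvg_expr; rewrite ger0_norm// invf_lt1// ltr1n].
  rewrite mulr0 => /cvgrPdist_lt/(_ _ e0); apply: filterS2 (nbhs_infty_ge N) => n Nn.
  rewrite sub0r normrN ger0_norm ?mulr_ge0 ?exprn_ge0// exprVn => h2 t tT.
  apply: le_lt_trans h2.
  have [l' hl' hb] := @geometric_cauchy R (fun n => J n t w) N (fun n Nn => g n Nn t tT).
  have -> : l (t, w) = l'.
    by apply: cvg_unique hl' => //; apply: (hl (t, w)) => //; exists N.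
  exact: hb.
(* The value 0 off the good set does not spoil adaptedness: the good set has full measure, hence
   belongs to the filtration at every time. *)
pose I t w := if pselect (Good w) then l (t, w) else 0.
have IE t w : Good w -> I t w = l (t, w) by rewrite /I; case: pselect.
exists I; split.
- move=> t tT; apply/measurable_wrtP.
  apply: (@measurable_fun_cvg _ (OmF P B t) R setT (fun n w => if pselect (Good w) then J n t w else 0)).
    move=> n; apply: (@ae_eq_Ft_measurable _ _ _ _ _ _ _ _ _ (J n t)).
      by apply: filterS aeG => w; case: pselect.
    by apply/measurable_wrtP; exact: simple_integral_adapted.
  move=> w _; rewrite /I; case: pselect => g; last exact: cvg_cst.
  exact: (hl (t, w)).
- have /ae_foralln hc : forall n, {ae P, forall w, path_continuous T (J n ^~ w)}.
    by move=> n; exact: (simple_integral_continuous B_brownian).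
  apply: filterS2 aeG hc => w g cJ.
  apply: (path_continuous_uniform_limit cJ) => e e0; apply: filterS (lunif w e g e0) => n h2 t tT.
  by rewrite IE//; exact: h2.
- split => //.
    apply: filterS BC => w h2 e e0; apply: filterS2 h2 _; last first.
      have : (2^-1 ^+ n : R)%R @[n --> \oo] --> (0 : R)%R.
        by apply: cvg_expr; rewrite ger0_norm// invf_lt1// ltr1n.
      by move=> /cvgrPdist_lt/(_ _ e0); exact.
    move=> n /= h3; rewrite sub0r normrN ger0_norm ?exprn_ge0// exprVn => h4.
    by apply: (lt_trans h3); rewrite lte_fin; apply: le_lt_trans h4; exact: le8.
  apply: filterS aeG => w g e e0; apply: filterS (lunif w e g e0) => n h2 t tT.
  by rewrite IE//; exact: h2.
Qed.

Lemma ito_limitD H G I J : predictable_mx T Ft H -> predictable_mx T Ft G ->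
  ito_limit H I -> ito_limit G J ->
  ito_limit (fun t w => H t w + G t w) (fun t w => I t w + J t w).
Proof.
move=> pH pG [S [sS SH SI]] [S' [sS' SG SJ]].
exists (fun n => simple_add (S n) (S' n)); split; first by move=> n; exact: is_simple_add.
  apply: filterS2 SH SG => w h1 h2 e e0; have e4 : 0 < e / 4 by rewrite divr_gt0.
  apply: filterS2 (h1 _ e4) (h2 _ e4) => n h3 h4.
  have -> : (fun t w => simple_val (simple_add (S n) (S' n)) t w - (H t w + G t w)) =
     (fun t w => (simple_val (S n) t w - H t w) + (simple_val (S' n) t w - G t w)).
    by apply/funext => t; apply/funext => w'; rewrite simple_val_add opprD addrACA.
  have p1 := predictable_simpleB (sS n) pH; have p2 := predictable_simpleB (sS' n) pG.
  apply: (le_lt_trans (energyD_le T_gt0 w p1 p2 (lexx T))).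
  move: h3 h4; move: (energy_ge0 (fun t w => simple_val (S n) t w - H t w) T w).
  move: (energy_ge0 (fun t w => simple_val (S' n) t w - G t w) T w).
  case: (energy _ _ _) => [a| |]//; case: (energy _ _ _) => [b| |]//.
  by rewrite -!EFinM -EFinD !lte_fin; lra.
apply: filterS2 SI SJ => w h1 h2 e e0; have e2 : 0 < e / 2 by rewrite divr_gt0.
apply: filterS2 (h1 _ e2) (h2 _ e2) => n h3 h4 t tT.
have := h3 t tT; have := h4 t tT; rewrite simple_integral_add.
by rewrite !ltr_norml => /andP[? ?] /andP[? ?]; apply/andP; split; lra.
Qed.

Lemma ito_limitZ a H I : predictable_mx T Ft H -> ito_limit H I ->
  ito_limit (fun t w => a *: H t w) (fun t w => a * I t w).
Proof.
move=> pH [S [sS SH SI]].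
exists (fun n => simple_scale a (S n)); split; first by move=> n; exact: is_simple_scale.
  apply: filterS SH => w h1 e e0.
  have a0 : 0 < a ^+ 2 + 1 by rewrite ltr_wpDl// sqr_ge0.
  have ea : 0 < e / (a ^+ 2 + 1) by rewrite divr_gt0.
  apply: filterS (h1 _ ea) => n.
  have -> : (fun t w => simple_val (simple_scale a (S n)) t w - a *: H t w) =
     (fun t w => a *: (simple_val (S n) t w - H t w)).
    by apply/funext => t; apply/funext => w'; rewrite simple_val_scale scalerBr.
  rewrite (energyZ T_gt0 a w (predictable_simpleB (sS n) pH) (lexx T)).
  move: (energy_ge0 (fun t w => simple_val (S n) t w - H t w) T w).
  case: (energy _ _ _) => [r| |]//; rewrite -EFinM !lte_fin lee_fin ltr_pdivlMr// => r0.
  by apply: le_lt_trans; rewrite mulrDr mulr1 mulrC lerDl.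
apply: filterS SI => w h1 e e0; have a0 : 0 < `|a| + 1 by rewrite ltr_wpDl.
have ea : 0 < e / (`|a| + 1) by rewrite divr_gt0.
apply: filterS (h1 _ ea) => n h t tT; have := h t tT.
rewrite simple_integral_scale -mulrBr normrM ltr_pdivlMr//.
by apply: le_lt_trans; rewrite mulrDr mulr1 mulrC lerDl.
Qed.

Lemma ito_limitB H G I J : predictable_mx T Ft H -> predictable_mx T Ft G ->
  ito_limit H I -> ito_limit G J ->
  ito_limit (fun t w => H t w - G t w) (fun t w => I t w - J t w).
Proof.
move=> pH pG HI GJ; have pG' := predictable_mxZ T_gt0 (predictable_cst T_gt0 (-1)) pG.
have -> : (fun t w => H t w - G t w) = (fun t w => H t w + -1 *: G t w).
  by apply/funext => t; apply/funext => w; rewrite scaleN1r.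
have -> : (fun t w => I t w - J t w) = (fun t w => I t w + -1 * J t w).
  by apply/funext => t; apply/funext => w; rewrite mulN1r.
exact: ito_limitD pH pG' HI (ito_limitZ (-1) pG GJ).
Qed.

(** The tail bound with [d = 1 / (j + 1)] for all [j]: the event of zero energy and nonzero integral
    lies in sets of arbitrarily small measure. The time may depend on the path, as stopping
    requires. *)
Lemma ito_limit_local H I : predictable_mx T Ft H -> ito_limit H I ->
  {ae P, forall w, forall t, 0 <= t <= T -> energy H t w = 0%E -> I t w = 0}.
Proof.
move=> pH HI.
have h k : {ae P, forall w, forall t, 0 <= t <= T -> energy H t w = 0%E -> `|I t w| <= k.+1%:R^-1}.
  have k0 : 0 < k.+1%:R^-1 :> R by [].
  have j0 j : 0 < j.+1%:R^-1 :> R by [].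
  have /choice[E hE] j := ito_limit_tail pH HI k0 (j0 j).
  have /ae_foralln hE' : forall j, {ae P, forall w, forall t, 0 <= t <= T ->
     k.+1%:R^-1 < `|I t w| -> (energy H t w <= (j.+1%:R^-1)%:E)%E -> E j w}.
    by move=> j; have [] := hE j.
  have aeE : {ae P, forall w, ~ (\bigcap_j E j) w}.
    exists (\bigcap_j E j); split.
    - by apply: bigcap_measurableType => j _; have [] := hE j.
    - apply/le_anti; rewrite measure_ge0 andbT; apply/lee_addgt0Pr => e e0; rewrite add0e.
      have : (16 / (k.+1%:R^-1) ^+ 2 * j.+1%:R^-1 : R) @[j --> \oo] --> (16 / (k.+1%:R^-1) ^+ 2 * 0 : R).
        by apply: cvgM; [exact: cvg_cst|exact: cvg_harmonic].
      rewrite mulr0 => /cvgrPdist_lt/(_ _ e0)[j _ /(_ j (leqnn j))].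
      rewrite sub0r normrN => /ltW he; apply: (@le_trans _ _ (P (E j))).
        apply: le_measure; rewrite ?inE//; last by move=> w; exact.
          by apply: bigcap_measurableType => i _; have [] := hE i.
        by have [] := hE j.
      have [_ + _] := hE j; move=> /le_trans; apply; rewrite lee_fin; apply: le_trans he.
      by rewrite -mulrA [X in 16 * X]mulrC mulrA ler_norm.
    - by move=> w /= /contrapT.
  apply: filterS2 hE' aeE => w h1 h2 t tT Ht0; rewrite leNgt; apply/negP => kI; apply: h2 => j _.
  by apply: (h1 j t tT kI); rewrite Ht0 lee_fin.
have /ae_foralln := h; apply: filterS => w hw t tT Ht0.
apply/eqP; rewrite -normr_eq0; apply/negPn/negP => I0.
have Ipos : 0 < `|I t w| by rewrite lt_neqAle eq_sym I0 normr_ge0.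
have [k _ /(_ k (leqnn k))] := near_infty_natSinv_lt (PosNum Ipos).
by move=> /=; rewrite ltNge hw.
Qed.

(** Convergence in probability gives almost sure convergence along a subsequence. Conversely the
    suprema over time are measurable, by continuity of paths and completeness, so almost sure
    convergence gives convergence in probability. *)
Lemma is_ito_integralP H I : predictable_mx T Ft H -> is_ito_integral P T B H I <->
  [/\ adapted T Ft I, {ae P, forall w, path_continuous T (I ^~ w)} & ito_limit H I].
Proof.
move=> pH.
have T0T : 0 <= T <= T by rewrite lexx ltW.
have cE : ae_continuous P T I <-> {ae P, forall w, path_continuous T (I ^~ w)}.
  by split; apply: filterS => w /path_continuousP.
have mJI S t : adapted T Ft I -> simple S -> 0 <= t <= T ->
    measurable_fun setT (fun w => simple_integral B S t w - I t w).
  move=> aI sS tT; have /andP[_ tT'] := tT.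
  apply: measurable_funB.
    by apply: (measurable_wrt_Om P_complete mB tT' (simple_integral_adapted sS tT)).
  by apply: (measurable_wrt_Om P_complete mB tT' (aI t tT)).
have msup (S : nat -> simple_process) : adapted T Ft I -> {ae P, forall w, path_continuous T (I ^~ w)} ->
    (forall n, simple (S n)) -> forall n (e : R), measurable [set w | (e%:E <=
      ereal_sup [set `|simple_integral B (S n) t w - I t w|%:E | t in `[0%R, T]])%E].
  move=> aI cI sS n e; apply: (@measurable_sup_paths _ _ _ _ P_complete _ T_gt0
    (fun t w => simple_integral B (S n) t w - I t w)); first by move=> t tT; exact: mJI.
  apply: filterS2 (simple_integral_continuous B_brownian (sS n)) cI => w h1 h2.
  exact: path_continuousB.
have men (S : nat -> simple_process) : (forall n, simple (S n)) -> forall n (e : R),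
    measurable [set w | (e%:E <= energy (fun t w => simple_val (S n) t w - H t w)%R T w)%E].
  by move=> sS n e; apply: (measurable_energy_level P_complete B_brownian T_gt0); exact: predictable_simpleB.
split=> [[aI /cE cI [S [sS SH SI]]]|[aI cI [S [sS SH SI]]]].
  split => //; have [g [h1 h2]] := cvg0_ae_subseq (men S sS) (msup S aI cI sS) SH SI.
  exists (S \o g); split => //; first by move=> n; exact: sS.
  apply: filterS h2 => w h2 e e0; apply: filterS (h2 e e0) => n h3 t tT.
  rewrite -lte_fin; apply: le_lt_trans h3; apply: ereal_sup_ubound; exists t => //.
split => //; first exact/cE.
exists S; split => //; first by apply: ae_small_cvg0; [exact: men|exact: SH].
apply: ae_small_cvg0; first exact: msup.
apply: filterS SI => w h e e0; have e2 : 0 < e / 2 by rewrite divr_gt0.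
apply: filterS (h _ e2) => n h2; apply: (@le_lt_trans _ _ (e / 2)%:E).
  apply: ge_ereal_sup => _ [t /= + <-]; rewrite in_itv/= => tT; rewrite lee_fin ltW//.
  exact: h2.
by rewrite lte_fin ltr_pdivrMr// ltr_pMr// ltr1n.
Qed.

(** [ito] is chosen by [xget], so it has these properties only once some Ito integral is known to
    exist; density with the rate [8^-(n+1)] provides one. *)
Lemma itoP H : predictable_mx T Ft H -> square_integrable P T H ->
  [/\ adapted T Ft (ito P T B H), {ae P, forall w, path_continuous T (ito P T B H ^~ w)} &
      ito_limit H (ito P T B H)].
Proof.
move=> pH sH; apply/is_ito_integralP => //; rewrite /ito.
apply: (@xgetPex _ (fun _ _ => 0) (is_ito_integral P T B H)).
have /choice[S hS] n : exists S, simple S /\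
  (P [set w | (((8 ^+ n.+1)^-1)%:E <= energy (fun t w => (simple_val S t w - H t w)%R) T w)%E] <= ((8 ^+ n.+1)^-1)%:E)%E.
  have e0 : 0 < (8 ^+ n.+1)^-1 :> R by rewrite invr_gt0 exprn_gt0.
  by have [S sS hS] := simple_dense P_complete B_brownian T_gt0 pH sH e0; exists S.
have [I [aI cI SI]] := ito_of_fast_approx pH (fun n => proj1 (hS n)) (fun n => proj2 (hS n)).
by exists I; apply/is_ito_integralP => //; split => //; exists S.
Qed.

Lemma ito_eq_local H G I J : predictable_mx T Ft H -> predictable_mx T Ft G ->
  ito_limit H I -> ito_limit G J ->
  {ae P, forall w, forall t, 0 <= t <= T -> energy (fun t w => H t w - G t w) t w = 0%E ->
    I t w = J t w}.
Proof.
move=> pH pG HI GJ.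
have := ito_limit_local (predictable_mxB T_gt0 pH pG) (ito_limitB pH pG HI GJ).
by apply: filterS => w h t tT e0; apply/eqP; rewrite -subr_eq0; apply/eqP; exact: h.
Qed.

Lemma ito_limit_unique H I J : predictable_mx T Ft H -> ito_limit H I -> ito_limit H J ->
  {ae P, forall w, forall t, 0 <= t <= T -> I t w = J t w}.
Proof.
move=> pH HI HJ; apply: filterS (ito_eq_local pH pH HI HJ) => w h t tT; apply: h => //.
rewrite /energy (eq_integral (cst 0%E)) ?integral0// => u _.
by rewrite subrr sqr_enorm dot0l.
Qed.

(** For a bounded integrand the approximants can share a bound. Their limit is a priori another
    version of the integral, identified with [ito] by uniqueness. *)
Lemma ito_bounded_approx H (c : R) : predictable_mx T Ft H -> (forall t w i, `|H t w i 0| <= c) ->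
  square_integrable P T H ->
  exists S, ito_approx S H (ito P T B H) /\
    exists2 K : R, 0 <= K & forall n t w, enorm (simple_val (S n) t w) ^+ 2 <= K.
Proof.
move=> pH bH sH.
have [K K0 hK] := simple_dense_bounded P_complete B_brownian T_gt0 pH bH.
have /choice[S hS] n : exists S, [/\ simple S, forall t w, enorm (simple_val S t w) ^+ 2 <= K &
  (P [set w | (((8 ^+ n.+1)^-1)%:E <= energy (fun t w => (simple_val S t w - H t w)%R) T w)%E] <= ((8 ^+ n.+1)^-1)%:E)%E].
  by apply: hK; rewrite invr_gt0 exprn_gt0.
have sS n : simple (S n) by have [] := hS n.
have [|I [aI cI [_ SH SI]]] := ito_of_fast_approx pH sS _; first by move=> n; have [] := hS n.
have [_ _ HI] := itoP pH sH.
have HI' : ito_limit H I by exists S; split.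
have eqI := ito_limit_unique pH HI' HI.
exists S; split; last by exists K => // n; have [] := hS n.
split => //; apply: filterS2 SI eqI => w h1 h2 e e0; apply: filterS (h1 e e0) => n h3 t tT.
by rewrite -h2//; exact: h3.
Qed.

(** The approximants are stopped at the same deterministic time, which makes neither error
    larger. *)
Lemma ito_limit_stop s H I : 0 <= s <= T -> predictable_mx T Ft H -> ito_limit H I ->
  ito_limit (fun t w => if t <= s then H t w else 0) (fun t w => I (Num.min s t) w).
Proof.
move=> sT pH [S [sS SH SI]]; have /andP[s0 sT'] := sT.
exists (fun n => simple_stop s (S n)); split; first by move=> n; exact: is_simple_stop.
  apply: filterS SH => w h e e0; apply: filterS (h e e0) => n; apply: le_lt_trans.
  have pD := predictable_simpleB (sS n) pH.
  have pD' : predictable_mx T Ft (fun t w => simple_val (simple_stop s (S n)) t w - if t <= s then H t w else 0).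
    have -> : (fun t w => simple_val (simple_stop s (S n)) t w - if t <= s then H t w else 0) =
       (fun t w => if t <= s then simple_val (S n) t w - H t w else 0).
      by apply/funext => t; apply/funext => w'; rewrite simple_val_stop; case: ifP; rewrite ?subr0.
    move=> i j; have -> : (fun t w => (if t <= s then simple_val (S n) t w - H t w else 0) i j) =
       (fun t w => if t <= s then (simple_val (S n) t w - H t w) i j else 0).
      by apply/funext => t; apply/funext => w'; case: ifP; rewrite ?mxE.
    apply: predictable_ite; [exact: T_gt0| |exact: pD|exact: predictable_cst].
    apply/predictable_setsE => //.
    have -> : `[0, T] `*` setT `&` [set z : R * Om | z.1 <= s] = [set 0] `*` setT `|` `]0, s] `*` setT.
      apply/seteqP; split => [[t w']|[t w']] /=.
        rewrite in_itv/= => -[[/andP[t0 tT] _] ts].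
        move: t0; rewrite le_eqVlt => /predU1P[<-|t0]; [by left|right].
        by rewrite in_itv/= t0 ts.
      move=> [[-> _]|[+ _]]; first by rewrite in_itv/= lexx ltW.
      by rewrite in_itv/= => /andP[t0 ts]; rewrite in_itv/= ltW// (le_trans ts).
    have [_ _ PU] : sigma_algebra (`[0, T] `*` setT) (predictable_sets T Ft) by exact: smallest_sigma_algebra.
    rewrite -bigcup2E; apply: PU => -[|[|k]] /=.
    - by apply: sub_sigma_algebra; right; exists setT => //; exact: Ft_setT.
    - move: s0; rewrite le_eqVlt => /predU1P[<-|s0].
        rewrite set_itvoc0 set0X.
        by have [] : sigma_algebra (`[0, T] `*` setT) (predictable_sets T Ft) by exact: smallest_sigma_algebra.
      apply: sub_sigma_algebra; left; exists 0, s, setT; split => //; exact: Ft_setT.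
    - by have [] : sigma_algebra (`[0, T] `*` setT) (predictable_sets T Ft) by exact: smallest_sigma_algebra.
  apply: ge0_le_integral => //.
  - by move=> t _; rewrite lee_fin sqr_ge0.
  - exact: (measurable_sqr_enorm T_gt0 w pD').
  - exact: (measurable_sqr_enorm T_gt0 w pD).
  - move=> t _; rewrite lee_fin simple_val_stop; case: ifP => // _.
    by rewrite subrr sqr_enorm dot0l sqr_ge0.
apply: filterS SI => w h e e0; apply: filterS (h e e0) => n h2 t /andP[t0 tT].
rewrite simple_integral_stop; last by move=> k; have [] := sS n k.
by apply: h2; rewrite le_min s0 t0 ge_min sT'.
Qed.

(** The hypothesis gives no rate, so the rate [8^-n] is bought by a subsequence; [n <= g n] keeps
    the convergence of the energies along it. *)
Lemma ito_cvg_subseq (H : nat -> R -> Om -> 'cV[R]_m) G (I : nat -> R -> Om -> R) J :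
  (forall n, predictable_mx T Ft (H n)) -> predictable_mx T Ft G ->
  (forall n, ito_limit (H n) (I n)) -> ito_limit G J ->
  {ae P, forall w, forall e : R, 0 < e ->
     \forall n \near \oo, (energy (fun t w => (H n t w - G t w)%R) T w < e%:E)%E} ->
  exists2 g : nat -> nat, (forall n, (n <= g n)%N) &
  {ae P, forall w, forall e : R, 0 < e -> \forall n \near \oo,
     forall t, 0 <= t <= T -> `|I (g n) t w - J t w| < e}.
Proof.
move=> pH pG HI GJ HG.
have pD n : predictable_mx T Ft (fun t w => H n t w - G t w) by exact: predictable_mxB.
have men n e := measurable_energy_level P_complete B_brownian T_gt0 e (pD n).
have cv := ae_small_cvg0 men HG.
have d0 n : 0 < (8 ^+ n)^-1 :> R by rewrite invr_gt0 exprn_gt0.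
have P0 (A : set Om) : (0 <= P A)%E by [].
have /choice[g hg] n : exists k, (n <= k)%N /\
    (P [set w | (((8 ^+ n)^-1)%:E <= energy (fun t w => (H k t w - G t w)%R) T w)%E] <= ((8 ^+ n)^-1)%:E)%E.
  have := cv _ (d0 n); move=> /cvge0P/(_ _ (d0 n))-/(_ (fun=> P0 _))[N _ hN].
  by exists (maxn n N); rewrite leq_maxl; split => //; apply/ltW/hN; rewrite /= leq_maxr.
exists g; first by move=> n; have [] := hg n.
have BC : {ae P, forall w, \forall n \near \oo,
    (energy (fun t w => (H (g n) t w - G t w)%R) T w <= ((8 ^+ n)^-1)%:E)%E}.
  have := @borel_cantelli_geometric _ _ _ P _ 1 (fun n => men (g n) ((8 ^+ n)^-1)) ler01.
  move=> /(_ _)/wrap[].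
    move=> n; have [_ /le_trans] := hg n; apply; rewrite lee_fin mul1r.
    rewrite lef_pV2 ?posrE ?exprn_gt0//; apply: lerXn2r; rewrite ?nnegrE// ler_nat//.
  by apply: filterS => w; apply: filterS => n /negP; rewrite -ltNge => /ltW.
have := ito_limit_small (fun n => pD (g n)) (fun n => ito_limitB (pH (g n)) pG (HI (g n)) GJ) BC.
apply: filterS => w h e e0.
have : (2^-1 ^+ n : R)%R @[n --> \oo] --> (0 : R)%R.
  by apply: cvg_expr; rewrite ger0_norm// invf_lt1// ltr1n.
move=> /cvgrPdist_lt/(_ _ e0); apply: filterS2 h => n h2.
rewrite sub0r normrN ger0_norm ?exprn_ge0// exprVn => h3 t tT.
by apply: le_lt_trans h3; exact: h2.
Qed.

End ito_limits.

(** * Uniform integrability *)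

Section real_integrals.
Context {d} {X : measurableType d} {R : realType} (mu : {measure set X -> \bar R}) (D : set X).
Hypothesis mD : measurable D.
Implicit Types f g : X -> R.

Local Notation intg f := (mu.-integrable D (EFin \o f)).

Lemma intgD f g : intg f -> intg g -> intg (fun x => f x + g x).
Proof. by move=> If Ig; exact: (integrableD mD If Ig). Qed.

Lemma intgB f g : intg f -> intg g -> intg (fun x => f x - g x).
Proof. by move=> If Ig; exact: (integrableB mD If Ig). Qed.

Lemma intgZ a f : intg f -> intg (fun x => a * f x).
Proof. by move=> If; exact: (integrableZl mD a If). Qed.

Lemma intg_measurable f : intg f -> measurable_fun D f.
Proof. by move=> /integrableP[/measurable_EFinP]. Qed.

Lemma intg_le f g : measurable_fun D f -> {ae mu, forall x, D x -> `|f x| <= g x} ->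
  intg g -> intg f.
Proof.
move=> mf fg Ig; have /integrableP[mg fing] := Ig.
apply/integrableP; split; first exact/measurable_EFinP.
apply: le_lt_trans fing; apply: ae_ge0_le_integral => //.
- by apply: measurableT_comp => //; exact/measurable_EFinP.
- exact: measurableT_comp.
- by apply: filterS fg => x h Dx; rewrite /= lee_fin (le_trans (h Dx)) ?ler_norm.
Qed.

Lemma intg_ge0 f (c : R) : measurable_fun D f -> (forall x, D x -> 0 <= f x) ->
  (\int[mu]_(x in D) (f x)%:E <= c%:E)%E -> intg f /\ \int[mu]_(x in D) f x <= c.
Proof.
move=> mf f0 fc.
have fin : (0 <= \int[mu]_(x in D) (f x)%:E)%E by apply: integral_ge0 => x Dx; rewrite lee_fin f0.
split.
  apply/integrableP; split; first exact/measurable_EFinP.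
  apply: le_lt_trans (ltry c); apply: le_trans fc.
  rewrite le_eqVlt; apply/orP; left; apply/eqP; apply: eq_integral => x /set_mem Dx.
  by rewrite /= ger0_norm// f0.
rewrite /Rintegral -lee_fin fineK// ge0_fin_numE//.
exact: le_lt_trans fc (ltry c).
Qed.

Lemma intg_fin_num f : intg f -> (\int[mu]_(x in D) (f x)%:E = (\int[mu]_(x in D) f x)%:E)%E.
Proof. by move=> If; rewrite /Rintegral fineK//; exact: (integrable_fin_num mD If). Qed.

Lemma intg_ae_eq f g : measurable_fun D g -> {ae mu, forall x, D x -> f x = g x} -> intg f -> intg g.
Proof.
move=> mg fg If; apply: (intg_le mg (g := fun x => `|f x|)).
  by apply: filterS fg => x h Dx; rewrite h.
exact: (integrable_norm If).
Qed.

Lemma Rintegral_ae_eq f g : measurable_fun D f -> measurable_fun D g ->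
  {ae mu, forall x, D x -> f x = g x} -> \int[mu]_(x in D) f x = \int[mu]_(x in D) g x.
Proof.
move=> mf mg fg; congr fine; apply: ae_eq_integral => //; try exact/measurable_EFinP.
by apply: filterS fg => x h Dx; rewrite h.
Qed.

Lemma Rintegral_le_ae f g : intg f -> intg g -> {ae mu, forall x, D x -> f x <= g x} ->
  \int[mu]_(x in D) f x <= \int[mu]_(x in D) g x.
Proof.
move=> If Ig fg; have mf := intg_measurable If; have mg := intg_measurable Ig.
rewrite -subr_ge0 -RintegralB//.
rewrite (@Rintegral_ae_eq _ (fun x => Num.max (g x - f x) 0)).
- by apply: Rintegral_ge0 => x _; rewrite le_max lexx orbT.
- exact: measurable_funB.
- by apply: measurable_maxr => //; exact: measurable_funB.
- by apply: filterS fg => x h Dx; rewrite max_l// subr_ge0 h.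
Qed.

End real_integrals.

Section uniform_integrability.
Context {d} {X : measurableType d} {R : realType} (P : probability X R).

Lemma intg_cst (a : R) : P.-integrable setT (EFin \o (fun=> a)).
Proof. exact: finite_measure_integrable_cst. Qed.

Lemma Rintegral_cstP (a : R) : \int[P]_w a = a.
Proof. by rewrite Rintegral_cst//= [X in fine X]probability_setT mulr1. Qed.

(** Uniform integrability in the form needed: all but [e] of the mass stays under a level [a]. The
    truncations at [a] converge by dominated convergence, so the limit keeps at least [1 - e]. *)
Lemma unif_integrable_ge1 (f : nat -> X -> R) (g : X -> R) :
  (forall n, measurable_fun setT (f n)) -> measurable_fun setT g ->
  (forall n x, 0 <= f n x) -> (forall x, 0 <= g x) ->
  {ae P, forall x, f ^~ x @ \oo --> g x} ->
  (forall e : R, 0 < e -> exists2 a : R, 0 <= a & \forall n \near \oo,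
     ((1 - e)%R%:E <= \int[P]_x (Num.min (f n x) a)%:E)%E) ->
  (1 <= \int[P]_x (g x)%:E)%E.
Proof.
move=> mf mg f0 g0 fg ui; apply/lee_addgt0Pr => e e0.
have [a a0 ha] := ui e e0.
have min0 (h : X -> R) x : (forall x, 0 <= h x) -> 0 <= Num.min (h x) a.
  by move=> h0; rewrite le_min h0.
have mmin (h : X -> R) : measurable_fun setT h -> measurable_fun setT (fun x => (Num.min (h x) a)%:E : \bar R).
  by move=> mh; apply/measurable_EFinP; exact: measurable_minr.
have := @dominated_convergence _ _ _ P setT measurableT
   (fun n x => (Num.min (f n x) a)%:E) (fun x => (Num.min (g x) a)%:E) (EFin \o (fun=> a)).
move=> /(_ _ _ _ _ _)/wrap[].
- by move=> n; exact: mmin.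
- exact: mmin.
- apply: filterS fg => x fx _; apply: cvg_EFin; first exact: nearW.
  apply: (@continuous_cvg _ _ _ _ _ (f ^~ x) (fun y : R => Num.min y a) (g x)); last exact: fx.
  by apply: continuous_min; [exact: cvg_id|exact: cvg_cst].
- exact: intg_cst.
- apply: aeW => x n _; rewrite /= lee_fin ger0_norm ?ge_min ?lexx ?orbT//; exact: min0.
move=> [_ _ cv].
rewrite -leeBlDr//; apply: (@le_trans _ _ (\int[P]_x (Num.min (g x) a)%:E)%E).
  by rewrite -EFinB; apply: (cvge_ge _ cv).
apply: ge0_le_integral => //.
- by move=> x _; rewrite lee_fin min0.
- exact: mmin.
- exact/measurable_EFinP.
- by move=> x _; rewrite lee_fin ge_min lexx.
Qed.

(** Bounds the mass above the level [a] by the second moment over [a]; after division by [a] it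
    rests on [1 - y + y^2 >= 0]. *)
Lemma min_sqr_le (x a : R) : 0 < a -> 0 <= x -> x - x ^+ 2 / a <= Num.min x a.
Proof.
move=> a0 x0; rewrite le_min; apply/andP; split; first by rewrite gerBl divr_ge0 ?sqr_ge0// ltW.
pose y := x / a; have xE : x = a * y by rewrite /y mulrC divfK// gt_eqF.
have -> : x - x ^+ 2 / a = a * (y - y ^+ 2) by rewrite xE; field; rewrite gt_eqF.
have : 0 <= 1 - y + y ^+ 2 by have := sqr_ge0 (y - 1); have := sqr_ge0 y; nra.
by nra.
Qed.

Lemma L2_bounded_ge1 (f : nat -> X -> R) (g : X -> R) (c : R) :
  (forall n, measurable_fun setT (f n)) -> measurable_fun setT g ->
  (forall n x, 0 <= f n x) -> (forall x, 0 <= g x) ->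
  {ae P, forall x, f ^~ x @ \oo --> g x} ->
  (forall n, \int[P]_x (f n x)%:E = 1)%E ->
  (forall n, \int[P]_x (f n x ^+ 2)%:E <= c%:E)%E ->
  (1 <= \int[P]_x (g x)%:E)%E.
Proof.
move=> mf mg f0 g0 fg f1 f2; apply: (unif_integrable_ge1 mf mg f0 g0 fg) => e e0.
have c0 : 0 <= c.
  rewrite -lee_fin; apply: le_trans (f2 0%N); apply: integral_ge0 => x _.
  by rewrite lee_fin sqr_ge0.
(* At this level [c / a] is below [e]; the added 1 keeps [a] positive when [c = 0]. *)
pose a := (c + 1) / e; have a0 : 0 < a by rewrite divr_gt0// ltr_wpDl.
exists a; first exact: ltW.
apply: nearW => n.
have msq : measurable_fun setT (fun x => f n x ^+ 2) by exact: measurable_funX.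
have f1' : (\int[P]_x (f n x)%:E <= 1%:E)%E by rewrite f1.
have [If _] := @intg_ge0 _ _ _ P setT (f n) 1 (mf n) (fun x _ => f0 n x) f1'.
have [If2 Ef2] := @intg_ge0 _ _ _ P setT _ c msq (fun x _ => sqr_ge0 _) (f2 n).
have Imin : P.-integrable setT (EFin \o (fun x => Num.min (f n x) a)).
  apply: (intg_le measurableT _ _ If); first exact: measurable_minr.
  apply: aeW => x _; rewrite ger0_norm ?ge_min ?lexx// le_min f0 ltW//.
rewrite (intg_fin_num measurableT Imin) lee_fin.
have Isub := intgB measurableT If (intgZ measurableT a^-1 If2).
apply: (@le_trans _ _ (\int[P]_x (f n x - a^-1 * f n x ^+ 2))).
  rewrite RintegralB//; last exact: intgZ.
  rewrite RintegralZl//.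
  have -> : \int[P]_x f n x = 1 by rewrite /Rintegral f1.
  rewrite lerB// mulrC ler_pdivrMr// /a mulrC divfK ?gt_eqF//; lra.
apply: Rintegral_le_ae => //; apply: aeW => x _.
by rewrite mulrC; apply: min_sqr_le.
Qed.

End uniform_integrability.

Section energy_comparison.
Context {disp : measure_display} {Om : measurableType disp} {R : realType}.
Context {m : nat}.
Variables (P : probability Om R) (T : R) (B : R -> Om -> 'cV[R]_m).
Hypothesis T_gt0 : 0 < T.
Local Notation Ft := (augmented_filtration P B).
Local Notation leb := (@lebesgue_measure R).
Implicit Types (H G : R -> Om -> 'cV[R]_m).

Lemma energy_comb2 H (G K : R -> Om -> 'cV[R]_m) (a b : R) t w :
  predictable_mx T Ft H -> predictable_mx T Ft G -> predictable_mx T Ft K -> t <= T ->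
  0 <= a -> 0 <= b ->
  (forall u, 0 <= u <= t -> dot (H u w) (H u w) <= a * dot (G u w) (G u w) + b * dot (K u w) (K u w)) ->
  (energy H t w <= a%:E * energy G t w + b%:E * energy K t w)%E.
Proof.
move=> pH pG pK tT a0 b0 h; have sub : `[0, t] `<=` `[0, T].
  by move=> u /=; rewrite !in_itv/= => /andP[-> /le_trans->].
have mI : measurable (`[0, t]%classic : set R) by exact: measurable_itv.
rewrite /energy -!ge0_integralZl_EFin//; [|by move=> u _; rewrite lee_fin sqr_ge0|
  exact: (measurable_sqr_enorm T_gt0 w pK)|
  by move=> u _; rewrite lee_fin sqr_ge0|exact: (measurable_sqr_enorm T_gt0 w pG)].
rewrite -ge0_integralD//; last 4 first.
- by move=> u _; rewrite -EFinM lee_fin mulr_ge0// sqr_ge0.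
- by apply: measurable_funeM; exact: (measurable_sqr_enorm T_gt0 w pG).
- by move=> u _; rewrite -EFinM lee_fin mulr_ge0// sqr_ge0.
- by apply: measurable_funeM; exact: (measurable_sqr_enorm T_gt0 w pK).
apply: ge0_le_integral => //.
- by move=> u _; rewrite lee_fin sqr_ge0.
- exact: (measurable_sqr_enorm T_gt0 w pH).
- apply: emeasurable_funD; apply: measurable_funeM.
    exact: (measurable_sqr_enorm T_gt0 w pG).
  exact: (measurable_sqr_enorm T_gt0 w pK).
- by move=> u; rewrite /= in_itv/= => ut; rewrite -!EFinM -EFinD lee_fin !sqr_enorm h.
Qed.

Lemma energy_le_pointwise H G t w :
  predictable_mx T Ft H -> predictable_mx T Ft G -> t <= T ->
  (forall u, 0 <= u <= t -> dot (H u w) (H u w) <= dot (G u w) (G u w)) ->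
  (energy H t w <= energy G t w)%E.
Proof.
move=> pH pG tT h; have := @energy_comb2 H G G 1 0 t w pH pG pG tT ler01 (lexx 0).
rewrite mul1e mul0e adde0; apply => u ut; rewrite mul1r mul0r addr0; exact: h.
Qed.

Lemma energyE H t w : (energy H T w < +oo)%E -> predictable_mx T Ft H -> 0 <= t <= T ->
  energy H t w = (qvar H t w)%:E.
Proof.
move=> fin pH /andP[t0 tT]; rewrite /qvar fineK// ge0_fin_numE ?energy_ge0//.
apply: le_lt_trans fin; exact: (energy_le T_gt0 w pH).
Qed.

Lemma qvar_cvg (H : nat -> R -> Om -> 'cV[R]_m) G w :
  (forall n, predictable_mx T Ft (H n)) -> predictable_mx T Ft G ->
  (forall n, energy (H n) T w < +oo)%E -> (energy G T w < +oo)%E ->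
  (forall e : R, 0 < e -> \forall n \near \oo, (energy (fun t w => (H n t w - G t w)%R) T w < e%:E)%E) ->
  qvar (H n) T w @[n --> \oo] --> qvar G T w.
Proof.
move=> pH pG finH finG HG.
have T0T : 0 <= T <= T by rewrite lexx ltW.
have pD n : predictable_mx T Ft (fun t w => H n t w - G t w) by exact: predictable_mxB.
have key c n : 0 < c -> (energy (fun t w => (H n t w - G t w)%R) T w < +oo)%E ->
   qvar (H n) T w <= (1 + c) * qvar G T w + (1 + c^-1) * qvar (fun t w => H n t w - G t w) T w /\
   qvar G T w <= (1 + c) * qvar (H n) T w + (1 + c^-1) * qvar (fun t w => H n t w - G t w) T w.
  move=> c0 finD; have c1 : 0 <= 1 + c by rewrite addr_ge0// ltW.
  have c2 : 0 <= 1 + c^-1 by rewrite addr_ge0// invr_ge0 ltW.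
  split; rewrite -lee_fin EFinD !EFinM.
    rewrite -(energyE (finH n) (pH n) T0T) -(energyE finG pG T0T) -(energyE finD (pD n) T0T).
    by apply: energy_comb2 => // u _; exact: dot_sqr_add.
  rewrite -(energyE (finH n) (pH n) T0T) -(energyE finG pG T0T) -(energyE finD (pD n) T0T).
  apply: energy_comb2 => // u _; rewrite -[X in _ + _ * X](_ : dot (G u w - H n u w) (G u w - H n u w) = _).
    exact: dot_sqr_add.
  by rewrite -opprB dotNl dotNr opprK.
apply/cvgrPdist_lt => e e0; set x := qvar G T w.
have x0 : 0 <= x by exact: qvar_ge0.
(* [c x] is at most [e / 4], and the threshold [e / (4 k)] below, with [k = 1 + 1 / c], keeps the
   other error term under [e / 4]. *)
pose c := Num.min 1 (e / (4 * (x + 1))).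
have x1 : 0 < 4 * (x + 1) by rewrite mulr_gt0// ltr_wpDl.
have c0 : 0 < c by rewrite lt_min ltr01 divr_gt0.
have c1 : c <= 1 by rewrite ge_min lexx.
have cx : c * (4 * (x + 1)) <= e by rewrite -ler_pdivlMr// ge_min lexx orbT.
pose k := 1 + c^-1; have k0 : 0 < k by rewrite addr_gt0// invr_gt0.
have ek : 0 < e / (4 * k) by rewrite divr_gt0// mulr_gt0.
apply: filterS (HG _ ek) => n he.
have finD := lt_trans he (ltry _).
have [] := key c n c0 finD; move: he; rewrite (energyE finD (pD n) T0T) lte_fin.
rewrite ltr_pdivlMr ?mulr_gt0// -/x -/k; set y := qvar (H n) T w; set z := qvar _ T w.
have z0 : 0 <= z by exact: qvar_ge0.
move=> h1 h2 h3; rewrite ltr_norml.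
have y3 : y <= 2 * x + e / 4 by nra.
by apply/andP; split; nra.
Qed.

End energy_comparison.

(** * Stochastic exponentials *)

(** With [x = 2 y], [exp x + exp (- x) - 2] is the square of [exp y - exp (- y)], whose absolute
    value is at least [|y|]. The resulting constant [1 / 4] is the origin of the factor 4 in
    [ito_L2]. *)
Lemma cosh_ge {R : realType} (x : R) : 2 + x ^+ 2 / 4 <= expR x + expR (- x).
Proof.
pose y := x / 2; have yE : x = y + y by rewrite /y -splitr.
have key (z : R) : 0 <= z -> z <= expR z - expR (- z).
  move=> z0; have h1 := expR_ge1Dx z; have : expR (- z) <= 1 by rewrite expR_le1 oppr_le0.
  by lra.
have h : y ^+ 2 <= (expR y - expR (- y)) ^+ 2.
  have [y0|y0] := leP 0 y; first by apply: lerXn2r; rewrite ?nnegrE ?key// (le_trans y0) ?key.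
  rewrite -sqrrN -[leRHS]sqrrN opprB; have y1 : 0 <= - y by rewrite oppr_ge0 ltW.
  have := key _ y1; rewrite opprK => h.
  by apply: lerXn2r; rewrite ?nnegrE// (le_trans y1).
have E : expR y * expR (- y) = 1 by rewrite -expRD subrr expR0.
rewrite yE opprD !expRD; move: h E; set a := expR y; set b := expR (- y) => h E.
have -> : (y + y) ^+ 2 / 4 = y ^+ 2 by field.
by rewrite -!expr2; move: h; rewrite sqrrB E; lra.
Qed.

Lemma norm_le_cosh {R : realType} (x : R) : `|x| <= expR x + expR (- x).
Proof.
have := expR_ge1Dx x; have := expR_ge1Dx (- x).
have := expR_ge0 x; have := expR_ge0 (- x); rewrite ler_norml; lra.
Qed.

Local Opaque expR.

Section exponential_martingales.
Context {disp : measure_display} {Om : measurableType disp} {R : realType}.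
Context {m : nat}.
Variables (P : probability Om R) (T : R) (B : R -> Om -> 'cV[R]_m).
Hypothesis P_complete : measure_is_complete P.
Hypothesis B_brownian : brownian_motion P T B.
Hypothesis T_gt0 : 0 < T.

Local Notation Ft := (augmented_filtration P B).
Local Notation leb := (@lebesgue_measure R).
Let mB := brownian_measurable B_brownian.
Local Notation simple := (is_simple P T B).
Local Notation pred := (predictable_mx T Ft).
Local Notation sqint := (square_integrable P T).
Local Notation itol := (ito_limit P T B).
Local Notation ito := (ito P T B).
Implicit Types (H G : R -> Om -> 'cV[R]_m) (I J : R -> Om -> R).
Let T0T : 0 <= T <= T. Proof. by rewrite lexx ltW. Qed.

(** The exponential at time [T] for any version [I] of the integral: sums and multiples of integrals
    enter without being identified with [ito] of the combined integrand. *)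
Definition doleans H I w := expR (I T w - 2^-1 * qvar H T w).

Lemma doleans_ge0 H I w : 0 <= doleans H I w.
Proof. exact: expR_ge0. Qed.
Hint Resolve doleans_ge0 : core.

Lemma measurable_qvar H : pred H -> measurable_fun setT (qvar H T).
Proof.
move=> pH; apply: (measurable_wrt_Om P_complete mB (lexx T)).
apply/measurable_wrtP; apply: (@measurableT_comp _ _ _ _ _ _ (@fine R)).
  exact: fine_measurable.
exact: (energy_measurable T_gt0 pH T0T).
Qed.

Lemma measurable_energy H : pred H -> measurable_fun setT (energy H T).
Proof.
move=> pH _ U mU; rewrite setTI; apply: (Ft_measurable P_complete mB (lexx T)).
rewrite -[X in Ft T X]setTI; exact: (energy_measurable T_gt0 pH T0T).
Qed.

Lemma measurable_doleans H I : pred H -> measurable_fun setT (I T) -> measurable_fun setT (doleans H I).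
Proof.
move=> pH mI; apply: measurableT_comp => //; apply: measurable_funB => //.
by apply: measurable_funM => //; exact: measurable_qvar.
Qed.

Lemma measurable_ito H t : pred H -> sqint H -> 0 <= t <= T -> measurable_fun setT (ito H t).
Proof.
move=> pH sH tT; have [aI _ _] := itoP P_complete B_brownian T_gt0 pH sH.
have /andP[_ tT'] := tT.
exact: (measurable_wrt_Om P_complete mB tT' (aI t tT)).
Qed.

Lemma measurable_simple_integral S t : simple S -> 0 <= t <= T ->
  measurable_fun setT (simple_integral B S t).
Proof.
move=> sS tT; have /andP[_ tT'] := tT.
exact: (measurable_wrt_Om P_complete mB tT' (simple_integral_adapted sS tT)).
Qed.

Lemma energy_fin_ae H (c : R) : {ae P, forall w, (energy H T w <= c%:E)%E} -> sqint H.
Proof. by apply: filterS => w h; apply: (le_lt_trans h); rewrite ltry. Qed.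

Let doleans_cvg (H : nat -> R -> Om -> 'cV[R]_m) (I : nat -> R -> Om -> R) G J :
  (forall n, pred (H n)) -> pred G -> (forall n, sqint (H n)) -> sqint G ->
  {ae P, forall w, forall e : R, 0 < e -> \forall n \near \oo,
    (energy (fun t w => (H n t w - G t w)%R) T w < e%:E)%E} ->
  {ae P, forall w, forall e : R, 0 < e -> \forall n \near \oo,
    forall t, 0 <= t <= T -> `|I n t w - J t w| < e} ->
  {ae P, forall w, doleans (H n) (I n) w @[n --> \oo] --> doleans G J w}.
Proof.
move=> pH pG sH sG HG IJ.
have /ae_foralln sH' := sH.
near=> w.
have h1 : forall e : R, 0 < e -> \forall n \near \oo,
    (energy (fun t w => (H n t w - G t w)%R) T w < e%:E)%E by near: w.
have h2 : forall e : R, 0 < e -> \forall n \near \oo,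
    forall t, 0 <= t <= T -> `|I n t w - J t w| < e by near: w.
have h3 : (energy G T w < +oo)%E by near: w.
have h4 : forall n, (energy (H n) T w < +oo)%E by near: w.
apply: (@continuous_cvg _ _ _ _ _ (fun n => I n T w - 2^-1 * qvar (H n) T w) expR).
  exact: continuous_expR.
apply: cvgB; last by apply: cvgM; [exact: cvg_cst|exact: qvar_cvg].
apply/cvgrPdist_lt => e e0; apply: filterS (h2 e e0) => n /(_ T T0T).
by rewrite distrC.
Unshelve. all: by end_near. Qed.

(** Fatou's lemma from simple integrands, whose exponentials have mass one. *)
Lemma doleans_le1 H I : pred H -> sqint H -> measurable_fun setT (I T) -> itol H I ->
  (\int[P]_w (doleans H I w)%:E <= 1)%E.
Proof.
move=> pH sH mI [S [sS SH SI]].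
have pS n := simple_val_predictable T_gt0 (sS n).
apply: (@fatou_le _ _ _ P (fun n => doleans (simple_val (S n)) (simple_integral B (S n)))) => //.
- by move=> n; apply: measurable_doleans => //; exact: measurable_simple_integral.
- exact: measurable_doleans.
- apply: doleans_cvg => // n.
  by apply: aeW => w; exact: (simple_energy_lty T_gt0 w (sS n) T0T).
- apply: nearW => n; have := expectation_simple_exp P_complete B_brownian T_gt0 (sS n) T0T.
  by rewrite /simple_exp /doleans => ->.
Qed.

(** The square of [E(H)] is [exp (int |H|^2) E(2 H)], so bounded energy bounds the exponential in
    [L^2]. *)
Lemma doleans_sqr H I c w : pred H -> (energy H T w <= c%:E)%E ->
  doleans H I w ^+ 2 <= expR c * doleans (fun t w => 2 *: H t w) (fun t w => 2 * I t w) w.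
Proof.
move=> pH; have := energy_ge0 H T w; rewrite /doleans (qvarZ T_gt0 2 w pH (lexx T)) /qvar.
case: (energy H T w) => [r| |]//=; rewrite !lee_fin => r0 rc.
by rewrite -expRM_natl -expRD ler_expR; lra.
Qed.

(** By [doleans_sqr] the squares are dominated by [exp c] times exponentials of mass at most one.
    The sequence is bounded in [L^2], and no mass escapes in the limit. *)
Let doleans_limit_ge1 (H : nat -> R -> Om -> 'cV[R]_m) (I : nat -> R -> Om -> R) G J (c : R) :
  (forall n, pred (H n)) -> pred G -> (forall n, sqint (H n)) -> sqint G ->
  (forall n, measurable_fun setT (I n T)) -> measurable_fun setT (J T) ->
  (forall n, itol (H n) (I n)) -> itol G J ->
  {ae P, forall w, forall e : R, 0 < e -> \forall n \near \oo,
    (energy (fun t w => (H n t w - G t w)%R) T w < e%:E)%E} ->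
  (forall n, {ae P, forall w, (energy (H n) T w <= c%:E)%E}) ->
  (forall n, \int[P]_w (doleans (H n) (I n) w)%:E = 1)%E ->
  (1 <= \int[P]_w (doleans G J w)%:E)%E.
Proof.
move=> pH pG sH sG mI mJ HI GJ HG Hc H1.
have [g gn gI] := ito_cvg_subseq P_complete B_brownian T_gt0 pH pG HI GJ HG.
have mD n : measurable_fun setT (doleans (H n) (I n)) by exact: measurable_doleans.
apply: (@L2_bounded_ge1 _ _ _ P (fun n => doleans (H (g n)) (I (g n))) _ (expR c)).
- by move=> n; exact: mD.
- exact: measurable_doleans.
- by move=> n w; exact: doleans_ge0.
- by move=> w; exact: doleans_ge0.
- apply: (doleans_cvg (fun n => pH (g n)) pG (fun n => sH (g n)) sG _ gI).
  apply: filterS HG => w h e e0; have [N _ hN] := h e e0; apply: (ex_intro2 _ _ N Logic.I) => n /= Nn.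
  by apply: hN; rewrite /= (leq_trans Nn).
- by move=> n; exact: H1.
- move=> n; set k := g n.
  have p2 : pred (fun t w => 2 *: H k t w).
    by apply: predictable_mxZ => //; exact: predictable_cst.
  have s2 : sqint (fun t w => 2 *: H k t w).
    apply: filterS (Hc k) => w hw; rewrite -[X in (X < _)%E]/(energy (fun t w => 2 *: H k t w) T w).
    rewrite (energyZ T_gt0 2 w (pH k) (lexx T)).
    apply: (@le_lt_trans _ _ ((2 ^+ 2)%:E * c%:E)%E); last by rewrite -EFinM ltry.
    by apply: lee_wpmul2l.
  have m2 : measurable_fun setT (fun w => 2 * I k T w) by exact: measurable_funM.
  have l2 : itol (fun t w => 2 *: H k t w) (fun t w => 2 * I k t w) by exact: ito_limitZ.
  have := @doleans_le1 _ (fun t w => 2 * I k t w) p2 s2 m2 l2.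
  have md2 := @measurable_doleans _ (fun t w => 2 * I k t w) p2 m2.
  move=> d1; apply: (@le_trans _ _ (\int[P]_w ((expR c)%:E *
     (doleans (fun t w => 2 *: H k t w) (fun t w => 2 * I k t w) w)%:E))%E).
    apply: ae_ge0_le_integral => //.
    + by move=> w _; rewrite lee_fin sqr_ge0.
    + by apply/measurable_EFinP; apply: measurable_funX; exact: mD.
    + by move=> w _; rewrite -EFinM lee_fin mulr_ge0// expR_ge0.
    + by apply/measurable_EFinP; exact: measurable_funM.
    + by apply: filterS (Hc k) => w h _; rewrite -EFinM lee_fin; exact: doleans_sqr.
  rewrite ge0_integralZl_EFin//; last 2 first.
  + by move=> w _; rewrite lee_fin doleans_ge0.
  + by apply/measurable_EFinP; exact: md2.
  by rewrite -[leRHS]mule1; apply: lee_wpmul2l => //; rewrite lee_fin expR_ge0.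
Qed.

Lemma truncate_le n H t w : dot (truncate_mx n H t w) (truncate_mx n H t w) <= dot (H t w) (H t w).
Proof.
apply: ler_sum => i _; rewrite mxE; case: ifP => // _.
by rewrite mulr0 -expr2 sqr_ge0.
Qed.

Lemma truncate_energy_cvg0 H w : pred H -> (energy H T w < +oo)%E -> forall e : R, 0 < e ->
  \forall n \near \oo, (energy (fun t w => (truncate_mx n%:R H t w - H t w)%R) T w < e%:E)%E.
Proof.
move=> pH fin; apply: (energy_dominated_cvg0 T_gt0 (P := P) (B := B) _ pH) => //.
- by move=> n; apply: predictable_mxB => //; exact: predictable_truncate.
- move=> n t; rewrite !sqr_enorm; apply: ler_sum => i _; rewrite 3!mxE.
  case: ifP => _; first by rewrite subrr mulr0 -expr2 sqr_ge0.
  by rewrite sub0r mulrNN.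
- move=> t _; apply: cvg_near_cst; apply: filterS (truncate_cvg0 H t w) => n hn.
  by rewrite hn subrr sqr_enorm dot0l.
Qed.

(** Two passages to the limit: from simple to bounded integrands, where the common bound [K] on the
    approximants gives the energy bound [K T], then from truncations to [H], whose energies stay
    below [c]. *)
Theorem doleans_bounded H (c : R) : pred H -> {ae P, forall w, (energy H T w <= c%:E)%E} ->
  (\int[P]_w (doleans H (ito H) w)%:E = 1)%E.
Proof.
have le1 G : pred G -> sqint G -> (\int[P]_w (doleans G (ito G) w)%:E <= 1)%E.
  move=> pG sG; apply: doleans_le1 => //; first exact: measurable_ito.
  by have [] := itoP P_complete B_brownian T_gt0 pG sG.
have bounded_case G k : pred G -> sqint G -> (forall t w i, `|G t w i 0| <= k) ->
    (\int[P]_w (doleans G (ito G) w)%:E = 1)%E.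
  move=> pG sG bG; apply/le_anti; rewrite le1//=.
  have [S [[sS SG SI] [K K0 hK]]] := ito_bounded_approx P_complete B_brownian T_gt0 pG bG sG.
  have [_ _ GI] := itoP P_complete B_brownian T_gt0 pG sG.
  have pS n := simple_val_predictable T_gt0 (sS n).
  apply: (@doleans_limit_ge1 (fun n => simple_val (S n)) (fun n => simple_integral B (S n)) _ _ (K * T)) => //.
  - move=> n; apply: aeW => w; exact: (simple_energy_lty T_gt0 w (sS n) T0T).
  - by move=> n; exact: measurable_simple_integral.
  - exact: measurable_ito.
  - by move=> n; exact: ito_limit_simple.
  - move=> n; apply: aeW => w.
    rewrite (energyD T_gt0 w (pS n) (lexx 0) (ltW T_gt0) (lexx T)).
    rewrite {1}/energy set_itv1 integral_set1 add0e.
    apply: (le_trans (simple_energy_increment T_gt0 w (sS n) (hK n) (lexx 0) (ltW T_gt0) (lexx T))).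
    by rewrite subr0.
  - move=> n; have := expectation_simple_exp P_complete B_brownian T_gt0 (sS n) T0T.
    by rewrite /simple_exp /doleans => ->.
move=> pH Hc; have sH := energy_fin_ae Hc.
apply/le_anti; rewrite le1//=.
have ptr n : pred (truncate_mx n%:R H) by exact: predictable_truncate.
have ctr n : {ae P, forall w, (energy (truncate_mx n%:R H) T w <= c%:E)%E}.
  apply: filterS Hc => w; apply: le_trans; apply: (energy_le_pointwise T_gt0 (P := P) (B := B)) => //.
  by move=> u _; exact: truncate_le.
have str n := energy_fin_ae (ctr n).
apply: (@doleans_limit_ge1 (fun n => truncate_mx n%:R H) (fun n => ito (truncate_mx n%:R H)) _ _ c) => //.
- by move=> n; exact: measurable_ito.
- exact: measurable_ito.
- by move=> n; have [] := itoP P_complete B_brownian T_gt0 (ptr n) (str n).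
- by have [] := itoP P_complete B_brownian T_gt0 pH sH.
- by apply: filterS sH => w; exact: truncate_energy_cvg0.
- move=> n; apply: (@bounded_case _ n%:R) => // t w i.
  by rewrite mxE; case: ifP => // _; rewrite normr0.
Qed.

(** The upper half of the Ito isometry, up to a factor. The exponentials of [e H] and [- e H] have
    mass at most one; expanding their sum to second order in [e], the constants cancel and [E[g I^2]
    <= 4 c] remains, where [g = exp (- e^2 A / 2)] tends to 1 with [e]. *)
Theorem ito_L2 H I (c : R) : pred H -> sqint H -> measurable_fun setT (I T) -> itol H I ->
  (\int[P]_w energy H T w <= c%:E)%E -> (\int[P]_w (I T w ^+ 2)%:E <= (4 * c)%:E)%E.
Proof.
have aux (x y k a : R) : x <= 1 -> y <= 1 -> a <= k -> x + y - (2 - a) <= k by lra.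
move=> pH sH mI HI Hc; pose A := qvar H T; have mA := measurable_qvar pH.
have A0 w : 0 <= A w by exact: qvar_ge0.
have [IA EA] : P.-integrable setT (EFin \o A) /\ \int[P]_w A w <= c.
  apply: intg_ge0 => //; apply: le_trans Hc; apply: ae_ge0_le_integral => //.
  - by move=> w _; rewrite lee_fin.
  - exact/measurable_EFinP.
  - by move=> w _; exact: energy_ge0.
  - exact: measurable_energy.
  - apply: filterS sH => w fin _; by rewrite (energyE T_gt0 (P := P) (B := B) fin pH T0T).
pose ep n : R := n.+1%:R^-1; have ep0 n : 0 < ep n by rewrite invr_gt0 ltr0Sn.
pose g n w := expR (- (2^-1 * (ep n ^+ 2 * A w))).
have mg n : measurable_fun setT (g n).
  apply: measurableT_comp => //; apply: measurableT_comp => //.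
  by apply: measurable_funM => //; exact: measurable_funM.
have mI2 : measurable_fun setT (fun w => I T w ^+ 2) by exact: measurable_funX.
pose f n w := g n w * I T w ^+ 2.
have mf n : measurable_fun setT (f n) by exact: measurable_funM.
have f0 n w : 0 <= f n w by rewrite mulr_ge0 ?expR_ge0 ?sqr_ge0.
apply: (@fatou_le _ _ _ P f) => //.
- by move=> w; exact: sqr_ge0.
- apply: aeW => w; rewrite -[X in _ --> X]mul1r; apply: cvgM; last exact: cvg_cst.
  rewrite -expR0; apply: (@continuous_cvg _ _ _ _ _ (fun n => - (2^-1 * (ep n ^+ 2 * A w))) expR).
    exact: continuous_expR.
  rewrite -oppr0; apply: cvgN; rewrite -(mulr0 2^-1); apply: cvgM; first exact: cvg_cst.
  rewrite -(mul0r (A w)); apply: cvgM; last exact: cvg_cst.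
  rewrite -(mulr0 0); under eq_fun do rewrite expr2.
  by apply: cvgM; exact: cvg_harmonic.
- apply: nearW => n; set e := ep n.
  have dole a : P.-integrable setT (EFin \o doleans (fun t w => a *: H t w) (fun t w => a * I t w)) /\
     \int[P]_w doleans (fun t w => a *: H t w) (fun t w => a * I t w) w <= 1.
    have pa : pred (fun t w => a *: H t w).
      by apply: predictable_mxZ => //; exact: predictable_cst.
    have ma : measurable_fun setT (fun w => a * I T w) by exact: measurable_funM.
    apply: intg_ge0; first exact: measurable_doleans.
      by move=> w _; exact: doleans_ge0.
    apply: doleans_le1 => //; last exact: ito_limitZ.
    apply: filterS sH => w fin; rewrite -[X in (X < _)%E]/(energy (fun t w => a *: H t w) T w).
    rewrite (energyZ T_gt0 a w pH (lexx T)) (energyE T_gt0 (P := P) (B := B) fin pH T0T).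
    by rewrite -EFinM ltry.
  have [I1 E1] := dole e; have [I2 E2] := dole (- e).
  (* [k] undoes the factor [e^2 / 4] that [cosh_ge] puts in front of the square of the integral. *)
  pose k : R := 4 / e ^+ 2; have e_neq0 : e != 0 by apply: lt0r_neq0; exact: ep0.
  have e20 : 0 < e ^+ 2 by apply: exprn_gt0; exact: ep0.
  have k0 : 0 <= k by rewrite divr_ge0// ltW.
  pose r w := k * (doleans (fun t w => e *: H t w) (fun t w => e * I t w) w +
     doleans (fun t w => - e *: H t w) (fun t w => - e * I t w) w - (2 - e ^+ 2 * A w)).
  have I12 := intgD measurableT I1 I2.
  have IA' := intgB measurableT (intg_cst P 2) (intgZ measurableT (e ^+ 2) IA).
  have Ir : P.-integrable setT (EFin \o r) := intgZ measurableT k (intgB measurableT I12 IA').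
  have fr w : f n w <= r w.
    rewrite /r /doleans !(qvarZ T_gt0 _ w pH (lexx T)) -/(A w) sqrrN !mulNr !expRD -/(g n w).
    have := cosh_ge (e * I T w); have : 1 - 2^-1 * (e ^+ 2 * A w) <= g n w.
      by have := expR_ge1Dx (- (2^-1 * (e ^+ 2 * A w))).
    have g0 : 0 <= g n w by exact: expR_ge0.
    rewrite -mulrDl => h1 h2.
    have h3 : (2 + (e * I T w) ^+ 2 / 4) * g n w <=
       (expR (e * I T w) + expR (- (e * I T w))) * g n w by rewrite ler_wpM2r.
    have -> : f n w = k * (g n w * (e * I T w) ^+ 2 / 4).
      by rewrite /f /k; field; exact: e_neq0.
    apply: ler_wpM2l => //; move: h3; rewrite mulrDl.
    by move: h1; clear; lra.
  have If : P.-integrable setT (EFin \o f n).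
    apply: (intg_le measurableT (mf n) _ Ir); apply: aeW => w _.
    by rewrite ger0_norm.
  rewrite (intg_fin_num measurableT If) lee_fin.
  apply: (le_trans (Rintegral_le_ae measurableT If Ir (aeW _ (fun w _ => fr w)))).
  rewrite (RintegralZl _ measurableT (intgB measurableT I12 IA')) (RintegralB measurableT I12 IA').
  rewrite (RintegralD measurableT I1 I2) (RintegralB measurableT (intg_cst P 2) (intgZ measurableT (e ^+ 2) IA)).
  rewrite (RintegralZl _ measurableT IA) Rintegral_cstP.
  have -> : 4 * c = k * (e ^+ 2 * c) by rewrite /k; field; exact: e_neq0.
  apply: ler_wpM2l => //.
  by apply: (aux _ _ _ _ E1 E2); rewrite ler_pM2l.
Qed.

Lemma intg_dot H G w : pred H -> pred G -> (energy H T w < +oo)%E -> (energy G T w < +oo)%E ->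
  leb.-integrable `[0, T] (EFin \o (fun u : measurableTypeR R => dot (H u w) (G u w))).
Proof.
move=> pH pG fH fG; have mI : measurable (`[0, T]%classic : set (measurableTypeR R)) by exact: measurable_itv.
have ie (K : R -> Om -> 'cV[R]_m) : pred K -> (energy K T w < +oo)%E ->
   leb.-integrable `[0, T] (EFin \o (fun u : measurableTypeR R => dot (K u w) (K u w))).
  move=> pK fK; have := predictable_path T_gt0 w (predictable_dot T_gt0 pK pK) => mK.
  apply: (proj1 (@intg_ge0 _ _ _ leb `[0, T] _ (qvar K T w) mK _ _)).
    by move=> u _; exact: dot_ge0.
  rewrite -(energyE T_gt0 (P := P) (B := B) fK pK T0T) /energy.
  rewrite le_eqVlt; apply/orP; left; apply/eqP; apply: eq_integral => u _.
  by rewrite sqr_enorm.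
apply: (intg_le mI _ _ (intgZ mI 2^-1 (intgD mI (ie H pH fH) (ie G pG fG)))).
  exact: (predictable_path T_gt0 w (predictable_dot T_gt0 pH pG)).
by apply: aeW => u _; exact: dot_norm_le.
Qed.

Lemma qvar_dot H w : qvar H T w = \int[leb]_(u in `[0, T]) dot (H u w) (H u w).
Proof. by apply: eq_Rintegral => u _; rewrite sqr_enorm. Qed.

Lemma qvarD H G w (a : R) : pred H -> pred G -> (energy H T w < +oo)%E -> (energy G T w < +oo)%E ->
  qvar (fun t w => H t w + a *: G t w) T w =
  qvar H T w + 2 * a * (\int[leb]_(u in `[0, T]) dot (G u w) (H u w)) + a ^+ 2 * qvar G T w.
Proof.
move=> pH pG fH fG; have mI : measurable (`[0, T]%classic : set (measurableTypeR R)) by exact: measurable_itv.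
rewrite !qvar_dot.
have -> : \int[leb]_(u in `[0, T]) dot (H u w + a *: G u w) (H u w + a *: G u w) =
  \int[leb]_(u in `[0, T]) (dot (H u w) (H u w) + 2 * a * dot (G u w) (H u w) + a ^+ 2 * dot (G u w) (G u w)).
  apply: eq_Rintegral => u _; rewrite !(dotDl, dotDr, dotZl, dotZr) (dotC (H u w) (G u w)); ring.
have I1 := intg_dot pH pH fH fH; have I2 := intg_dot pG pH fG fH; have I3 := intg_dot pG pG fG fG.
have I2' := intgZ mI (2 * a) I2; have I3' := intgZ mI (a ^+ 2) I3.
by rewrite RintegralD ?RintegralD ?RintegralZl//; exact: intgD.
Qed.

(* Differentiate [E (doleans (h + a q)) <= 1] at [a = 0]. *)
Theorem doleans_orthogonal h q (c : R) : pred h -> pred q -> sqint h ->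
  (\int[P]_w (doleans h (ito h) w)%:E = 1)%E -> 0 <= c ->
  {ae P, forall w, (energy q T w <= c%:E)%E} ->
  let M w := doleans h (ito h) w *
    (ito q T w - \int[leb]_(u in `[0, T]) dot (q u w) (h u w)) in
  P.-integrable setT (EFin \o M) /\ \int[P]_w M w = 0.
Proof.
have aux (i j x v a k l : R) : k <= l ->
    i - 2^-1 * v + (a * (j - x) - 2^-1 * l) <= i + a * j - 2^-1 * (v + 2 * a * x + k).
  by lra.
have aux2 (a k x : R) : 0 < a -> a * x <= 2^-1 * (a ^+ 2 * k) ->
    (- a) * x <= 2^-1 * (a ^+ 2 * k) -> 0 <= k -> `|x| <= a * k.
  move=> a0 h1 h2 k0; rewrite ler_norml; apply/andP; split; rewrite -(ler_pM2l a0); nra.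
move=> ph pq sh h1 c0 qc; have sq := energy_fin_ae qc.
pose D := doleans h (ito h).
pose W w := ito q T w - \int[leb]_(u in `[0, T]) dot (q u w) (h u w).
have [_ _ hI] := itoP P_complete B_brownian T_gt0 ph sh.
have [_ _ qI] := itoP P_complete B_brownian T_gt0 pq sq.
have mih := measurable_ito ph sh T0T; have miq := measurable_ito pq sq T0T.
have mD : measurable_fun setT D by exact: measurable_doleans.
have mW : measurable_fun setT W.
  apply: measurable_funB => //.
  have mI : measurable (`[0, T]%classic : set R) by exact: measurable_itv.
  have := predictable_Rintegral T_gt0 T0T mI (fun x h => h) (predictable_dot T_gt0 pq ph).
  exact: (measurable_wrt_Om P_complete mB (f := fun _ w => \int[leb]_(u in `[0, T]) dot (q u w) (h u w)) (lexx T)).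
have D1 : (\int[P]_w (D w)%:E <= 1%:E)%E by rewrite h1.
have [ID _] := @intg_ge0 _ _ _ P setT D 1 mD (fun w _ => doleans_ge0 _ _ _) D1.
have ED : \int[P]_w D w = 1 by rewrite /Rintegral h1.
pose Da a := doleans (fun t w => h t w + a *: q t w) (fun t w => ito h t w + a * ito q t w).
have hDa a : P.-integrable setT (EFin \o Da a) /\ \int[P]_w Da a w <= 1.
  have paq : pred (fun t w => a *: q t w).
    by apply: predictable_mxZ => //; exact: predictable_cst.
  have pa : pred (fun t w => h t w + a *: q t w) by exact: predictable_mxD.
  have ma : measurable_fun setT (fun w => ito h T w + a * ito q T w).
    by apply: measurable_funD => //; exact: measurable_funM.
  apply: intg_ge0; first exact: measurable_doleans.
    by move=> w _; exact: doleans_ge0.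
  apply: doleans_le1 => //; last by apply: ito_limitD => //; exact: ito_limitZ.
  apply: filterS2 sh sq => w fh fq; rewrite -[X in (X < _)%E]/(energy (fun t w => h t w + a *: q t w) T w).
  apply: (le_lt_trans (energyD_le T_gt0 w ph paq (lexx T))).
  rewrite (energyZ T_gt0 a w pq (lexx T)).
  rewrite (energyE T_gt0 (P := P) (B := B) fh ph T0T) (energyE T_gt0 (P := P) (B := B) fq pq T0T).
  by rewrite -!EFinM -EFinD ltry.
have DaE a : {ae P, forall w, setT w -> D w * expR (a * W w - 2^-1 * (a ^+ 2 * c)) <= Da a w}.
  apply: filterS3 sh sq qc => w fh fq; rewrite (energyE T_gt0 (P := P) (B := B) fq pq T0T) lee_fin => qc' _.
  rewrite /D /Da /doleans -expRD ler_expR (qvarD a ph pq fh fq) /W.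
  by apply: aux; rewrite ler_wpM2l// sqr_ge0.
have mDW : measurable_fun setT (fun w => D w * W w) by exact: measurable_funM.
(* Integrability comes from the two signs [a = 1] and [a = -1], because
   [|W| <= exp W + exp (- W)]. *)
have IDW : P.-integrable setT (EFin \o (fun w => D w * W w)).
  have [I1 _] := hDa 1; have [I2 _] := hDa (-1).
  apply: (intg_le measurableT mDW _ (intgZ measurableT (expR (2^-1 * c)) (intgD measurableT I1 I2))).
  apply: filterS2 (DaE 1) (DaE (-1)) => w /(_ Logic.I) d1 /(_ Logic.I) d2 _.
  have D0 : 0 <= D w by exact: expR_ge0.
  rewrite normrM (ger0_norm D0).
  apply: (@le_trans _ _ (D w * (expR (W w) + expR (- W w)))).
    by apply: ler_wpM2l => //; exact: norm_le_cosh.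
  have split_exp x : D w * expR x = expR (2^-1 * c) * (D w * expR (x - 2^-1 * c)).
    by rewrite mulrCA; congr (D w * _); rewrite -expRD addrC subrK.
  rewrite mulrDr (split_exp (W w)) (split_exp (- W w)) -mulrDr.
  apply: ler_wpM2l; first exact: expR_ge0.
  apply: lerD; first by move: d1; rewrite mul1r expr1n mul1r.
  by move: d2; rewrite mulN1r sqrrN expr1n mul1r.
have key a : a * \int[P]_w (D w * W w) <= 2^-1 * (a ^+ 2 * c).
  have [Ia Ea] := hDa a; set k := 2^-1 * (a ^+ 2 * c).
  have Il1 := intgZ measurableT (1 - k) ID; have Il2 := intgZ measurableT a IDW.
  have : \int[P]_w ((1 - k) * D w + a * (D w * W w)) <= \int[P]_w Da a w.
    apply: (Rintegral_le_ae measurableT (intgD measurableT Il1 Il2) Ia).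
    apply: filterS (DaE a) => w /(_ Logic.I) hw _; apply: le_trans hw.
    have D0 : 0 <= D w by exact: expR_ge0.
    have -> : (1 - k) * D w + a * (D w * W w) = D w * (1 + (a * W w - k)) by ring.
    by apply: ler_wpM2l => //; exact: expR_ge1Dx.
  rewrite (RintegralD measurableT Il1 Il2) (RintegralZl _ measurableT ID) (RintegralZl _ measurableT IDW) ED.
  move: Ea; rewrite mulr1 => e1 e2; have := le_trans e2 e1.
  by rewrite -addrA gerDl addrC subr_le0.
split => //; set x := \int[P]_w _ in key *.
have x1 a : 0 < a -> `|x| <= a * c.
  by move=> a0; apply: (aux2 _ _ _ a0 (key a) _ c0); rewrite -(sqrrN a); exact: key.
apply/eqP; rewrite -normr_eq0 eq_le normr_ge0 andbT.
apply/ler_addgt0Pr => e e0; rewrite add0r.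
have ec : 0 < e / (c + 1) by rewrite divr_gt0// ltr_wpDl.
apply: (le_trans (x1 _ ec)); rewrite mulrAC ler_pdivrMr ?ltr_wpDl//.
by rewrite mulrDr mulr1 lerDl ltW.
Qed.

End exponential_martingales.

(** * Stopping *)

Section stopping.
Context {disp : measure_display} {Om : measurableType disp} {R : realType}.
Context {m : nat}.
Variables (P : probability Om R) (T : R) (B : R -> Om -> 'cV[R]_m).
Hypothesis P_complete : measure_is_complete P.
Hypothesis B_brownian : brownian_motion P T B.
Hypothesis T_gt0 : 0 < T.

Local Notation Ft := (augmented_filtration P B).
Local Notation leb := (@lebesgue_measure R).
Local Notation pred := (predictable_mx T Ft).
Local Notation sqint := (square_integrable P T).
Local Notation ito := (ito P T B).
Implicit Types (H G : R -> Om -> 'cV[R]_m).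

Local Notation D0 := (`[0, T] `*` setT : set (R * Om)).

Lemma predictable_before r : 0 <= r <= T ->
  measurable (D0 `&` [set z | z.1 <= r] : set (OmP P T B)).
Proof.
move=> /andP[r0 rT].
have -> : D0 `&` [set z | z.1 <= r] = D0 `\` (`]r, T] `*` setT).
  apply/seteqP; split => [[t w]|[t w]] /=; rewrite !in_itv/=.
    by move=> [h tr]; split => // -[/andP[rt _] _]; rewrite leNgt rt in tr.
  move=> [[/andP[t0 tT] _] h]; split; first by rewrite t0.
  by rewrite leNgt; apply/negP => rt; apply: h; rewrite rt.
apply: measurableD; first exact: predictable_dom.
by apply: predictable_rectangle => //; exact: Ft_setT.
Qed.

Lemma predictable_mx_ite (b : R -> Om -> bool) H :
  measurable (D0 `&` [set z | b z.1 z.2] : set (OmP P T B)) -> pred H ->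
  pred (fun t w => if b t w then H t w else 0).
Proof.
move=> mb pH i j.
have -> : (fun t w => (if b t w then H t w else 0) i j) = (fun t w => if b t w then H t w i j else 0).
  by apply/funext => t; apply/funext => w; case: ifP; rewrite ?mxE.
by apply: predictable_ite => //; exact: predictable_cst.
Qed.

Lemma sqint_le H G : pred H -> pred G -> sqint G ->
  (forall t w, dot (H t w) (H t w) <= dot (G t w) (G t w)) -> sqint H.
Proof.
move=> pH pG sG HG; apply: filterS sG => w; apply: le_lt_trans.
exact: (energy_le_pointwise T_gt0 pH pG (lexx T)).
Qed.

(** Locality, with the integrand cut at a deterministic time, settles dyadic [s]. A general [s],
    possibly random, is reached by path continuity from dyadic times just after it, where the
    integrand still vanishes. *)
Lemma ito_constant_after H : pred H -> sqint H ->
  {ae P, forall w, forall s, 0 <= s <= T -> (forall u, s < u <= T -> H u w = 0) ->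
    ito H T w = ito H s w}.
Proof.
move=> pH sH; have [_ cI HI] := itoP P_complete B_brownian T_gt0 pH sH.
have T0T : 0 <= T <= T by rewrite lexx ltW.
have h i j : {ae P, forall w, (j <= 2 ^ i)%N ->
    (forall u, dyadic T i j < u <= T -> H u w = 0) -> ito H T w = ito H (dyadic T i j) w}.
  case: (boolP (j <= 2 ^ i)%N) => jn; last by apply: aeW => w h; exfalso; move/negP: jn; apply.
  have rT := dyadic_itv T_gt0 jn; set r := dyadic T i j in rT *.
  have lim := ito_limit_stop T_gt0 rT pH HI.
  have pS : pred (fun t w => if t <= r then H t w else 0).
    exact: (predictable_mx_ite (b := fun t _ => t <= r) (predictable_before rT) pH).
  apply: filterS (ito_eq_local P_complete B_brownian T_gt0 pH pS HI lim) => w hw _ H0.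
  have -> : ito H T w = ito H (Num.min r T) w.
    apply: hw => //; rewrite /energy; apply: integral0_eq => u; rewrite /= in_itv/= => /andP[u0 uT].
    case: ifPn => [_|]; first by rewrite subrr sqr_enorm dot0l.
    by rewrite -ltNge => ru; rewrite H0 ?ru// subrr sqr_enorm dot0l.
  by rewrite min_l//; case/andP: rT.
have /ae_foralln h' := fun i => (ae_foralln (h i)).
apply: filterS2 cI h' => w cw hw s sT H0; have /andP[s0 sT'] := sT.
move: sT'; rewrite le_eqVlt => /predU1P[->//|sT'].
apply/eqP; rewrite -subr_eq0 -normr_eq0 eq_le normr_ge0 andbT.
apply/ler_addgt0Pr => e e0; rewrite add0r.
have [d d0 hd] := cw s sT e e0.
(* A dyadic time within [k] of [s + k] lies strictly between [s] and [s + 2 k], inside both the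
   modulus of continuity and the horizon. *)
pose k := Num.min d (T - s) / 2; have k0 : 0 < k by rewrite divr_gt0// lt_min d0 subr_gt0.
have kd : k + k <= d by rewrite /k -splitr ge_min lexx.
have ks : k + k <= T - s by rewrite /k -splitr ge_min lexx orbT.
have skT : 0 <= s + k <= T by apply/andP; split; lra.
have [i [j [jn]]] := dyadic_dense T_gt0 skT k0; rewrite ltr_norml => /andP[r1 r2].
set r := dyadic T i j in r1 r2.
have sr : s < r by lra.
have rT : 0 <= r <= T by exact: dyadic_itv.
rewrite (hw i j jn); last first.
  by move=> u /andP[ru uT]; apply: H0; rewrite (lt_trans sr).
by rewrite -/r; apply/ltW/hd => //; rewrite ltr_norml; apply/andP; split; lra.
Qed.

Variable a : R -> Om -> R.
Hypothesis a_predictable : predictable T Ft a.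
Hypothesis a_ge0 : forall t w, 0 <= a t w.

Definition clock t w := (\int[leb]_(u in `[0%R, t]) (a u w)%:E)%E.

(** The clock is tested only at dyadic times strictly before [t]. The condition is thus countable
    and left-continuous in [t], hence predictable, without any theory of stopping times. *)
Definition alive (n : R) t w : bool :=
  `[< forall i j, (j <= 2 ^ i)%N -> dyadic T i j < t -> (clock (dyadic T i j) w <= n%:E)%E >].

Definition stopped n H t w : 'cV[R]_m := if alive n t w then H t w else 0.

Definition stop_time n w : R := sup [set t | 0 <= t <= T /\ alive n t w].

Lemma measurable_clock t : 0 <= t <= T ->
  measurable_fun setT (clock t : OmF P B t -> \bar R).
Proof.
move=> tT; have mI : measurable (`[0, t]%classic : set R) by exact: measurable_itv.
exact: (predictable_eintegral T_gt0 tT mI (fun x h => h) a_predictable).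
Qed.

Let a_path t w : t <= T -> measurable_fun `[0, t] (fun u : measurableTypeR R => (a u w)%:E).
Proof.
move=> tT; apply/measurable_EFinP; apply: (@measurable_funS _ _ _ _ `[0, T]) => //.
  by move=> u /=; rewrite !in_itv/= => /andP[-> /le_trans->].
exact: (predictable_path T_gt0 w a_predictable).
Qed.

Lemma clock_le s t w : s <= t -> t <= T -> (clock s w <= clock t w)%E.
Proof.
move=> st tT; apply: ge0_subset_integral => //.
- exact: a_path.
- by move=> u _; rewrite lee_fin.
- by move=> u /=; rewrite !in_itv/= => /andP[-> /le_trans->].
Qed.

Lemma alive_predictable n : measurable (D0 `&` [set z | alive n z.1 z.2] : set (OmP P T B)).
Proof.
pose E i j : set (R * Om) := if (j <= 2 ^ i)%N then
   `]dyadic T i j, T] `*` [set w | (n%:E < clock (dyadic T i j) w)%E] else set0.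
have -> : D0 `&` [set z | alive n z.1 z.2] = D0 `\` \bigcup_i \bigcup_j E i j.
  apply/seteqP; split => [[t w] [Dt /= /asboolP al]|[t w] [Dt h]].
    split => // -[i _ [j _]]; rewrite /E; case: ifPn => // jn [/= + h2].
    by rewrite in_itv/= => /andP[rt _]; move: h2; rewrite ltNge al.
  split => //=; apply/asboolP => i j jn rt; rewrite leNgt; apply/negP => h2.
  apply: h; exists i => //; exists j => //; rewrite /E jn; split => //=.
  by case: Dt => /=; rewrite !in_itv/= => /andP[_ ->] _; rewrite rt.
apply: measurableD; first exact: predictable_dom.
apply: bigcupT_measurable => i; apply: bigcupT_measurable => j; rewrite /E.
case: ifPn => [jn|_]; last exact: measurable0.
have rT := dyadic_itv T_gt0 jn; have /andP[r0 rT'] := rT.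
apply: predictable_rectangle => //.
rewrite (_ : [set w | _] = clock (dyadic T i j) @^-1` `]n%:E, +oo%E]).
  by rewrite -[X in Ft _ X]setTI; apply: (measurable_clock rT) => //; exact: emeasurable_itv.
by apply/seteqP; split => w /=; rewrite in_itv/= leey andbT.
Qed.

Lemma predictable_stopped n H : pred H -> pred (stopped n H).
Proof. by move=> pH; apply: predictable_mx_ite => //; exact: alive_predictable. Qed.

Lemma stopped_le n H t w : dot (stopped n H t w) (stopped n H t w) <= dot (H t w) (H t w).
Proof. by rewrite /stopped; case: ifP => // _; rewrite dot0l dot_ge0. Qed.

Lemma alive_le n s t w : s <= t -> alive n t w -> alive n s w.
Proof.
move=> st /asboolP al; apply/asboolP => i j jn rs; apply: al => //.
exact: lt_le_trans st.
Qed.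

Lemma stop_time_itv n w : 0 <= stop_time n w <= T.
Proof.
have al0 : alive n 0 w.
  apply/asboolP => i j jn; have /andP[r0 _] := dyadic_itv T_gt0 jn.
  by rewrite ltNge r0.
have ub : has_ubound [set t | 0 <= t <= T /\ alive n t w] by exists T => t [/andP[_ ->]].
apply/andP; split.
  by apply: ub_le_sup => //; split => //; rewrite lexx ltW.
by apply: ge_sup => [|t [/andP[_ ->]]//]; exists 0; split => //; rewrite lexx ltW.
Qed.

Lemma aliveE n t w : 0 <= t <= T -> alive n t w = (t <= stop_time n w).
Proof.
move=> tT; have ub : has_ubound [set t | 0 <= t <= T /\ alive n t w] by exists T => s [/andP[_ ->]].
apply/idP/idP => [al|ts]; first by apply: ub_le_sup.
apply: (alive_le ts); apply/asboolP => i j jn rs.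
have [|s [_ /asboolP al] rs'] := sup_gt _ rs; last exact: al.
have /andP[r0 _] := dyadic_itv T_gt0 jn.
exists 0; split; first by rewrite lexx ltW.
by apply/asboolP => i' j' jn'; have /andP[r0' _] := dyadic_itv T_gt0 jn'; rewrite ltNge r0'.
Qed.

Lemma stop_time_T n w : (clock T w <= n%:E)%E -> stop_time n w = T.
Proof.
move=> cn; have /andP[s0 sT] := stop_time_itv n w; apply/le_anti; rewrite sT/=.
rewrite -aliveE ?lexx ?(ltW T_gt0)//; apply/asboolP => i j jn _; apply: le_trans cn.
by apply: clock_le => //; have /andP[] := dyadic_itv T_gt0 jn.
Qed.

(** If the clock exceeded [n] at the stopping time, continuity would give an earlier dyadic time
    with the same excess, although the path is alive at its stopping time. A stopping time equal to
    0 is settled by [0 <= n]. *)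
Lemma clock_stop_time n w : 0 <= n -> (clock T w < +oo)%E -> (clock (stop_time n w) w <= n%:E)%E.
Proof.
move=> n0 fin; have sT := stop_time_itv n w; set s := stop_time n w in sT *.
have clE t : t <= T -> clock t w = (\int[leb]_(u in `[0, t]) a u w)%:E.
  move=> tT; rewrite /Rintegral fineK// ge0_fin_numE; first exact: le_lt_trans (clock_le w tT (lexx T)) fin.
  by apply: integral_ge0 => u _; rewrite lee_fin.
have Ia : leb.-integrable `[0, T] (EFin \o (a ^~ w)).
  apply/integrableP; split; first exact: a_path.
  move: fin; rewrite /clock; congr (_ < _)%E; apply: eq_integral => u _.
  by rewrite /= ger0_norm.
have /path_continuousP cA := parameterized_integral_continuous (ltW T_gt0) Ia.
rewrite clE; last by case/andP: sT.
rewrite lee_fin leNgt; apply/negP => ns.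
have /andP[s0 sT'] := sT; move: s0; rewrite le_eqVlt => /predU1P[s0|s0].
  by move: ns; rewrite -s0 set_itv1 /Rintegral integral_set1/= ltNge n0.
have ns0 : 0 < \int[leb]_(u in `[0, s]) a u w - n by rewrite subr_gt0.
have [d d0 hd] := cA s sT _ ns0.
pose k := Num.min d s / 2; have k0 : 0 < k by rewrite divr_gt0// lt_min d0.
have kd : k + k <= d by rewrite /k -splitr ge_min lexx.
have ks : k + k <= s by rewrite /k -splitr ge_min lexx orbT.
have skT : 0 <= s - k <= T by apply/andP; split; lra.
have [i [j [jn]]] := dyadic_dense T_gt0 skT k0; rewrite ltr_norml => /andP[r1 r2].
have rT := dyadic_itv T_gt0 jn; have /andP[r0 rT'] := rT.
have rs : dyadic T i j < s by lra.
have als : alive n s w by rewrite aliveE// lexx.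
move/asboolP : als => /(_ i j jn rs); rewrite clE// lee_fin.
have rd : `|dyadic T i j - s| < d by rewrite ltr_norml; apply/andP; split; lra.
have := hd _ rT rd; rewrite /parameterized_integral ltr_norml opprB => /andP[+ _].
by rewrite ltrD2r => nr; rewrite leNgt nr.
Qed.

(** Up to the stopping time the two integrands agree, so locality applies at that random time; after
    it the stopped one vanishes and its integral no longer moves. *)
Lemma ito_stopped n H : pred H -> sqint H ->
  {ae P, forall w, ito (stopped n H) T w = ito H (stop_time n w) w}.
Proof.
move=> pH sH; have pG := predictable_stopped n pH.
have sG : sqint (stopped n H) by apply: (sqint_le pG pH sH) => t w; exact: stopped_le.
have [_ _ HI] := itoP P_complete B_brownian T_gt0 pH sH.
have [_ _ GI] := itoP P_complete B_brownian T_gt0 pG sG.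
apply: filterS2 (ito_constant_after pG sG) (ito_eq_local P_complete B_brownian T_gt0 pG pH GI HI).
move=> w h1 h2; have sT := stop_time_itv n w; have /andP[s0 sT'] := sT.
rewrite (h1 _ sT).
  apply: h2 => //; rewrite /energy; apply: integral0_eq => u; rewrite /= in_itv/= => /andP[u0 us].
  by rewrite /stopped aliveE ?us ?u0 ?(le_trans us)// subrr sqr_enorm dot0l.
move=> u /andP[su uT]; rewrite /stopped aliveE; last by rewrite uT (le_trans s0 (ltW su)).
by rewrite leNgt su.
Qed.

Lemma integral_alive n w (f : R -> \bar R) :
  (\int[leb]_(u in `[0%R, T]) (if alive n u w then f u else 0) =
   \int[leb]_(u in `[0%R, stop_time n w]) f u)%E.
Proof.
have /andP[s0 sT] := stop_time_itv n w.
rewrite integral_mkcond [RHS]integral_mkcond; apply: eq_integral => u _.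
rewrite !patchE !mem_setE !in_itv/=; case: ifPn => [uT|].
  rewrite aliveE//; case/andP: uT => -> _ /=; by [].
rewrite negb_and -!ltNge => /orP[u0|uT].
  by rewrite [0 <= u]leNgt u0.
by rewrite [u <= stop_time n w]leNgt (le_lt_trans sT uT) andbF.
Qed.

Lemma Rintegral_alive n w (f : R -> R) :
  \int[leb]_(u in `[0, T]) (if alive n u w then f u else 0) =
  \int[leb]_(u in `[0, stop_time n w]) f u.
Proof.
rewrite /Rintegral -integral_alive; congr fine; apply: eq_integral => u _.
by case: ifP.
Qed.

Lemma energy_stopped_le n H w : 0 <= n -> (clock T w < +oo)%E -> pred H ->
  (forall t, dot (H t w) (H t w) <= a t w) -> (energy (stopped n H) T w <= n%:E)%E.
Proof.
move=> n0 fin pH Ha; apply: (le_trans _ (clock_stop_time n0 fin)).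
have -> : energy (stopped n H) T w = (\int[leb]_(u in `[0%R, T])
   (if alive n u w then (dot (H u w) (H u w))%:E else 0))%E.
  apply: eq_integral => u _; rewrite sqr_enorm /stopped; case: ifP => // _.
  by rewrite dot0l.
have /andP[s0 sT] := stop_time_itv n w.
have sub : `[0, stop_time n w] `<=` `[0, T].
  by move=> u /=; rewrite !in_itv/= => /andP[-> /le_trans->].
rewrite integral_alive; apply: ge0_le_integral => //.
- by move=> u _; rewrite lee_fin dot_ge0.
- apply/measurable_EFinP; apply: (@measurable_funS _ _ _ _ `[0, T]) => //.
  exact: (predictable_path T_gt0 w (predictable_dot T_gt0 pH pH)).
- exact: a_path.
- by move=> u _; rewrite lee_fin.
Qed.

End stopping.

(** * Measurable projections *)

Section projections.
Context {R : realType} {n : nat}.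
Implicit Types (K : set 'cV[R]_n) (z p : 'cV[R]_n).

Lemma enorm_le_sqr (u v : 'cV[R]_n) : (enorm u <= enorm v) = (dot u u <= dot v v).
Proof. by rewrite /enorm ler_sqrt// dot_ge0. Qed.

Lemma is_proj_dot K z p : (forall x y (t : R), K x -> K y -> 0 <= t <= 1 -> K (t *: x + (1 - t) *: y)) ->
  is_proj K z p -> forall y, K y -> dot (z - p) (y - p) <= 0.
Proof.
move=> Kconv [Kp pmin] y Ky; rewrite leNgt; apply/negP => c0.
set c := dot (z - p) (y - p) in c0; set l := dot (y - p) (y - p).
have l0 : 0 <= l by exact: dot_ge0.
(* Moving from [p] towards [y] by [t] changes the squared distance by [- 2 t c + t^2 l], and
   [t l <= c] makes this negative. *)
pose t := c / (c + l); have cl : 0 < c + l by rewrite ltr_wpDr.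
have t0 : 0 < t by rewrite divr_gt0.
have t1 : t <= 1 by rewrite ler_pdivrMr// mul1r lerDl.
have t01 : 0 <= t <= 1 by rewrite ltW.
have := pmin _ (Kconv y p t Ky Kp t01); rewrite enorm_le_sqr.
have -> : z - (t *: y + (1 - t) *: p) = (z - p) - t *: (y - p).
  by rewrite scalerBl scale1r scalerBr !opprD !opprK !addrA; congr (_ + _); rewrite addrAC.
have -> (u v : 'cV[R]_n) : dot (u - t *: v) (u - t *: v) = dot u u - 2 * t * dot u v + t ^+ 2 * dot v v.
  by rewrite !(dotBl, dotBr, dotZl, dotZr) (dotC v u); ring.
rewrite -/l -/c.
have tl : t * l <= c.
  by rewrite /t mulrAC ler_pdivrMr// ler_pM2l// lerDr ltW.
move: (dot _ _) => k h; have h1 : t * (2 * c) <= t * (t * l) by lra.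
by move: h1; rewrite ler_pM2l//; lra.
Qed.

Lemma dist_proj K z p : is_proj K z p -> dist K z = enorm (z - p).
Proof.
move=> [Kp pmin]; apply/le_anti/andP; split.
  by apply: ge_inf; [exists 0 => _ [y _ <-]; exact: sqrtr_ge0|exists p].
by apply: lb_le_inf => [|_ [y Ky <-]]; [exists (enorm (z - p)), p|exact: pmin].
Qed.

Lemma convex_combination (C : set 'cV[R]_n) : convex_set (C : set (convex_lmodType 'cV[R]_n)) ->
  forall x y (t : R), C x -> C y -> 0 <= t <= 1 -> C (t *: x + (1 - t) *: y).
Proof.
move=> Cc x y t Cx Cy /andP[t0 t1].
by have /(_ (mem_set Cx) (mem_set Cy))/set_mem := Cc x y (Itv01 t0 t1).
Qed.

Lemma closed_coord (C : set 'cV[R]_n) (u : nat -> 'cV[R]_n) (l : 'cV[R]_n) : closed C ->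
  (forall k, C (u k)) -> (forall i, u k i 0 @[k --> \oo] --> l i 0) -> C l.
Proof.
move=> Ccl Cu ul; have nC : \forall k \near \oo, C (u k) by exact: nearW.
apply: (@closed_cvg _ _ _ _ u C Ccl nC l).
apply/cvg_ballP => e e0.
have : \forall k \near \oo, forall i, `|l i 0 - u k i 0| < e.
  by apply: filter_forall => i; have /cvgrPdist_lt := ul i; exact.
by apply: filterS => k hk; split => // i j; rewrite ord1; exact: hk.
Qed.

(** Each rational centre and radius selects a point of [C] in the corresponding box if there is one,
    and 0 otherwise. A box of radius below [e / 2] around a rational point near [y] then yields a
    point within [e] of [y]. *)
Lemma countable_dense_subset (C : set 'cV[R]_n) : C 0 -> exists c : nat -> 'cV[R]_n,
  (forall k, C (c k)) /\ forall y, C y -> forall e : R, 0 < e -> exists k, forall i, `|c k i 0 - y i 0| < e.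
Proof.
move=> C0.
have /choice[f hf] (x : 'cV[rat]_n * nat) : exists y : 'cV[R]_n, C y /\
    ((exists2 y', C y' & forall i, `|y' i 0 - ratr (x.1 i 0)| < x.2.+1%:R^-1) ->
     forall i, `|y i 0 - ratr (x.1 i 0)| < x.2.+1%:R^-1).
  have [[y Cy hy]|h] := pselect (exists2 y', C y' & forall i, `|y' i 0 - ratr (x.1 i 0)| < x.2.+1%:R^-1).
    by exists y.
  by exists 0; split => // /h.
exists (fun k => if unpickle k is Some x then f x else 0); split.
  by move=> k; case: (unpickle k) => // x; have [] := hf x.
move=> y Cy e e0; have e2 : 0 < e / 2 by rewrite divr_gt0.
have [k _ /(_ k (leqnn k))/= ke] := near_infty_natSinv_lt (PosNum e2).
have k0 : 0 < k.+1%:R^-1 :> R by rewrite invr_gt0 ltr0Sn.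
set r := k.+1%:R^-1 in ke k0.
have /choice[v hv] (i : 'I_n) : exists q : rat, `|y i 0 - ratr q| < r.
  have [|q] := @rat_in_itvoo R (y i 0 - r) (y i 0 + r); first by lra.
  by rewrite in_itv/= => /andP[h1 h2]; exists q; rewrite ltr_norml; apply/andP; split; lra.
pose x := (\col_i v i, k); exists (pickle x); rewrite pickleK => i.
have [_ hx] := hf x.
have h1 : `|f x i 0 - ratr (x.1 i 0)| < r.
  by apply: hx; exists y => // j; rewrite /= mxE; exact: hv.
have h2 := hv i; move: h1; rewrite /x/= mxE -/x => h1.
apply: (le_lt_trans (ler_distD (ratr (v i)) _ _)).
by move: h1 h2; rewrite [`|ratr _ - _|]distrC; move: ke; lra.
Qed.

End projections.

Section operator_bounds.
Context {R : realType} {d m : nat}.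

Lemma dot_mulmx_bound (A : 'M[R]_(m, d)) : exists2 s : R, 0 <= s &
  forall (v : 'cV[R]_d) (e : R), (forall i, `|v i 0| <= e) -> dot (A *m v) (A *m v) <= s * e ^+ 2.
Proof.
exists (\sum_j (\sum_i `|A j i|) ^+ 2); first by apply: sumr_ge0 => j _; rewrite sqr_ge0.
move=> v e hv; rewrite /dot mulr_suml; apply: ler_sum => j _.
rewrite -expr2 -exprMn -[leLHS]real_normK ?num_real//.
have h : `|(A *m v) j 0| <= (\sum_i `|A j i|) * e.
  rewrite mxE mulr_suml (le_trans (ler_norm_sum _ _ _))//; apply: ler_sum => i _.
  by rewrite normrM ler_wpM2l.
by apply: lerXn2r => //; rewrite nnegrE// (le_trans _ h).
Qed.

Lemma coord_mulmx_bound (G : 'M[R]_(d, m)) : exists2 s : R, 0 <= s &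
  forall (u : 'cV[R]_m) i, `|(G *m u) i 0| <= s * enorm u.
Proof.
exists (\sum_i \sum_j `|G i j|); first by apply: sumr_ge0 => i _; apply: sumr_ge0.
move=> u i; rewrite mxE (le_trans (ler_norm_sum _ _ _))//.
apply: (@le_trans _ _ ((\sum_j `|G i j|) * enorm u)).
  rewrite mulr_suml; apply: ler_sum => j _; rewrite normrM ler_wpM2l//.
  by rewrite -sqrtr_sqr; apply: ler_wsqrtr; exact: coord_sqr_le.
rewrite ler_wpM2r ?sqrtr_ge0// [leRHS](bigD1 i)//= lerDl.
by apply: sumr_ge0 => k _; apply: sumr_ge0.
Qed.

End operator_bounds.

Lemma cvg_sumr {R : realType} (I : Type) (r : seq I) (f : I -> nat -> R) (l : I -> R) :
  (forall i, f i n @[n --> \oo] --> l i) ->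
  \sum_(i <- r) f i n @[n --> \oo] --> \sum_(i <- r) l i.
Proof.
move=> fl; elim: r => [|i r IH]; first by rewrite big_nil; under eq_fun do rewrite big_nil; exact: cvg_cst.
by rewrite big_cons; under eq_fun do rewrite big_cons; exact: cvgD.
Qed.

(** [x exp (- ln (x^2))] is a composition of measurable functions and is right at 0 too, where both
    sides vanish. *)
Lemma measurable_invr_real {R : realType} : measurable_fun setT (fun x : R => x^-1).
Proof.
have -> : (fun x : R => x^-1) = (fun x => x * expR (- ln (x ^+ 2))).
  apply/funext => x; have [->|x0] := eqVneq x 0; first by rewrite invr0 mul0r.
  have x2 : x ^+ 2 \is Num.pos by rewrite posrE exprn_even_gt0//= x0.
  by rewrite expRN lnK// expr2 invfM mulrA divff// mul1r.
apply: measurable_funM => //; apply: measurableT_comp => //; apply: measurableT_comp => //.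
by apply: measurableT_comp.
Qed.

Section predictable_selection.
Context {disp : measure_display} {Om : measurableType disp} {R : realType}.
Context {m : nat}.
Variables (P : probability Om R) (T : R) (B : R -> Om -> 'cV[R]_m).
Hypothesis T_gt0 : 0 < T.
Local Notation Ft := (augmented_filtration P B).
Local Notation D0 := (`[0, T] `*` setT : set (R * Om)).

Lemma predictable_det k (A : R -> Om -> 'M[R]_k) : predictable_mx T Ft A ->
  predictable T Ft (fun t w => \det (A t w)).
Proof.
move=> pA; apply: predictable_sum => // s; apply: predictableM => //; first exact: predictable_cst.
by apply: predictable_prod.
Qed.

Lemma predictable_level (f : R -> Om -> R) (U : set R) (b : R -> Om -> bool) : predictable T Ft f ->
  measurable U -> (forall t w, b t w <-> U (f t w)) ->
  measurable (D0 `&` [set z | b z.1 z.2] : set (OmP P T B)).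
Proof.
move=> pf mU bU; apply/predictable_setsE => //; have := pf U mU; congr predictable_sets.
by apply/seteqP; split => z [h1 h2]; split => //=; apply/bU.
Qed.

(** The adjugate formula holds on the predictable set where the determinant is nonzero; elsewhere
    [invmx] returns the matrix itself. *)
Lemma predictable_invmx k (A : R -> Om -> 'M[R]_k) : predictable_mx T Ft A ->
  predictable_mx T Ft (fun t w => invmx (A t w)).
Proof.
move=> pA i j; have pdet := predictable_det pA.
have -> : (fun t w => invmx (A t w) i j) = (fun t w =>
    if \det (A t w) == 0 then A t w i j else (\det (A t w))^-1 * \adj (A t w) i j).
  apply/funext => t; apply/funext => w; rewrite /invmx unitmxE unitfE.
  by case: eqVneq => _ /=; rewrite ?mxE.
apply: predictable_ite => //.
  apply: (predictable_level (b := fun t w => \det (A t w) == 0) pdet (measurable_set1 0)) => t w.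
  by split => [/eqP|/= ->].
apply: predictableM => //; first exact: (predictable_comp T_gt0 measurable_invr_real).
have -> : (fun t w => \adj (A t w) i j) = (fun t w => cofactor (A t w) j i).
  by apply/funext => t; apply/funext => w; rewrite mxE.
apply: predictableM => //; first exact: predictable_cst.
apply: predictable_det => k' l.
have -> : (fun t w => row' j (col' i (A t w)) k' l) = (fun t w => A t w (lift j k') (lift i l)).
  by apply/funext => t; apply/funext => w; rewrite !mxE.
exact: pA.
Qed.

Variables (d : nat) (sigma : R -> Om -> 'M[R]_(d, m)) (C : set 'cV[R]_d) (z : R -> Om -> 'cV[R]_m).
Hypotheses (psigma : predictable_mx T Ft sigma) (pz : predictable_mx T Ft z).
Hypotheses (C_closed : closed C) (C0 : C 0).
Hypothesis C_convex : forall x y (t : R), C x -> C y -> 0 <= t <= 1 -> C (t *: x + (1 - t) *: y).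

Let phi t w y : R := dot ((sigma t w)^T *m y - z t w) ((sigma t w)^T *m y - z t w).
Let regular t w := \det (sigma t w *m (sigma t w)^T) != 0.

Section approximate_minimisers.
Variable c : nat -> 'cV[R]_d.
Hypothesis Cc : forall k, C (c k).
Hypothesis c_dense : forall y, C y -> forall e : R, 0 < e -> exists k, forall i, `|c k i 0 - y i 0| < e.

Let pphi k : predictable T Ft (fun t w => phi t w (c k)).
Proof.
have pu : predictable_mx T Ft (fun t w => (sigma t w)^T *m c k - z t w).
  apply: predictable_mxB => //; apply: predictable_mulmx => //; first exact: predictable_tr.
  exact: predictable_mx_const.
exact: predictable_dot.
Qed.

Let runmin : nat -> R -> Om -> R := fix run N t w :=
  if N is k.+1 then Num.min (run k t w) (phi t w (c k.+1)) else phi t w (c 0%N).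

Let infphi t w := inf (range (fun N => runmin N t w)).

Let runmin_ge0 N t w : 0 <= runmin N t w.
Proof. by elim: N => [|N IH] /=; [exact: dot_ge0|rewrite le_min IH dot_ge0]. Qed.

Let lb_runmin t w : has_lbound (range (fun N => runmin N t w)).
Proof. by exists 0 => _ [N _ <-]. Qed.

Let pinf : predictable T Ft infphi.
Proof.
apply: (predictable_limit T_gt0 (F := runmin)) => [N|t w _].
  elim: N => [|N IH]; first exact: pphi.
  have minp f g : predictable T Ft f -> predictable T Ft g ->
      predictable T Ft (fun t w => Num.min (f t w) (g t w)).
    move=> /predictableP-/(_ T_gt0) pf /predictableP-/(_ T_gt0) pg.
    by apply/predictableP => //; exact: measurable_minr.
  exact: minp IH (pphi _).
apply: nonincreasing_cvgn; last exact: lb_runmin.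
by apply/nonincreasing_seqP => N /=; rewrite ge_min lexx.
Qed.

Let inf_le k t w : infphi t w <= phi t w (c k).
Proof.
apply: (@le_trans _ _ (runmin k t w)); first by apply: ge_inf => //; exists k.
by case: k => [|k] //=; rewrite ge_min lexx orbT.
Qed.

Let inf_approx t w (e : R) : 0 < e -> exists k, phi t w (c k) < infphi t w + e.
Proof.
move=> e0; have [|_ [N _ <-] hN] := @inf_adherent _ (range (fun N => runmin N t w)) _ e0.
  by split => //; exists (runmin 0 t w); exists 0%N.
elim: N hN => [|N IH] /= hN; first by exists 0%N.
by move: hN; rewrite gt_min => /orP[/IH//|h]; exists N.+1.
Qed.

Let phi_close y x t w (e : R) : 0 < e ->
  phi t w y <= (1 + e) * phi t w x + (1 + e^-1) * dot ((sigma t w)^T *m (y - x)) ((sigma t w)^T *m (y - x)).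
Proof.
move=> e0; apply: (le_trans (dot_sqr_add _ ((sigma t w)^T *m x - z t w) e0)).
by rewrite opprB addrA subrK -mulmxBr.
Qed.

Let inf_min y t w : C y -> infphi t w <= phi t w y.
Proof.
move=> Cy; have [s s0 hs] := dot_mulmx_bound (sigma t w)^T.
apply/ler_addgt0Pr => e e0.
have p0 : 0 <= phi t w y by exact: dot_ge0.
(* The error [e] is split in two: [x] controls the growth of the main term, and [r] the distance to
   the dense sequence, seen through the bound [s] on the matrix. *)
pose x := e / (2 * (phi t w y + 1)); have x0 : 0 < x by rewrite divr_gt0// mulr_gt0// ltr_wpDl.
have x1 : 0 < 1 + x^-1 by rewrite addr_gt0// invr_gt0.
have s1 : 0 < s + 1 by rewrite ltr_wpDl.
have k0 : 0 < 2 * ((1 + x^-1) * (s + 1)) by rewrite !mulr_gt0.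
pose r := Num.min 1 (e / (2 * ((1 + x^-1) * (s + 1)))).
have r0 : 0 < r by rewrite lt_min ltr01 divr_gt0.
have [k hk] := c_dense Cy r0.
apply: (le_trans (inf_le k t w)); apply: (le_trans (phi_close (c k) y t w x0)).
have h1 : dot ((sigma t w)^T *m (c k - y)) ((sigma t w)^T *m (c k - y)) <= s * r ^+ 2.
  by apply: hs => i; rewrite !mxE ltW.
have r1 : r <= 1 by rewrite ge_min lexx.
have r2 : r * (2 * ((1 + x^-1) * (s + 1))) <= e.
  by rewrite -ler_pdivlMr// ge_min lexx orbT.
have h2 : (1 + x^-1) * (s * r ^+ 2) <= (1 + x^-1) * (s + 1) * r.
  rewrite -mulrA ler_pM2l//.
  by apply: ler_pM => //; [exact: sqr_ge0|rewrite lerDl|rewrite expr2 ler_piMr// ltW].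
have h3 : (1 + x^-1) * dot ((sigma t w)^T *m (c k - y)) ((sigma t w)^T *m (c k - y)) <= (1 + x^-1) * (s * r ^+ 2).
  by rewrite ler_pM2l.
have h4 : x * phi t w y <= e / 2.
  have -> : e / 2 = x * (phi t w y + 1) by rewrite /x; field; rewrite gt_eqF// ltr_wpDl.
  by rewrite ler_pM2l// lerDl.
move: (le_trans h3 h2) r2 h4; rewrite mulrDl mul1r; lra.
Qed.

Let small n k t w := phi t w (c k) <= infphi t w + n.+1%:R^-1.

(** [N] is fuel for the search of the first suitable index. Every stage is a finite case
    distinction, hence predictable, and the search stabilises as [N] grows. *)
Let pick_first n : nat -> nat -> R -> Om -> 'cV[R]_d := fix pk N k t w :=
  if N is N'.+1 then (if small n k t w then c k else pk N' k.+1 t w) else 0.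

Let ppick n N k : predictable_mx T Ft (pick_first n N k).
Proof.
elim: N k => [|N IH] k i j; first exact: predictable_cst.
have -> : (fun t w => pick_first n N.+1 k t w i j) =
    (fun t w => if small n k t w then c k i j else pick_first n N k.+1 t w i j).
  by apply/funext => t; apply/funext => w /=; case: ifP.
apply: predictable_ite => //; [|exact: predictable_cst|exact: IH].
have pd : predictable T Ft (fun t w => phi t w (c k) - infphi t w).
  have := predictableD T_gt0 (pphi k) (predictableM T_gt0 (predictable_cst T_gt0 (-1)) pinf).
  by congr predictable; apply/funext => t; apply/funext => w; rewrite mulN1r.
apply: (predictable_level pd (measurable_itv `]-oo, n.+1%:R^-1])) => t w.
by rewrite /small/= in_itv/= lerBlDl.
Qed.

Let pick_firstP n t w : exists2 k, small n k t w & \forall N \near \oo, pick_first n N 0%N t w = c k.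
Proof.
have e0 : 0 < n.+1%:R^-1 :> R by rewrite invr_gt0 ltr0Sn.
have ex : exists k, small n k t w by have [k /ltW] := inf_approx t w e0; exists k.
pose k := ex_minn ex; have [sk mk] : small n k t w /\ forall l, small n l t w -> (k <= l)%N.
  by rewrite /k; case: ex_minnP.
exists k => //; exists k.+1 => // N /= kN.
have key j l : (l + j = k)%N -> forall M, (j < M)%N -> pick_first n M l t w = c k.
  elim: j l => [|j IH] l; first by rewrite addn0 => -> [|M] //= _; rewrite sk.
  move=> lj [|M] //= jM; case: ifPn => [/mk|_]; first by rewrite -lj addnS ltnNge leq_addr.
  by apply: IH; rewrite ?addSn -?addnS.
exact: (key k 0%N).
Qed.

Let approx_min n t w : 'cV[R]_d := c (xget 0%N [set k | small n k t w /\
  \forall N \near \oo, pick_first n N 0%N t w = c k]).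

Let approx_minP n t w : phi t w (approx_min n t w) <= infphi t w + n.+1%:R^-1 /\
  \forall N \near \oo, pick_first n N 0%N t w = approx_min n t w.
Proof.
rewrite /approx_min; case: xgetP => [k _ //|h].
by have [k sk hk] := pick_firstP n t w; have := h k; case.
Qed.

Let papprox n : predictable_mx T Ft (approx_min n).
Proof.
move=> i j; apply: (predictable_limit T_gt0 (F := fun N t w => pick_first n N 0%N t w i j)).
  by move=> N; exact: ppick.
move=> t w _; apply: cvg_near_cst; have [_] := approx_minP n t w.
by apply: filterS => N ->.
Qed.

(** Parallelogram law: by convexity the midpoint of two near-minimisers is in [C] and cannot beat
    the infimum, so their images are close to each other. *)
Let approx_close n k t w : (n <= k)%N ->
  dot ((sigma t w)^T *m (approx_min k t w - approx_min n t w))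
      ((sigma t w)^T *m (approx_min k t w - approx_min n t w)) <= 4 * n.+1%:R^-1.
Proof.
move=> nk; set a := approx_min k t w; set b := approx_min n t w.
have [ha _] := approx_minP k t w; have [hb _] := approx_minP n t w.
have Ca : C a by exact: Cc. have Cb : C b by exact: Cc.
have h01 : 0 <= (2^-1 : R) <= 1 by apply/andP; split; lra.
have := inf_min t w (C_convex Ca Cb h01).
have kn : k.+1%:R^-1 <= n.+1%:R^-1 :> R by rewrite lef_pV2 ?posrE ?ltr0Sn// ler_nat.
have -> : 1 - 2^-1 = 2^-1 :> R by lra.
have -> : phi t w (2^-1 *: a + 2^-1 *: b) = 2^-1 * phi t w a + 2^-1 * phi t w b -
   4^-1 * dot ((sigma t w)^T *m (a - b)) ((sigma t w)^T *m (a - b)).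
  rewrite /phi mulmxDr mulmxBr -!scalemxAr; set u := _ *m a; set v := _ *m b; set zz := z t w.
  rewrite !(dotDl, dotDr, dotBl, dotBr, dotZl, dotZr, dotNl, dotNr).
  by rewrite (dotC v u) (dotC zz u) (dotC zz v); field.
by move: ha hb kn; rewrite -/a -/b; set r := n.+1%:R^-1; set r' := k.+1%:R^-1; lra.
Qed.

(** [(sigma sigma^tr)^-1 sigma] is a left inverse of [sigma^tr]. It transfers the Cauchy property
    from the images to the strategies themselves. *)
Let regular_inj t w : regular t w -> exists2 s : R, 0 <= s &
  forall (v : 'cV[R]_d) i, `|v i 0| <= s * enorm ((sigma t w)^T *m v).
Proof.
rewrite /regular => h; have [s s0 hs] := coord_mulmx_bound (invmx (sigma t w *m (sigma t w)^T) *m sigma t w).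
exists s => // v i; have := hs ((sigma t w)^T *m v) i.
by rewrite -mulmxA (mulmxA (sigma t w)) mulKmx// unitmxE unitfE.
Qed.

Let approx_cvg t w i : regular t w -> cvgn (fun n => approx_min n t w i 0).
Proof.
move=> reg; have [s s0 hs] := regular_inj reg.
apply/cauchy_cvgP/cauchy_exP => e e0.
(* Squared coordinate distances are at most [4 s^2 / (N + 1)]; the 1 added to the denominator covers
   [s = 0]. *)
have e2 : 0 < e ^+ 2 / (4 * s ^+ 2 + 1).
  by rewrite divr_gt0// ?exprn_gt0// ltr_wpDl// mulr_ge0// sqr_ge0.
have [N _ /(_ N (leqnn N))/= hN] := near_infty_natSinv_lt (PosNum e2).
exists (approx_min N t w i 0); exists N => // k /= Nk.
rewrite /ball/= distrC; have := hs (approx_min k t w - approx_min N t w) i; rewrite !mxE => h.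
have r0 : 0 <= enorm ((sigma t w)^T *m (approx_min k t w - approx_min N t w)) by exact: sqrtr_ge0.
have := approx_close t w Nk; rewrite -sqr_enorm; move: hN h r0; rewrite ltr_pdivlMr ?ltr_wpDl// ?mulr_ge0 ?sqr_ge0//.
set E := enorm _; set x := `|_|; set r := N.+1%:R^-1 => h1 h2 E0 h3.
have x0 : 0 <= x by rewrite normr_ge0.
have r0 : 0 < r by rewrite invr_gt0 ltr0Sn.
rewrite -(ltr_pXn2r (n := 2)) ?nnegrE ?(ltW e0)//.
apply: (@le_lt_trans _ _ (s ^+ 2 * (4 * r))).
  apply: (@le_trans _ _ ((s * E) ^+ 2)); first by apply: lerXn2r; rewrite ?nnegrE// mulr_ge0.
  by rewrite exprMn ler_wpM2l// sqr_ge0.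
by move: h1; rewrite mulrDr mulr1; move: r0; lra.
Qed.

Let regular_predictable : measurable (D0 `&` [set x | regular x.1 x.2] : set (OmP P T B)).
Proof.
have pdet : predictable T Ft (fun t w => \det (sigma t w *m (sigma t w)^T)).
  by apply: predictable_det; apply: predictable_mulmx => //; exact: predictable_tr.
apply: (predictable_level (b := regular) pdet (U := ~` [set 0])).
  by apply: measurableC; exact: measurable_set1.
by move=> t w; split => /eqP.
Qed.

Let selection t w : 'cV[R]_d := if regular t w then \col_i limn (fun n => approx_min n t w i 0) else 0.

Let selection_cvg t w i : regular t w -> approx_min n t w i 0 @[n --> \oo] --> selection t w i 0.
Proof. by move=> reg; rewrite /selection reg mxE; exact: approx_cvg. Qed.

Let selection_in t w : C (selection t w).
Proof.
have [reg|nreg] := boolP (regular t w); last by rewrite /selection (negbTE nreg).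
by apply: (closed_coord (u := fun n => approx_min n t w) C_closed) => [k|i]; [exact: Cc|exact: selection_cvg].
Qed.

Let selection_min t w y : regular t w -> C y -> phi t w (selection t w) <= phi t w y.
Proof.
move=> reg Cy; apply: le_trans (inf_min t w Cy).
have cv : phi t w (approx_min n t w) @[n --> \oo] --> phi t w (selection t w).
  have uE (v : 'cV[R]_d) j : ((sigma t w)^T *m v - z t w) j 0 =
      \sum_l (sigma t w)^T j l * v l 0 - z t w j 0 by rewrite !mxE.
  apply: cvg_sumr => j; have h : ((sigma t w)^T *m approx_min n t w - z t w) j 0 @[n --> \oo] -->
     ((sigma t w)^T *m selection t w - z t w) j 0.
    rewrite uE; under eq_fun do rewrite uE; apply: cvgB; last exact: cvg_cst.
    by apply: cvg_sumr => i; apply: cvgM; [exact: cvg_cst|exact: selection_cvg].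
  exact: cvgM.
have cv' : infphi t w + n.+1%:R^-1 @[n --> \oo] --> infphi t w + 0.
  by apply: cvgD; [exact: cvg_cst|exact: cvg_harmonic].
rewrite -[leRHS]addr0; apply: (ler_cvg_to cv cv').
by apply: nearW => n; have [] := approx_minP n t w.
Qed.

Let selection_predictable : predictable_mx T Ft selection.
Proof.
move=> i j; rewrite ord1 {j}.
apply: (predictable_limit T_gt0 (F := fun n t w => if regular t w then approx_min n t w i 0 else 0)).
  move=> n; apply: predictable_ite => //; last exact: predictable_cst.
  exact: papprox.
move=> t w _; have [reg|nreg] := boolP (regular t w); first exact: selection_cvg.
by rewrite /selection (negbTE nreg) mxE; exact: cvg_cst.
Qed.

(** Approximate minimisers over the dense sequence converge where [sigma sigma^tr] is invertible.
    The limit stays in [C] by closedness and attains the infimum by continuity; elsewhere the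
    selection is 0, a point of [C]. *)
Lemma selection_exists : exists pi : R -> Om -> 'cV[R]_d, [/\ predictable_mx T Ft pi,
  forall t w, C (pi t w) &
  forall t w, sigma t w *m (sigma t w)^T \in unitmx ->
    is_proj [set (sigma t w)^T *m y | y in C] (z t w) ((sigma t w)^T *m pi t w)].
Proof.
exists selection; split => // t w; rewrite unitmxE unitfE => reg; split; first by exists (selection t w).
move=> _ [y Cy <-]; rewrite -(opprB _ (z t w)) -[X in _ <= enorm X]opprB.
by rewrite enorm_le_sqr !(dotNl, dotNr) !opprK; exact: selection_min.
Qed.

End approximate_minimisers.

Theorem projection_selection : exists pi : R -> Om -> 'cV[R]_d, [/\ predictable_mx T Ft pi,
  forall t w, C (pi t w) &
  forall t w, sigma t w *m (sigma t w)^T \in unitmx ->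
    is_proj [set (sigma t w)^T *m y | y in C] (z t w) ((sigma t w)^T *m pi t w)].
Proof.
by have [c [Cc cd]] := countable_dense_subset C0; exact: (selection_exists Cc cd).
Qed.

End predictable_selection.

(** * Almost sure constancy and change of measure *)

Section trivial_sigma_field.
Context {disp : measure_display} {Om : measurableType disp} {R : realType} {m : nat}.
Variables (P : probability Om R) (T : R) (B : R -> Om -> 'cV[R]_m).
Hypothesis P_complete : measure_is_complete P.
Hypothesis B_brownian : brownian_motion P T B.
Hypothesis T_gt0 : 0 < T.
Local Notation Ft := (augmented_filtration P B).
Let mB := brownian_measurable B_brownian.

(** The only raw information at time 0 is [B 0], almost surely equal to 0, so all generators have
    probability 0 or 1, and such events form a sigma-algebra. *)
Lemma F0_trivial (A : set Om) : Ft 0 A -> {ae P, forall w, A w} \/ {ae P, forall w, ~ A w}.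
Proof.
pose M := [set A : set Om | {ae P, forall w, A w} \/ {ae P, forall w, ~ A w}].
suff h : Ft 0 `<=` M by move=> /h.
apply: smallest_sub; first split.
- by right; apply: aeW => w [].
- by move=> C [h|h]; [right|left]; apply: filterS h => w Cw; rewrite setTD.
- move=> F MF; have [[n hn]|/forallNP h] := pselect (exists n, {ae P, forall w, F n w}).
    by left; apply: filterS hn => w Fw; exists n.
  have h' n : {ae P, forall w, ~ F n w} by case: (MF n) => // /h.
  by right; have /ae_foralln := h'; apply: filterS => w Fw [n _ /Fw].
- move=> C [[s [i [U [/andP[s0 s0'] mU ->]]]]|nC]; last first.
    by right; apply: negligibleS nC => w /contrapT.
  have -> : s = 0 by apply/le_anti; rewrite s0'.
  have [_ B0 _ _] := B_brownian.
  have [U0|nU0] := pselect (U 0); [left|right]; apply: filterS B0 => w Bw /=.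
    by rewrite Bw mxE.
  by rewrite Bw mxE.
Qed.

(** Each level is exceeded either almost surely or almost never, and the constant is the supremum of
    the levels exceeded almost surely. *)
Lemma ae_constant (f : Om -> R) : measurable_wrt (Ft 0) f -> exists y : R, {ae P, forall w, f w = y}.
Proof.
move=> mf.
have tri (r : R) : {ae P, forall w, r < f w} \/ {ae P, forall w, ~ (r < f w)}.
  have := F0_trivial (mf `]r, +oo[%classic (measurable_itv _)).
  by case=> h; [left|right]; apply: filterS h => w; rewrite /= in_itv/= andbT.
have ae_false : {ae P, forall w : Om, False} -> False.
  move=> [N [_ N0 /= sub]]; have : P N = 1%E.
    have -> : N = setT by apply/seteqP; split => // w _; apply: sub.
    exact: probability_setT.
  by rewrite N0 => /eqP; rewrite eq_sym onee_eq0.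
pose S := [set r : R | {ae P, forall w, r < f w}].
have S0 : S !=set0.
  apply: contrapT => nS; apply: ae_false.
  have h n : {ae P, forall w, ~ (- n%:R < f w)}.
    by case: (tri (- n%:R)) => // h; exfalso; apply: nS; exists (- n%:R).
  have /ae_foralln := h; apply: filterS => w hw.
  have [n _ /(_ n (leqnn n))] : \forall n \near \oo, - f w < (n%:R : R) by exact: nbhs_infty_gtr.
  by rewrite /= ltrNl; exact: hw.
have [n nS] : exists n : nat, {ae P, forall w, ~ (n%:R < f w)}.
  apply: contrapT => /forallNP h; apply: ae_false.
  have h' n : {ae P, forall w, n%:R < f w} by case: (tri n%:R) => // /h.
  have /ae_foralln := h'; apply: filterS => w hw.
  have [n _ /(_ n (leqnn n))] : \forall n \near \oo, f w < (n%:R : R) by exact: nbhs_infty_gtr.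
  by move=> /= /lt_trans-/(_ _ (hw n)); rewrite ltxx.
have ub r : S r -> r <= n%:R.
  move=> Sr; rewrite leNgt; apply/negP => nr; apply: ae_false.
  by apply: filterS2 nS Sr => w h1 h2; apply: h1; exact: lt_trans h2.
have ubS : has_ubound S by exists n%:R.
exists (sup S).
have k0 k : 0 < k.+1%:R^-1 :> R by rewrite invr_gt0 ltr0Sn.
have lo k : {ae P, forall w, sup S - k.+1%:R^-1 < f w}.
  have [r Sr hr] := @sup_adherent _ S _ (k0 k) (conj S0 ubS).
  by apply: filterS Sr => w; exact: lt_trans.
have hi k : {ae P, forall w, ~ (sup S + k.+1%:R^-1 < f w)}.
  case: (tri (sup S + k.+1%:R^-1)) => // h; exfalso.
  have : sup S + k.+1%:R^-1 <= sup S by apply: ub_le_sup.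
  by rewrite gerDl leNgt k0.
have /ae_foralln lo' := lo; have /ae_foralln hi' := hi.
apply: filterS2 lo' hi' => w h1 h2.
apply/eqP; rewrite -subr_eq0 -normr_eq0 eq_le normr_ge0 andbT.
apply/ler_addgt0Pr => e e0; rewrite add0r.
have [k _ /(_ k (leqnn k))/= ke] := near_infty_natSinv_lt (PosNum e0).
have := h1 k; have /negP := h2 k; rewrite -leNgt; move: ke; set r := k.+1%:R^-1.
by rewrite ler_norml => ? ? ?; apply/andP; split; lra.
Qed.

(** Tonelli's theorem exchanges the quantifiers. Admissibility constrains a strategy at each time up
    to a null set, whereas pathwise integrals need almost every time on almost every path. *)
Lemma ae_time (g : R -> Om -> R) : predictable T Ft g -> (forall t w, 0 <= g t w) ->
  (forall t, 0 <= t <= T -> {ae P, forall w, g t w = 0}) ->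
  {ae P, forall w, {ae @lebesgue_measure R, forall t, `[0, T]%classic t -> g t w = 0}}.
Proof.
move=> pg g0 gt0; have T0T : 0 <= T <= T by rewrite lexx ltW.
have mI : measurable (`[0, T]%classic : set (measurableTypeR R)) by exact: measurable_itv.
have pf := proj1 (predictableP _ _ T_gt0 _) pg.
have mf : measurable_fun (`[0, T] `*` setT : set (measurableTypeR R * Om)) (fun z => g z.1 z.2).
  exact: (measurable_fun_prod_Ft P_complete mB (lexx T) mI (predictable_fun_progressive T_gt0 T0T pf)).
pose f : measurableTypeR R * Om -> \bar R := (fun z => (g z.1 z.2)%:E) \_ (`[0, T] `*` setT).
have mff : measurable_fun setT f.
  apply/(measurable_restrictT (fun z : measurableTypeR R * Om => (g z.1 z.2)%:E)); first exact: measurableX.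
  exact/measurable_EFinP.
have f0 z : (0 <= f z)%E by rewrite /f patchE; case: ifP => // _; rewrite lee_fin.
have := @fubini_tonelli _ _ (measurableTypeR R) Om R (@lebesgue_measure R) P f mff f0.
rewrite integral0_eq; last first.
  move=> t _; rewrite /f; have [tT|tT] := boolP (t \in (`[0, T]%classic : set R)).
    have /gt0 h : 0 <= t <= T by move/set_mem : tT; rewrite /= in_itv.
    rewrite -[RHS](@integral0 _ _ _ P setT); apply: ae_eq_integral => //.
      apply: (measurableT_comp mff); apply/measurable_fun_pairP; split; [exact: measurable_cst|exact: measurable_id].
    by apply: filterS h => w h _; rewrite patchE; case: ifP => //= _; rewrite h.
  apply: integral0_eq => w _; rewrite patchE memNset// => -[/= h _].
  by move/negP: tT; apply; exact/mem_set.
move=> /esym h0.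
have mint : measurable_fun setT (fun w => \int[@lebesgue_measure R]_t f (t, w))%E.
  apply: (@measurable_fun_integral _ _ (measurableTypeR R) Om R (@lebesgue_measure R) setT f) => //.
  by rewrite setXTT.
have /(ae_eq_integral_abs P measurableT mint) : (\int[P]_w `|\int[@lebesgue_measure R]_t f (t, w)| = 0)%E.
  by rewrite -h0; apply: eq_integral => w _; rewrite gee0_abs// integral_ge0.
apply: filterS => w /(_ Logic.I)/= hw.
have mfw : measurable_fun setT (fun t : measurableTypeR R => f (t, w)).
  apply: (measurableT_comp mff); apply/measurable_fun_pairP; split; [exact: measurable_id|exact: measurable_cst].
have /(ae_eq_integral_abs (@lebesgue_measure R) measurableT mfw) : (\int[@lebesgue_measure R]_t `|f (t, w)| = 0)%E.
  by rewrite -hw; apply: eq_integral => t _; rewrite gee0_abs.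
apply: filterS => t /(_ Logic.I); rewrite /f patchE /= => h tT.
by move: h; rewrite mem_set// => -[].
Qed.

(** A closed set is described by countably many distances to a dense sequence, so the excursions of
    [pi] outside [C] form a predictable set, to which the exchange of quantifiers applies. *)
Lemma ae_time_closed d (C : set 'cV[R]_d) (pi : R -> Om -> 'cV[R]_d) : predictable_mx T Ft pi ->
  closed C -> C 0 -> (forall t, 0 <= t <= T -> {ae P, forall w, C (pi t w)}) ->
  {ae P, forall w, {ae @lebesgue_measure R, forall t, `[0, T]%classic t -> C (pi t w)}}.
Proof.
move=> ppi Ccl C0 Cpi; have [c [Cc cd]] := countable_dense_subset C0.
have CE y : C y <-> forall n, exists k, dot (y - c k) (y - c k) <= n.+1%:R^-1.
  split=> [Cy n|h].
    (* A coordinate error [r <= 1] gives a squared distance of at most [d r^2 <= d r], and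
       [(d + 1) r] is [1 / (n + 1)]. *)
    have r0 : 0 < (n.+1%:R * (d%:R + 1))^-1 :> R.
      by rewrite invr_gt0 mulr_gt0 ?ltr0Sn// ltr_wpDl.
    have [k hk] := cd y Cy _ r0; exists k.
    set r := _^-1 in r0 hk; have r1 : r <= 1.
      by rewrite invf_le1 ?mulr_gt0 ?ltr0Sn ?ltr_wpDl// mulr_ege1 ?ler1n// lerDr.
    apply: (@le_trans _ _ (\sum_(i < d) r)).
      apply: ler_sum => i _; rewrite -expr2 -[leLHS]real_normK ?num_real// !mxE distrC.
      by rewrite (le_trans (y := r ^+ 2))// ?lerXn2r ?nnegrE ?(ltW (hk i)) ?(ltW r0)// expr2 ler_piMr// ltW.
    rewrite sumr_const card_ord -(mulr_natr r).
    have -> : n.+1%:R^-1 = r * (d%:R + 1) by rewrite /r invfM divfK// natr1 pnatr_eq0.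
    by rewrite ler_pM2l// lerDl.
  have /choice[k hk] := h; apply: (closed_coord (u := fun n => c (k n)) Ccl) => [n|i]; first exact: Cc.
  apply/cvgrPdist_lt => e e0; have e2 : 0 < e ^+ 2 by rewrite exprn_gt0.
  have [N _ hN] := near_infty_natSinv_lt (PosNum e2).
  exists N => // n /= Nn; rewrite -(ltr_pXn2r (n := 2)) ?nnegrE ?(ltW e0)// real_normK ?num_real//.
  apply: le_lt_trans (hN n Nn); apply: le_trans (hk n).
  by have := coord_sqr_le (y - c (k n)) i; rewrite !mxE.
pose bad t w : bool := `[< ~ C (pi t w) >].
have mbad : measurable ((`[0, T] `*` setT) `&` [set z | bad z.1 z.2] : set (OmP P T B)).
  have -> : (`[0, T] `*` setT) `&` [set z | bad z.1 z.2] = (`[0, T] `*` setT) `\`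
     \bigcap_n \bigcup_k ((`[0, T] `*` setT) `&`
       [set z | dot (pi z.1 z.2 - c k) (pi z.1 z.2 - c k) <= n.+1%:R^-1]).
    apply/seteqP; split => [z [Dz /asboolP nC]|z [Dz nh]]; split => //.
      by move=> h; apply: nC; apply/CE => n; have [k _ [_ hk]] := h n Logic.I; exists k.
    by apply/asboolP => /CE h; apply: nh => n _; have [k hk] := h n; exists k.
  apply: measurableD; first exact: predictable_dom.
  apply: bigcapT_measurable => n; apply: bigcupT_measurable => k.
  have pu : predictable T Ft (fun t w => dot (pi t w - c k) (pi t w - c k)).
    by apply: predictable_dot => //; apply: predictable_mxB => //; exact: predictable_mx_const.
  apply: (predictable_level (b := fun t w => dot (pi t w - c k) (pi t w - c k) <= n.+1%:R^-1) T_gt0 pu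
    (measurable_itv `]-oo, n.+1%:R^-1])) => t w.
  by rewrite /= in_itv.
have pg : predictable T Ft (fun t w => if bad t w then 1 else 0).
  by apply: predictable_ite => //; exact: predictable_cst.
have := ae_time pg (fun t w => _) _; move=> /(_ _ _)/wrap[].
- by move=> t w; case: ifP.
- by move=> t /Cpi; apply: filterS => w Cw; rewrite /bad; case: ifP => // /asboolP.
apply: filterS => w; apply: negligibleS => t /= nC h; apply: nC => tT; have := h tT.
by rewrite /bad; case: ifP => [_ /eqP|/asboolP/contrapT//]; rewrite oner_eq0.
Qed.

End trivial_sigma_field.

Section change_of_measure.
Context {disp : measure_display} {Om : measurableType disp} {R : realType} {m : nat}.
Variables (P Q : probability Om R) (T : R) (B : R -> Om -> 'cV[R]_m) (D : Om -> R).
Hypothesis P_complete : measure_is_complete P.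
Hypothesis B_brownian : brownian_motion P T B.
Local Notation Ft := (augmented_filtration P B).
Let mB := brownian_measurable B_brownian.
Hypotheses (mD : measurable_fun setT D) (D_ge0 : forall w, 0 <= D w).
Hypothesis QD : forall A, Ft T A -> Q A = (\int[P]_(w in A) (D w)%:E)%E.

Let idF_mixin := isMeasurableFun.Build _ _ _ _ (id : Om -> OmF P B T)
  (Ft_measurable_id P_complete mB (lexx T)).
Let idF : {mfun Om >-> OmF P B T} := HB.pack (id : Om -> OmF P B T) idF_mixin.

(** [D] is a density of [Q] on [Ft T] only, so [f] is integrated over [Om] under that sigma-algebra,
    on which the image of [Q] is determined. *)
Lemma integral_change_ge0 (f : Om -> \bar R) : measurable_fun setT (f : OmF P B T -> \bar R) ->
  (forall w, 0 <= f w)%E -> (\int[Q]_w f w = \int[P]_w (f w * (D w)%:E))%E.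
Proof.
move=> mf f0.
rewrite (@ge0_integral_law _ _ _ P _ (OmF P B T) (id : Om -> OmF P B T) D (distribution Q idF) _ mD D_ge0 _ f mf f0).
- by rewrite ge0_integral_distribution.
- exact: (Ft_measurable_id P_complete mB (lexx T)).
- by move=> C mC; rewrite -QD.
Qed.

Lemma integral_change (f : Om -> R) : measurable_wrt (Ft T) f ->
  P.-integrable setT (EFin \o (fun w => f w * D w)) ->
  Q.-integrable setT (EFin \o f) /\ (\int[Q]_w (f w)%:E = \int[P]_w (f w * D w)%:E)%E.
Proof.
move=> mf If; have mf' : measurable_fun setT (f : OmF P B T -> R) by exact/measurable_wrtP.
have mfE : measurable_fun setT ((EFin \o f) : OmF P B T -> \bar R) by exact/measurable_EFinP.
split.
  apply/integrableP; split.
    apply/measurable_EFinP; exact: (measurable_wrt_Om P_complete mB (f := fun=> f) (lexx T)).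
  rewrite (@integral_change_ge0 (fun w => `|(f w)%:E|)%E)//; last exact: measurableT_comp.
  have /integrableP[_] := If; congr (_ < _)%E; apply: eq_integral => w _.
  by rewrite /= -EFinM normrM (ger0_norm (D_ge0 w)).
rewrite [LHS]integralE [RHS]integralE; congr (_ - _)%E.
  rewrite integral_change_ge0//; last exact: measurable_funepos.
  apply: eq_integral => w _; rewrite !funeposE /= -!EFin_max -EFinM; congr _%:E.
  by rewrite maxr_pMl// mul0r.
rewrite integral_change_ge0//; last exact: measurable_funeneg.
apply: eq_integral => w _; rewrite !funenegE /= -!EFin_max -EFinM; congr _%:E.
by rewrite maxr_pMl// mul0r mulNr.
Qed.

End change_of_measure.

(** * Martingales under the changed measure *)

Lemma young_weighted {R : realFieldType} (x y e : R) : 0 < e ->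
  `|x * y| <= 2^-1 * e * x ^+ 2 + 2^-1 * e^-1 * y ^+ 2.
Proof.
move=> e0; have h1 := sqr_ge0 (e * x - y); have h2 := sqr_ge0 (e * x + y).
have -> : 2^-1 * e * x ^+ 2 + 2^-1 * e^-1 * y ^+ 2 = e^-1 * (2^-1 * ((e * x) ^+ 2 + y ^+ 2)).
  by field; rewrite gt_eqF.
have -> : `|x * y| = e^-1 * `|(e * x) * y|.
  by rewrite -(mulrA e) (normrM e) (gtr0_norm e0) mulKf ?gt_eqF.
rewrite ler_pM2l ?invr_gt0// ler_norml; move: h1 h2; rewrite sqrrB sqrrD; lra.
Qed.

Section girsanov.
Context {disp : measure_display} {Om : measurableType disp} {R : realType} {m : nat}.
Variables (P : probability Om R) (T : R) (B : R -> Om -> 'cV[R]_m).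
Hypothesis P_complete : measure_is_complete P.
Hypothesis B_brownian : brownian_motion P T B.
Hypothesis T_gt0 : 0 < T.

Local Notation Ft := (augmented_filtration P B).
Local Notation leb := (@lebesgue_measure R).
Let mB := brownian_measurable B_brownian.
Local Notation pred := (predictable_mx T Ft).
Local Notation sqint := (square_integrable P T).
Local Notation ito := (ito P T B).
Local Notation D0 := (`[0, T] `*` setT : set (R * Om)).
Implicit Types (H G q : R -> Om -> 'cV[R]_m).
Let T0T : 0 <= T <= T. Proof. by rewrite lexx ltW. Qed.

(* The discriminant of [a |-> int |H + a G|^2]. *)
Lemma dot_integral_sqr_le H G w : pred H -> pred G -> (energy H T w < +oo)%E -> (energy G T w < +oo)%E ->
  (\int[leb]_(u in `[0, T]) dot (G u w) (H u w)) ^+ 2 <= qvar G T w * qvar H T w.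
Proof.
move=> pH pG fH fG; have h a := qvarD T_gt0 a pH pG fH fG.
set x := \int[leb]_(u in _) _ in h *; set g := qvar G T w in h *; set k := qvar H T w in h *.
have pos a : 0 <= k + 2 * a * x + a ^+ 2 * g by rewrite -h qvar_ge0.
have g0 : 0 <= g by exact: qvar_ge0.
move: g0; rewrite le_eqVlt => /predU1P[g0|g0].
  have -> : x = 0; last by rewrite expr0n mulr_ge0 ?qvar_ge0.
  apply/eqP; apply: contraT => x0; have := pos (- (k + 1) / (2 * x)).
  rewrite -g0 mulr0 addr0; have -> : 2 * (- (k + 1) / (2 * x)) * x = - (k + 1) by field.
  by lra.
have := pos (- x / g).
have -> : k + 2 * (- x / g) * x + (- x / g) ^+ 2 * g = (k * g - x ^+ 2) / g by field; rewrite gt_eqF.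
by rewrite pmulr_lge0 ?invr_gt0// subr_ge0 mulrC.
Qed.

Variables (theta : R -> Om -> 'cV[R]_m) (ct : R).
Hypothesis theta_predictable : pred theta.
Hypothesis ct_ge0 : 0 <= ct.
Hypothesis theta_energy : {ae P, forall w, (energy theta T w <= ct%:E)%E}.

Let sqtheta : sqint theta := energy_fin_ae theta_energy.

(** [int q.(dB + theta dt)], the gain from trade of a strategy with [sigma^tr pi = q]; under [Q] it
    is an integral against a Brownian motion. *)
Definition drifted q t w := ito q t w + \int[leb]_(u in `[0, t]) dot (q u w) (theta u w).

Definition density := doleans T (fun t w => - theta t w) (ito (fun t w => - theta t w)).

Lemma measurable_dot_integral H G : pred H -> pred G ->
  measurable_fun setT (fun w => \int[leb]_(u in `[0, T]) dot (H u w) (G u w)).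
Proof.
move=> pH pG; have mI : measurable (`[0, T]%classic : set R) by exact: measurable_itv.
apply: (measurable_wrt_Om P_complete mB (lexx T) (f := fun _ w => \int[leb]_(u in `[0, T]) dot (H u w) (G u w))).
have pd := predictable_dot T_gt0 pH pG.
exact: (predictable_Rintegral T_gt0 T0T mI _ pd).
Qed.

Lemma drifted_adapted q : pred q -> sqint q -> adapted T Ft (drifted q).
Proof.
move=> pq sq t tT; have [aI _ _] := itoP P_complete B_brownian T_gt0 pq sq.
have mI : measurable (`[0, t]%classic : set R) by exact: measurable_itv.
apply/measurable_wrtP; apply: measurable_funD; apply/measurable_wrtP; first exact: aI.
exact: (predictable_Rintegral T_gt0 tT mI (fun x h => h) (predictable_dot T_gt0 pq theta_predictable)).
Qed.

Lemma measurable_drifted q t : pred q -> sqint q -> 0 <= t <= T -> measurable_fun setT (drifted q t).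
Proof.
move=> pq sq tT; have /andP[_ tT'] := tT.
exact: (measurable_wrt_Om P_complete mB tT' (drifted_adapted pq sq tT)).
Qed.

Let pN H : pred H -> pred (fun t w => - H t w).
Proof. exact: predictable_mxN. Qed.

Lemma energyN H t w : energy (fun t w => - H t w) t w = energy H t w.
Proof. by apply: eq_integral => u _; rewrite !sqr_enorm dotNl dotNr opprK. Qed.

Let theta_energyN : {ae P, forall w, (energy (fun t w => (- theta t w)%R) T w <= ct%:E)%E}.
Proof. by apply: filterS theta_energy => w; rewrite energyN. Qed.

Let sqN : sqint (fun t w => - theta t w) := energy_fin_ae theta_energyN.

Lemma measurable_density : measurable_fun setT density.
Proof.
exact: (measurable_doleans P_complete B_brownian T_gt0 (pN theta_predictable)
  (measurable_ito P_complete B_brownian T_gt0 (pN theta_predictable) sqN T0T)).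
Qed.

Lemma density_L2 : P.-integrable setT (EFin \o density) /\ P.-integrable setT (EFin \o (fun w => density w ^+ 2)).
Proof.
have pth := pN theta_predictable.
have E1 := doleans_bounded P_complete B_brownian T_gt0 pth theta_energyN.
split.
  apply: (proj1 (@intg_ge0 _ _ _ P setT density 1 measurable_density _ _)).
    by move=> w _; exact: doleans_ge0.
  by rewrite /density E1.
pose th2 t w := 2 *: (- theta t w).
have p2 : pred th2 by apply: predictable_mxZ => //; exact: predictable_cst.
have s2 : sqint th2.
  apply: filterS theta_energyN => w h; rewrite -[X in (X < _)%E]/(energy th2 T w).
  rewrite (energyZ T_gt0 2 w pth (lexx T)); apply: (@le_lt_trans _ _ ((2 ^+ 2)%:E * ct%:E)%E); last by rewrite -EFinM ltry.
  exact: lee_wpmul2l.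
have m2 : measurable_fun setT (fun w => 2 * ito (fun t w => - theta t w) T w).
  by apply: measurable_funM => //; exact: (measurable_ito P_complete B_brownian T_gt0 pth sqN T0T).
have [_ _ li] := itoP P_complete B_brownian T_gt0 pth sqN.
have d1 := doleans_le1 P_complete B_brownian T_gt0 p2 s2 m2 (ito_limitZ T_gt0 2 pth li).
have md2 := @measurable_doleans _ _ _ _ P T B P_complete B_brownian T_gt0 th2 (fun t w => 2 * ito (fun t w => - theta t w) t w) p2 m2.
have [I2 _] := intg_ge0 md2 (fun w _ => doleans_ge0 _ _ _ _) d1.
apply: (intg_le measurableT _ _ (intgZ measurableT (expR ct) I2)).
  by apply: measurable_funX; exact: measurable_density.
apply: filterS theta_energyN => w h _; rewrite (ger0_norm (sqr_ge0 _)).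
exact: (doleans_sqr T_gt0 _ pth h).
Qed.

(** From [(i + x)^2 <= 2 i^2 + 2 x^2]: the Ito part contributes [8 c] by [ito_L2], and the drift
    part, by the Cauchy-Schwarz inequality, [2 ct c]. *)
Let drifted_L2 q c : pred q -> sqint q -> (\int[P]_w energy q T w <= c%:E)%E ->
  P.-integrable setT (EFin \o (fun w => drifted q T w ^+ 2)) /\
  \int[P]_w (drifted q T w ^+ 2) <= (8 + 2 * ct) * c.
Proof.
move=> pq sq qc; have miq := measurable_ito P_complete B_brownian T_gt0 pq sq T0T.
have [_ _ li] := itoP P_complete B_brownian T_gt0 pq sq.
have I2 := ito_L2 P_complete B_brownian T_gt0 pq sq miq li qc.
have [Ii Ei] := intg_ge0 (measurable_funX 2 miq) (fun w _ => sqr_ge0 _) I2.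
have mqv := measurable_qvar P_complete B_brownian T_gt0 pq.
have Eqv : (\int[P]_w (qvar q T w)%:E <= c%:E)%E.
  apply: le_trans qc; apply: ae_ge0_le_integral => //.
  - by move=> w _; rewrite lee_fin qvar_ge0.
  - exact/measurable_EFinP.
  - by move=> w _; exact: energy_ge0.
  - exact: (measurable_energy P_complete B_brownian T_gt0 pq).
  - by apply: filterS sq => w fin _; rewrite (energyE T_gt0 fin pq T0T).
have [Iq Eq] := intg_ge0 mqv (fun w _ => qvar_ge0 _ _ _) Eqv.
have Ib := intgD measurableT (intgZ measurableT 2 Ii) (intgZ measurableT (2 * ct) Iq).
have mdr := measurable_drifted pq sq T0T.
have le : {ae P, forall w, setT w -> drifted q T w ^+ 2 <= 2 * ito q T w ^+ 2 + 2 * ct * qvar q T w}.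
  apply: filterS3 sq sqtheta theta_energy => w fq fth ht _.
  have := dot_integral_sqr_le theta_predictable pq fth fq; rewrite /drifted.
  set x := \int[leb]_(u in _) _; set i := ito q T w => hx.
  have qt : qvar theta T w <= ct by rewrite -lee_fin -(energyE T_gt0 fth theta_predictable T0T).
  have h2 : x ^+ 2 <= ct * qvar q T w.
    by apply: (le_trans hx); rewrite mulrC ler_wpM2r// qvar_ge0.
  by have := sqr_ge0 (i - x); rewrite sqrrB sqrrD -mulrA; move: h2; lra.
have Idr : P.-integrable setT (EFin \o (fun w => drifted q T w ^+ 2)).
  apply: (intg_le measurableT _ _ Ib); first exact: measurable_funX.
  by apply: filterS le => w h _; rewrite ger0_norm ?sqr_ge0// h.
split => //; apply: (le_trans (Rintegral_le_ae measurableT Idr Ib le)).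
rewrite (RintegralD measurableT (intgZ measurableT 2 Ii) (intgZ measurableT (2 * ct) Iq)).
rewrite !(RintegralZl _ measurableT)//.
have h1 : 2 * \int[P]_w (ito q T w ^+ 2) <= 2 * (4 * c) by rewrite ler_pM2l.
have h2 : 2 * ct * \int[P]_w qvar q T w <= 2 * ct * c by rewrite ler_wpM2l// mulr_ge0.
by apply: (le_trans (lerD h1 h2)); rewrite mulrA -mulrDl -natrM.
Qed.

Lemma drifted_stop q s : pred q -> sqint q -> 0 <= s <= T ->
  {ae P, forall w, drifted (fun t w => if t <= s then q t w else 0) T w = drifted q s w}.
Proof.
move=> pq sq sT; have /andP[s0 sT'] := sT.
pose qs t w := if t <= s then q t w else 0.
have pqs : pred qs by apply: (@predictable_mx_ite _ _ _ _ P T B T_gt0 (fun t w => t <= s)) => //; exact: predictable_before.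
have sqs : sqint qs.
  by apply: (sqint_le T_gt0 pqs pq sq) => t w; rewrite /qs; case: ifP => // _; rewrite dot0l dot_ge0.
have [_ _ li] := itoP P_complete B_brownian T_gt0 pq sq.
have [_ _ lis] := itoP P_complete B_brownian T_gt0 pqs sqs.
have := ito_limit_unique P_complete B_brownian T_gt0 pqs lis (ito_limit_stop T_gt0 sT pq li).
apply: filterS => w /(_ T T0T); rewrite (min_idPl sT') => h; rewrite /drifted -h; congr (_ + _).
rewrite [LHS]Rintegral_mkcond [RHS]Rintegral_mkcond; apply: eq_Rintegral => u _.
rewrite !patchE !mem_setE !in_itv/=; case: ifPn => [/andP[u0 uT]|].
  by rewrite u0/=; case: ifPn => _ //; rewrite dot0l.
rewrite negb_and; case: ifPn => // /andP[-> us]; rewrite (le_trans us sT')//.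
Qed.

Lemma driftedB q r : pred q -> sqint q -> pred r -> sqint r -> sqint (fun t w => q t w - r t w) ->
  {ae P, forall w, drifted (fun t w => q t w - r t w) T w = drifted q T w - drifted r T w}.
Proof.
move=> pq sq pr sr sqr; have pqr := predictable_mxB T_gt0 pq pr.
have [_ _ liq] := itoP P_complete B_brownian T_gt0 pq sq.
have [_ _ lir] := itoP P_complete B_brownian T_gt0 pr sr.
have [_ _ li] := itoP P_complete B_brownian T_gt0 pqr sqr.
have e := ito_limit_unique P_complete B_brownian T_gt0 pqr li (ito_limitB T_gt0 pq pr liq lir).
apply: filterS3 (filterI e sqtheta) sq sr => w [/(_ T T0T) h fth] fq fr; rewrite /drifted h.
have mI : measurable (`[0, T]%classic : set (measurableTypeR R)) by exact: measurable_itv.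
have -> : \int[leb]_(u in `[0, T]) dot (q u w - r u w) (theta u w) =
   \int[leb]_(u in `[0, T]) dot (q u w) (theta u w) - \int[leb]_(u in `[0, T]) dot (r u w) (theta u w).
  rewrite -(RintegralB mI (intg_dot T_gt0 pq theta_predictable fq fth) (intg_dot T_gt0 pr theta_predictable fr fth)).
  by apply: eq_Rintegral => u _; rewrite dotBl.
by rewrite opprD addrACA.
Qed.

Let clock_energy q w : clock (fun t w => dot (q t w) (q t w)) T w = energy q T w.
Proof. by apply: eq_integral => u _; rewrite sqr_enorm. Qed.

(** For bounded energy this is the orthogonality relation at [h = - theta]. In general [q] is
    stopped by its own energy clock; the remainder tends to 0 in [L^2], and the density is square
    integrable. *)
Lemma drifted_centered q c : pred q -> sqint q -> (\int[P]_w energy q T w <= c%:E)%E ->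
  P.-integrable setT (EFin \o (fun w => density w * drifted q T w)) /\
  \int[P]_w (density w * drifted q T w) = 0.
Proof.
move=> pq sq qc; pose a t w := dot (q t w) (q t w).
have pa : predictable T Ft a by exact: predictable_dot.
have a0 t w : 0 <= a t w by exact: dot_ge0.
have [Iden Iden2] := density_L2; have mden := measurable_density.
have DV G cG : pred G -> sqint G -> (\int[P]_w energy G T w <= cG%:E)%E ->
   P.-integrable setT (EFin \o (fun w => density w * drifted G T w)).
  move=> pG sG Gc; have [IG _] := drifted_L2 pG sG Gc.
  apply: (intg_le measurableT _ _ (intgZ measurableT 2^-1 (intgD measurableT Iden2 IG))).
    exact: (measurable_funM mden (measurable_drifted pG sG T0T)).
  apply: aeW => w _; set x := density w; set y := drifted G T w.
  by have := sqr_ge0 (x - y); have := sqr_ge0 (x + y); rewrite sqrrB sqrrD ler_norml; lra.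
have Iq := DV q c pq sq qc; split => //.
pose qn (n : nat) := stopped T a n%:R q.
have pqn n : pred (qn n) by exact: predictable_stopped.
have sqn n : sqint (qn n) by apply: (sqint_le T_gt0 (pqn n) pq sq) => t w; exact: stopped_le.
have pth := pN theta_predictable.
have zero n : \int[P]_w (density w * drifted (qn n) T w) = 0.
  have cn : {ae P, forall w, (energy (qn n) T w <= n%:R%:E)%E}.
    apply: filterS sq => w fin; apply: (energy_stopped_le T_gt0 pa a0 (ler0n _ n) _ pq) => //.
    by rewrite clock_energy.
  have E1 := doleans_bounded P_complete B_brownian T_gt0 pth theta_energyN.
  have [_ h0] := doleans_orthogonal P_complete B_brownian T_gt0 pth (pqn n) sqN E1 (ler0n _ n) cn.
  rewrite -[RHS]h0; apply: Rintegral_ae_eq => //.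
  - exact: (measurable_funM mden (measurable_drifted (pqn n) (sqn n) T0T)).
  - apply: (measurable_funM mden); apply: measurable_funB.
      exact: (measurable_ito P_complete B_brownian T_gt0 (pqn n) (sqn n) T0T).
    exact: measurable_dot_integral.
  apply: filterS2 (sqn n) sqtheta => w fq fth _; congr (_ * (_ + _)).
  rewrite -[RHS]mulN1r -(RintegralZl (-1) _ (intg_dot T_gt0 (pqn n) pth fq _)).
  - by apply: eq_Rintegral => u _; rewrite mulN1r dotNr opprK.
  - exact: measurable_itv.
  - by rewrite energyN.
pose rn (n : nat) := fun t w => q t w - qn n t w.
have prn n : pred (rn n) by exact: (predictable_mxB T_gt0 pq (pqn n)).
have rn_le n t w : dot (rn n t w) (rn n t w) <= dot (q t w) (q t w).
  by rewrite /rn /qn /stopped; case: ifP => _; rewrite ?subr0// subrr dot0l dot_ge0.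
have srn n : sqint (rn n) := sqint_le T_gt0 (prn n) pq sq (rn_le n).
have ern n w : (energy (rn n) T w <= energy q T w)%E.
  by apply: (energy_le_pointwise T_gt0 (prn n) pq (lexx T)).
have Ieq : P.-integrable setT (energy q T).
  apply/integrableP; split; first exact: (measurable_energy P_complete B_brownian T_gt0 pq).
  under eq_integral => w _ do rewrite gee0_abs ?energy_ge0//.
  exact: le_lt_trans (ltry c).
have cvg0 : (\int[P]_w energy (rn n) T w)%E @[n --> \oo] --> 0%E.
  have := @dominated_convergence _ _ _ P setT measurableT (fun n => energy (rn n) T) (cst 0%E) (energy q T)
    (fun n => measurable_energy P_complete B_brownian T_gt0 (prn n)) (measurable_cst _).
  case => //.
  - apply: filterS sq => w fin _; apply/cvge0P => //; first by move=> n; exact: energy_ge0.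
    move=> e e0; have [N hN] : exists N : nat, (energy q T w <= N%:R%:E)%E.
      exists (Num.bound (qvar q T w)); rewrite (energyE T_gt0 fin pq T0T) lee_fin.
      by apply: ltW; apply: archi_boundP; exact: qvar_ge0.
    exists N => // n /= Nn; rewrite (_ : energy _ T w = 0%E) ?lte_fin//.
    apply: integral0_eq => u uT; have st : stop_time T a n%:R w = T.
      apply: (stop_time_T T_gt0 pa a0); rewrite clock_energy; apply: (le_trans hN).
      by rewrite lee_fin ler_nat.
    rewrite /rn /qn /stopped (aliveE T_gt0); last by move: uT; rewrite /= in_itv.
    rewrite st (_ : u <= T); last by move: uT; rewrite /= in_itv/= => /andP[].
    by rewrite subrr sqr_enorm dot0l.
  - by apply: aeW => w n _; rewrite gee0_abs ?energy_ge0.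
  - by move=> _ _; rewrite integral0.
have K0 : 0 < 8 + 2 * ct by rewrite ltr_wpDr// mulr_ge0.
set K := 8 + 2 * ct in K0; set D2 := \int[P]_w (density w ^+ 2).
have small e : 0 < e -> `|\int[P]_w (density w * drifted q T w)| <= 2^-1 * (e * D2 + e).
  (* The weighted Young inequality splits the remainder into [e D2 / 2] and its second moment over
     [2 e]; an energy below [e^2 / K] makes the latter at most [e / 2]. *)
  move=> e0; have e1 : 0 < e * e / K by rewrite divr_gt0// mulr_gt0.
  have [N _ /(_ N (leqnn N)) hN] := (proj1 (cvge0P (fun n => integral_ge0 _ (fun w _ => energy_ge0 _ _ _))) cvg0) _ e1.
  have [Ir2 Er2] := drifted_L2 (prn N) (srn N) (ltW hN).
  have EN : (\int[P]_w energy (qn N) T w <= c%:E)%E.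
    apply: le_trans qc; apply: ge0_le_integral => //.
    - by move=> w _; exact: energy_ge0.
    - exact: (measurable_energy P_complete B_brownian T_gt0 (pqn N)).
    - exact: (measurable_energy P_complete B_brownian T_gt0 pq).
    - move=> w _; apply: (energy_le_pointwise T_gt0 (pqn N) pq (lexx T)) => t _; exact: stopped_le.
  have IN := DV _ _ (pqn N) (sqn N) EN.
  have IR := DV _ _ (prn N) (srn N) (ltW hN).
  have -> : \int[P]_w (density w * drifted q T w) = \int[P]_w (density w * drifted (rn N) T w).
    rewrite -[RHS]add0r -[in RHS](zero N) -(RintegralD measurableT IN IR).
    apply: (Rintegral_ae_eq measurableT).
    - exact: (measurable_funM mden (measurable_drifted pq sq T0T)).
    - apply: measurable_funD; first exact: (measurable_funM mden (measurable_drifted (pqn N) (sqn N) T0T)).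
    exact: (measurable_funM mden (measurable_drifted (prn N) (srn N) T0T)).
    apply: filterS (driftedB pq sq (pqn N) (sqn N) (srn N)) => w h _.
    by rewrite -mulrDr [X in _ + X]h addrCA subrr addr0.
  have Ib := intgD measurableT (intgZ measurableT (2^-1 * e) Iden2) (intgZ measurableT (2^-1 * e^-1) Ir2).
  apply: (le_trans (le_normr_Rintegral measurableT IR)).
  have le : \int[P]_w `|density w * drifted (rn N) T w| <= 
    \int[P]_w (2^-1 * e * density w ^+ 2 + 2^-1 * e^-1 * drifted (rn N) T w ^+ 2).
    apply: (Rintegral_le_ae measurableT _ Ib); first exact: (integrable_norm IR).
    apply: aeW => w _; set x := density w; set y := drifted _ T w; exact: young_weighted.
  apply: (le_trans le).
  rewrite (RintegralD measurableT (intgZ measurableT _ Iden2) (intgZ measurableT _ Ir2)).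
  rewrite !(RintegralZl _ measurableT)// -/D2 mulrDr mulrA lerD2l -mulrA ler_pM2l ?invr_gt0//.
  by rewrite ler_pdivrMl//; move: Er2; rewrite -/K mulrCA divff ?mulr1// gt_eqF.
apply/eqP; rewrite -normr_eq0; apply: contraT => x0.
set x := `|_| in small x0; have x1 : 0 < x by rewrite lt_neqAle eq_sym x0 normr_ge0.
have D20 : 0 <= D2 by apply: Rintegral_ge0 => w _; exact: sqr_ge0.
have D21 : 0 < D2 + 1 by exact: ltr_wpDl.
have := small (x / (D2 + 1)) (divr_gt0 x1 D21).
have -> : x / (D2 + 1) * D2 + x / (D2 + 1) = x.
  by rewrite -[X in _ + X]mulr1 -mulrDr divfK ?gt_eqF.
by rewrite -[X in X <= _]mul1r ler_pM2r// invf_ge1// leNgt ltr1n.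
Qed.

Variable Q : probability Om R.
Hypothesis Q_density : forall A, Ft T A -> Q A = (\int[P]_(w in A) (density w)%:E)%E.

Let density_ge0 w : 0 <= density w. Proof. exact: doleans_ge0. Qed.

Let rect s t A q u w : 'cV[R]_m := if (s < u <= t) && `[< A w >] then q u w else 0.

Let rect_predictable s t A q : 0 <= s -> s <= t -> t <= T -> Ft s A -> pred q -> pred (rect s t A q).
Proof.
move=> s0 st tT FA pq; apply: (predictable_mx_ite T_gt0 (b := fun u w => (s < u <= t) && `[< A w >])) => //.
rewrite (_ : _ `&` _ = `]s, t] `*` A); first exact: predictable_rectangle.
apply/seteqP; split=> -[u w] /=; rewrite in_itv/=.
  by move=> [[uT _] /andP[ust /asboolP Aw]]; split => //; rewrite in_itv.
move=> [+ Aw]; rewrite in_itv/= => ust; split; last by rewrite ust; apply/asboolP.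
by have /andP[su ut] := ust; rewrite (le_trans s0 (ltW su)) (le_trans ut tT).
Qed.

Let rect_le s t A q u w : dot (rect s t A q u w) (rect s t A q u w) <= dot (q u w) (q u w).
Proof. by rewrite /rect; case: ifP => // _; rewrite dot0l dot_ge0. Qed.

Let before t q u w : 'cV[R]_m := if u <= t then q u w else 0.

Let before_predictable t q : 0 <= t <= T -> pred q -> pred (before t q).
Proof.
move=> tT pq; apply: (predictable_mx_ite T_gt0 (b := fun u w => u <= t)) => //.
exact: predictable_before.
Qed.

Let before_le t q u w : dot (before t q u w) (before t q u w) <= dot (q u w) (q u w).
Proof. by rewrite /before; case: ifP => // _; rewrite dot0l dot_ge0. Qed.

(** An event of [Ft s] is pulled out of the integral by locality: on [A] the integrand is the
    difference of two stopped ones, off [A] it vanishes. *)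
Let drifted_rect s t A q : 0 <= s -> s <= t -> t <= T -> Ft s A -> pred q -> sqint q ->
  {ae P, forall w, drifted (rect s t A q) T w = \1_A w * (drifted q t w - drifted q s w)}.
Proof.
move=> s0 st tT FA pq sq.
have tT' : 0 <= t <= T by rewrite (le_trans s0 st).
have sT' : 0 <= s <= T by rewrite s0 (le_trans st tT).
have pt := before_predictable tT' pq; have ps := before_predictable sT' pq.
have sqt : sqint (before t q) := sqint_le T_gt0 pt pq sq (before_le t q).
have sqs : sqint (before s q) := sqint_le T_gt0 ps pq sq (before_le s q).
pose G u w := before t q u w - before s q u w.
have pG : pred G by exact: predictable_mxB.
have GE u w : G u w = if s < u <= t then q u w else 0.
  rewrite /G /before; case: (leP u s) => us /=.
    by rewrite (le_trans us st) subrr.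
  by case: ifP; rewrite subr0.
have sqG : sqint G.
  by apply: (sqint_le T_gt0 pG pq sq) => u w; rewrite GE; case: ifP => // _; rewrite dot0l dot_ge0.
have pr := rect_predictable s0 st tT FA pq.
have sqr : sqint (rect s t A q) := sqint_le T_gt0 pr pq sq (rect_le s t A q).
have [_ _ liG] := itoP P_complete B_brownian T_gt0 pG sqG.
have [_ _ lir] := itoP P_complete B_brownian T_gt0 pr sqr.
have onA := ito_eq_local P_complete B_brownian T_gt0 pr pG lir liG.
have offA := ito_limit_local P_complete B_brownian T_gt0 pr lir.
have dG := driftedB pt sqt ps sqs sqG.
have dt := drifted_stop pq sq tT'; have ds := drifted_stop pq sq sT'.
apply: filterS3 (filterI onA offA) dG (filterI dt ds) => w [on off] eG [et es].
rewrite indicE; case: (boolP (w \in A)) => [/set_mem wA|/negP nA].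
  rewrite mul1r -et -es -eG /drifted.
  have e u : rect s t A q u w = G u w by rewrite GE /rect (asboolT wA) andbT.
  rewrite (on T T0T); last by apply: integral0_eq => u _; rewrite e subrr sqr_enorm dot0l.
  by congr (_ + _); apply: eq_Rintegral => u _; rewrite e.
have e u : rect s t A q u w = 0.
  by rewrite /rect (asboolF (fun h => nA (mem_set h))) andbF.
rewrite mul0r /drifted (off T T0T); last by apply: integral0_eq => u _; rewrite e sqr_enorm dot0l.
by rewrite add0r /Rintegral integral0_eq// => u _; rewrite e dot0l.
Qed.

(** The martingale identity on an event [A] of time [s] amounts to the integrand [q], restricted to
    [A] and to times in []s, t]], having a centred gain under the density. *)
Lemma drifted_martingale q c x : pred q -> sqint q -> (\int[P]_w energy q T w <= c%:E)%E ->
  martingale Q T Ft (fun t w => x + drifted q t w).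
Proof.
move=> pq sq qc.
have Er H : pred H -> (forall u w, dot (H u w) (H u w) <= dot (q u w) (q u w)) -> (\int[P]_w energy H T w <= c%:E)%E.
  move=> pH le; apply: le_trans qc; apply: ge0_le_integral => //.
  - by move=> w _; exact: energy_ge0.
  - exact: (measurable_energy P_complete B_brownian T_gt0 pH).
  - exact: (measurable_energy P_complete B_brownian T_gt0 pq).
  - by move=> w _; apply: (energy_le_pointwise T_gt0 pH pq (lexx T)).
have [Iden Iden2] := density_L2; have mden := measurable_density.
have ad : adapted T Ft (fun t w => x + drifted q t w).
  move=> t tT; apply/measurable_wrtP; apply: measurable_funD; first exact: measurable_cst.
  by apply/measurable_wrtP; exact: drifted_adapted.
have adT t : 0 <= t <= T -> measurable_wrt (Ft T) (fun w => x + drifted q t w).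
  by move=> /[dup] /andP[_ tT] tT' U mU; apply: (Ft_sub tT); exact: ad.
have Idt t : 0 <= t <= T -> P.-integrable setT (EFin \o (fun w => density w * drifted q t w)).
  move=> tT; have pt := before_predictable tT pq.
  have sqt : sqint (before t q) := sqint_le T_gt0 pt pq sq (before_le t q).
  have [It _] := drifted_centered pt sqt (Er _ pt (before_le t q)).
  apply: (intg_ae_eq measurableT _ _ It); first exact: (measurable_funM mden (measurable_drifted pq sq tT)).
  by apply: filterS (drifted_stop pq sq tT) => w h _; rewrite h.
have IQ t : 0 <= t <= T -> Q.-integrable setT (EFin \o (fun w => x + drifted q t w)).
  move=> tT; apply: (proj1 (integral_change P_complete B_brownian mden density_ge0 Q_density (adT _ tT) _)).
  apply: (intg_ae_eq measurableT _ _ (intgD measurableT (intgZ measurableT x Iden) (Idt _ tT))).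
    apply: measurable_funM => //; apply: measurable_funD => //; exact: measurable_drifted.
  by apply: aeW => w _; rewrite mulrDl (mulrC (drifted _ _ _)).
split; [exact: ad|exact: IQ|move=> s t s0 st tT A FA].
have tT' : 0 <= t <= T by rewrite (le_trans s0 st).
have sT' : 0 <= s <= T by rewrite s0 (le_trans st tT).
have mA : measurable A by apply: (Ft_measurable P_complete mB) FA; exact: le_trans tT.
have pr := rect_predictable s0 st tT FA pq.
have sqr : sqint (rect s t A q) := sqint_le T_gt0 pr pq sq (rect_le s t A q).
have [Irc Erc] := drifted_centered pr sqr (Er _ pr (rect_le s t A q)).
have ItA := integrableS measurableT mA (@subsetT _ A) (IQ _ tT').
have IsA := integrableS measurableT mA (@subsetT _ A) (IQ _ sT').
pose f w := \1_A w * (drifted q t w - drifted q s w).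
have mf : measurable_wrt (Ft T) f.
  apply/measurable_wrtP; apply: measurable_funM; first exact: measurable_indic (Ft_sub (le_trans st tT) FA : measurable (A : set (OmF P B T))).
  by apply: measurable_funB; apply/measurable_wrtP => U mU; [apply: (Ft_sub tT)|apply: (Ft_sub (le_trans st tT))]; exact: drifted_adapted.
have mfP : measurable_fun setT f.
  exact: (measurable_wrt_Om P_complete mB (lexx T) (f := fun _ => f) mf).
have ae_f : {ae P, forall w, setT w -> density w * drifted (rect s t A q) T w = f w * density w}.
  by apply: filterS (drifted_rect s0 st tT FA pq sq) => w h _; rewrite h mulrC.
have IfD : P.-integrable setT (EFin \o (fun w => f w * density w)).
  by apply: (intg_ae_eq measurableT _ ae_f Irc); exact: measurable_funM.
have [_ Ef] := integral_change P_complete B_brownian mden density_ge0 Q_density mf IfD.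
have f0 : \int[Q]_w f w = 0.
  rewrite /Rintegral Ef -[LHS]/(\int[P]_w (f w * density w)) -Erc.
  apply: (Rintegral_ae_eq measurableT).
  - exact: measurable_funM.
  - exact: (measurable_funM mden (measurable_drifted pr sqr T0T)).
  - by apply: filterS ae_f => w h /h ->.
have : \int[Q]_(w in A) (x + drifted q t w) = \int[Q]_(w in A) (x + drifted q s w).
  apply/eqP; rewrite -subr_eq0 -(RintegralB mA ItA IsA) -f0 Rintegral_mkcond; apply/eqP.
  apply: eq_Rintegral => w _; rewrite patchE /f indicE; case: ifPn => wA; last by rewrite mul0r.
  by rewrite mul1r opprD addrACA subrr add0r.
by move=> h; rewrite (intg_fin_num mA ItA) (intg_fin_num mA IsA) h.
Qed.

End girsanov.

(** * Finite entropy *)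

Section exponential_inequalities.
Context {R : realType}.
Implicit Types L u b : R.

(** [x ln x >= -1] with [x = exp L], a crude but sufficient lower bound for Fatou's lemma. *)
Lemma expR_mul_ge L : -1 <= expR L * L.
Proof.
have h : - L <= expR (- L) by apply: le_trans (expR_ge1Dx (- L)); rewrite lerDr.
by rewrite lerNl -mulrN -(expRxMexpNx_1 L) ler_pM2l// expR_gt0.
Qed.

(* Fenchel's inequality for the conjugate functions exp and [x ln x - x]. *)
Lemma expR_fenchel L u : expR L * u <= expR L * L - expR L + expR u.
Proof.
have := expR_ge1Dx (u - L); rewrite -(ler_pM2l (expR_gt0 L)) -expRD subrKC.
rewrite mulrDr mulr1 mulrBr; set x := expR L * u; set y := expR L * L; set z := expR L; set t := expR u; lra.
Qed.

(** Entropy controls tails: above the level [exp b] one has [L > b], so the mass there is at most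
    the entropy over [b]. Adding 1 makes the right-hand side nonnegative everywhere. *)
Lemma expR_tail L b : 0 < b -> expR L - Num.min (expR L) (expR b) <= b^-1 * (expR L * L + 1).
Proof.
move=> b0; have h := expR_mul_ge L.
have h1 : 0 <= expR L * L + 1 by rewrite -lerBlDr sub0r.
have [Lb|bL] := leP L b.
  by rewrite (min_idPl _) ?ler_expR// subrr mulr_ge0// invr_ge0 ltW.
have e0 := expR_gt0 b; have eL := expR_gt0 L.
apply: (@le_trans _ _ (expR L)); first by rewrite gerBl le_min !ltW.
rewrite ler_pdivlMl//; apply: (@le_trans _ _ (expR L * L)); last by rewrite lerDl.
by rewrite mulrC ler_pM2l// ltW.
Qed.

End exponential_inequalities.

Section fatou.
Context {d : measure_display} {X : measurableType d} {R : realType}.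
Variable P : probability X R.

(** Fatou's lemma after adding the integrable bound [G]; the maximum with 0 makes the functions
    nonnegative everywhere and not just almost everywhere. *)
Lemma fatou_lower (f : nat -> X -> R) (g G : X -> R) (c : R) :
  (forall n, P.-integrable setT (EFin \o f n)) -> measurable_fun setT g ->
  P.-integrable setT (EFin \o G) ->
  (forall n, {ae P, forall w, - G w <= f n w}) ->
  {ae P, forall w, \forall n \near \oo, f n w = g w} ->
  (forall n, \int[P]_w f n w <= c) ->
  P.-integrable setT (EFin \o g) /\ \int[P]_w g w <= c.
Proof.
move=> If mg IG /ae_foralln le cvg Ec.
have mG : measurable_fun setT G by apply/measurable_EFinP; case/integrableP: IG.
have mf n : measurable_fun setT (f n) by apply/measurable_EFinP; case/integrableP: (If n).
have ge : {ae P, forall w, 0 <= g w + G w}.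
  by apply: filterS2 le cvg => w lew [n _ /(_ n (leqnn n)) <-]; rewrite -lerBlDr sub0r.
pose fG n w := Num.max (f n w + G w) 0; pose gG w := Num.max (g w + G w) 0.
have mfG n : measurable_fun setT (fG n) by apply: measurable_maxr => //; exact: measurable_funD.
have mgG : measurable_fun setT gG by apply: measurable_maxr => //; exact: measurable_funD.
have fG0 n w : 0 <= fG n w by rewrite le_max lexx orbT.
have gG0 w : 0 <= gG w by rewrite le_max lexx orbT.
have cvgG : {ae P, forall w, fG n w @[n --> \oo] --> gG w}.
  apply: filterS cvg => w h; apply: cvg_near_cst; apply: filterS h => n h.
  by rewrite /fG h.
have E n : (\int[P]_w (fG n w)%:E <= (c + \int[P]_w G w)%:E)%E.
  rewrite (_ : (\int[P]_w (fG n w)%:E)%E = (\int[P]_w (f n w + G w)%:E)%E).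
    rewrite -[leLHS]fineK; last exact: (integrable_fin_num measurableT (intgD measurableT (If n) IG)).
    by rewrite lee_fin -[leLHS]/(Rintegral _ _ _) (RintegralD measurableT (If n) IG) lerD2r.
  apply: ae_eq_integral => //.
  - exact/measurable_EFinP.
  - by apply/measurable_EFinP; exact: measurable_funD.
  apply: filterS le => w le _; rewrite /fG (max_idPl _)//.
  by rewrite -lerBlDr sub0r.
have [IgG EgG] := intg_ge0 mgG (fun w _ => gG0 w) (fatou_le mfG mgG fG0 gG0 cvgG (@nearW nat _ _ _ E)).
have ae_g : {ae P, forall w, setT w -> gG w - G w = g w}.
  by apply: filterS ge => w h _; rewrite /gG (max_idPl h) addrK.
have IgB := intgB measurableT IgG IG.
have Ig := intg_ae_eq measurableT mg ae_g IgB.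
split => //; have -> : \int[P]_w g w = \int[P]_w (gG w - G w).
  apply: (Rintegral_ae_eq measurableT mg _ (filterS _ ae_g)) => [|w h /h //].
  exact: measurable_funB.
by rewrite (RintegralB measurableT IgG IG) lerBlDr.
Qed.

End fatou.

Section change_of_measure.
Context {disp : measure_display} {Om : measurableType disp} {R : realType} {m : nat}.
Variables (P : probability Om R) (T : R) (B : R -> Om -> 'cV[R]_m).
Hypothesis P_complete : measure_is_complete P.
Hypothesis B_brownian : brownian_motion P T B.
Hypothesis T_gt0 : 0 < T.

Local Notation Ft := (augmented_filtration P B).
Local Notation leb := (@lebesgue_measure R).
Let mB := brownian_measurable B_brownian.
Local Notation pred := (predictable_mx T Ft).
Local Notation sqint := (square_integrable P T).
Local Notation ito := (ito P T B).
Local Notation drifted := (drifted P T B).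
Let T0T : 0 <= T <= T. Proof. by rewrite lexx ltW. Qed.

Variables (theta h v : R -> Om -> 'cV[R]_m) (a : R -> Om -> R).
Hypotheses (ptheta : pred theta) (ph : pred h) (pv : pred v) (pa : predictable T Ft a).
Hypothesis a_theta : forall t w, dot (theta t w) (theta t w) <= a t w.
Hypothesis a_h : forall t w, dot (h t w) (h t w) <= a t w.
Hypothesis a_v : forall t w, dot (v t w) (v t w) <= a t w.
Hypothesis a_fin : {ae P, forall w, (clock a T w < +oo)%E}.

Let a0 t w : 0 <= a t w. Proof. exact: le_trans (dot_ge0 _) (a_h t w). Qed.

Implicit Type q : R -> Om -> 'cV[R]_m.

Let energy_clock q w : pred q -> (forall t, dot (q t w) (q t w) <= a t w) ->
  (energy q T w <= clock a T w)%E.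
Proof.
move=> pq le; apply: ge0_le_integral => //.
- by move=> u _; rewrite lee_fin sqr_ge0.
- apply: (eq_measurable_fun (fun u => (dot (q u w) (q u w))%:E)) => [u _|]; first by rewrite sqr_enorm.
  by apply/measurable_EFinP; exact: (predictable_path T_gt0 w (predictable_dot T_gt0 pq pq)).
- by apply/measurable_EFinP; exact: (predictable_path T_gt0 w pa).
- by move=> u _; rewrite lee_fin sqr_enorm.
Qed.

Let sqint_clock q : pred q -> (forall t w, dot (q t w) (q t w) <= a t w) -> sqint q.
Proof.
move=> pq le; apply: filterS a_fin => w; apply: le_lt_trans.
by apply: energy_clock => // t.
Qed.

Local Notation tau := (stop_time T a).
Local Notation st n q := (stopped T a n q).

Lemma stopped_near : {ae P, forall w, \forall n \near \oo, tau n%:R w = T}.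
Proof.
apply: filterS a_fin => w fin; exists (Num.bound (fine (clock a T w))) => // n /= le.
apply: (stop_time_T T_gt0 pa a0); have c0 : (0 <= clock a T w)%E by apply: integral_ge0 => u _; rewrite lee_fin.
rewrite -[clock a T w]fineK ?ge0_fin_numE// lee_fin; apply: (@le_trans _ _ (Num.bound (fine (clock a T w)))%:R).
  by apply: ltW; apply: archi_boundP; rewrite fine_ge0.
by rewrite ler_nat.
Qed.

Lemma stopped_full n q u w : tau n w = T -> 0 <= u <= T -> st n q u w = q u w.
Proof.
move=> tT uT; rewrite /stopped (aliveE T_gt0)// tT.
by have /andP[_ ->] := uT.
Qed.

Lemma qvar_stopped n q w : qvar (st n q) T w = qvar q (tau n w) w.
Proof.
rewrite /qvar /energy -(integral_alive T_gt0); congr fine; apply: eq_integral => u _.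
by rewrite /stopped; case: ifP => // _; rewrite sqr_enorm dot0l.
Qed.

Let stopped_energy n q : pred q -> (forall t w, dot (q t w) (q t w) <= a t w) ->
  {ae P, forall w, (energy (st n%:R q) T w <= n%:R%:E)%E}.
Proof.
move=> pq le; apply: filterS a_fin => w fin.
exact: (energy_stopped_le T_gt0 pa a0 (ler0n _ n) fin pq (fun t => le t w)).
Qed.

Let pst n q : pred q -> pred (st n q). Proof. exact: predictable_stopped. Qed.

Let sst n q : pred q -> (forall t w, dot (q t w) (q t w) <= a t w) -> sqint (st n q).
Proof.
move=> pq le; apply: sqint_clock; first exact: pst.
by move=> t w; exact: le_trans (stopped_le _ _ _ _ _ _) (le t w).
Qed.

Let sqh : sqint h. Proof. exact: sqint_clock. Qed.
Let sqv : sqint v. Proof. exact: sqint_clock. Qed.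
Let sqtheta : sqint theta. Proof. exact: sqint_clock. Qed.

Definition stopped_doleans n w := doleans T (st n h) (ito (st n h)) w.
Local Notation M n := (stopped_doleans n).
Let Minf w := doleans T h (ito h) w.

Let M_ge0 n w : 0 <= M n w. Proof. exact: doleans_ge0. Qed.

Let mM n : measurable_fun setT (M n).
Proof.
exact: (measurable_doleans P_complete B_brownian T_gt0 (pst _ ph)
  (measurable_ito P_complete B_brownian T_gt0 (pst _ ph) (sst _ ph a_h) T0T)).
Qed.

Let mMinf : measurable_fun setT Minf.
Proof.
exact: (measurable_doleans P_complete B_brownian T_gt0 ph
  (measurable_ito P_complete B_brownian T_gt0 ph sqh T0T)).
Qed.

Let E_M (n : nat) : P.-integrable setT (EFin \o M n%:R) /\ \int[P]_w M n%:R w = 1.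
Proof.
have E1 := doleans_bounded P_complete B_brownian T_gt0 (pst n%:R ph) (stopped_energy n ph a_h).
split; first by apply: (proj1 (@intg_ge0 _ _ _ P setT (M n%:R) 1 (mM _) _ _)) => [w _|]; [exact: M_ge0|rewrite E1].
by rewrite /Rintegral E1.
Qed.

Definition log_doleans n w := ito (st n h) T w - 2^-1 * qvar (st n h) T w.
Local Notation L n := (log_doleans n).
Let Linf w := ito h T w - 2^-1 * qvar h T w.

Let ME n w : M n w = expR (L n w). Proof. by []. Qed.

Let mL n : measurable_fun setT (L n).
Proof.
apply: measurable_funB; first exact: (measurable_ito P_complete B_brownian T_gt0 (pst _ ph) (sst _ ph a_h) T0T).
apply: measurable_funM => //; exact: (measurable_qvar P_complete B_brownian T_gt0 (pst _ ph)).
Qed.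

Let mLinf : measurable_fun setT Linf.
Proof.
apply: measurable_funB; first exact: (measurable_ito P_complete B_brownian T_gt0 ph sqh T0T).
apply: measurable_funM => //; exact: (measurable_qvar P_complete B_brownian T_gt0 ph).
Qed.

Definition drift_gain n w := \int[leb]_(u in `[0, T]) dot (st n v u w) (theta u w + h u w).
Local Notation J n := (drift_gain n).
Let Jinf w := \int[leb]_(u in `[0, T]) dot (v u w) (theta u w + h u w).

Let log_stopped : {ae P, forall w, forall n : nat, L n%:R w = ito h (tau n%:R w) w - 2^-1 * qvar h (tau n%:R w) w}.
Proof.
apply/ae_foralln => n; apply: filterS (ito_stopped P_complete B_brownian T_gt0 pa n%:R ph sqh) => w e.
by rewrite /log_doleans e qvar_stopped.
Qed.

Let drifted_stopped q : pred q -> (forall t w, dot (q t w) (q t w) <= a t w) ->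
  {ae P, forall w, forall n : nat, drifted theta q (tau n%:R w) w =
    ito (st n%:R q) T w + \int[leb]_(u in `[0, T]) dot (st n%:R q u w) (theta u w)}.
Proof.
move=> pq aq; apply/ae_foralln => n.
apply: filterS (ito_stopped P_complete B_brownian T_gt0 pa n%:R pq (sqint_clock pq aq)) => w e.
rewrite /drifted e -(Rintegral_alive T_gt0); congr (_ + _); apply: eq_Rintegral => u _.
by rewrite /stopped; case: ifP => // _; rewrite dot0l.
Qed.

Lemma stopped_limit : {ae P, forall w, \forall n \near \oo,
  [/\ tau n%:R w = T, L n%:R w = Linf w & J n%:R w = Jinf w]}.
Proof.
apply: filterS2 stopped_near log_stopped => w [N _ hN] hL; exists N => // n Nn.
have tT := hN n Nn; split => //; first by rewrite hL tT.
apply: eq_Rintegral => u; rewrite inE/= in_itv/= => uT.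
by rewrite (stopped_full _ tT).
Qed.

Let U n w := ito (st n v) T w - \int[leb]_(u in `[0, T]) dot (st n v u w) (st n h u w).

Let U_centered (n : nat) : P.-integrable setT (EFin \o (fun w => M n%:R w * U n%:R w)) /\
  \int[P]_w (M n%:R w * U n%:R w) = 0.
Proof.
exact: (doleans_orthogonal P_complete B_brownian T_gt0 (pst _ ph) (pst _ pv) (sst _ ph a_h)
  (doleans_bounded P_complete B_brownian T_gt0 (pst n%:R ph) (stopped_energy n ph a_h)) (ler0n _ n) (stopped_energy n pv a_v)).
Qed.

Variables (alpha y0 : R) (Y : R -> Om -> R) (p : nat) (SY : Om -> R) (k : R).
Hypothesis alpha_gt0 : 0 < alpha.
Hypothesis p_gt1 : (1 < p)%N.
Hypothesis mYT : measurable_fun setT (Y T).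
Hypothesis logE : {ae P, forall w, forall t, 0 <= t <= T ->
  ito h t w - 2^-1 * qvar h t w = alpha * (Y t w - y0) - alpha * drifted theta v t w}.
Hypothesis gain_ge0 : {ae P, forall w, forall t, 0 <= t <= T -> 0 <= dot (v t w) (theta t w + h t w)}.
Hypothesis SY_integrable : P.-integrable setT (EFin \o SY).
Hypothesis Y_SY : {ae P, forall w, forall t, 0 <= t <= T -> expR (p%:R * alpha * Num.max (Y t w) 0) <= SY w}.
Hypothesis YT_ge : {ae P, forall w, - k <= Y T w}.

(** Its mean is [- alpha y0], because [U] is centred under [M_n]. By the BSDE it also equals the
    entropy term [M_n L_n], minus [alpha M_n Y] at the stopping time, plus [alpha M_n] times the
    gain. Comparing the two bounds the entropy. *)
Let N n w := M n w * (- alpha * y0 - alpha * U n w).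

Let E_N (n : nat) : P.-integrable setT (EFin \o N n%:R) /\ \int[P]_w N n%:R w = - alpha * y0.
Proof.
have [IM E1] := E_M n; have [IU EU] := U_centered n.
have I1 := intgZ measurableT (- alpha * y0) IM; have I2 := intgZ measurableT alpha IU.
have e w : N n%:R w = - alpha * y0 * M n%:R w - alpha * (M n%:R w * U n%:R w).
  by rewrite /N mulrBr mulrC (mulrCA (M _ _)).
split; first by rewrite (funext e : N _ = _); exact: (intgB measurableT I1 I2).
under eq_Rintegral => w _ do rewrite e.
by rewrite (RintegralB measurableT I1 I2) !(RintegralZl _ measurableT)// E1 EU mulr1 mulr0 subr0.
Qed.

Let NE : {ae P, forall w, forall n : nat, N n%:R w =
   M n%:R w * (L n%:R w - alpha * Y (tau n%:R w) w + alpha * J n%:R w)}.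
Proof.
have le n q t w : (dot (q t w) (q t w) <= a t w) -> dot (st n q t w) (st n q t w) <= a t w.
  by move=> le; exact: le_trans (stopped_le _ _ _ _ _ _) le.
apply: filterS3 (filterI log_stopped (drifted_stopped pv a_v)) logE a_fin => w [hL hV] hE fin n.
have tI := stop_time_itv T_gt0 a n%:R w.
have fin_q q : pred q -> (forall t, dot (q t w) (q t w) <= a t w) -> (energy q T w < +oo)%E.
  by move=> pq lq; exact: le_lt_trans (energy_clock pq lq) fin.
congr (_ * _); rewrite hL (hE _ tI) hV /U.
have I1 := intg_dot T_gt0 (pst n%:R pv) ptheta (fin_q _ (pst _ pv) (fun t => le n%:R v t w (a_v t w))) (fin_q _ ptheta (a_theta ^~ w)).
have I2 := intg_dot T_gt0 (pst n%:R pv) ph (fin_q _ (pst _ pv) (fun t => le n%:R v t w (a_v t w))) (fin_q _ ph (a_h ^~ w)).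
have mI : measurable (`[0, T]%classic : set (measurableTypeR R)) by exact: measurable_itv.
have -> : J n%:R w = \int[leb]_(u in `[0, T]) dot (st n%:R v u w) (theta u w) + \int[leb]_(u in `[0, T]) dot (st n%:R v u w) (h u w).
  by rewrite -(RintegralD mI I1 I2); apply: eq_Rintegral => u _; rewrite dotDr.
have -> : \int[leb]_(u in `[0, T]) dot (st n%:R v u w) (st n%:R h u w) = \int[leb]_(u in `[0, T]) dot (st n%:R v u w) (h u w).
  by apply: eq_Rintegral => u _; rewrite /stopped; case: ifP => // _; rewrite !dot0l.
set x := \int[leb]_(u in _) _; set y := \int[leb]_(u in _) _; ring.
Qed.

Let J_ge0 : {ae P, forall w, forall n : nat, 0 <= J n%:R w <= Jinf w}.
Proof.
have pth : pred (fun t w => theta t w + h t w) by exact: predictable_mxD.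
apply: filterS2 gain_ge0 a_fin => w ge fin n.
have mI : measurable (`[0, T]%classic : set (measurableTypeR R)) by exact: measurable_itv.
have fin_q q : pred q -> (forall t, dot (q t w) (q t w) <= a t w) -> (energy q T w < +oo)%E.
  by move=> pq lq; exact: le_lt_trans (energy_clock pq lq) fin.
have ef : (energy (fun t w => (theta t w + h t w)%R) T w < +oo)%E.
  apply: (le_lt_trans (energyD_le T_gt0 w ptheta ph (lexx T))).
  have f1 := fin_q _ ptheta (a_theta ^~ w); have f2 := fin_q _ ph (a_h ^~ w).
  by apply: lte_add_pinfty; apply: lte_mul_pinfty.
have sv t : dot (st n%:R v t w) (st n%:R v t w) <= a t w.
  exact: le_trans (stopped_le _ _ _ _ _ _) (a_v t w).
have I1 := intg_dot T_gt0 (pst n%:R pv) pth (fin_q _ (pst _ pv) sv) ef.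
have I2 := intg_dot T_gt0 pv pth (fin_q _ pv (a_v ^~ w)) ef.
have gs u : 0 <= u <= T -> 0 <= dot (st n%:R v u w) (theta u w + h u w) <= dot (v u w) (theta u w + h u w).
  by move=> uT; rewrite /stopped; case: ifP => _; rewrite ?dot0l ?lexx ?ge.
apply/andP; split.
  by apply: Rintegral_ge0 => u; rewrite /= in_itv/= => /gs/andP[].
apply: (Rintegral_le_ae mI I1 I2); apply: aeW => u; rewrite /= in_itv/= => /gs/andP[_].
by [].
Qed.

Let cp := p%:R^-1 : R.
Let cp_gt0 : 0 < cp. Proof. by rewrite invr_gt0 ltr0n ltnW. Qed.
Let cp_lt1 : cp < 1. Proof. by rewrite invf_lt1 ?ltr1n// ltr0n ltnW. Qed.

(** Fenchel's inequality at [p alpha Y^+], divided by [p]: the entropy enters with the factor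
    [1 / p] only. *)
Let fenchel_Y w l t : 0 <= t <= T -> expR (p%:R * alpha * Num.max (Y t w) 0) <= SY w ->
  expR l * (alpha * Num.max (Y t w) 0) <= cp * (expR l * l + SY w).
Proof.
move=> tT le; have := expR_fenchel l (p%:R * alpha * Num.max (Y t w) 0).
have p0 : 0 < p%:R :> R by rewrite ltr0n ltnW.
rewrite -mulrA mulrCA -ler_pdivlMl// => /le_trans; apply.
rewrite ler_pM2l// -addrA lerD2l; have := expR_ge0 l; move: le; rewrite -mulrA; lra.
Qed.

(** Since [p > 1], a positive share [1 - 1 / p] of the entropy is left after the term in [Y] is
    absorbed; the gain is dropped because of its sign. *)
Let N_ge : {ae P, forall w, forall n : nat, (1 - cp) * (M n%:R w * L n%:R w) - cp * SY w <= N n%:R w}.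
Proof.
apply: filterS3 NE J_ge0 Y_SY => w hN hJ hY n; rewrite hN.
have tI := stop_time_itv T_gt0 a n%:R w.
have aux (x1 x2 x3 z s c : R) : 0 <= x1 -> x2 <= x3 -> x3 <= c * (z + s) -> (1 - c) * z - c * s <= z - x2 + x1.
  by rewrite mulrBl mul1r mulrDr; lra.
have := fenchel_Y (L n%:R w) tI (hY _ tI); rewrite -ME.
have /andP[J0 _] := hJ n; have M0 := M_ge0 n%:R w.
have h1 : 0 <= M n%:R w * (alpha * J n%:R w) := mulr_ge0 M0 (mulr_ge0 (ltW alpha_gt0) J0).
have h2 : M n%:R w * (alpha * Y (tau n%:R w) w) <= M n%:R w * (alpha * Num.max (Y (tau n%:R w) w) 0).
  by rewrite ler_wpM2l// ler_pM2l// le_max lexx.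
have -> : M n%:R w * (L n%:R w - alpha * Y (tau n%:R w) w + alpha * J n%:R w) =
  M n%:R w * L n%:R w - M n%:R w * (alpha * Y (tau n%:R w) w) + M n%:R w * (alpha * J n%:R w) by ring.
exact: aux.
Qed.

Let entropy_bound := (- alpha * y0 + cp * \int[P]_w SY w) / (1 - cp).

Let ML_integrable (n : nat) : P.-integrable setT (EFin \o (fun w => M n%:R w * L n%:R w)) /\
  \int[P]_w (M n%:R w * L n%:R w) <= entropy_bound.
Proof.
have [IN EN] := E_N n; have c1 : 0 < 1 - cp by rewrite subr_gt0.
have ISY := intgZ measurableT cp SY_integrable.
have IB := intgZ measurableT (1 - cp)^-1 (intgD measurableT IN ISY).
have le : {ae P, forall w, setT w -> M n%:R w * L n%:R w <= (1 - cp)^-1 * (N n%:R w + cp * SY w)}.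
  by apply: filterS N_ge => w /(_ n) hN _; rewrite ler_pdivlMl// -lerBlDr.
have IL : P.-integrable setT (EFin \o (fun w => M n%:R w * L n%:R w)).
  apply: (intg_le measurableT _ _ (intgD measurableT (intg_cst P 2) IB)).
    exact: (measurable_funM (mM _) (mL _)).
  apply: filterS le => w /(_ Logic.I) + _; have := expR_mul_ge (L n%:R w); rewrite -ME ler_norml.
  set x := M _ _ * L _ _; set b := (1 - cp)^-1 * _; lra.
split => //; apply: (le_trans (Rintegral_le_ae measurableT IL IB le)).
rewrite (RintegralZl _ measurableT (intgD measurableT IN ISY)) (RintegralD measurableT IN ISY).
by rewrite EN (RintegralZl _ measurableT SY_integrable) mulrC.
Qed.

(** The entropy bound is uniform in [n], so [expR_tail] gives uniform integrability of the stopped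
    exponentials, which all have mass one. *)
Lemma doleans_one : (\int[P]_w (doleans T h (ito h) w)%:E = 1)%E.
Proof.
apply/eqP; rewrite eq_le; apply/andP; split.
  have [_ _ li] := itoP P_complete B_brownian T_gt0 ph sqh.
  exact: (doleans_le1 P_complete B_brownian T_gt0 ph sqh (measurable_ito P_complete B_brownian T_gt0 ph sqh T0T) li).
apply: (@unif_integrable_ge1 _ _ _ P (fun n : nat => M n%:R) Minf (fun n => mM _) mMinf (fun n w => M_ge0 _ w)).
- by move=> w; exact: doleans_ge0.
- apply: filterS stopped_limit => w [n0 _ hn]; apply: cvg_near_cst; apply: (ex_intro2 _ _ n0 Logic.I) => n nn.
  by have [_ e _] := hn n nn; rewrite ME e.
(* [K] dominates the entropy bound plus one and is positive whatever the sign of that bound, so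
   truncation at the level [exp (K / e)] removes at most [e]. *)
move=> e e0; set K := `|entropy_bound + 1| + 1.
have K0 : 0 < K by rewrite ltr_wpDl.
have b0 : 0 < K / e by rewrite divr_gt0.
exists (expR (K / e)); first exact: expR_ge0.
apply: nearW => n; have [IM EM] := E_M n; have [IL EL] := ML_integrable n.
have Imin : P.-integrable setT (EFin \o (fun w => Num.min (M n%:R w) (expR (K / e)))).
  apply: (intg_le measurableT _ _ IM); first by apply: measurable_minr; [exact: mM|exact: measurable_cst].
  apply: aeW => w _; rewrite ger0_norm ?ge_min ?lexx//.
  by rewrite le_min M_ge0 expR_ge0.
have I1 := intgD measurableT IL (intg_cst P 1).
have IB := intgZ measurableT (K / e)^-1 I1.
have le : \int[P]_w (M n%:R w - Num.min (M n%:R w) (expR (K / e))) <= \int[P]_w ((K / e)^-1 * (M n%:R w * L n%:R w + 1)).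
  apply: (Rintegral_le_ae measurableT (intgB measurableT IM Imin) IB).
  by apply: aeW => w _; exact: expR_tail.
have rhs : \int[P]_w ((K / e)^-1 * (M n%:R w * L n%:R w + 1)) <= e.
  rewrite (RintegralZl _ measurableT I1) (RintegralD measurableT IL (intg_cst P 1)) Rintegral_cstP.
  rewrite ler_pdivrMl//; apply: (@le_trans _ _ K); last by rewrite divfK// gt_eqF.
  apply: (le_trans (lerD EL (lexx _))); rewrite /K; apply: (le_trans (ler_norm _)).
  by rewrite lerDl.
have := le_trans le rhs; rewrite (RintegralB measurableT IM Imin) EM => dif.
by rewrite (intg_fin_num measurableT Imin) lee_fin lerBlDr -lerBlDl.
Qed.

Let Minf_integrable : P.-integrable setT (EFin \o Minf).
Proof.
by apply: (proj1 (@intg_ge0 _ _ _ P setT Minf 1 mMinf _ _)) => [w _|]; [exact: doleans_ge0|rewrite doleans_one].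
Qed.

(** The stopped products are at least [-1], have bounded means, and on almost every path equal the
    limit from some rank on. *)
Lemma entropy_integrable : P.-integrable setT (EFin \o (fun w => Minf w * Linf w)).
Proof.
apply: (proj1 (@fatou_lower _ _ _ P (fun n : nat => fun w => M n%:R w * L n%:R w) _ (cst 1) entropy_bound _ _ _ _ _ _)).
- by move=> n; have [] := ML_integrable n.
- exact: (measurable_funM mMinf mLinf).
- exact: intg_cst.
- by move=> n; apply: aeW => w; exact: expR_mul_ge.
- apply: filterS stopped_limit => w [n0 _ hn]; apply: (ex_intro2 _ _ n0 Logic.I) => n nn.
  by have [_ e _] := hn n nn; rewrite ME e.
- by move=> n; have [] := ML_integrable n.
Qed.

(** Fenchel's inequality pairs finite entropy with an exponential moment of any positive order. This
    is how the lower bound of a competing wealth becomes integrable against [M]. *)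
Lemma entropy_exp_integrable (S G : Om -> R) (b : R) : 0 < b ->
  measurable_fun setT S -> P.-integrable setT (EFin \o G) ->
  {ae P, forall w, expR (b * `|S w|) <= G w} ->
  P.-integrable setT (EFin \o (fun w => doleans T h (ito h) w * S w)).
Proof.
move=> b0 mS IG le.
apply: (intg_le measurableT _ _ (intgZ measurableT b^-1 (intgD measurableT entropy_integrable IG))).
  exact: (measurable_funM mMinf mS).
apply: filterS le => w le _; rewrite normrM (ger0_norm (doleans_ge0 _ _ _ _)) ler_pdivlMl//.
have := expR_fenchel (Linf w) (b * `|S w|).
rewrite -[expR (Linf w)]/(Minf w) mulrCA -/(Minf w) => /le_trans; apply.
have := doleans_ge0 T h (ito h) w; rewrite -/(Minf w); move: le; lra.
Qed.

Let mJinf : measurable_fun setT Jinf.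
Proof.
exact: (@measurable_dot_integral _ _ _ _ P T B P_complete B_brownian T_gt0 v _ pv (predictable_mxD T_gt0 ptheta ph)).
Qed.

Let mdv : measurable_fun setT (drifted theta v T).
Proof. exact: (measurable_drifted P_complete B_brownian T_gt0 ptheta pv sqv T0T). Qed.

(** Fatou's lemma for [N], which is bounded below by an integrable variable, gives the limit a mean
    of at most [- alpha y0]. That limit plus [alpha y0 M] is [alpha M] times the difference between
    the integrated drift and the realised gain, whose mean is therefore nonpositive. *)
Lemma drift_gain_le :
  [/\ P.-integrable setT (EFin \o (fun w => Minf w * Jinf w)),
      P.-integrable setT (EFin \o (fun w => Minf w * drifted theta v T w)) &
      \int[P]_w (Minf w * Jinf w) <= \int[P]_w (Minf w * drifted theta v T w)].
Proof.
have IML := entropy_integrable.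
pose Ninf w := Minf w * (Linf w - alpha * Y T w + alpha * Jinf w).
have mN : measurable_fun setT Ninf.
  apply: (measurable_funM mMinf); apply: measurable_funD; last exact: measurable_funM.
  by apply: measurable_funB; [exact: mLinf|exact: measurable_funM].
have [IN EN] : P.-integrable setT (EFin \o Ninf) /\ \int[P]_w Ninf w <= - alpha * y0.
  apply: (@fatou_lower _ _ _ P (fun n : nat => N n%:R) _ (fun w => 1 - cp + cp * SY w)).
  - by move=> n; have [] := E_N n.
  - exact: mN.
  - exact: (intgD measurableT (intg_cst P _) (intgZ measurableT cp SY_integrable)).
  - move=> n; apply: filterS N_ge => w /(_ n); apply: le_trans.
    rewrite opprD lerD2r -mulrN1 ler_pM2l ?subr_gt0//; exact: expR_mul_ge.
  - apply: filterS2 stopped_limit NE => w [n0 _ hn] hN; apply: (ex_intro2 _ _ n0 Logic.I) => n nn.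
    by have [t e eJ] := hn n nn; rewrite hN ME e eJ t.
  - by move=> n; have [_ ->] := E_N n.
(* The positive part of [Y T] is handled by Fenchel's inequality, the negative part by the bound
   [k]. *)
have IMY : P.-integrable setT (EFin \o (fun w => Minf w * (alpha * Y T w))).
  apply: (intg_le measurableT _ _ (intgD measurableT (intgZ measurableT (alpha * `|k|) Minf_integrable) (intgZ measurableT cp (intgD measurableT IML SY_integrable)))).
    by apply: (measurable_funM mMinf); exact: measurable_funM.
  apply: filterS2 Y_SY YT_ge => w /(_ T T0T) hS hk _.
  have := fenchel_Y (Linf w) T0T hS; rewrite -[expR (Linf w)]/(Minf w).
  have M0 : 0 <= Minf w by exact: doleans_ge0.
  have aY : `|alpha * Y T w| <= alpha * Num.max (Y T w) 0 + alpha * `|k|.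
    rewrite normrM (gtr0_norm alpha_gt0) -mulrDr ler_pM2l// ler_norml.
    have := ler_norm k; have /orP[y0'|y0'] := le_total 0 (Y T w).
      by rewrite (max_idPl y0') => _; rewrite lerDl normr_ge0 andbT (le_trans _ y0')// oppr_le0 addr_ge0.
    by rewrite (max_idPr y0') add0r => h1; move: hk y0' (normr_ge0 k) h1; lra.
  rewrite normrM (ger0_norm M0) => le1; apply: (le_trans (ler_wpM2l M0 aY)).
  by rewrite mulrDr addrC lerD// mulrC.
have eY : {ae P, forall w, alpha * Y T w = Linf w + alpha * y0 + alpha * drifted theta v T w}.
  by apply: filterS logE => w /(_ T T0T) e; rewrite /Linf e; ring.
have IMV : P.-integrable setT (EFin \o (fun w => Minf w * drifted theta v T w)).
  have IZ := intgZ measurableT alpha^-1 (intgB measurableT (intgB measurableT IMY IML) (intgZ measurableT (alpha * y0) Minf_integrable)).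
  apply: (intg_ae_eq measurableT _ _ IZ); first exact: (measurable_funM mMinf mdv).
  by apply: filterS eY => w e _; rewrite e; field; rewrite gt_eqF.
have IMJ : P.-integrable setT (EFin \o (fun w => Minf w * Jinf w)).
  have IZ := intgZ measurableT alpha^-1 (intgD measurableT (intgB measurableT IN IML) IMY).
  apply: (intg_ae_eq measurableT _ _ IZ); first exact: (measurable_funM mMinf mJinf).
  by apply: aeW => w _; rewrite /Ninf; field; rewrite gt_eqF.
split => //; rewrite -(ler_pM2l alpha_gt0) -subr_le0.
rewrite -!(RintegralZl _ measurableT)// -(RintegralB measurableT (intgZ measurableT _ IMJ) (intgZ measurableT _ IMV)).
have -> : \int[P]_w (alpha * (Minf w * Jinf w) - alpha * (Minf w * drifted theta v T w)) =
   \int[P]_w (Ninf w + alpha * y0 * Minf w).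
  apply: (Rintegral_ae_eq measurableT).
  - apply: measurable_funB; apply: measurable_funM => //; exact: (measurable_funM mMinf).
  - by apply: measurable_funD => //; exact: measurable_funM.
  apply: filterS eY => w e _; rewrite /Ninf e; ring.
rewrite (RintegralD measurableT IN (intgZ measurableT _ Minf_integrable)) (RintegralZl _ measurableT Minf_integrable).
rewrite [X in _ + _ * X](_ : _ = 1); last by rewrite /Rintegral doleans_one.
by rewrite mulr1 -lerBrDr sub0r -mulNr.
Qed.

(** Only [q] is stopped, not the exponential, whose mass is one by now. The stopped gain is a part
    [O] centred under [M] plus a drift [K] that does not exceed that of [v]; Fatou's lemma with the
    lower bound [- M S] passes to the limit. *)
Lemma drift_competitor q (S : Om -> R) : pred q ->
  (forall t w, dot (q t w) (q t w) <= a t w) ->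
  {ae P, forall w, {ae leb, forall t, `[0, T]%classic t ->
     dot (q t w) (theta t w + h t w) <= dot (v t w) (theta t w + h t w)}} ->
  P.-integrable setT (EFin \o (fun w => Minf w * S w)) ->
  {ae P, forall w, forall t, 0 <= t <= T -> - S w <= drifted theta q t w} ->
  P.-integrable setT (EFin \o (fun w => Minf w * drifted theta q T w)) /\
  \int[P]_w (Minf w * drifted theta q T w) <= \int[P]_w (Minf w * Jinf w).
Proof.
move=> pq aq opt IS hS; have [IJ _ _] := drift_gain_le.
have sqq := sqint_clock pq aq.
have pth : pred (fun t w => theta t w + h t w) by exact: predictable_mxD.
pose O n w := ito (st n q) T w - \int[leb]_(u in `[0, T]) dot (st n q u w) (h u w).
pose K n w := \int[leb]_(u in `[0, T]) dot (st n q u w) (theta u w + h u w).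
pose f n w := Minf w * O n w + Minf w * K n w.
have Minf0 w : 0 <= Minf w by exact: doleans_ge0.
have IO (n : nat) := doleans_orthogonal P_complete B_brownian T_gt0 ph (pst n%:R pq) sqh doleans_one (ler0n _ n) (stopped_energy n pq aq).
have le_st n w t : dot (st n q t w) (st n q t w) <= a t w.
  exact: le_trans (stopped_le _ _ _ _ _ _) (aq t w).
have mI : measurable (`[0, T]%classic : set (measurableTypeR R)) by exact: measurable_itv.
have fE : {ae P, forall w, forall n : nat, O n%:R w + K n%:R w = drifted theta q (tau n%:R w) w}.
  apply: filterS2 (drifted_stopped pq aq) a_fin => w hV fin n; rewrite hV.
  have fin_q (r : R -> Om -> 'cV[R]_m) : pred r -> (forall t, dot (r t w) (r t w) <= a t w) -> (energy r T w < +oo)%E.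
    by move=> pr lr; exact: le_lt_trans (energy_clock pr lr) fin.
  have I1 := intg_dot T_gt0 (pst n%:R pq) ptheta (fin_q _ (pst _ pq) (le_st n%:R w)) (fin_q _ ptheta (a_theta ^~ w)).
  have I2 := intg_dot T_gt0 (pst n%:R pq) ph (fin_q _ (pst _ pq) (le_st n%:R w)) (fin_q _ ph (a_h ^~ w)).
  have -> : K n%:R w = \int[leb]_(u in `[0, T]) dot (st n%:R q u w) (theta u w) + \int[leb]_(u in `[0, T]) dot (st n%:R q u w) (h u w).
    by rewrite -(RintegralD mI I1 I2); apply: eq_Rintegral => u _; rewrite dotDr.
  by rewrite /O; set x := \int[leb]_(u in _) _; set y := \int[leb]_(u in _) _; ring.
have KJ : {ae P, forall w, forall n : nat, K n%:R w <= Jinf w}.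
  apply: filterS3 J_ge0 opt a_fin => w hJ hopt fin n; have /andP[_ le2] := hJ n.
  apply: (le_trans _ le2).
  have fin_q (r : R -> Om -> 'cV[R]_m) : pred r -> (forall t, dot (r t w) (r t w) <= a t w) -> (energy r T w < +oo)%E.
    by move=> pr lr; exact: le_lt_trans (energy_clock pr lr) fin.
  have ef : (energy (fun t w => (theta t w + h t w)%R) T w < +oo)%E.
    apply: (le_lt_trans (energyD_le T_gt0 w ptheta ph (lexx T))).
    have f1 := fin_q _ ptheta (a_theta ^~ w); have f2 := fin_q _ ph (a_h ^~ w).
    by apply: lte_add_pinfty; apply: lte_mul_pinfty.
  have sv t : dot (st n%:R v t w) (st n%:R v t w) <= a t w.
    exact: le_trans (stopped_le _ _ _ _ _ _) (a_v t w).
  have I1 := intg_dot T_gt0 (pst n%:R pq) pth (fin_q _ (pst _ pq) (le_st n%:R w)) ef.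
  have I2 := intg_dot T_gt0 (pst n%:R pv) pth (fin_q _ (pst _ pv) sv) ef.
  apply: (Rintegral_le_ae mI I1 I2); apply: (negligibleS _ hopt); apply: subsetC => u hu uT.
  by rewrite /stopped; case: ifP => _; [exact: hu|rewrite !dot0l].
have Sf : {ae P, forall w, forall n : nat, - (Minf w * S w) <= f n%:R w}.
  apply: filterS2 fE hS => w hf hs n; rewrite /f -mulrDr hf -mulrN ler_wpM2l//.
  by apply: hs; exact: stop_time_itv.
have mK n : measurable_fun setT (K n).
  exact: (@measurable_dot_integral _ _ _ _ P T B P_complete B_brownian T_gt0 _ _ (pst n pq) pth).
have IK (n : nat) : P.-integrable setT (EFin \o (fun w => Minf w * K n%:R w)).
  have [IOn _] := IO n.
  apply: (intg_le measurableT _ _ (intgD measurableT (integrable_norm IJ) (intgD measurableT (integrable_norm IS) (integrable_norm IOn)))).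
    exact: (measurable_funM mMinf (mK _)).
  apply: filterS2 Sf KJ => w hs hk _ /=; have := hs n; rewrite /f.
  have := ler_wpM2l (Minf0 w) (hk n).
  rewrite -/(Minf w) -/(O n%:R w).
  set j := Minf w * Jinf w; set k' := Minf w * K _ w; set o := Minf w * O _ w; set s := Minf w * S w => h1 h2.
  have := ler_norm j; have := ler_norm s; have := ler_norm o.
  have := normr_ge0 j; have := normr_ge0 s; have := normr_ge0 o.
  rewrite ler_norml; lra.
apply: (@fatou_lower _ _ _ P (fun n : nat => f n%:R) _ (fun w => Minf w * S w)) => //.
- by move=> n; have [IOn _] := IO n; exact: (intgD measurableT IOn (IK n)).
- apply: (measurable_funM mMinf).
  exact: (measurable_drifted P_complete B_brownian T_gt0 ptheta pq sqq T0T).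
- by move=> n; apply: filterS Sf => w /(_ n).
- apply: filterS2 stopped_near fE => w [n0 _ hn] hf; apply: (ex_intro2 _ _ n0 Logic.I) => n nn.
  by rewrite /f -mulrDr hf (hn n nn).
move=> n; have [IOn EOn] := IO n.
rewrite (RintegralD measurableT IOn (IK n)) EOn add0r.
apply: (Rintegral_le_ae measurableT (IK n) IJ); apply: filterS KJ => w /(_ n) hk _.
exact: (ler_wpM2l (Minf0 w) hk).
Qed.

End change_of_measure.

(** * Exponential moments of a running minimum *)

Lemma intg_fine {d : measure_display} {X : measurableType d} {R : realType} (P : probability X R) (L : X -> \bar R) :
  measurable_fun setT L -> (forall w, 0 <= L w)%E -> (\int[P]_w L w < +oo)%E ->
  P.-integrable setT (EFin \o (fine \o L)) /\ {ae P, forall w, L w \is a fin_num}.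
Proof.
move=> mL L0 fin.
have IL : P.-integrable setT L.
  apply/integrableP; split=> //.
  by under eq_integral => w _ do rewrite gee0_abs//.
have finL : {ae P, forall w, L w \is a fin_num}.
  by apply: filterS (integrable_ae measurableT IL) => w h; exact: h.
split => //; apply: (proj1 (@intg_ge0 _ _ _ P setT _ (fine (\int[P]_w L w)%E) _ _ _)).
- exact: measurableT_comp.
- by move=> w _; exact: fine_ge0.
rewrite fineK; last by rewrite ge0_fin_numE ?integral_ge0// => w _; exact: L0.
rewrite le_eqVlt; apply/orP; left; apply/eqP; apply: ae_eq_integral => //.
- by apply/measurable_EFinP; exact: measurableT_comp.
- by apply: filterS finL => w h _ /=; rewrite fineK.
Qed.

Section exponential_moment.
Context {disp : measure_display} {Om : measurableType disp} {R : realType} {m : nat}.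
Variables (P : probability Om R) (T : R) (B : R -> Om -> 'cV[R]_m).
Hypothesis P_complete : measure_is_complete P.
Hypothesis B_brownian : brownian_motion P T B.
Hypothesis T_gt0 : 0 < T.

Local Notation Ft := (augmented_filtration P B).
Local Notation leb := (@lebesgue_measure R).
Let mB := brownian_measurable B_brownian.
Local Notation pred := (predictable_mx T Ft).
Local Notation sqint := (square_integrable P T).
Local Notation ito := (ito P T B).
Let T0T : 0 <= T <= T. Proof. by rewrite lexx ltW. Qed.

Variables (theta : R -> Om -> 'cV[R]_m) (ct : R).
Hypothesis theta_predictable : pred theta.
Hypothesis ct_ge0 : 0 <= ct.
Hypothesis theta_energy : {ae P, forall w, (energy theta T w <= ct%:E)%E}.

Local Notation dens := (density P T B theta).
Let density_gt0 w : 0 < dens w. Proof. exact: expR_gt0. Qed.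

(** The density is [E(- theta)], and its inverse is [exp (int |theta|^2) E(theta)], where the energy
    of [theta] is bounded and [E(theta)] has mass at most one. *)
Lemma density_inv : P.-integrable setT (EFin \o (fun w => (dens w)^-1)).
Proof.
have pN := predictable_mxN T_gt0 theta_predictable.
have eN : {ae P, forall w, (energy (fun t w => (- theta t w)%R) T w <= ct%:E)%E}.
  by apply: filterS theta_energy => w; rewrite energyN.
have sN := energy_fin_ae eN.
pose th2 t w := (-1) *: (- theta t w).
have p2 : pred th2 by apply: predictable_mxZ => //; exact: predictable_cst.
have s2 : sqint th2.
  apply: filterS sN => w fin; rewrite -[X in (X < _)%E]/(energy th2 T w) (energyZ T_gt0 (-1) w pN (lexx T)).
  by apply: lte_mul_pinfty => //; rewrite lee_fin sqr_ge0.
have m2 : measurable_fun setT (fun w => (-1) * ito (fun t w => - theta t w) T w).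
  by apply: measurable_funM => //; exact: (measurable_ito P_complete B_brownian T_gt0 pN sN T0T).
have [_ _ li] := itoP P_complete B_brownian T_gt0 pN sN.
have d1 := doleans_le1 P_complete B_brownian T_gt0 p2 s2 m2 (ito_limitZ T_gt0 (-1) pN li).
have md2 := @measurable_doleans _ _ _ _ P T B P_complete B_brownian T_gt0 th2 (fun t w => (-1) * ito (fun t w => - theta t w) t w) p2 m2.
have [I2 _] := intg_ge0 md2 (fun w _ => doleans_ge0 _ _ _ _) d1.
apply: (intg_le measurableT _ _ (intgZ measurableT (expR ct) I2)).
  have mden : measurable_fun setT dens.
    exact: (measurable_doleans P_complete B_brownian T_gt0 pN (measurable_ito P_complete B_brownian T_gt0 pN sN T0T)).
  exact: measurableT_comp measurable_invr_real mden.
apply: filterS2 eN sN => w le fin _; rewrite ger0_norm ?invr_ge0 ?(ltW (density_gt0 w))//.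
rewrite /density /doleans -expRN -expRD ler_expR (qvarZ T_gt0 (-1) w pN (lexx T)).
have : qvar (fun t w => - theta t w) T w <= ct by rewrite -lee_fin -(energyE T_gt0 fin pN T0T).
rewrite sqrrN expr1n mul1r; set x := qvar _ _ _; lra.
Qed.

Variable Q : probability Om R.
Hypothesis Q_density : forall A, Ft T A -> Q A = (\int[P]_(w in A) (dens w)%:E)%E.
Variable X : R -> Om -> R.
Hypothesis X_martingale : martingale Q T Ft X.
Hypothesis X_paths : {ae P, forall w, path_continuous T (X ^~ w)}.
Variable beta : R.
Hypothesis beta_gt0 : 0 < beta.
Hypothesis XT_exp : P.-integrable setT (EFin \o (fun w => expR (- (2 * beta) * X T w))).

(** A finite grid, so that the discrete maximal inequality applies; [ever_below] collects all
    grids. *)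
Definition below (i : nat) (r : R) : set Om :=
  \bigcup_(j in [set j | (j <= 2 ^ i)%N]) [set w | X (dyadic T i j) w <= - r].

Let X_adapted : adapted T Ft X. Proof. by case: X_martingale. Qed.

Let dyadic_below i j r : (j <= 2 ^ i)%N -> Ft (dyadic T i j) [set w | X (dyadic T i j) w <= - r].
Proof.
move=> ji; have := X_adapted (dyadic_itv T_gt0 ji) (measurable_itv `]-oo, - r]).
by rewrite (_ : X _ @^-1` _ = [set w | X (dyadic T i j) w <= - r])//; apply/seteqP; split => w /=; rewrite in_itv.
Qed.

Lemma Ft_below i r : Ft T (below i r).
Proof.
apply: (@bigcup_measurable _ (OmF P B T)) => j /= ji.
have /andP[_ jT] := dyadic_itv T_gt0 ji.
exact: (Ft_sub jT (dyadic_below r ji)).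
Qed.

Lemma measurable_below i r : measurable (below i r).
Proof. exact: (Ft_measurable P_complete mB (lexx T) (Ft_below i r)). Qed.

Let mXT : measurable_fun setT (X T).
Proof. exact: (measurable_wrt_Om P_complete mB (lexx T) (X_adapted T0T)). Qed.

Let Z w := expR (- beta * X T w).
Let mZ : measurable_fun setT Z.
Proof. by apply: measurableT_comp => //; exact: measurable_funM. Qed.

Let mden : measurable_fun setT dens.
Proof. exact: (measurable_density P_complete B_brownian T_gt0 theta_predictable theta_energy). Qed.

(** [Z D <= (Z^2 + D^2) / 2] with [D] the density, which is why the moment of order [2 beta] is
    assumed. *)
Let DZ : P.-integrable setT (EFin \o (fun w => Z w * dens w)).
Proof.
have [_ Iden2] := density_L2 P_complete B_brownian T_gt0 theta_predictable theta_energy.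
apply: (intg_le measurableT _ _ (intgZ measurableT 2^-1 (intgD measurableT Iden2 XT_exp))).
  exact: measurable_funM.
apply: aeW => w _; rewrite ger0_norm; last by rewrite mulr_ge0 ?expR_ge0// ltW.
have -> : expR (- (2 * beta) * X T w) = Z w ^+ 2 by rewrite /Z -expRM_natl mulr_natl; congr expR; ring.
by have := sqr_ge0 (Z w - dens w); rewrite sqrrB; lra.
Qed.

Let Zwrt : measurable_wrt (Ft T) Z.
Proof.
apply/measurable_wrtP; apply: measurableT_comp => //; apply: measurable_funM => //.
by apply/measurable_wrtP; exact: X_adapted.
Qed.

Let Z_Q := integral_change P_complete B_brownian mden (fun w => ltW (density_gt0 w)) Q_density Zwrt DZ.

(* The tangent of [exp (- beta x)] at [- r] turns the martingale property into
   the submartingale inequality. *)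
Let Q_slice i j r A : (j <= 2 ^ i)%N -> Ft (dyadic T i j) A ->
  A `<=` [set w | X (dyadic T i j) w <= - r] ->
  ((expR (beta * r))%:E * Q A <= \int[Q]_(w in A) (Z w)%:E)%E.
Proof.
move=> ji FA sub; have jT := dyadic_itv T_gt0 ji; have /andP[j0 jT'] := jT.
have mA : measurable A := Ft_measurable P_complete mB jT' FA.
have [_ IX EX] := X_martingale; have [IZ _] := Z_Q.
have IXT := integrableS measurableT mA (@subsetT _ A) (IX _ T0T).
have IXs := integrableS measurableT mA (@subsetT _ A) (IX _ jT).
have IZA := integrableS measurableT mA (@subsetT _ A) IZ.
have Icst c : Q.-integrable A (EFin \o (fun _ => c)) := integrableS measurableT mA (@subsetT _ A) (intg_cst Q c).
set s := dyadic T i j in jT j0 jT' FA sub EX IXs *.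
have e : \int[Q]_(w in A) X T w = \int[Q]_(w in A) X s w.
  by rewrite /Rintegral (EX s T j0 jT' (lexx T) A FA).
have QA : Q A = (fine (Q A))%:E by rewrite fineK// fin_num_measure.
rewrite (intg_fin_num mA IZA) QA -EFinM lee_fin; set E := expR (beta * r).
have cA c : \int[Q]_(w in A) c = c * fine (Q A) by exact: Rintegral_cst.
have lin : \int[Q]_(w in A) (E * (1 - beta * r) - E * beta * X T w) <= \int[Q]_(w in A) Z w.
  apply: (Rintegral_le_ae mA (intgB mA (Icst _) (intgZ mA _ IXT)) IZA).
  apply: aeW => w _; have := expR_ge1Dx (- beta * X T w - beta * r).
  rewrite -(ler_pM2l (expR_gt0 (beta * r))) -expRD subrKC -/(Z w) -/E; apply: le_trans.
  by rewrite le_eqVlt; apply/orP; left; apply/eqP; ring.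
apply: le_trans lin; rewrite (RintegralB mA (Icst _) (intgZ mA _ IXT)) (RintegralZl _ mA IXT) cA e.
have h : \int[Q]_(w in A) X s w <= - r * fine (Q A).
  rewrite -cA; apply: (Rintegral_le_ae mA IXs (Icst _)); apply: aeW => w Aw; exact: sub.
have Eb : 0 <= E * beta by rewrite mulr_ge0 ?expR_ge0// ltW.
have := ler_wpM2l Eb h; set y := \int[Q]_(w in A) _; set z := fine _.
have -> : E * beta * (- r * z) = - (E * beta * r * z) by ring.
have -> : E * (1 - beta * r) * z = E * z - E * beta * r * z by ring.
lra.
Qed.

Let C1 := \int[P]_w (Z w * dens w).

Let Q_below i r : (Q (below i r) <= (expR (- (beta * r)) * C1)%:E)%E.
Proof.
have := @maximal_inequality _ Om R Q (fun j => Ft (Num.min (dyadic T i j) T))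
  (fun j => if (j <= 2 ^ i)%N then [set w | X (dyadic T i j) w <= - r] else set0) Z (expR (beta * r)) (2 ^ i) (expR_ge0 _).
have minE j : (j <= 2 ^ i)%N -> Num.min (dyadic T i j) T = dyadic T i j.
  by move=> /(dyadic_itv T_gt0)/andP[_ h]; exact: (min_idPl h).
have -> : \bigcup_(j in [set j | (j <= 2 ^ i)%N]) (if (j <= 2 ^ i)%N then [set w | X (dyadic T i j) w <= - r] else set0) = below i r.
  by apply: eq_bigcupr => j /= ->.
have [IZ EZ] := Z_Q.
have -> : (\int[Q]_w (Z w)%:E)%E = C1%:E by rewrite EZ (intg_fin_num measurableT DZ).
move=> max; have Qb : Q (below i r) = (fine (Q (below i r)))%:E.
  by rewrite fineK// fin_num_measure//; exact: measurable_below.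
have : ((expR (beta * r))%:E * Q (below i r) <= C1%:E)%E.
  apply: max => //.
  - by move=> j; exact: smallest_sigma_algebra.
  - move=> j1 j2 j12; apply: Ft_sub; rewrite le_min !ge_min lexx orbT andbT; apply/orP; left.
    by rewrite /dyadic ler_wpM2l ?(ltW T_gt0)// ler_wpM2r ?invr_ge0 ?exprn_ge0// ler_nat.
  - move=> j ji; apply: (Ft_measurable P_complete mB); rewrite ge_min lexx orbT//.
  - move=> j; case: ifPn => ji; last exact: (@measurable0 _ (OmF P B (Num.min (dyadic T i j) T))).
    by rewrite minE//; exact: dyadic_below.
  - by move=> w; exact: expR_ge0.
  by move=> j A ji; rewrite minE// ji => FA sub; exact: (@Q_slice i j r A ji FA sub).
rewrite Qb -EFinM !lee_fin expRN -ler_pdivlMl ?expR_gt0//.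
Qed.

Let C2 := \int[P]_w (dens w)^-1.
Let K := 2^-1 * (C1 + C2).

Let C1_ge0 : 0 <= C1.
Proof. by apply: Rintegral_ge0 => w _; rewrite mulr_ge0 ?expR_ge0// ltW. Qed.

Let C2_ge0 : 0 <= C2.
Proof. by apply: Rintegral_ge0 => w _; rewrite invr_ge0 ltW. Qed.

Let K_ge0 : 0 <= K. Proof. by rewrite mulr_ge0 ?addr_ge0. Qed.

(* [1 <= (l D + 1 / (l D)) / 2] transfers the tail estimate from Q to P. *)
Let P_below i r : (P (below i r) <= (expR (- (beta / 2 * r)) * K)%:E)%E.
Proof.
(* This [l] balances the two terms: [l exp (- beta r)] and [1 / l] are both [exp (- beta r / 2)]. *)
set E := below i r; set l := expR (beta / 2 * r).
have mE : measurable E by exact: measurable_below.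
have l0 : 0 < l by exact: expR_gt0.
have [Iden _] := density_L2 P_complete B_brownian T_gt0 theta_predictable theta_energy.
have Iinv := density_inv.
have mi : measurable_fun setT (\1_E : Om -> R) by exact: measurable_indic.
have IE : P.-integrable setT (EFin \o (fun w => \1_E w * dens w)).
  apply: (intg_le measurableT _ _ Iden); first exact: measurable_funM.
  apply: aeW => w _; rewrite normrM (gtr0_norm (density_gt0 w)) indicE.
  by case: (_ \in _); rewrite ?normr1 ?mul1r// normr0 mul0r ltW.
have I1 : P.-integrable setT (EFin \o (\1_E : Om -> R)).
  apply: (intg_le measurableT mi _ (intg_cst P 1)); apply: aeW => w _; rewrite indicE.
  by case: (_ \in _); rewrite ?normr1 ?normr0.
have QE : Q E = (\int[P]_w (\1_E w * dens w))%:E.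
  rewrite (Q_density (Ft_below i r)) -(intg_fin_num measurableT IE) [LHS]integral_mkcond.
  apply: eq_integral => w _; rewrite patchE indicE; case: ifP => _; by rewrite ?mul1r// mul0r.
have PE : P E = (\int[P]_w \1_E w)%:E.
  by rewrite -(intg_fin_num measurableT I1) integral_indic// setIT.
rewrite PE lee_fin.
have IB := intgZ measurableT 2^-1 (intgD measurableT (intgZ measurableT l IE) (intgZ measurableT l^-1 Iinv)).
have le : {ae P, forall w, setT w -> \1_E w <= 2^-1 * (l * (\1_E w * dens w) + l^-1 * (dens w)^-1)}.
  apply: aeW => w _; rewrite indicE -invfM; have D0 := density_gt0 w.
  have x0 : 0 < l * dens w by exact: mulr_gt0.
  case: (_ \in _); last by rewrite mul0r mulr0 add0r mulr_ge0// invr_ge0 ltW.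
  rewrite mul1r; set x := l * dens w in x0 *.
  rewrite ler_pdivlMl// mulr1 -subr_ge0 -(pmulr_lge0 _ x0) mulrBl mulrDl mulVf ?gt_eqF//.
  have := sqr_ge0 (x - 1); rewrite sqrrB expr1n mulr1 expr2; lra.
apply: (le_trans (Rintegral_le_ae measurableT I1 IB le)).
rewrite (RintegralZl _ measurableT (intgD measurableT (intgZ measurableT l IE) (intgZ measurableT l^-1 Iinv))).
rewrite (RintegralD measurableT (intgZ measurableT l IE) (intgZ measurableT l^-1 Iinv)) !(RintegralZl _ measurableT)//.
have := Q_below i r; rewrite QE lee_fin => h.
rewrite /K mulrCA ler_pM2l ?invr_gt0// mulrDr; apply: lerD; last by rewrite /l -expRN.
apply: (le_trans (ler_wpM2l (ltW l0) h)); rewrite mulrA /l -expRD.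
by rewrite (_ : beta / 2 * r - beta * r = - (beta / 2 * r))//; field.
Qed.

Definition ever_below r := \bigcup_i below i r.

Let measurable_ever r : measurable (ever_below r).
Proof. by apply: bigcupT_measurable => i; exact: measurable_below. Qed.

Let P_ever r : (P (ever_below r) <= (expR (- (beta / 2 * r)) * K)%:E)%E.
Proof.
have nd : nondecreasing_seq (below ^~ r).
  apply/nondecreasing_seqP => i; apply/subsetPset => w [j /= ji h].
  exists j.*2 => /=; last by rewrite -dyadic_refine.
  by rewrite expnS mul2n leq_double.
have cvg := @nondecreasing_cvg_mu _ _ _ P _ (fun i => measurable_below i r) (measurable_ever r) nd.
rewrite -(cvg_lim _ cvg)//; apply: lime_le; first by apply/cvg_ex; eexists; exact: cvg.
by apply: nearW => i; exact: P_below.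
Qed.

(** Half of the decay rate [beta / 2] in [P_ever], which leaves a geometric series of ratio
    [exp (- b)]. *)
Let b := beta / 4.
Let b_gt0 : 0 < b. Proof. by rewrite divr_gt0. Qed.

(** Majorises [exp (- b X)] along the whole path wherever [X] is negative: if [n < - X <= n + 1] at
    some time, layer [n] alone suffices. *)
Definition layer_sum w := (\sum_(n <oo) (expR (b * n.+1%:R) * \1_(ever_below n%:R) w)%:E)%E.

Let layer_ge0 w n : (0 <= (expR (b * n.+1%:R) * \1_(ever_below n%:R) w)%:E)%E.
Proof. by rewrite lee_fin mulr_ge0 ?expR_ge0. Qed.

Let measurable_layer n : measurable_fun setT (fun w => (expR (b * n.+1%:R) * \1_(ever_below n%:R) w)%:E).
Proof. by apply/measurable_EFinP; apply: measurable_funM => //; exact: measurable_indic. Qed.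

Let measurable_layer_sum : measurable_fun setT layer_sum.
Proof.
apply: (@ge0_emeasurable_sum _ _ _ setT (fun n w => (expR (b * n.+1%:R) * \1_(ever_below n%:R) w)%:E) xpredT) => //.
Qed.

Let layer_sum_fin : (\int[P]_w layer_sum w < +oo)%E.
Proof.
rewrite (integral_nneseries P measurableT measurable_layer) => [|n w _]; last exact: layer_ge0.
apply: (@le_lt_trans _ _ (expR b * K * (1 - expR (- b))^-1)%:E); last exact: ltry.
apply: lime_le; first by apply: is_cvg_nneseries => n _ _; apply: integral_ge0 => w _.
apply: nearW => n.
apply: (@le_trans _ _ (series (geometric (expR b * K) (expR (- b))) n)%:E); last first.
  rewrite lee_fin; apply: geometric_le_lim.
  - by rewrite mulr_ge0 ?expR_ge0.
  - exact: expR_gt0.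
  by rewrite ger0_norm ?expR_ge0// -expR0 ltr_expR oppr_lt0.
rewrite /series/= -sumEFin; apply: lee_sum => j _.
under eq_integral => w _ do rewrite EFinM.
rewrite ge0_integralZl//; last by apply/measurable_EFinP; exact: measurable_indic.
rewrite integral_indic// setIT.
apply: (le_trans (lee_wpmul2l _ (P_ever _))); first by rewrite lee_fin expR_ge0.
rewrite -EFinM lee_fin /geometric/= mulrA [X in _ <= X]mulrAC ler_wpM2r// -expRM_natl -!expRD ler_expR.
by rewrite mulrS le_eqVlt; apply/orP; left; apply/eqP; rewrite /b; field.
Qed.

(** [S] is the logarithm of [1 + layer_sum] divided by [b], so its exponential moment of order [b]
    is finite by construction; the added 1 makes it nonnegative. *)
Lemma path_lower_bound : exists S : Om -> R, [/\ measurable_fun setT S,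
  (forall w, 0 <= S w), P.-integrable setT (EFin \o (fun w => expR (b * S w))) &
  {ae P, forall w, forall t, 0 <= t <= T -> - S w <= X t w}].
Proof.
have G0 w : (0 <= layer_sum w)%E by apply: nneseries_ge0.
pose g w := 1 + fine (layer_sum w).
have g1 w : 1 <= g w by rewrite lerDl fine_ge0.
have mg : measurable_fun setT g.
  by apply: measurable_funD => //; exact: measurableT_comp.
exists (fun w => b^-1 * ln (g w)).
have S0 w : 0 <= b^-1 * ln (g w) by rewrite mulr_ge0 ?ln_ge0// invr_ge0 ltW.
have [IL finL] := intg_fine measurable_layer_sum G0 layer_sum_fin.
split => //.
- by apply: measurable_funM => //; apply: measurableT_comp => //; exact: measurable_ln.
- have e : (fun w => expR (b * (b^-1 * ln (g w)))) = g.
    by apply/funext => w; rewrite mulVKf ?gt_eqF// lnK// posrE (lt_le_trans ltr01).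
  rewrite e; exact: (intgD measurableT (intg_cst P 1) IL).
apply: filterS2 finL X_paths => w fin cX t tT.
rewrite lerNl -ler_pdivrMl ?invr_gt0// invrK.
have [/le_trans->//|x0] := leP (b * - X t w) 0; first exact: ln_ge0.
rewrite -ler_expR lnK ?posrE ?(lt_le_trans ltr01)//.
have y0 : 0 < - X t w by rewrite pmulr_rgt0 in x0.
have [n nlt nle] : exists2 n : nat, n%:R < - X t w & - X t w <= n.+1%:R.
  have ex : exists n : nat, - X t w <= n%:R.
    by exists (Num.bound (- X t w)); apply/ltW/archi_boundP/ltW.
  case: (ex_minnP ex) => -[|n] ne min; first by rewrite leNgt y0 in ne.
  by exists n => //; rewrite ltNge; apply/negP => /min; rewrite ltnn.
have [i [j [ji hj]]] := path_continuous_dyadic T_gt0 (path_continuousN cX) tT nlt.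
apply: (@le_trans _ _ (expR (b * n.+1%:R))); first by rewrite ler_expR ler_pM2l.
rewrite -[X in X <= _]add0r lerD// -lee_fin fineK//.
have wn : \1_(ever_below n%:R) w = 1 :> R.
  rewrite indicE mem_set//; exists i => //; exists j => //=.
  by rewrite lerNr ltW.
apply: (@le_trans _ _ (expR (b * n.+1%:R) * \1_(ever_below n%:R) w)%:E); first by rewrite wn mulr1.
apply: le_trans (nneseries_lim_ge (m := 0) n.+1 (fun k _ _ => layer_ge0 w k)).
by rewrite big_nat_recr//= leeDr// sume_ge0.
Qed.

End exponential_moment.

(** * Verification *)

Section verification.
Context {disp : measure_display} {Om : measurableType disp} {R : realType} {m : nat}.
Variables (P : probability Om R) (T : R) (B : R -> Om -> 'cV[R]_m).
Hypothesis P_complete : measure_is_complete P.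
Hypothesis B_brownian : brownian_motion P T B.
Hypothesis T_gt0 : 0 < T.

Local Notation Ft := (augmented_filtration P B).
Local Notation leb := (@lebesgue_measure R).
Let mB := brownian_measurable B_brownian.
Local Notation pred := (predictable_mx T Ft).
Local Notation sqint := (square_integrable P T).
Local Notation ito := (ito P T B).
Local Notation drifted := (drifted P T B).
Local Notation density := (density P T B).
Let T0T : 0 <= T <= T. Proof. by rewrite lexx ltW. Qed.

Implicit Type q : R -> Om -> 'cV[R]_m.

Variables (theta Z v : R -> Om -> 'cV[R]_m) (ct cZ alpha : R).
Hypotheses (ptheta : pred theta) (pZ : pred Z) (pv : pred v).
Hypothesis ct_ge0 : 0 <= ct.
Hypothesis theta_energy : {ae P, forall w, (energy theta T w <= ct%:E)%E}.
Hypothesis Z_energy : (\int[P]_w energy Z T w <= cZ%:E)%E.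
Hypothesis sqZ : sqint Z.
Hypothesis alpha_gt0 : 0 < alpha.

Let zeta t w := Z t w + alpha^-1 *: theta t w.
Hypothesis v_zeta : {ae P, forall w, forall t, 0 <= t <= T -> 0 <= dot (v t w) (zeta t w - v t w)}.

(** Chosen so that the marginal utility along the strategy given by [v] is proportional to the
    exponential of this integrand. *)
Definition exponent t w := alpha *: (Z t w - v t w).
Local Notation h := exponent.

Let sqtheta : sqint theta := energy_fin_ae theta_energy.

Lemma exponent_predictable : pred h.
Proof. by apply: predictable_mxZ => //; [exact: predictable_cst|exact: predictable_mxB]. Qed.
Let ph := exponent_predictable.

Let theta_exponent t w : theta t w + h t w = alpha *: (zeta t w - v t w).
Proof.
by rewrite /exponent /zeta !scalerBr scalerDr scalerA mulfV ?gt_eqF// scale1r addrA (addrC (theta _ _)).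
Qed.

Let v_le_zeta : {ae P, forall w, forall t, 0 <= t <= T -> dot (v t w) (v t w) <= dot (zeta t w) (zeta t w)}.
Proof.
apply: filterS v_zeta => w hv t /hv; rewrite dotBr => h1.
have := dot_ge0 (v t w - zeta t w).
rewrite !(dotBl, dotBr) (dotC (zeta _ _)); move: h1; lra.
Qed.

Let pzeta : pred zeta.
Proof. by apply: predictable_mxD => //; apply: predictable_mxZ => //; exact: predictable_cst. Qed.

Let c1 := 2 * cZ + 2 * (alpha^-1 ^+ 2 * ct).

Let zeta_energy : {ae P, forall w, (energy zeta T w <= 2 * energy Z T w + (2 * (alpha^-1 ^+ 2 * ct))%:E)%E}.
Proof.
have pth : pred (fun t w => alpha^-1 *: theta t w) by apply: predictable_mxZ => //; exact: predictable_cst.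
apply: filterS theta_energy => w le; apply: (le_trans (energyD_le T_gt0 w pZ pth (lexx T))).
rewrite leeD2l// (energyZ T_gt0 alpha^-1 w ptheta (lexx T)) [leRHS]EFinM lee_pmul2l//.
rewrite EFinM; have s0 : (0 <= (alpha^-1 ^+ 2)%:E)%E by rewrite lee_fin sqr_ge0.
exact: (lee_wpmul2l s0 le).
Qed.

Let v_energy_le : {ae P, forall w, (energy v T w <= 2 * energy Z T w + (2 * (alpha^-1 ^+ 2 * ct))%:E)%E}.
Proof.
apply: filterS2 v_le_zeta zeta_energy => w le; apply: le_trans.
by apply: (energy_le_pointwise T_gt0 pv pzeta (lexx T)).
Qed.

(** Since [v.(zeta - v) >= 0], the norm of [v] is at most that of [zeta], and [v] inherits the
    energy bounds of [Z] and [theta]. *)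
Lemma v_energy : (\int[P]_w energy v T w <= c1%:E)%E.
Proof.
have mZ := measurable_energy P_complete B_brownian T_gt0 pZ.
have c0 : 0 <= 2 * (alpha^-1 ^+ 2 * ct) by rewrite mulr_ge0// mulr_ge0// sqr_ge0.
apply: (@le_trans _ _ (\int[P]_w (2 * energy Z T w + (2 * (alpha^-1 ^+ 2 * ct))%:E))%E).
  apply: ae_ge0_le_integral => //.
  - by move=> w _; exact: energy_ge0.
  - exact: (measurable_energy P_complete B_brownian T_gt0 pv).
  - by move=> w _; rewrite adde_ge0// mule_ge0// energy_ge0.
  - by apply: emeasurable_funD => //; exact: measurable_funeM.
  - by apply: filterS v_energy_le.
rewrite ge0_integralD//; last 2 first.
- by move=> w _; rewrite mule_ge0// energy_ge0.
- exact: measurable_funeM.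
rewrite ge0_integralZl//; last by move=> w _; exact: energy_ge0.
have -> : (\int[P]_w (2 * (alpha^-1 ^+ 2 * ct))%:E = (2 * (alpha^-1 ^+ 2 * ct))%:E)%E.
  by rewrite integral_cst//= probability_setT mule1.
have s0 : (0 <= 2%:E :> \bar R)%E by rewrite lee_fin.
have -> : (c1%:E = 2%:E * cZ%:E + (2 * (alpha^-1 ^+ 2 * ct))%:E)%E by rewrite -EFinM -EFinD.
exact: (leeD (lee_wpmul2l s0 Z_energy) (lexx _)).
Qed.

Lemma v_sqint : sqint v.
Proof.
apply: filterS2 v_energy_le sqZ => w le fin; apply: (le_lt_trans le).
by apply: lte_add_pinfty; [apply: lte_mul_pinfty|exact: ltry].
Qed.
Let sqv := v_sqint.

Let sqh : sqint h.
Proof.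
have pZv := predictable_mxB T_gt0 pZ pv.
have pvN := predictable_mxN T_gt0 pv.
apply: filterS2 sqZ sqv => w fZ fv; rewrite -[X in (X < _)%E]/(energy h T w).
rewrite (energyZ T_gt0 alpha w pZv (lexx T)); apply: lte_mul_pinfty => //; first by rewrite lee_fin sqr_ge0.
apply: (le_lt_trans (energyD_le T_gt0 w pZ pvN (lexx T))).
rewrite energyN.
by apply: lte_add_pinfty; apply: lte_mul_pinfty.
Qed.

Variables (g : R -> Om -> R) (Y : R -> Om -> R) (F : Om -> R) (y0 : R).
Hypothesis g_gen : {ae P, forall w, forall t, 0 <= t <= T ->
  g t w = alpha / 2 * dot (zeta t w - v t w) (zeta t w - v t w) - dot (Z t w) (theta t w)
    - (2 * alpha)^-1 * dot (theta t w) (theta t w)}.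
Hypothesis bsde : {ae P, forall w, forall t, 0 <= t <= T ->
  Y t w = F w + \int[leb]_(s in `[t, T]) g s w - (ito Z T w - ito Z t w)}.
Hypothesis Y0_cst : {ae P, forall w, Y 0 w = y0}.

(** Completing the square with [zeta - v = (h + theta) / alpha]: the terms in [|theta|^2] cancel and
    the cross term is [(Z - v).theta]. *)
Let g_exponent : {ae P, forall w, forall t, 0 <= t <= T ->
  g t w = (2 * alpha)^-1 * dot (h t w) (h t w) - dot (v t w) (theta t w)}.
Proof.
apply: filterS g_gen => w hg t tT; rewrite hg// /exponent /zeta.
set z := Z t w; set th := theta t w; set u := v t w.
rewrite !(dotBl, dotBr, dotDl, dotDr, dotZl, dotZr) (dotC th z) (dotC u z) (dotC u th) (dotC th u).
by field; rewrite gt_eqF.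
Qed.

(** [alpha] times the increment of the BSDE over [[0, t]]: the integral of [Z = h / alpha + v] is
    split accordingly, and the generator supplies the quadratic term and the drift of [v]. *)
Lemma bsde_exponent : {ae P, forall w, forall t, 0 <= t <= T ->
  ito h t w - 2^-1 * qvar h t w = alpha * (Y t w - y0) - alpha * drifted theta v t w}.
Proof.
have aux (al iZ iv zT f q d i2 : R) : al != 0 ->
  al * (iZ - iv) - 2^-1 * q = al * (f + i2 - (zT - iZ) - (f + ((2 * al)^-1 * q - d + i2) - zT)) - al * (iv + d).
  by move=> al0; field.
have [_ _ liZ] := itoP P_complete B_brownian T_gt0 pZ sqZ.
have [_ _ liv] := itoP P_complete B_brownian T_gt0 pv sqv.
have [_ _ lih] := itoP P_complete B_brownian T_gt0 ph sqh.
have ih := ito_limit_unique P_complete B_brownian T_gt0 ph lih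
  (ito_limitZ T_gt0 alpha (predictable_mxB T_gt0 pZ pv) (ito_limitB T_gt0 pZ pv liZ liv)).
have Z0 := ito_limit_local P_complete B_brownian T_gt0 pZ liZ.
have T00 : (0 : R) <= 0 <= T by rewrite lexx ltW.
apply: filterS3 (filterI ih Z0) (filterI g_exponent (filterI bsde Y0_cst)) (filterI sqh (filterI sqv sqtheta)).
move=> w [eh hZ0] [hg [hY hy0]] [fh [fv fth]] t tT; have /andP[t0 tT'] := tT.
have Z00 : ito Z 0 w = 0.
  by apply: (hZ0 0 T00); rewrite /energy set_itv1 integral_set1.
have mI : measurable (`[0, t]%classic : set (measurableTypeR R)) by exact: measurable_itv.
have mIT : measurable (`[0, T]%classic : set (measurableTypeR R)) by exact: measurable_itv.
have sub : `[0, t]%classic `<=` `[0, T]%classic.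
  by move=> u /=; rewrite !in_itv/= => /andP[-> /le_trans->].
have Ihh := intg_dot T_gt0 ph ph fh fh; have Ivt := intg_dot T_gt0 pv ptheta fv fth.
have Ig : leb.-integrable `[0, T] (EFin \o (fun u : measurableTypeR R => g u w)).
  apply: eq_integrable (intgB mIT (intgZ mIT (2 * alpha)^-1 Ihh) Ivt) => // u.
  by rewrite inE/= in_itv/= => uT; rewrite hg.
have split0 : \int[leb]_(s in `[0, T]) g s w = \int[leb]_(s in `[0, t]) g s w + \int[leb]_(s in `[t, T]) g s w.
  rewrite -(Rintegral_itv_obnd_cbnd (r := t)); last first.
    apply: (integrableS mIT _ _ Ig); first exact: measurable_itv.
    by move=> u /=; rewrite !in_itv/= => /andP[/ltW/(le_trans t0)-> ->].
  by rewrite -(Rintegral_itvB Ig) ?bnd_simp// addrC subrK.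
have gt : \int[leb]_(s in `[0, t]) g s w = (2 * alpha)^-1 * qvar h t w - \int[leb]_(s in `[0, t]) dot (v s w) (theta s w).
  have Ihh' := integrableS mIT mI sub Ihh; have Ivt' := integrableS mIT mI sub Ivt.
  have -> : qvar h t w = \int[leb]_(s in `[0, t]) dot (h s w) (h s w).
    by rewrite /qvar /energy /Rintegral; congr fine; apply: eq_integral => u _; rewrite sqr_enorm.
  rewrite -(RintegralZl _ mI Ihh') -(RintegralB mI (intgZ mI _ Ihh') Ivt').
  apply: eq_Rintegral => u; rewrite inE/= in_itv/= => /andP[u0 ut]; apply: hg.
  by rewrite u0 (le_trans ut).
have := hY 0 T00; rewrite hy0 split0 Z00 gt subr0 => ->; rewrite (hY t tT) (eh t tT) /drifted.
by apply: aux; rewrite gt_eqF.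
Qed.

Variables (p : nat) (SY : Om -> R) (k : R).
Hypothesis mF : measurable_wrt (Ft T) F.
Hypothesis mYT : measurable_fun setT (Y T).
Hypothesis p_gt1 : (1 < p)%N.
Hypothesis SY_integrable : P.-integrable setT (EFin \o SY).
Hypothesis Y_SY : {ae P, forall w, forall t, 0 <= t <= T -> expR (p%:R * alpha * Num.max (Y t w) 0) <= SY w}.
Hypothesis F_ge : {ae P, forall w, - k <= F w}.

Let Y_final : {ae P, forall w, Y T w = F w}.
Proof.
apply: filterS bsde => w /(_ T T0T) ->.
by rewrite subrr subr0 set_itv1 /Rintegral integral_set1 addr0.
Qed.

Let YT_ge : {ae P, forall w, - k <= Y T w}.
Proof. by apply: filterS2 Y_final F_ge => w ->. Qed.

Let gain_ge0 : {ae P, forall w, forall t, 0 <= t <= T -> 0 <= dot (v t w) (theta t w + h t w)}.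
Proof.
apply: filterS v_zeta => w hv t tT; rewrite theta_exponent dotZr.
by rewrite mulr_ge0 ?hv// ltW.
Qed.

(** Rate of a clock that dominates [h], [v], [theta] and one competitor at once, so that a single
    stopping bounds all their energies. *)
Let total q t w := dot (h t w) (h t w) + dot (v t w) (v t w) + (dot (theta t w) (theta t w) + dot (q t w) (q t w)).

Let total_predictable q : pred q -> predictable T Ft (total q).
Proof.
by move=> pq; apply: predictableD => //; apply: predictableD => //; exact: predictable_dot.
Qed.

Let total_h q t w : dot (h t w) (h t w) <= total q t w.
Proof. by rewrite /total -addrA lerDl !addr_ge0 ?dot_ge0. Qed.

Let total_v q t w : dot (v t w) (v t w) <= total q t w.
Proof. by rewrite /total addrAC lerDr !addr_ge0 ?dot_ge0. Qed.

Let total_theta q t w : dot (theta t w) (theta t w) <= total q t w.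
Proof. by rewrite /total addrCA lerDl !addr_ge0 ?dot_ge0. Qed.

Let total_q q t w : dot (q t w) (q t w) <= total q t w.
Proof. by rewrite /total addrA lerDr !addr_ge0 ?dot_ge0. Qed.

Let total_fin q : pred q -> sqint q -> {ae P, forall w, (clock (total q) T w < +oo)%E}.
Proof.
move=> pq sq; apply: filterS3 (filterI sqh sqv) sqtheta sq => w [fh fv] fth fq.
have mI : measurable (`[0, T]%classic : set (measurableTypeR R)) by exact: measurable_itv.
have Is := intgD mI (intgD mI (intg_dot T_gt0 ph ph fh fh) (intg_dot T_gt0 pv pv fv fv))
  (intgD mI (intg_dot T_gt0 ptheta ptheta fth fth) (intg_dot T_gt0 pq pq fq fq)).
by rewrite /clock (intg_fin_num mI Is) ltry.
Qed.

Let M := doleans T h (ito h).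
Let mM : measurable_fun setT M.
Proof. exact: (measurable_doleans P_complete B_brownian T_gt0 ph (measurable_ito P_complete B_brownian T_gt0 ph sqh T0T)). Qed.

Lemma exponent_mass : (\int[P]_w (M w)%:E = 1)%E.
Proof.
exact: (doleans_one P_complete B_brownian T_gt0 ptheta ph pv (total_predictable pv)
  (total_theta v) (total_h v) (total_v v) (total_fin pv sqv) alpha_gt0 p_gt1 bsde_exponent gain_ge0 SY_integrable Y_SY).
Qed.

Let IM : P.-integrable setT (EFin \o M).
Proof.
by apply: (proj1 (@intg_ge0 _ _ _ P setT M 1 mM _ _)) => [w _|]; [exact: doleans_ge0|rewrite exponent_mass].
Qed.

Let exp_utility x q w := expR (- alpha * (x + drifted theta q T w - F w)).

Let exp_utilityE x q : {ae P, forall w, exp_utility x q w =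
  expR (- alpha * (x - y0)) * (M w * expR (alpha * (drifted theta v T w - drifted theta q T w)))}.
Proof.
apply: filterS2 bsde_exponent Y_final => w /(_ T T0T) e eY.
rewrite /exp_utility /M /doleans e eY -!expRD; congr expR; ring.
Qed.

Lemma optimal_utility x : (\int[P]_w (exp_utility x v w)%:E = (expR (- alpha * (x - y0)))%:E)%E.
Proof.
have mFP : measurable_fun setT F := measurable_wrt_Om P_complete mB (lexx T) (f := fun _ => F) mF.
have -> : (\int[P]_w (exp_utility x v w)%:E = \int[P]_w ((expR (- alpha * (x - y0)))%:E * (M w)%:E))%E.
  apply: ae_eq_integral => //.
  - apply/measurable_EFinP; apply: measurableT_comp => //; apply: measurable_funM => //.
    apply: measurable_funB => //; apply: measurable_funD => //.
    exact: (measurable_drifted P_complete B_brownian T_gt0 ptheta pv sqv T0T).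
  - by apply/measurable_EFinP; exact: measurable_funM.
  by apply: filterS (exp_utilityE x v) => w e _; rewrite e subrr mulr0 expR0 mulr1 EFinM.
rewrite ge0_integralZl ?exponent_mass ?mule1//.
- by apply/measurable_EFinP.
- by move=> w _; rewrite lee_fin; exact: doleans_ge0.
Qed.

Variable Q : probability Om R.
Hypothesis Q_density : forall A, Ft T A -> Q A = (\int[P]_(w in A) (density theta w)%:E)%E.

Let drifted_path q : pred q -> sqint q -> {ae P, forall w, path_continuous T (drifted theta q ^~ w)}.
Proof.
move=> pq sq; have [_ cI _] := itoP P_complete B_brownian T_gt0 pq sq.
apply: filterS3 cI sq sqtheta => w cI fq fth; apply: path_continuousD => //.
apply/path_continuousP; apply: parameterized_integral_continuous; first exact: ltW.
exact: (intg_dot T_gt0 pq ptheta fq fth).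
Qed.

Lemma utility_le x q : pred q -> sqint q ->
  {ae P, forall w, {ae leb, forall t, `[0, T]%classic t ->
     dot (zeta t w - v t w) (q t w - v t w) <= 0}} ->
  martingale Q T Ft (drifted theta q) ->
  ((expR (- alpha * (x - y0)))%:E <= \int[P]_w (exp_utility x q w)%:E)%E.
Proof.
move=> pq sq opt mart; set I := (\int[P]_w _)%E.
have mFP : measurable_fun setT F := measurable_wrt_Om P_complete mB (lexx T) (f := fun _ => F) mF.
have mdq : measurable_fun setT (drifted theta q T) := measurable_drifted P_complete B_brownian T_gt0 ptheta pq sq T0T.
have mdv : measurable_fun setT (drifted theta v T) := measurable_drifted P_complete B_brownian T_gt0 ptheta pv sqv T0T.
have mU : measurable_fun setT (exp_utility x q).
  apply: measurableT_comp => //; apply: measurable_funM => //.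
  by apply: measurable_funB => //; exact: measurable_funD.
have I0 : (0 <= I)%E by apply: integral_ge0 => w _; rewrite lee_fin expR_ge0.
(* An infinite disutility satisfies the bound trivially. A finite one amounts to an exponential
   moment of the terminal gain, since [F] is bounded below. *)
have [fin|] := ltP I +oo%E; last by rewrite leye_eq => /eqP ->; exact: leey.
have [IU _] : P.-integrable setT (EFin \o exp_utility x q) /\ \int[P]_w exp_utility x q w <= fine I.
  by apply: intg_ge0 => [//|w _|]; [exact: expR_ge0|rewrite fineK// ge0_fin_numE].
have IX : P.-integrable setT (EFin \o (fun w => expR (- (2 * (alpha / 2)) * drifted theta q T w))).
  apply: (intg_le measurableT _ _ (intgZ measurableT (expR (alpha * (x + k))) IU)).
    by apply: measurableT_comp => //; exact: measurable_funM.
  apply: filterS F_ge => w Fk _; rewrite ger0_norm ?expR_ge0// /exp_utility -expRD ler_expR.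
  have : alpha * - k <= alpha * F w by rewrite ler_pM2l.
  set y := drifted _ _ _ _; have -> : - (2 * (alpha / 2)) * y = - alpha * y by field.
  by rewrite !(mulrBr, mulrDr) mulrN !mulNr; lra.
(* The path bound is applied with [beta = alpha / 2]: it asks for the moment of order [2 beta], and
   the utility supplies order [alpha]. *)
have a2 : 0 < alpha / 2 by rewrite divr_gt0.
have [S [mS S0 IS hS]] := path_lower_bound P_complete B_brownian T_gt0 ptheta theta_energy Q_density mart (drifted_path pq sq) a2 IX.
have b0 : 0 < alpha / 2 / 4 by rewrite divr_gt0.
have pt := total_predictable pq; have tf := total_fin pq sq.
have IMS : P.-integrable setT (EFin \o (fun w => M w * S w)).
  apply: (entropy_exp_integrable P_complete B_brownian T_gt0 ptheta ph pv pt
    (total_theta q) (total_h q) (total_v q) tf alpha_gt0 p_gt1 bsde_exponent gain_ge0 SY_integrable Y_SY b0 mS IS).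
  by apply: aeW => w; rewrite ger0_norm.
have opt' : {ae P, forall w, {ae leb, forall t, `[0, T]%classic t ->
     dot (q t w) (theta t w + h t w) <= dot (v t w) (theta t w + h t w)}}.
  apply: filterS opt => w hw; apply: (negligibleS _ hw); apply: subsetC => t ht tT.
  have := ht tT; rewrite theta_exponent !dotZr ler_pM2l// dotBr subr_le0 => h1.
  by rewrite (dotC (q t w)) (dotC (v t w)).
have [IMq Eq] := drift_competitor P_complete B_brownian T_gt0 ptheta ph pv pt
    (total_theta q) (total_h q) (total_v q) tf alpha_gt0 p_gt1 mYT bsde_exponent gain_ge0 SY_integrable Y_SY YT_ge pq (total_q q) opt' IMS hS.
have [IMJ IMv Ev] := drift_gain_le P_complete B_brownian T_gt0 ptheta ph pv pt
    (total_theta q) (total_h q) (total_v q) tf alpha_gt0 p_gt1 mYT bsde_exponent gain_ge0 SY_integrable Y_SY YT_ge.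
have le := le_trans Eq Ev.
(* Tangent line of the exponential at the gain of [v], weighted by [M]. Its mean is at least the
   mass of [M], because under [M] the competitor gains no more than [v]. *)
pose G w := M w + (alpha * (M w * drifted theta v T w) - alpha * (M w * drifted theta q T w)).
have I1 := intgZ measurableT alpha IMv; have I2 := intgZ measurableT alpha IMq.
have IG : P.-integrable setT (EFin \o G) := intgD measurableT IM (intgB measurableT I1 I2).
have EG : 1 <= \int[P]_w G w.
  rewrite /G (RintegralD measurableT IM (intgB measurableT I1 I2)) (RintegralB measurableT I1 I2).
  rewrite !(RintegralZl _ measurableT)// -mulrBr.
  have -> : \int[P]_w M w = 1 by rewrite /Rintegral exponent_mass.
  by rewrite lerDl mulr_ge0 ?subr_ge0// ltW.
have key : {ae P, forall w, setT w -> expR (- alpha * (x - y0)) * G w <= exp_utility x q w}.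
  apply: filterS (exp_utilityE x q) => w -> _; rewrite ler_pM2l ?expR_gt0//.
  have := expR_ge1Dx (alpha * (drifted theta v T w - drifted theta q T w)).
  move=> /(ler_wpM2l (doleans_ge0 T h (ito h) w)); apply: le_trans.
  by rewrite -/(M w) /G le_eqVlt; apply/orP; left; apply/eqP; ring.
have h2 := Rintegral_le_ae measurableT (intgZ measurableT _ IG) IU key.
rewrite /I (intg_fin_num measurableT IU) lee_fin; apply: le_trans h2.
by rewrite (RintegralZl _ measurableT IG) -[X in X <= _]mulr1 ler_pM2l ?expR_gt0.
Qed.

Lemma optimal_martingale x : martingale Q T Ft (fun t w => x + drifted theta v t w).
Proof. exact: (drifted_martingale P_complete B_brownian T_gt0 ptheta ct_ge0 theta_energy Q_density x pv sqv v_energy). Qed.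

End verification.

(** * Measurability and energy bounds for the data of the market *)

Section adaptedness.
Context {disp : measure_display} {Om : measurableType disp} {R : realType} {m : nat}.
Variables (P : probability Om R) (T : R) (B : R -> Om -> 'cV[R]_m).
Hypothesis P_complete : measure_is_complete P.
Hypothesis T_gt0 : 0 < T.
Local Notation Ft := (augmented_filtration P B).

Lemma predictable_adapted (X : R -> Om -> R) : predictable T Ft X -> adapted T Ft X.
Proof.
move=> pX t tT; apply/measurable_wrtP.
have pf := predictable_fun_progressive T_gt0 tT (proj1 (predictableP P B T_gt0 X) pX).
have mD : measurable (`[0, t] `*` setT : set (R * OmF P B t)).
  by apply: measurableX => //; exact: measurable_itv.
apply: (measurable_comp mD _ pf (g := fun w : OmF P B t => (t, w))).
  by move=> _ [w _ <-]; split => //=; rewrite in_itv/= lexx andbT; case/andP: tT.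
exact: measurable_fun_pair.
Qed.

Lemma measurable_path_sup (f : R -> Om -> R) :
  (forall t w, 0 <= f t w) ->
  (forall t, 0 <= t <= T -> measurable_fun setT (f t)) ->
  {ae P, forall w, path_continuous T (f ^~ w)} ->
  measurable_fun setT (fun w => ereal_sup [set (f t w)%:E | t in `[0%R, T]]).
Proof.
move=> f0 mf cf; apply: (measurability _ (ErealGenCInfty.measurableE R)) => //.
move=> _ [_ [r ->] <-]; rewrite setTI.
rewrite (_ : _ @^-1` _ = [set w | (r%:E <= ereal_sup [set `|f t w|%:E | t in `[0%R, T]])%E]).
  exact: (measurable_sup_paths P_complete T_gt0 r mf cf).
have e w : (fun t => `|f t w|%:E) = (fun t => (f t w)%:E) by apply/funext => t; rewrite ger0_norm.
by apply/seteqP; split => w /=; rewrite in_itv/= andbT e.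
Qed.

End adaptedness.

Section market_facts.
Context {disp : measure_display} {Om : measurableType disp} {R : realType} {d m : nat}.
Variables (P : probability Om R) (T : R) (B : R -> Om -> 'cV[R]_m).
Hypothesis T_gt0 : 0 < T.
Variables (b : R -> Om -> 'cV[R]_d) (sigma : R -> Om -> 'M[R]_(d, m)).
Local Notation Ft := (augmented_filtration P B).

Lemma theta_predictable : predictable_mx T Ft b -> predictable_mx T Ft sigma ->
  predictable_mx T Ft (theta b sigma).
Proof.
move=> pb ps; apply: predictable_mulmx => //; apply: predictable_mulmx => //; first exact: predictable_tr.
by apply: predictable_invmx => //; apply: predictable_mulmx => //; exact: predictable_tr.
Qed.

Lemma bounded_energy (H : R -> Om -> 'cV[R]_m) : predictable_mx T Ft H -> bounded_mx P T H ->
  exists2 c, 0 <= c & {ae P, forall w, (energy H T w <= c%:E)%E}.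
Proof.
move=> pH [c hc]; exists (m%:R * c ^+ 2 * T); first exact: (mulr_ge0 (mulr_ge0 (ler0n _ _) (sqr_ge0 _)) (ltW T_gt0)).
apply: filterS hc => w hw.
have le t : 0 <= t <= T -> enorm (H t w) ^+ 2 <= m%:R * c ^+ 2.
  move=> tT; rewrite sqr_enorm /dot; apply: (@le_trans _ _ (\sum_(i < m) c ^+ 2)).
    by apply: ler_sum => i _; rewrite -expr2 -real_normK ?num_real// lerXn2r ?nnegrE ?(le_trans _ (hw t tT i 0))// hw.
  by rewrite sumr_const card_ord mulr_natl.
apply: (@le_trans _ _ (\int[@lebesgue_measure R]_(t in `[0%R, T]) (m%:R * c ^+ 2)%:E)%E).
  apply: ge0_le_integral => //.
  - by move=> t _; rewrite lee_fin sqr_ge0.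
  - apply: (eq_measurable_fun (fun t => (dot (H t w) (H t w))%:E)) => [t _|]; first by rewrite sqr_enorm.
    by apply/measurable_EFinP; exact: (predictable_path T_gt0 w (predictable_dot T_gt0 pH pH)).
by rewrite integral_cst//= lebesgue_measure_itv/= lte_fin T_gt0 oppr0 -EFinD addr0 -EFinM lexx.
Qed.

End market_facts.

Unset Implicit Arguments.
Theorem theorem4p7 (R : realType) (disp : measure_display)
    (Om : measurableType disp) (P : probability Om R)
    (T : R) (d m : nat) (alpha : R)
    (B : R -> Om -> 'cV[R]_m) (b : R -> Om -> 'cV[R]_d)
    (sigma : R -> Om -> 'M[R]_(d, m)) (C : set 'cV[R]_d)
    (Q : probability Om R)
    (F : Om -> R) (p : nat) (k : R)
    (Y : R -> Om -> R) (Z : R -> Om -> 'cV[R]_m)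
    (T_gt0 : 0 < T) (d_gt0 : (0 < d)%N) (le_dm : (d <= m)%N)
    (alpha_gt0 : 0 < alpha)
    (P_complete : measure_is_complete P)
    (B_brownian : brownian_motion P T B)
    (b_predictable : predictable_mx T (augmented_filtration P B) b)
    (b_bounded : bounded_mx P T b)
    (sigma_predictable : predictable_mx T (augmented_filtration P B) sigma)
    (sigma_bounded : bounded_mx P T sigma)
    (sigma_unit : {ae P, forall w, forall t : R, 0 <= t <= T ->
       sigma t w *m (sigma t w)^T \in unitmx})
    (theta_bounded : bounded_mx P T (theta b sigma))
    (C_closed : closed C)
    (C_convex : convex_set (C : set (convex_lmodType 'cV[R]_d)))
    (C0 : C 0)
    (Q_theta : is_Qtheta P T B b sigma Q)
    (F_measurable : measurable_wrt (augmented_filtration P B T) F)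
    (p_gt1 : (1 < p)%N)
    (F_exp : ('E_P[(fun w => expR (p%:R * alpha * Num.max (F w) 0))%R] < +oo)%E)
    (k_gt0 : 0 < k)
    (F_neg : {ae P, forall w, Num.max (- F w) 0 <= k})
    (YZ_solution : bsde_solution P T B alpha b sigma C F Y Z)
    (YZ_class : uniqueness_class P T alpha p Y Z) :
  (forall x : R, {ae P, forall w,
     value_function P T B alpha b sigma C Q F x =
     (- expR (- alpha * (x - Y 0 w)))%:E}) /\
  exists pi : R -> Om -> 'cV[R]_d,
    [/\ admissible P T B b sigma C Q pi,
        (forall x : R, expected_utility P T B alpha b sigma F x pi =
                       value_function P T B alpha b sigma C Q F x) &
        forall t : R, 0 <= t <= T -> {ae P, forall w,
          is_proj (sigmaC sigma C t w) (Z t w + alpha^-1 *: theta b sigma t w)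
            ((sigma t w)^T *m pi t w)}].
Proof.
pose th := theta b sigma; pose K := sigmaC sigma C.
have pth : predictable_mx T (augmented_filtration P B) th by exact: theta_predictable.
have [ct ct0 thE] := bounded_energy T_gt0 pth theta_bounded.
have [[pY pZ] cY sqZ _ hY] := YZ_solution.
have [SYfin _ ZE] := YZ_class.
have mB := brownian_measurable B_brownian.
have T0T : 0 <= T <= T by rewrite lexx ltW.
have T00 : (0 : R) <= 0 <= T by rewrite lexx ltW.
have convC x y (t : R) : C x -> C y -> 0 <= t <= 1 -> C (t *: x + (1 - t) *: y) := @convex_combination _ _ C C_convex x y t.
pose z t w := Z t w + alpha^-1 *: th t w.
have pz : predictable_mx T (augmented_filtration P B) z.
  by apply: predictable_mxD => //; apply: predictable_mxZ => //; exact: predictable_cst.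
have [pi [ppi piC piproj]] := projection_selection T_gt0 sigma_predictable pz C_closed C0 convC.
pose q (pi : R -> Om -> 'cV[R]_d) t w := (sigma t w)^T *m pi t w.
have pq pi' : predictable_mx T (augmented_filtration P B) pi' -> predictable_mx T (augmented_filtration P B) (q pi').
  by move=> ppi'; apply: predictable_mulmx => //; exact: predictable_tr.
pose v := q pi.
have pv : predictable_mx T (augmented_filtration P B) v by exact: pq.
have convK t w x y (r : R) : K t w x -> K t w y -> 0 <= r <= 1 -> K t w (r *: x + (1 - r) *: y).
  move=> [x' Cx <-] [y' Cy <-] r01; exists (r *: x' + (1 - r) *: y'); first exact: convC.
  by rewrite mulmxDr -!scalemxAr.
have proj : {ae P, forall w, forall t, 0 <= t <= T -> is_proj (K t w) (z t w) (v t w)}.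
  by apply: filterS sigma_unit => w hw t tT; apply: piproj; exact: hw.
have K0 t w : K t w 0 by exists 0 => //; rewrite mulmx0.
(* The variational inequality of the projection, tested at the point 0 of [sigma^tr C]. *)
have v_zeta : {ae P, forall w, forall t, 0 <= t <= T -> 0 <= dot (v t w) (z t w - v t w)}.
  apply: filterS proj => w hw t tT.
  have := is_proj_dot (convK t w) (hw t tT) (K0 t w).
  by rewrite sub0r dotNr oppr_le0 dotC.
pose g t w := gen alpha b sigma C t w (Z t w).
have g_gen : {ae P, forall w, forall t, 0 <= t <= T ->
    g t w = alpha / 2 * dot (z t w - v t w) (z t w - v t w) - dot (Z t w) (th t w)
      - (2 * alpha)^-1 * dot (th t w) (th t w)}.
  apply: filterS proj => w hw t tT.
  by rewrite /g /gen (dist_proj (hw t tT)) !sqr_enorm.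
(* [Y 0] is measurable for a trivial sigma-algebra, so the initial value may be treated as a
   number. *)
have [y0 Y0E] := ae_constant B_brownian (predictable_adapted T_gt0 pY T00).
have mY t : 0 <= t <= T -> measurable_fun setT (Y t).
  move=> /[dup] /andP[_ tT] tT'.
  exact: (measurable_wrt_Om P_complete mB tT (predictable_adapted T_gt0 pY tT')).
pose eY t w := expR (p%:R * alpha * Num.max (Y t w) 0).
(* Measurability of the supremum turns the moment condition of the uniqueness class into an
   integrable majorant of the whole path. *)
have mSY : measurable_fun setT (fun w => ereal_sup [set (eY t w)%:E | t in `[0%R, T]]).
  apply: (measurable_path_sup P_complete T_gt0) => [t w|t tT|]; first exact: expR_ge0.
    apply: measurableT_comp => //; apply: measurable_funM => //; apply: measurable_maxr => //; exact: mY.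
  have cg : continuous (fun y : R => expR (p%:R * alpha * Num.max y 0)).
    move=> y; apply: (@continuous_comp R R R (fun y : R => p%:R * alpha * Num.max y 0) expR); last exact: continuous_expR.
    apply: cvgM; first exact: cvg_cst.
    exact: (@continuous_max R R id (cst 0) y (@cvg_id _ _) (@cvg_cst _ _ _ _ _)).
  apply: filterS cY => w cYw; apply/path_continuousP => t.
  exact: (@continuous_comp (subspace `[0, T]) R R (Y ^~ w) _ t (cYw t) (cg _)).
have SY0 w : (0 <= ereal_sup [set (eY t w)%:E | t in `[0%R, T]])%E.
  apply: (@le_trans _ _ (eY 0 w)%:E); first by rewrite lee_fin expR_ge0.
  by apply: ereal_sup_ubound; exists 0 => //=; rewrite in_itv.
have [ISY finSY] := intg_fine mSY SY0 SYfin.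
have Y_SY : {ae P, forall w, forall t, 0 <= t <= T ->
    eY t w <= fine (ereal_sup [set (eY t w)%:E | t in `[0%R, T]])}.
  apply: filterS finSY => w fin t tT; rewrite -lee_fin fineK//.
  by apply: ereal_sup_ubound; exists t => //=; rewrite in_itv.
have F_ge : {ae P, forall w, - k <= F w}.
  by apply: filterS F_neg => w h; rewrite lerNl; apply: le_trans h; rewrite le_max lexx.
pose cZ := fine (\int[P]_w energy Z T w)%E.
have Z_energy : (\int[P]_w energy Z T w <= cZ%:E)%E.
  rewrite fineK// ge0_fin_numE//; apply: integral_ge0 => w _; exact: energy_ge0.
have sqv : square_integrable P T v := v_sqint T_gt0 pth pZ pv thE sqZ v_zeta.
have wealthE x pi' : wealth P T B b sigma x pi' = fun t w => x + drifted P T B th (q pi') t w.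
  by apply/funext => t; apply/funext => w; rewrite /wealth -addrA.
have adm : admissible P T B b sigma C Q pi.
  split; [exact: ppi|exact: sqv|by move=> t _; apply: aeW => w; exact: piC|].
  by move=> x; rewrite wealthE; exact: (optimal_martingale P_complete B_brownian T_gt0 pth pZ pv ct0 thE Z_energy sqZ v_zeta Q_theta).
have utilityE x pi' : expected_utility P T B alpha b sigma F x pi' =
    (- \int[P]_w (expR (- alpha * (x + drifted P T B th (q pi') T w - F w)))%:E)%E.
  rewrite /expected_utility unlock wealthE -integral_ge0N; last by move=> w _; rewrite lee_fin expR_ge0.
  by apply: eq_integral.
have util_pi x : expected_utility P T B alpha b sigma F x pi = (- expR (- alpha * (x - y0)))%:E.
  by rewrite utilityE (optimal_utility P_complete B_brownian T_gt0 pth pZ pv thE sqZ alpha_gt0 v_zeta g_gen hY Y0E F_measurable p_gt1 ISY Y_SY).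
have value x : value_function P T B alpha b sigma C Q F x = (- expR (- alpha * (x - y0)))%:E.
  apply/eqP; rewrite eq_le; apply/andP; split; last first.
    by rewrite -util_pi; apply: ereal_sup_ubound; exists pi.
  apply: ge_ereal_sup => _ [pi' [ppi' sq' C' mart'] <-].
  rewrite utilityE EFinN leeN2.
  apply: (utility_le P_complete B_brownian T_gt0 pth pZ pv thE sqZ alpha_gt0 v_zeta g_gen hY Y0E F_measurable (mY T T0T) p_gt1 ISY Y_SY F_ge Q_theta x (pq _ ppi') sq').
    (* The constraint is known at each time almost surely; the comparison of drifts needs it on
       almost every path at almost every time. *)
    apply: filterS2 proj (ae_time_closed P_complete B_brownian T_gt0 ppi' C_closed C0 C') => w hw hC.
    apply: (negligibleS _ hC); apply: subsetC => t ht tT.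
    apply: (is_proj_dot (convK t w) (hw t _)); last by exists (pi' t w) => //; exact: ht.
    by move: tT; rewrite /= in_itv.
  have := mart' 0; rewrite wealthE; congr martingale.
  by apply/funext => t; apply/funext => w; rewrite add0r.
split=> [x|]; first by apply: filterS Y0E => w ->; exact: value.
exists pi; split => // [x|t tT]; first by rewrite util_pi value.
by apply: filterS proj => w; apply.
Qed.
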